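(* Let $\overline{X}$ be a compact Riemann surface with canonical bundle $K$, $p_1,\dots,p_m\in\overline{X}$ distinct points, $X=\overline{X}\setminus\{p_1,\dots,p_m\}$, $D=p_1+\cdots+p_m$, and $\theta_1,\dots,\theta_m$ real numbers with $\chi(\overline{X})+\sum_{i=1}^m(\theta_i-1)<0$. Let $D_1,D_3,D_4$ and, for a quadratic differential $a$, $\hat h_a$ be as defined in the context. If all $\theta_i\in[0,\frac12)$, then $D_1=D_3=D_4=0$, and for any $a\in H^0\big(\overline{X},K^2\otimes\mathcal{O}_{\overline{X}}(D)\big)$, $\hat h_a$ is a Riemannian metric on $X$ of constant Gaussian curvature $-1$.
   Context: Notation. $[x]$ is the largest integer $\le x$ and $\{x\}=x-[x]$. $\tilde D=\sum_i[\theta_i]p_i$. $D_1,D_3,D_4$ are the reduced divisors supported respectively on the points $p_i$ with $\theta_i\ne0$ and: $\{\theta_i\}=0$ (for $D_1$); $\{\theta_i\}=\frac12$ (for $D_3$); $\frac12<\{\theta_i\}<1$ (for $D_4$). For an effective divisor $B$, $1_B$ is the natural section of $\mathcal{O}_{\overline{X}}(B)$ given by the constant function $1$. Parabolic bundle. Fix a line bundle $K^{\frac12}$ with $(K^{\frac12})^2=K$, and let $E_0=K^{\frac12}\oplus\big(K^{-\frac12}\otimes\mathcal{O}_{\overline{X}}(\tilde D-D)\big)$. At $p_i$ with $\{\theta_i\}\ne0$, the flag is $(E_0)_{p_i}\supset\big(K^{-\frac12}\otimes\mathcal{O}_{\overline{X}}(\tilde D-D)\big)_{p_i}\supset0$ with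 weights $\frac12(1-\{\theta_i\})<\frac12(1+\{\theta_i\})$; at $p_i$ with $\{\theta_i\}=0$ the flag is trivial with weight $\frac12$ (multiplicity two). The parabolic degree of $E_0$ ($\deg E_0$ plus all weights with multiplicity) is $\sum_i[\theta_i]$ and $\mathrm{slope}(E_0)=\frac12\sum_i[\theta_i]$. For $a\in H^0\big(\overline{X},K^2\otimes\mathcal{O}_{\overline{X}}(D-\tilde D)\big)$ let $$\Phi_a=\begin{pmatrix}0&a\otimes1_D\\ \frac12 1_{\tilde D}&0\end{pmatrix}\in H^0\big(\overline{X},\mathrm{End}(E_0)\otimes K\otimes\mathcal{O}_{\overline{X}}(D)\big).$$ $(E_0,\Phi_a)$ is a stable parabolic Higgs bundle, i.e. every proper nonzero subbundle preserved by $\Phi_a$ has parabolic slope (for the induced weights) strictly less than that of $E_0$. Hermitian-Einstein metric. Fix a smooth conformal metric on $\overline{X}$, Euclidean near each $p_i$, with Kähler form $\omega$. Write $E=E_0|_X$, identified with $(K^{\frac12}\oplus K^{-\frac12})|_X$. $H_a$ is a smooth Hermitian metric on $E$ with $$F_{H_a}+[\Phi_a,\Phi_a^{*H_a}]=-2\pi\mathrm{i}\,\frac{\mathrm{slope}(E_0)}{\int_X\omega}\,\mathrm{Id}_E\otimes\omega\quad\text{on }X$$ ($F_{H_a}$ the Chern curvature), which near each $p_i$ is mutually bounded with the following model metric: if $z$ is a local coordinate centred at $p_i$, $r=|z|$, in the holomorphic frame $(dz^{\frac12},\,z^{1-[\theta_i]}dz^{-\frac12})$ of $E_0$ the model is $\mathrm{diag}\big(r^{1-\{\theta_i\}},r^{1+\{\theta_i\}}\big)$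 if $\theta_i>0$, and $\mathrm{diag}\big(-r\log r,-r/\log r\big)$ if $\theta_i=0$. The induced Kähler metric on $X$ is, in any local coordinate $z$ on $X$, $h_a=g_a|dz|^2$ with $g_a=H_a(dz^{-\frac12},dz^{-\frac12})/H_a(dz^{\frac12},dz^{\frac12})$. Define $$\hat h_a:=2a+h_a+2\bar a+\frac{4a\bar a}{h_a},$$ i.e. if $a=f(z)\,dz^2$ locally, $\hat h_a=2f\,dz^2+\big(g_a+\frac{4|f|^2}{g_a}\big)dz\,d\bar z+2\bar f\,d\bar z^2$. *)

(* Defs.v *)
From HB Require Import structures.
From mathcomp Require Import all_boot all_order all_algebra.
From mathcomp Require Import complex.
From mathcomp Require Import all_classical all_reals all_analysis.

Set Implicit Arguments.
Unset Strict Implicit.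
Unset Printing Implicit Defensive.

Import Order.TTheory GRing.Theory Num.Theory numFieldNormedType.Exports.

Local Open Scope classical_set_scope.
Local Open Scope complex_scope.
Local Open Scope sesquilinear_scope.
Local Open Scope ring_scope.

(* [R[i]] carries its norm topology only through the alias [R[i]^o]. *)
Notation cplx R := ((R[i])^o).

Section Calculus.
Variable R : realType.
Local Notation C := (cplx R).

Definition holomorphic_on (U : set C) (f : C -> C) : Prop :=
  forall z, U z -> derivable f z 1.

Definition sqmod (z : C) : R := complex.Re z ^+ 2 + complex.Im z ^+ 2.
Definition modulus (z : C) : R := Num.sqrt (sqmod z).

(* The coordinate directions of z = x + iy: 0 is d/dx and 1 is d/dy. *)
Definition dir (k : 'I_2) : C := if k == 0 then 1 else 'i.

Definition partial (k : 'I_2) (f : C -> R) (z : C) : R :=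
  derive1 (fun t : R => f (z + t%:C * dir k)) 0.

(* All iterated partial derivatives exist and are continuous. *)
Definition smooth_on (U : set C) (f : C -> R) : Prop :=
  forall (s : seq 'I_2) (z : C), U z ->
    let h := foldr partial f s in
    {for z, continuous h} /\
    forall k : 'I_2, derivable (fun t : R => h (z + t%:C * dir k)) 0 1.

Definition csmooth_on (U : set C) (f : C -> C) : Prop :=
  smooth_on U (fun z => complex.Re (f z)) /\
  smooth_on U (fun z => complex.Im (f z)).

Definition cpartial (k : 'I_2) (f : C -> C) (z : C) : C :=
  partial k (fun w => complex.Re (f w)) z +i*
  partial k (fun w => complex.Im (f w)) z.

Definition d_z (f : C -> C) (z : C) : C :=
  2^-1 * (cpartial 0 f z - 'i * cpartial 1 f z).
Definition d_zbar (f : C -> C) (z : C) : C :=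
  2^-1 * (cpartial 0 f z + 'i * cpartial 1 f z).

Definition mx2 (a b c d : R[i]) : 'M[R[i]]_2 :=
  \matrix_(k, l) if k == 0 then (if l == 0 then a else b)
                 else (if l == 0 then c else d).

Definition d_zM (M : C -> 'M[R[i]]_2) (z : C) : 'M[R[i]]_2 :=
  \matrix_(k, l) d_z (fun w => M w k l) z.
Definition d_zbarM (M : C -> 'M[R[i]]_2) (z : C) : 'M[R[i]]_2 :=
  \matrix_(k, l) d_zbar (fun w => M w k l) z.

(* A Hermitian metric H in a holomorphic frame (e_0, e_1) is given by its
   Gram matrix G, G k l = H(e_l, e_k), so that H(v, w) = w^* G v. *)
Definition hform (G : 'M[R[i]]_2) (v : 'cV[R[i]]_2) : R[i] :=
  (v^t* *m G *m v) 0 0.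

Definition hermitian_posdef (G : 'M[R[i]]_2) : Prop :=
  G^t* = G /\ forall v : 'cV[R[i]]_2, v != 0 -> 0 < hform G v.

(* The Chern connection is d + G^-1 (d_z G) dz, with curvature
   F = dbar (G^-1 (d_z G) dz); this is the coefficient of dz /\ dzbar in F. *)
Definition chern_curvature (G : C -> 'M[R[i]]_2) (z : C) : 'M[R[i]]_2 :=
  - d_zbarM (fun w => invmx (G w) *m d_zM G w) z.

(* H(phi v, w) = H(v, phi^* w) for phi^* = hadjoint G phi. *)
Definition hadjoint (G phi : 'M[R[i]]_2) : 'M[R[i]]_2 :=
  invmx G *m phi^t* *m G.

Definition christoffel (g : C -> 'M[R]_2) (l j k : 'I_2) (z : C) : R :=
  2^-1 * \sum_(q < 2) invmx (g z) l q *
    (partial j (fun w => g w k q) z + partial k (fun w => g w j q) z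
     - partial q (fun w => g w j k) z).

(* Component along d_l of Riem(d_0, d_1) d_1, where
   Riem(u, v) = [nabla_u, nabla_v] - nabla_[u, v]. *)
Definition riemann011 (g : C -> 'M[R]_2) (l : 'I_2) (z : C) : R :=
  partial 0 (christoffel g l 1 1) z - partial 1 (christoffel g l 0 1) z
  + \sum_(q < 2) (christoffel g q 1 1 z * christoffel g l 0 q z
                  - christoffel g q 0 1 z * christoffel g l 1 q z).

Definition gauss_curvature (g : C -> 'M[R]_2) (z : C) : R :=
  (\sum_(l < 2) g z l 0 * riemann011 g l z) / \det (g z).

End Calculus.

Section Euler.
Variables (R : realType) (X : topologicalType).

Definition std_simplex (n : nat) : set 'rV[R]_n.+1 :=
  [set x | (forall k, 0 <= x 0 k) /\ \sum_k x 0 k = 1].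
Arguments std_simplex : clear implicits.

Definition face (n : nat) (k : 'I_n.+2) (x : 'rV[R]_n.+1) : 'rV[R]_n.+2 :=
  \row_l oapp (fun l' => x 0 l') 0 (unlift k l).

Definition singular_simplex (n : nat) (s : 'rV[R]_n.+1 -> X) : Prop :=
  {within std_simplex n, continuous s}.

(* Singular simplices are total functions, of which only the restriction to
   the standard simplex matters. *)
Definition cochain (n : nat) (phi : ('rV[R]_n.+1 -> X) -> R) : Prop :=
  forall s t, singular_simplex s -> singular_simplex t ->
    {in std_simplex n, s =1 t} -> phi s = phi t.

Definition coboundary (n : nat) (phi : ('rV[R]_n.+1 -> X) -> R)
    (s : 'rV[R]_n.+2 -> X) : R :=
  \sum_(k < n.+2) (-1) ^+ k * phi (s \o face k).

Definition cocycle (n : nat) (phi : ('rV[R]_n.+1 -> X) -> R) : Prop :=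
  cochain phi /\ forall s, singular_simplex s -> coboundary phi s = 0.

Definition exact_cochain (n : nat) : (('rV[R]_n.+1 -> X) -> R) -> Prop :=
  match n with
  | 0 => fun phi => forall s, singular_simplex s -> phi s = 0
  | n'.+1 => fun phi => exists psi : ('rV[R]_n'.+1 -> X) -> R,
      cochain psi /\ forall s, singular_simplex s -> phi s = coboundary psi s
  end.

(* dim H^n(X; R) = b. *)
Definition betti (n b : nat) : Prop :=
  exists beta : 'I_b -> ('rV[R]_n.+1 -> X) -> R,
    (forall k, cocycle (beta k)) /\
    forall phi, cocycle phi ->
      exists! c : 'rV[R]_b,
        exact_cochain (fun s => phi s - \sum_(k < b) c 0 k * beta k s).

(* The topological Euler characteristic, for surfaces only: the cohomology
   vanishes above degree 2. *)
Definition euler_characteristic (chi : int) : Prop :=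
  exists b0 b1 b2 : nat, [/\ betti 0 b0, betti 1 b1, betti 2 b2 &
    chi = b0%:Z - b1%:Z + b2%:Z].

End Euler.

Section RiemannSurface.
Variables (R : realType) (X : topologicalType).
Local Notation C := (cplx R).

Record chart : Type := Chart {
  cdom : set X;
  cmap : X -> C;
  cinv : C -> X;
  cdom_open : open cdom;
  crange_open : open (cmap @` cdom);
  cmap_continuous : forall x, cdom x -> {for x, continuous cmap};
  cinv_continuous : forall z, (cmap @` cdom) z -> {for z, continuous cinv};
  cmapK : forall x, cdom x -> cinv (cmap x) = x
}.

(* The part of the range of c that corresponds to A. *)
Definition crange (c : chart) (A : set X) : set C :=
  cmap c @` (cdom c `&` A).

Definition compatible (c d : chart) : Prop :=
  holomorphic_on (crange d (cdom c)) (cmap c \o cinv d) /\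
  holomorphic_on (crange c (cdom d)) (cmap d \o cinv c).

Record compact_riemann_surface : Type := CompactRiemannSurface {
  surface_nonempty : [set: X] !=set0;
  surface_hausdorff : hausdorff_space X;
  surface_connected : connected [set: X];
  surface_compact : compact [set: X];
  atlas : set chart;
  atlas_cover : forall x, exists2 c, atlas c & cdom c x;
  atlas_compatible : forall c d, atlas c -> atlas d -> compatible c d;
  atlas_maximal : forall c, (forall d, atlas d -> compatible c d) -> atlas c
}.

(* dz_c / dz_d at x. *)
Definition jac (c d : chart) (x : X) : C :=
  derive1 (cmap c \o cinv d) (cmap d x).

Variable S : compact_riemann_surface.

(* A line bundle with square K, presented by local holomorphic frames
   e_j = dz_j^(1/2) over the domains of coordinates z_j, with
   e_j = (half_trans j k) e_k.  There is no loss of generality: if e is a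
   local frame and e^2 = u dz, take a local coordinate with dz_j = u dz. *)
Record half_canonical : Type := HalfCanonical {
  half_index : Type;
  half_chart : half_index -> chart;
  half_chart_atlas : forall j, atlas S (half_chart j);
  half_cover : forall x, exists j, cdom (half_chart j) x;
  half_trans : half_index -> half_index -> X -> C;
  half_trans_holomorphic : forall j k,
    holomorphic_on (crange (half_chart k) (cdom (half_chart j)))
                   (half_trans j k \o cinv (half_chart k));
  half_trans_square : forall j k x,
    cdom (half_chart j) x -> cdom (half_chart k) x ->
    half_trans j k x ^+ 2 = jac (half_chart j) (half_chart k) x;
  half_trans_cocycle : forall j k l x,
    cdom (half_chart j) x -> cdom (half_chart k) x -> cdom (half_chart l) x ->
    half_trans j l x = half_trans j k x * half_trans k l x
}.

(* a is in H^0(K^2 (x) O(B)): a = a_c dz_c^2 is holomorphic off the support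
   of B, and ord_x a + B(x) >= 0 at the points x of the support, where the
   value of a_c itself is irrelevant. *)
Definition quadratic_differential (B : X -> int) (a : chart -> X -> C) : Prop :=
  [/\ forall c d x, atlas S c -> atlas S d -> cdom c x -> cdom d x -> B x = 0 ->
        a d x = a c x * jac c d x ^+ 2,
      forall c, atlas S c ->
        holomorphic_on (crange c [set x | B x = 0]) (a c \o cinv c) &
      forall c x, atlas S c -> cdom c x -> B x != 0 ->
        exists2 u : C -> C,
          \forall z \near cmap c x, derivable u z 1 &
          \forall z \near cmap c x, z != cmap c x ->
            a c (cinv c z) = (z - cmap c x) ^ (- B x) * u z].

(* The conformal metric lam_c |dz_c|^2. *)
Definition conformal_metric (lam : chart -> X -> R) : Prop :=
  [/\ forall c x, atlas S c -> cdom c x -> 0 < lam c x,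
      forall c, atlas S c -> smooth_on (crange c setT) (lam c \o cinv c) &
      forall c d x, atlas S c -> atlas S d -> cdom c x -> cdom d x ->
        lam d x = lam c x * sqmod (jac c d x)].

Definition euclidean_near (lam : chart -> X -> R) (x0 : X) : Prop :=
  exists c, [/\ atlas S c, cdom c x0 & \forall x \near x0, lam c x = 1].

(* The integral over the surface of omega = lam_c dx /\ dy, cut along a finite
   cover by coordinate domains. *)
Definition total_area (lam : chart -> X -> R) (A : R) : Prop :=
  exists (n : nat) (c : 'I_n -> chart),
    [/\ forall k, atlas S (c k),
        forall x, exists k, cdom (c k) x &
        A%:E = (\sum_(k < n) \int[lebesgue_measure \x lebesgue_measure]_(u in
          [set u : R * R | crange (c k)
             [set x | forall l : 'I_n, (l < k)%N -> ~ cdom (c l) x]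
             (u.1 +i* u.2)])
          (lam (c k) (cinv (c k) (u.1 +i* u.2)))%:E)%E].

(* m c x v w is the value at x of the metric on the tangent vectors with
   coordinates v and w in the chart c, a complex number v standing for
   (Re v) d/dx + (Im v) d/dy. *)
Definition riemannian_metric_on (Y : set X) (m : chart -> X -> C -> C -> R)
    : Prop :=
  [/\ forall c x, atlas S c -> cdom c x -> Y x ->
        [/\ forall v w, m c x v w = m c x w v,
            forall (t : R) u v w,
              m c x (t%:C * u + v) w = t * m c x u w + m c x v w &
            forall v, v != 0 -> 0 < m c x v v],
      forall c v w, atlas S c ->
        smooth_on (crange c Y) (fun z => m c (cinv c z) v w) &
      forall c d x v w, atlas S c -> atlas S d -> cdom c x -> cdom d x -> Y x ->
        m d x v w = m c x (jac c d x * v) (jac c d x * w)].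

Definition metric_mx (m : chart -> X -> C -> C -> R) (c : chart) (z : C)
    : 'M[R]_2 :=
  \matrix_(k, l) m c (cinv c z) (dir R k) (dir R l).

Definition has_gauss_curvature (Y : set X) (m : chart -> X -> C -> C -> R)
    (kappa : R) : Prop :=
  forall c z, atlas S c -> crange c Y z ->
    gauss_curvature (metric_mx m c) z = kappa.

End RiemannSurface.

Section Parabolic.
Variables (R : realType) (X : topologicalType) (m : nat).
Variables (p : 'I_m -> X) (theta : 'I_m -> R).

Definition fracpart (t : R) : R := t - (Num.floor t)%:~R.

Definition punctured : set X := ~` range p.

(* The divisor sum_i n_i p_i. *)
Definition point_divisor (n : 'I_m -> int) (x : X) : int :=
  \sum_(i < m | p i == x) n i.

Definition div_D : X -> int := point_divisor (fun=> 1).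
Definition div_D1 : X -> int := point_divisor (fun i =>
  ((theta i != 0) && (fracpart (theta i) == 0))%:Z).
Definition div_D3 : X -> int := point_divisor (fun i =>
  ((theta i != 0) && (fracpart (theta i) == 2^-1))%:Z).
Definition div_D4 : X -> int := point_divisor (fun i =>
  ((theta i != 0) && (2^-1 < fracpart (theta i)))%:Z).

(* The determinant of E_0 = K^(1/2) (+) K^(-1/2)(Dtilde - D) is
   O(Dtilde - D), where Dtilde = sum_i [theta_i] p_i. *)
Definition degree_E0 : int := \sum_(i < m) (Num.floor (theta i) - 1).
Definition weight1 (i : 'I_m) : R := 2^-1 * (1 - fracpart (theta i)).
Definition weight2 (i : 'I_m) : R := 2^-1 * (1 + fracpart (theta i)).
Definition parabolic_degree : R :=
  degree_E0%:~R + \sum_(i < m) (weight1 i + weight2 i).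
Definition slope : R := parabolic_degree / 2.

(* Gram matrix of the model metric in the frame
   (dz^(1/2), z^(1 - [theta]) dz^(-1/2)), with r = |z|. *)
Definition model_metric (t r : R) : 'M[R[i]]_2 :=
  if t == 0 then mx2 (- r * ln r)%:C 0 0 (- r / ln r)%:C
  else mx2 (r `^ (1 - fracpart t))%:C 0 0 (r `^ (1 + fracpart t))%:C.

End Parabolic.

Section HermitianEinstein.
Variables (R : realType) (X : topologicalType).
Variables (S : compact_riemann_surface R X) (L : half_canonical S).
Variables (m : nat) (p : 'I_m -> X) (theta : 'I_m -> R).
Local Notation C := (cplx R).

(* A smooth Hermitian metric on E = K^(1/2) (+) K^(-1/2) over the punctured
   surface: H j is its Gram matrix in the frame (e_j, e_j^-1). *)
Definition hermitian_metric (H : half_index L -> X -> 'M[R[i]]_2) : Prop :=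
  [/\ forall j x, cdom (half_chart j) x -> punctured p x ->
        hermitian_posdef (H j x),
      forall j k x, cdom (half_chart j) x -> cdom (half_chart k) x ->
        punctured p x ->
        let s := half_trans j k x in
        H j x = (mx2 s 0 0 s^-1)^t* *m H k x *m mx2 s 0 0 s^-1 &
      forall j k l, csmooth_on (crange (half_chart j) (punctured p))
        (fun z => H j (cinv (half_chart j) z) k l)].

(* Phi_a = higgs_field a j dz_j in the frame (e_j, e_j^-1); the sections 1_D
   and 1_Dtilde are the constant function 1 on the punctured surface. *)
Definition higgs_field (a : chart R X -> X -> C) (j : half_index L) (x : X)
    : 'M[R[i]]_2 :=
  mx2 0 (a (half_chart j) x) 2^-1 0.

(* Coefficients of dz /\ dzbar, where omega = lam (i/2) dz /\ dzbar. *)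
Definition hermitian_einstein_equation (a : chart R X -> X -> C)
    (lam : chart R X -> X -> R) (A : R)
    (H : half_index L -> X -> 'M[R[i]]_2) : Prop :=
  forall j x, cdom (half_chart j) x -> punctured p x ->
    let c := half_chart j in
    let phi := higgs_field a j x in
    let phis := hadjoint (H j x) phi in
    chern_curvature (fun z => H j (cinv c z)) (cmap c x)
      + (phi *m phis - phis *m phi)
    = (- 2 * (pi : R)%:C * 'i * (slope theta / A)%:C
        * ((lam c x)%:C * ('i / 2)))%:M.

Definition adapted_at_punctures (H : half_index L -> X -> 'M[R[i]]_2) : Prop :=
  forall (i : 'I_m) (j : half_index L), cdom (half_chart j) (p i) ->
    exists2 K : R, 0 < K &
      \forall x \near p i, x != p i ->
        let z := cmap (half_chart j) x - cmap (half_chart j) (p i) in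
        let T := mx2 1 0 0 (z ^ (1 - Num.floor (theta i))) in
        let M := model_metric (theta i) (modulus z) in
        forall v : 'cV[R[i]]_2,
          K^-1%:C * hform M v <= hform (T^t* *m H j x *m T) v
            <= K%:C * hform M v.

Definition hermitian_einstein (a : chart R X -> X -> C)
    (lam : chart R X -> X -> R) (A : R)
    (H : half_index L -> X -> 'M[R[i]]_2) : Prop :=
  [/\ hermitian_metric H, hermitian_einstein_equation a lam A H &
      adapted_at_punctures H].

(* h_a = g_a |dz|^2 in the coordinate z = z_c.  If e_j is a frame at x then
   dz^(1/2) = t e_j with t^2 = dz/dz_j, whence the factors |dz/dz_j|; the
   choice of j is immaterial. *)
Definition g_of (H : half_index L -> X -> 'M[R[i]]_2)
    (c : chart R X) (x : X) : R :=
  let j := sval (cid (half_cover L x)) in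
  let q := modulus (jac c (half_chart j) x) in
  (q^-1 * complex.Re (H j x 1 1)) / (q * complex.Re (H j x 0 0)).

(* 2 f dz^2 + (g + 4 |f|^2 / g) dz dzbar + 2 fbar dzbar^2 as a symmetric
   bilinear form, where dz dzbar = (dz (x) dzbar + dzbar (x) dz) / 2. *)
Definition hhat (a : chart R X -> X -> C)
    (H : half_index L -> X -> 'M[R[i]]_2)
    (c : chart R X) (x : X) (v w : C) : R :=
  let f : R[i] := a c x in
  let g : R[i] := (g_of H c x)%:C in
  complex.Re (2 * f * (v * w)
    + (g + 4 * f * f^* / g) * ((v * w^* + v^* * w) / 2)
    + 2 * f^* * (v^* * w^*)).

End HermitianEinstein.

(* Main.v *)
Require Import Defs.
From HB Require Import structures.
From mathcomp Require Import all_boot all_order all_algebra.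
From mathcomp Require Import complex.
From mathcomp Require Import all_classical all_reals all_analysis.
From mathcomp Require Import ring lra zify.
Set Implicit Arguments.
Unset Strict Implicit.
Unset Printing Implicit Defensive.
Import Order.TTheory GRing.Theory Num.Theory numFieldNormedType.Exports.
Local Open Scope classical_set_scope.
Local Open Scope complex_scope.
Local Open Scope ring_scope.

(** For weights in [0, 1/2) all integer parts vanish and all fractional parts are
   below 1/2, so that the three divisors are zero; moreover the slope is 0, and
   the Hermitian-Einstein equation says that the connection with the Higgs field
   is flat. The point is then that the metric [H] is diagonal. In a coordinate,
   the equation for [H = diag (A, C)] reduces to an equation for [g = C / A],

     d_zbar (d_z g / g) = g / 2 - 2 |a|^2 / g                         ([toda]),

   and [hhat] is the form [|2 a dz + g dzbar|^2 / g]. It is positive definite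
   exactly where [2 |a| < g], and it then has curvature -1, by a computation with
   the Brioschi formula ([pullback_curvature]). So two facts remain: [H] is
   diagonal, and [2 |a| < g].

   [H] is diagonal. Changing the sign of the second summand of the bundle changes
   the sign of the Higgs field, and thus carries [H] to another solution. The
   [defect], which measures how far apart the two solutions are, is subharmonic,
   its Laplacian being a sum of squares ([defect_lap]). It is bounded at the
   punctures, where both solutions are bounded by the same model, and a bounded
   subharmonic function on a punctured compact surface is constant
   ([subharmonic_constant]). If the constant is not 0, all the squares vanish,
   and one of them gives [2 |a| = g] everywhere ([diagonal_or_flat]).

   [2 |a| < g]. The function [s = 4 |a|^2 / g^2] satisfies
   [Lap s >= 4 g s (s - 1)], and it tends to 0 at the punctures: [a] has at most
   simple poles there, and [g] grows faster than [1 / |z|] because the weights are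
   below 1/2 ([model_ratio], [ratio_small]). At a maximum, [s <= 1]; by the strong
   minimum principle applied to [1 - s], either [s < 1] everywhere or [s = 1]
   everywhere ([ratio_lt1_or_flat]).

   In both arguments the exceptional case is that [2 |a| = g] everywhere. As [s]
   tends to 0 at punctures there are none, and [a] is a quadratic differential
   without zeros and poles. This contradicts the negative Euler characteristic
   ([nowhere_zero_euler_ge0]). Indeed, the local coordinates in which [a] is
   [dz^2] fit together, up to signs and translations, into a map [F] from the
   plane onto the surface, obtained by translating natural discs of a uniform
   radius. Two points with the same image differ by a period of [F]: the other
   possibility, a half-turn, would contradict the injectivity of [F] near the
   centre. Paths lift through [F], whence a 1-cocycle with the value 0 on all
   periods is exact. The periods form a discrete group, so that all of them depend
   rationally on two, and the first Betti number is at most 2. If it is 2, the cup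
   product of a basis is not exact, and the second Betti number is not 0. As the
   one of degree 0 is not 0 either, the Euler characteristic is not negative
   ([flat_euler_ge0]).

   The smoothness of holomorphic functions, which are only assumed to be
   differentiable, comes from Goursat's theorem and Cauchy's formula on a
   square. *)

(** * The modulus *)
Section Modulus.
Variable R : realType.
Local Notation C := (cplx R).
Implicit Types z w : C.

Lemma modulusE z : modulus z = ComplexField.Normc.normc z.
Proof. by case: z. Qed.

Lemma modulus_ge0 z : 0 <= modulus z.
Proof. exact: sqrtr_ge0. Qed.

Lemma modulus0 : modulus (0 : C) = 0.
Proof. by rewrite modulusE ComplexField.Normc.normc0. Qed.

Lemma modulus1 : modulus (1 : C) = 1.
Proof. by rewrite modulusE ComplexField.Normc.normc1. Qed.

Lemma modulusM z w : modulus (z * w) = modulus z * modulus w.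
Proof. by rewrite !modulusE ComplexField.Normc.normcM. Qed.

Lemma modulusV z : modulus z^-1 = (modulus z)^-1.
Proof. by rewrite !modulusE ComplexField.Normc.normcV. Qed.

Lemma modulusX z n : modulus (z ^+ n) = modulus z ^+ n.
Proof. by elim: n => [|n IH]; rewrite ?modulus1// !exprS modulusM IH. Qed.

Lemma modulusN z : modulus (- z) = modulus z.
Proof. by rewrite !modulusE normcN. Qed.

Lemma modulusD z w : modulus (z + w) <= modulus z + modulus w.
Proof. by rewrite !modulusE le_normcD. Qed.

Lemma modulusBC z w : modulus (z - w) = modulus (w - z).
Proof. by rewrite -modulusN opprB. Qed.

Lemma modulusB z w : modulus z - modulus w <= modulus (z - w).
Proof. by rewrite lerBlDr; apply: le_trans (modulusD _ _); rewrite subrK. Qed.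

Lemma modulus_sqr z : modulus z ^+ 2 = sqmod z.
Proof. by rewrite sqr_sqrtr// addr_ge0// sqr_ge0. Qed.

Lemma modulus_eq0 z : (modulus z == 0) = (z == 0).
Proof.
apply/idP/idP => [|/eqP->]; last by rewrite modulus0.
by rewrite modulusE => /eqP/ComplexField.Normc.eq0_normc ->.
Qed.

Lemma modulus_gt0 z : (0 < modulus z) = (z != 0).
Proof. by rewrite lt_neqAle modulus_ge0 andbT eq_sym modulus_eq0. Qed.

Lemma modulus_real (x : R) : modulus (x%:C : C) = `|x|.
Proof. by rewrite /modulus /sqmod /= expr0n addr0 sqrtr_sqr. Qed.

Lemma modulus_i : modulus ('i : C) = 1.
Proof. by rewrite /modulus /sqmod /= expr0n add0r expr1n sqrtr1. Qed.

Lemma modulus_conj z : modulus (z^* : C) = modulus z.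
Proof. by case: z => a b; rewrite /modulus /sqmod /= sqrrN. Qed.

Lemma Re_le_modulus z : `|complex.Re z| <= modulus z.
Proof.
by rewrite -sqrtr_sqr ler_sqrt ?lerDl ?sqr_ge0// addr_ge0// sqr_ge0.
Qed.

Lemma Im_le_modulus z : `|complex.Im z| <= modulus z.
Proof.
by rewrite -sqrtr_sqr ler_sqrt ?lerDr ?sqr_ge0// addr_ge0// sqr_ge0.
Qed.

Lemma modulus_le_ReIm z : modulus z <= `|complex.Re z| + `|complex.Im z|.
Proof.
have -> : z = (complex.Re z)%:C + 'i * (complex.Im z)%:C by case: z => a b; simpc.
apply: le_trans (modulusD _ _) _; rewrite modulusM modulus_i mul1r !modulus_real.
by case: z => a b; rewrite /= !mul0r !mulr0 ?addr0 ?add0r ?mul1r ?subr0.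
Qed.

Lemma normr_modulus z : `|z| = (modulus z)%:C.
Proof. exact: normc_def. Qed.

Lemma ReB z w : complex.Re (z - w) = complex.Re z - complex.Re w.
Proof. by case: z w => [? ?] [? ?]. Qed.

Lemma ImB z w : complex.Im (z - w) = complex.Im z - complex.Im w.
Proof. by case: z w => [? ?] [? ?]. Qed.

Lemma nbhs_modulus z (P : set C) :
  nbhs z P <-> exists2 d : R, 0 < d & forall w, modulus (w - z) < d -> P w.
Proof.
split=> [/nbhs_ballP[e /= e0 eP]|[d d0 dP]].
- have [er epos] : (complex.Re e)%:C = e /\ 0 < complex.Re e.
    by move: e0; case: (e) => a b; rewrite ltcE /= => /andP[/eqP-> ->].
  exists (complex.Re e) => // w wz; apply: eP.
  by rewrite -ball_normE /= distrC normr_modulus -er ltcR.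
- apply/nbhs_ballP; exists d%:C; first by rewrite /= ltcR.
  by move=> w; rewrite -ball_normE /= distrC normr_modulus ltcR => /dP.
Qed.

Lemma cvg_modulus (T : Type) (F : set_system T) (FF : Filter F) (f : T -> C) (l : C) :
  f @ F --> l <-> forall e : R, 0 < e -> \forall x \near F, modulus (f x - l) < e.
Proof.
split=> [fl e e0|H].
  have /fl// : nbhs l [set w | modulus (w - l) < e] by apply/nbhs_modulus; exists e.
by move=> P /nbhs_modulus[d d0 dP]; apply: filterS (H _ d0) => x; exact: dP.
Qed.

Lemma near_modulus z (d : R) : 0 < d -> \forall w \near z, modulus (w - z) < d.
Proof. by move=> d0; apply/nbhs_modulus; exists d. Qed.

Lemma open_modulus (U : set C) z : open U -> U z ->
  exists2 d : R, 0 < d & forall w, modulus (w - z) < d -> U w.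
Proof. by move=> oU Uz; apply/nbhs_modulus; apply: open_nbhs_nbhs. Qed.

Lemma open_disc z (d : R) : open [set w : C | modulus (w - z) < d].
Proof.
rewrite openE => w /= wd; apply/nbhs_modulus.
exists (d - modulus (w - z)); first by rewrite subr_gt0.
move=> v vw /=; rewrite -(subrK w v) -addrA.
by apply: le_lt_trans (modulusD _ _) _; rewrite -ltrBrDr.
Qed.

Lemma continuous_modulusP (f : C -> R) z :
  {for z, continuous f} <-> forall e : R, 0 < e ->
    exists2 d : R, 0 < d & forall w, modulus (w - z) < d -> `|f w - f z| < e.
Proof.
split=> [fz e e0|H].
  have /nbhs_modulus[d d0 dP] : \forall w \near z, `|f w - f z| < e.
    have /(@cvgrPdist_lt _ _ _ (nbhs z)) /(_ _ e0) := fz.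
    by apply: filterS => w; rewrite distrC.
  by exists d.
apply/(@cvgrPdist_lt _ _ _ (nbhs z)) => e /H[d d0 dP]; apply/nbhs_modulus; exists d => // w /dP.
by rewrite distrC.
Qed.

Lemma continuous_Re : continuous (@complex.Re R : C -> R).
Proof.
move=> z; apply/continuous_modulusP => e e0; exists e => // w; apply: le_lt_trans.
by rewrite -ReB Re_le_modulus.
Qed.

Lemma continuous_Im : continuous (@complex.Im R : C -> R).
Proof.
move=> z; apply/continuous_modulusP => e e0; exists e => // w; apply: le_lt_trans.
by rewrite -ImB Im_le_modulus.
Qed.

Lemma continuous_dist z : continuous ((fun w => modulus (w - z)) : C -> R).
Proof.
move=> w; apply/continuous_modulusP => e e0; exists e => // v; apply: le_lt_trans.
have h a b : modulus (a - z) <= modulus (b - z) + modulus (a - b).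
  by rewrite -[a - z](subrKA b) addrC modulusD.
have h1 := h v w; have h2 := h w v; rewrite (modulusBC w v) in h2.
by rewrite ler_norml; apply/andP; split; lra.
Qed.

Lemma continuous_modulus : continuous (@modulus R : C -> R).
Proof.
rewrite (_ : @modulus R = fun w => modulus (w - 0)); first exact: continuous_dist.
by apply/funext => w; rewrite subr0.
Qed.

Lemma continuous_real_complex : continuous ((fun x : R => x%:C) : R -> C).
Proof.
move=> x; apply/cvg_modulus => e e0; near=> y.
rewrite -rmorphB modulus_real distrC; near: y; exact: cvgr_dist_lt.
Unshelve. all: by end_near. Qed.

Lemma cvg_Complex (T : Type) (F : set_system T) (FF : Filter F) (f g : T -> R) (a b : R) :
  f @ F --> a -> g @ F --> b ->
  ((fun t => f t +i* g t) : T -> C) @ F --> (a +i* b : C).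
Proof.
move=> fa gb; apply/(@cvg_modulus _ F) => e e0; have e2 : 0 < e / 2 by lra.
have /cvgrPdist_lt /(_ _ e2) ha := fa; have /cvgrPdist_lt /(_ _ e2) hb := gb.
apply: filterS2 ha hb => t; rewrite (distrC a) (distrC b) => ha hb.
apply: le_lt_trans (modulus_le_ReIm _) _; rewrite ReB ImB /=.
by rewrite (splitr e) ltrD.
Qed.

(** A closed square is the image of a product of two segments. *)
Lemma compact_square (z : C) (d : R) :
  compact [set w : C | `|complex.Re w - complex.Re z| <= d /\
                       `|complex.Im w - complex.Im z| <= d].
Proof.
pose I (x : R) := `[x - d, x + d]%classic.
have -> : [set w : C | `|complex.Re w - complex.Re z| <= d /\
                       `|complex.Im w - complex.Im z| <= d] =
   ((fun u : R * R => u.1 +i* u.2) : R * R -> C) @` (I (complex.Re z) `*` I (complex.Im z)).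
  apply/seteqP; split => w /=.
    move=> [h1 h2]; exists (complex.Re w, complex.Im w); last by case: (w).
    by split; rewrite /I /= in_itv/= -ler_distl.
  by case=> -[a b] [/= + +] <- /=; rewrite /I /= !in_itv/= -!ler_distl.
apply: continuous_compact; last by apply: compact_setX; apply: segment_compact.
apply: continuous_subspaceT => u; apply: cvg_Complex; [exact: cvg_fst|exact: cvg_snd].
Qed.

Lemma compact_disc (z : C) (d : R) : compact [set w : C | modulus (w - z) <= d].
Proof.
apply: (subclosed_compact _ (@compact_square z d)).
- rewrite (_ : [set w | _] = (fun w : C => modulus (w - z)) @^-1` [set x | x <= d])//.
  apply: closed_comp; last exact: closed_le.
  by move=> w _; exact: continuous_dist.
- move=> w /= h; split; apply: le_trans h.
    by rewrite -ReB Re_le_modulus.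
  by rewrite -ImB Im_le_modulus.
Qed.

End Modulus.

(** * Derivatives *)
Section Derivatives.
Variable R : realType.
Local Notation C := (cplx R).
Implicit Types z w l : C.

Lemma cderP (f : C -> C) z l :
  is_derive z (1 : C) f l <-> forall e : R, 0 < e -> exists2 d : R, 0 < d &
    forall w, modulus (w - z) < d ->
      modulus (f w - f z - l * (w - z)) <= e * modulus (w - z).
Proof.
have key : ((fun h : C => h^-1 *: (f (h *: (1 : C) + z) - f z)) @ (0 : C)^' --> l) <->
   forall e : R, 0 < e -> exists2 d : R, 0 < d &
    forall w, modulus (w - z) < d ->
      modulus (f w - f z - l * (w - z)) <= e * modulus (w - z).
  split=> [/cvg_modulus H e e0|H].
    have /nbhs_modulus[d d0 dP] := H _ e0; exists d => // w wz.
    have [->|wn] := eqVneq w z; first by rewrite !subrr mulr0 subrr modulus0 mulr0.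
    have wz0 : w - z != 0 by rewrite subr_eq0.
    have := dP (w - z); rewrite subr0 => /(_ wz wz0) /ltW.
    rewrite /= [(w - z) *: 1]mulr1 subrK.
    rewrite [_ *: _](_ : _ = (f w - f z) / (w - z)); last by rewrite mulrC.
    rewrite (_ : f w - f z - l * (w - z) = ((f w - f z) / (w - z) - l) * (w - z)).
      by rewrite modulusM => h; apply: ler_wpM2r => //; apply: modulus_ge0.
    by rewrite mulrBl divfK.
  apply/cvg_modulus => e e0; have [|d d0 dP] := H (e / 2); first by rewrite divr_gt0.
  apply/nbhs_modulus; exists d => // h; rewrite subr0 => hd hn.
  have := dP (h + z); rewrite addrK => /(_ hd).
  rewrite /= [h *: 1]mulr1.
  rewrite (_ : f (h + z) - f z - l * h = h * (h^-1 *: (f (h + z) - f z) - l)).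
    rewrite modulusM mulrC ler_pM2r ?modulus_gt0// => /le_lt_trans; apply; lra.
  by rewrite mulrBr -[_ *: _]/(_ * _) mulVKf// [l * h]mulrC.
rewrite -key; split=> [[dfz <-] //|H].
by apply: DeriveDef; [apply: cvgP H|apply: (cvg_lim _ H)].
Qed.

Lemma rderP (f : R -> R) (x a : R) :
  is_derive x (1 : R) f a <-> forall e : R, 0 < e -> exists2 d : R, 0 < d &
    forall y, `|y - x| < d -> `|f y - f x - a * (y - x)| <= e * `|y - x|.
Proof.
have key : ((fun h : R => h^-1 *: (f (h *: (1 : R) + x) - f x)) @ (0 : R)^' --> a) <->
   forall e : R, 0 < e -> exists2 d : R, 0 < d &
    forall y, `|y - x| < d -> `|f y - f x - a * (y - x)| <= e * `|y - x|.
  split=> [/cvgrPdist_lt H e e0|H].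
    have /nbhs_ballP[d /= d0 dP] := H _ e0; exists d => // w wz.
    have [->|wn] := eqVneq w x; first by rewrite !subrr mulr0 subrr normr0 mulr0.
    have wz0 : w - x != 0 by rewrite subr_eq0.
    have /dP : ball (0 : R) d (w - x) by rewrite -ball_normE /= sub0r normrN.
    move=> /(_ wz0) /ltW; rewrite /= [(w - x) *: 1]mulr1 subrK distrC.
    rewrite [_ *: _](_ : _ = (f w - f x) / (w - x)); last by rewrite mulrC.
    rewrite (_ : f w - f x - a * (w - x) = ((f w - f x) / (w - x) - a) * (w - x)).
      by rewrite normrM => h; apply: ler_wpM2r => //; apply: normr_ge0.
    by rewrite mulrBl divfK.
  apply/cvgrPdist_lt => e e0; have [|d d0 dP] := H (e / 2); first by rewrite divr_gt0.
  apply/nbhs_ballP; exists d => // h; rewrite -ball_normE /= sub0r normrN => hd hn.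
  have := dP (h + x); rewrite addrK => /(_ hd).
  rewrite /= [h *: 1]mulr1 [`|a - _|]distrC.
  rewrite (_ : f (h + x) - f x - a * h = h * (h^-1 *: (f (h + x) - f x) - a)).
    rewrite normrM mulrC ler_pM2r ?normr_gt0// => /le_lt_trans; apply; lra.
  by rewrite mulrBr -[_ *: _]/(_ * _) mulVKf// [a * h]mulrC.
rewrite -key; split=> [[dfz <-] //|H].
by apply: DeriveDef; [apply: cvgP H|apply: (cvg_lim _ H)].
Qed.

Lemma rder_shift (f : R -> R) (x a : R) :
  is_derive (0 : R) (1 : R) (fun s => f (x + s)) a -> is_derive x (1 : R) f a.
Proof.
move=> /rderP H; apply/rderP => e /H[d d0 dP]; exists d => // y yd.
by have := dP (y - x); rewrite subr0 addr0 subrKC; apply.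
Qed.

Lemma holomorphic_cder (U : set C) (f : C -> C) z :
  holomorphic_on U f -> U z -> is_derive z (1 : C) f (derive1 f z).
Proof. by move=> hf Uz; rewrite derive1E; apply: DeriveDef => //; apply: hf. Qed.

Lemma cder_derive1 (f : C -> C) z l : is_derive z (1 : C) f l -> derive1 f z = l.
Proof. by move=> [_ <-]; rewrite derive1E. Qed.

Lemma cder_holomorphic (f : C -> C) z l : is_derive z (1 : C) f l -> derivable f z 1.
Proof. by case. Qed.

Lemma cder_continuous (f : C -> C) z l : is_derive z (1 : C) f l -> {for z, continuous f}.
Proof.
move=> /cderP df; apply/(@cvg_modulus _ _ (nbhs z)) => e e0; have [d d0 dP] := df 1 ltr01.
have M0 : 0 < modulus l + 1 by rewrite ltr_wpDl// modulus_ge0.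
apply/nbhs_modulus; exists (Num.min d (e / (modulus l + 1))).
  by rewrite lt_min d0 divr_gt0.
move=> w; rewrite lt_min ltr_pdivlMr// => /andP[wd we].
apply: le_lt_trans we; have := dP _ wd; rewrite mul1r => h.
have -> : f w - f z = (f w - f z - l * (w - z)) + l * (w - z) by rewrite subrK.
rewrite (le_trans (modulusD _ _))// [leRHS]mulrDr mulr1 addrC lerD//.
by rewrite modulusM mulrC.
Qed.

Lemma cder_comp (f g : C -> C) z a b :
  is_derive (g z) (1 : C) f a -> is_derive z (1 : C) g b ->
  is_derive z (1 : C) (f \o g) (a * b).
Proof.
move=> /cderP df /cderP dg; apply/cderP => e e0.
pose M := modulus b + 1; have M0 : 0 < M by rewrite ltr_wpDl// modulus_ge0.
pose N := modulus a + 1; have N0 : 0 < N by rewrite ltr_wpDl// modulus_ge0.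
have [|d1 d10 d1P] := df (e / 2 / M); first by rewrite !divr_gt0.
have e1 : 0 < Num.min 1 (e / 2 / N) by rewrite lt_min ltr01 !divr_gt0.
have [d2 d20 d2P] := dg _ e1.
exists (Num.min d2 (d1 / M)); first by rewrite lt_min d20 divr_gt0.
move=> w; rewrite lt_min ltr_pdivlMr// => /andP[wd2 wd1].
have {d2P} := d2P _ wd2; rewrite minr_pMl ?modulus_ge0// le_min mul1r => /andP[h1 h2].
have gM : modulus (g w - g z) <= modulus (w - z) * M.
  have -> : g w - g z = (g w - g z - b * (w - z)) + b * (w - z) by rewrite subrK.
  rewrite (le_trans (modulusD _ _))// [leRHS]mulrDr mulr1 addrC lerD//.
  by rewrite modulusM mulrC.
have h3 := d1P _ (le_lt_trans gM wd1).
have h5 : N * modulus (g w - g z - b * (w - z)) <= e / 2 * modulus (w - z).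
  have := ler_wpM2l (ltW N0) h2; move/le_trans; apply.
  by rewrite mulrA [N * _]mulrC divfK ?gt_eqF.
have h6 : e / 2 / M * modulus (g w - g z) <= e / 2 * modulus (w - z).
  by rewrite -[leLHS]mulrA ler_wpM2l ?(divr_ge0 (ltW e0))// [leLHS]mulrC ler_pdivrMr.
have -> : (f \o g) w - (f \o g) z - a * b * (w - z) =
    (f (g w) - f (g z) - a * (g w - g z)) + a * (g w - g z - b * (w - z)).
  by rewrite /=; ring.
rewrite (le_trans (modulusD _ _))// (splitr e) [leRHS]mulrDl lerD//.
  exact: le_trans h3 h6.
apply: le_trans h5; rewrite modulusM ler_wpM2r ?modulus_ge0// /N lerDl ler01 //.
Qed.

Lemma cderV (f : C -> C) z l : f z != 0 -> is_derive z (1 : C) f l ->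
  is_derive z (1 : C) (fun w => (f w)^-1) (- (f z) ^- 2 * l).
Proof.
move=> fz [df <-]; apply: DeriveDef; first exact: derivableV.
by rewrite deriveV.
Qed.

Lemma cderM (f g : C -> C) z a b :
  is_derive z (1 : C) f a -> is_derive z (1 : C) g b ->
  is_derive z (1 : C) (fun w => f w * g w) (f z * b + g z * a).
Proof. by move=> fz gz; apply: (is_deriveM fz gz). Qed.

Lemma near_cder (f g : C -> C) z l :
  (\forall w \near z, f w = g w) -> is_derive z (1 : C) f l -> is_derive z (1 : C) g l.
Proof. exact: near_eq_is_derive. Qed.

(** ** Real differentials and partial derivatives *)

Definition rdiff (f : C -> R) z (a b : R) := forall e : R, 0 < e ->
  exists2 d : R, 0 < d & forall w, modulus (w - z) < d ->
    `|f w - f z - (a * complex.Re (w - z) + b * complex.Im (w - z))|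
      <= e * modulus (w - z).

Definition derdir (f : C -> R) (k : 'I_2) z (a : R) :=
  is_derive (0 : R) (1 : R) (fun t : R => f (z + t%:C * dir R k)) a.

Lemma derdirP (f : C -> R) k z a : derdir f k z a -> partial k f z = a.
Proof. by move=> [_ <-]; rewrite /partial derive1E. Qed.

Lemma modulus_dir k : modulus (dir R k) = 1.
Proof. by rewrite /dir; case: ifP => _; rewrite ?modulus1 ?modulus_i. Qed.

Lemma near_line (P : set C) z k : nbhs z P ->
  \forall t \near (0 : R), P (z + t%:C * dir R k).
Proof.
move=> /nbhs_modulus[d d0 dP]; apply/nbhs_ballP; exists d => // t.
rewrite -ball_normE /= sub0r normrN => td; apply: dP.
by rewrite addrAC subrr add0r modulusM modulus_dir mulr1 modulus_real.
Qed.

Lemma near_derdir (f g : C -> R) k z a :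
  (\forall w \near z, f w = g w) -> derdir f k z a -> derdir g k z a.
Proof. by move=> fg; exact: near_eq_is_derive (near_line k fg). Qed.

Lemma near_partial (f g : C -> R) k z :
  (\forall w \near z, f w = g w) -> partial k f z = partial k g z.
Proof.
by move=> fg; rewrite /partial !derive1E; exact: near_eq_derive (near_line k fg).
Qed.

Lemma rdiff_derdir (f : C -> R) k z a b : rdiff f z a b ->
  derdir f k z (if k == 0 then a else b).
Proof.
move=> H; apply/rderP => e /H[d d0 dP]; exists d => // t; rewrite subr0 => td.
have E : z + t%:C * dir R k - z = t%:C * dir R k by rewrite addrAC subrr add0r.
have := dP (z + t%:C * dir R k); rewrite E modulusM modulus_dir mulr1 modulus_real.
move=> /(_ td); rewrite mul0r addr0; congr (`| _ - _ - _| <= _).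
by rewrite /dir; case: ifP => _ /=; ring.
Qed.

(** The increment is split along a horizontal and a vertical segment, with the
   mean value theorem on each. *)
Lemma C1_rdiff (f : C -> R) (U : set C) z : open U -> U z ->
  (forall w k, U w -> derivable (fun t : R => f (w + t%:C * dir R k)) 0 1) ->
  (forall k, {for z, continuous (partial k f)}) ->
  rdiff f z (partial 0 f z) (partial 1 f z).
Proof.
move=> oU Uz df cf e e0; have [r r0 rU] := open_modulus oU Uz.
have e2 : 0 < e / 2 by lra.
have /continuous_modulusP/(_ _ e2)[d0 d00 d0P] := cf 0.
have /continuous_modulusP/(_ _ e2)[d1 d10 d1P] := cf 1.
exists (Num.min r (Num.min d0 d1)); first by rewrite !lt_min r0 d00.
move=> w; rewrite !lt_min => /and3P[wr w0 w1].
set h := complex.Re (w - z); set k := complex.Im (w - z).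
have Ew : w = z + h%:C + k%:C * 'i.
  rewrite /h /k; case: (w) (z) => [a b] [c d]; apply/eqP; rewrite eq_complex /=.
  by apply/andP; split; apply/eqP; ring.
have line (v : C) j (a b : R) : a <= b ->
   (forall t, a <= t <= b -> U (v + t%:C * dir R j)) ->
   exists2 t, a <= t <= b & f (v + b%:C * dir R j) - f (v + a%:C * dir R j)
       = partial j f (v + t%:C * dir R j) * (b - a).
  move=> ab Uab; pose g t := f (v + t%:C * dir R j).
  have dg t : a <= t <= b -> is_derive t (1 : R) g (partial j f (v + t%:C * dir R j)).
    move=> /Uab /(df _ j) /derivableP dd.
    have H : is_derive (0 : R) (1 : R) (fun s => f (v + t%:C * dir R j + s%:C * dir R j))
       (partial j f (v + t%:C * dir R j)) by rewrite /partial derive1E.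
    apply: rder_shift; rewrite (_ : (fun s => g (t + s)) =
      (fun s => f (v + t%:C * dir R j + s%:C * dir R j)))//.
    by apply/funext => s; rewrite /g -addrA -mulrDl -rmorphD.
  have [| |t tab ->] := @MVT_segment R g (fun t => partial j f (v + t%:C * dir R j)) a b ab.
  - move=> t; rewrite in_itv /= => /andP[h1 h2]; apply: dg; by rewrite !ltW.
  - apply: derivable_within_continuous => t; rewrite in_itv /= => h1.
    by case: (dg t h1).
  - by exists t => //; move: tab; rewrite in_itv.
have line' (v : C) j (b : R) : (forall t, `|t| <= `|b| -> U (v + t%:C * dir R j)) ->
   exists2 t, `|t| <= `|b| & f (v + b%:C * dir R j) - f v
       = partial j f (v + t%:C * dir R j) * b.
  move=> Ub; have [b0|b0] := leP 0 b.
    have [t|t tb E] := line v j 0 b b0.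
      by move=> /andP[t0 tb]; apply: Ub; rewrite !ger0_norm.
    exists t; first by move: tb => /andP[t0 tb]; rewrite !ger0_norm.
    by move: E; rewrite mul0r addr0 subr0.
  have [t|t tb E] := line v j b 0 (ltW b0).
    by move=> /andP[t0 tb]; apply: Ub; rewrite !ler0_norm ?lerN2// ltW.
  exists t; first by move: tb => /andP[t0 tb]; rewrite !ler0_norm ?lerN2// ltW.
  by rewrite -opprB -[f v](_ : f (v + 0%:C * dir R j) = _) ?E ?mul0r ?addr0//; ring.
have hh : `|h| <= modulus (w - z) by exact: Re_le_modulus.
have kk : `|k| <= modulus (w - z) by exact: Im_le_modulus.
have small t s : `|t| <= `|h| -> `|s| <= `|k| ->
    modulus (t%:C + s%:C * 'i : C) <= modulus (w - z).
  move=> th sk; rewrite -ler_sqr ?nnegrE ?modulus_ge0// !modulus_sqr /sqmod.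
  rewrite -/h -/k /= !mul0r !mulr0 !mulr1 subr0 !addr0 add0r.
  by rewrite lerD// -[_ ^+ 2]real_normK ?num_real// -[X in _ <= X]real_normK ?num_real//
     ler_sqr ?nnegrE.
have D0 : dir R 0 = 1 by rewrite /dir eqxx.
have D1 : dir R 1 = 'i by [].
have [t0|t ht E0] := line' z 0 h.
  move=> h0; rewrite D0 mulr1; apply: rU; rewrite addrAC subrr add0r.
  have := small t0 0 h0; rewrite normr0 mul0r addr0 normr_ge0 => /(_ isT).
  by move=> /le_lt_trans; apply.
have [s0|s hs E1] := line' (z + h%:C) 1 k.
  move=> h0; rewrite D1; apply: rU.
  rewrite (_ : _ - z = h%:C + s0%:C * 'i); last by ring.
  by have /le_lt_trans := small h s0 (lexx _) h0; apply.
rewrite D0 !mulr1 in E0.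
rewrite D1 -Ew in E1.
have p0 : `|partial 0 f (z + t%:C) - partial 0 f z| < e / 2.
  apply: d0P; rewrite addrAC subrr add0r.
  have := small t 0 ht; rewrite normr0 mul0r addr0 normr_ge0 => /(_ isT).
  by move=> /le_lt_trans; apply.
have p1 : `|partial 1 f (z + h%:C + s%:C * 'i) - partial 1 f z| < e / 2.
  apply: d1P; rewrite (_ : _ - z = h%:C + s%:C * 'i); last by ring.
  by have /le_lt_trans := small h s (lexx _) hs; apply.
have -> : f w - f z - (partial 0 f z * h + partial 1 f z * k) =
   (partial 0 f (z + t%:C) - partial 0 f z) * h +
   (partial 1 f (z + h%:C + s%:C * 'i) - partial 1 f z) * k.
  have -> : f w - f z = (f w - f (z + h%:C)) + (f (z + h%:C) - f z) by ring.
  by rewrite E0 E1; ring.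
rewrite (le_trans (ler_normD _ _))// !normrM (splitr e) mulrDl lerD//.
  by rewrite ler_pM// ltW.
by rewrite ler_pM// ltW.
Qed.

Lemma rdiff_comp (f : C -> R) (g : C -> C) z a b l :
  rdiff f (g z) a b -> is_derive z (1 : C) g l ->
  rdiff (f \o g) z (a * complex.Re l + b * complex.Im l)
                   (b * complex.Re l - a * complex.Im l).
Proof.
move=> df dg e e0.
pose M := modulus l + 1; have M0 : 0 < M by rewrite ltr_wpDl// modulus_ge0.
pose N := `|a| + `|b| + 1; have N0 : 0 < N by rewrite ltr_wpDl// addr_ge0.
have [|d1 d10 d1P] := df (e / 2 / M); first by rewrite !divr_gt0.
have e1 : 0 < Num.min 1 (e / 2 / N) by rewrite lt_min ltr01 !divr_gt0.
have /cderP/(_ _ e1)[d2 d20 d2P] := dg.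
exists (Num.min d2 (d1 / M)); first by rewrite lt_min d20 divr_gt0.
move=> w; rewrite lt_min ltr_pdivlMr// => /andP[wd2 wd1].
have {d2P} := d2P _ wd2; rewrite minr_pMl ?modulus_ge0// le_min mul1r => /andP[h1 h2].
have gM : modulus (g w - g z) <= modulus (w - z) * M.
  have -> : g w - g z = (g w - g z - l * (w - z)) + l * (w - z) by rewrite subrK.
  rewrite (le_trans (modulusD _ _))// [leRHS]mulrDr mulr1 addrC lerD//.
  by rewrite modulusM mulrC.
have := d1P _ (le_lt_trans gM wd1).
set u := f (g w) - _; rewrite /= -/u => h3.
have h4 : `|a * complex.Re (g w - g z - l * (w - z)) + b * complex.Im (g w - g z - l * (w - z))|
   <= N * modulus (g w - g z - l * (w - z)).
  rewrite /N !mulrDl mul1r (le_trans (ler_normD _ _))// !normrM -[leLHS]addr0.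
  rewrite lerD ?modulus_ge0// lerD// ler_wpM2l//; first exact: Re_le_modulus.
  exact: Im_le_modulus.
have h5 : N * modulus (g w - g z - l * (w - z)) <= e / 2 * modulus (w - z).
  have := ler_wpM2l (ltW N0) h2; move/le_trans; apply.
  by rewrite mulrA [N * _]mulrC divfK ?gt_eqF.
have h6 : e / 2 / M * modulus (g w - g z) <= e / 2 * modulus (w - z).
  rewrite -[leLHS]mulrA ler_wpM2l ?(divr_ge0 (ltW e0))// [leLHS]mulrC ler_pdivrMr//.
have -> : u - ((a * complex.Re l + b * complex.Im l) * complex.Re (w - z) +
      (b * complex.Re l - a * complex.Im l) * complex.Im (w - z)) =
   (u - (a * complex.Re (g w - g z) + b * complex.Im (g w - g z))) +
   (a * complex.Re (g w - g z - l * (w - z)) + b * complex.Im (g w - g z - l * (w - z))).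
  by case: (l) (w - z) (g w - g z) => [? ?] [? ?] [? ?] /=; ring.
rewrite (le_trans (ler_normD _ _))// (splitr e) [leRHS]mulrDl lerD//.
  exact: le_trans h3 h6.
exact: le_trans h4 h5.
Qed.

Lemma rdiff_Re (g : C -> C) z l : is_derive z (1 : C) g l ->
  rdiff (fun w => complex.Re (g w)) z (complex.Re l) (- complex.Im l).
Proof.
move=> /cderP dg e /dg[d d0 dP]; exists d => // w /dP; apply: le_trans.
apply: le_trans (Re_le_modulus _); rewrite le_eqVlt; apply/orP; left; apply/eqP; congr `| _ |.
by case: (l) (w) (z) (g w) (g z) => [? ?] [? ?] [? ?] [? ?] [? ?] /=; ring.
Qed.

Lemma rdiff_Im (g : C -> C) z l : is_derive z (1 : C) g l ->
  rdiff (fun w => complex.Im (g w)) z (complex.Im l) (complex.Re l).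
Proof.
move=> /cderP dg e /dg[d d0 dP]; exists d => // w /dP; apply: le_trans.
apply: le_trans (Im_le_modulus _); rewrite le_eqVlt; apply/orP; left; apply/eqP; congr `| _ |.
by case: (l) (w) (z) (g w) (g z) => [? ?] [? ?] [? ?] [? ?] [? ?] /=; ring.
Qed.

End Derivatives.

(** * Integrals of continuous functions on segments *)
Section Integral.
Variable R : realType.
Local Notation C := (cplx R).

Definition antider (a b : R) (f F : R -> R) :=
  forall t, a <= t <= b -> is_derive t (1 : R) F (f t).

Definition rcts_on (a b : R) (f : R -> R) :=
  forall t, a <= t <= b -> {for t, continuous f}.

Definition cts_on (a b : R) (f : R -> C) :=
  forall t, a <= t <= b -> {for t, continuous f}.

Lemma antider_exists (a b : R) (f : R -> R) : rcts_on a b f -> exists F, antider a b f F.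
Proof.
move=> cf; have [ab|ba] := leP a b; last first.
  by exists (fun=> 0) => t /andP[h1 h2]; move: (lt_le_trans ba (le_trans h1 h2)); rewrite ltxx.
pose g t := f (Num.max a (Num.min t b)).
have clamp t : a <= Num.max a (Num.min t b) <= b.
  by rewrite le_max lexx ge_max ab ge_min lexx orbT.
have cg : continuous g.
  move=> t; apply: (@continuous_comp _ _ _ (fun t => Num.max a (Num.min t b)) f).
    apply: (@continuous_max R R (cst a) (fun t => Num.min t b)); first exact: cvg_cst.
    by apply: (@continuous_min R R id (cst b)); [exact: cvg_id|exact: cvg_cst].
  exact: cf.
have intg : lebesgue_measure.-integrable `[a - 1, b + 1] (EFin \o g).
  apply: continuous_compact_integrable; first exact: segment_compact.
  exact: continuous_subspaceT.
exists (fun x => \int[lebesgue_measure]_(t in `[a - 1, x]) g t) => t /andP[at_ tb].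
have tb1 : t < b + 1 by lra.
have at1 : a - 1 < t by lra.
have intg' : lebesgue_measure.-integrable `[a - 1, b + 1] (EFin \o g) by [].
have [dF EF] := continuous_FTC1_closed tb1 intg' at1 (cg t).
have -> : f t = g t by rewrite /g min_l// max_r.
by rewrite -EF derive1E; apply: DeriveDef.
Qed.

Definition oint (a b : R) (f : R -> R) : R :=
  let F := xget (fun=> 0) [set F | antider a b f F] in F b - F a.

Lemma antider_bound (a b M : R) (f F : R -> R) : a <= b -> antider a b f F ->
  (forall t, a <= t <= b -> `|f t| <= M) -> `|F b - F a| <= M * (b - a).
Proof.
move=> ab aF fM; have [| |t tab ->] := @MVT_segment R F f a b ab.
- by move=> t; rewrite in_itv /= => /andP[h1 h2]; apply: aF; rewrite !ltW.
- by apply: derivable_within_continuous => t; rewrite in_itv /= => /aF[].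
- rewrite normrM [`|b - a|]ger0_norm ?subr_ge0// ler_wpM2r ?subr_ge0//.
  by apply: fM; move: tab; rewrite in_itv.
Qed.

Lemma antider_ge (a b m : R) (f F : R -> R) : a <= b -> antider a b f F ->
  (forall t, a <= t <= b -> m <= f t) -> m * (b - a) <= F b - F a.
Proof.
move=> ab aF fM; have [| |t tab ->] := @MVT_segment R F f a b ab.
- by move=> t; rewrite in_itv /= => /andP[h1 h2]; apply: aF; rewrite !ltW.
- by apply: derivable_within_continuous => t; rewrite in_itv /= => /aF[].
- rewrite ler_wpM2r ?subr_ge0//.
  by apply: fM; move: tab; rewrite in_itv.
Qed.

Lemma antiderD (a b : R) f g F G : antider a b f F -> antider a b g G ->
  antider a b (fun t => f t + g t) (fun t => F t + G t).
Proof. by move=> hF hG t tab; apply: is_deriveD; [apply: hF|apply: hG]. Qed.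

Lemma antiderZ (a b k : R) f F : antider a b f F ->
  antider a b (fun t => k * f t) (fun t => k * F t).
Proof. by move=> hF t tab; apply: (@is_deriveZ _ _ _ F k); apply: hF. Qed.

Lemma ointE (a b : R) f F : a <= b -> antider a b f F -> oint a b f = F b - F a.
Proof.
move=> ab aF; rewrite /oint; case: xgetP => [G _ aG|/(_ F)//].
have aD : antider a b (fun=> 0) (fun t => G t + -1 * F t).
  move=> t tab; have := antiderD aG (antiderZ (-1) aF) tab.
  by rewrite mulN1r subrr.
have := @antider_bound a b 0 (fun=> 0) _ ab aD; rewrite normr0 mul0r normr_le0.
move=> H; have /eqP : G b + -1 * F b - (G a + -1 * F a) == 0 by apply: H => t _.
lra.
Qed.

Definition cint (a b : R) (phi : R -> C) : C :=
  oint a b (fun t => complex.Re (phi t)) +i* oint a b (fun t => complex.Im (phi t)).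

Definition cantider (a b : R) (phi Phi : R -> C) :=
  antider a b (fun t => complex.Re (phi t)) (fun t => complex.Re (Phi t)) /\
  antider a b (fun t => complex.Im (phi t)) (fun t => complex.Im (Phi t)).

Lemma cantider_exists (a b : R) (phi : R -> C) :
  cts_on a b phi -> exists Phi, cantider a b phi Phi.
Proof.
move=> cp.
have [|F aF] := @antider_exists a b (fun t => complex.Re (phi t)).
  by move=> t tab; apply: continuous_comp (cp _ tab) _; exact: continuous_Re.
have [|G aG] := @antider_exists a b (fun t => complex.Im (phi t)).
  by move=> t tab; apply: continuous_comp (cp _ tab) _; exact: continuous_Im.
by exists (fun t => F t +i* G t).
Qed.

Lemma cintE (a b : R) phi Phi : a <= b -> cantider a b phi Phi ->
  cint a b phi = Phi b - Phi a.
Proof.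
move=> ab [aF aG]; rewrite /cint (ointE ab aF) (ointE ab aG).
by case: (Phi a) (Phi b) => [? ?] [? ?].
Qed.

Lemma antider_eq (a b : R) f g F : (forall t, a <= t <= b -> f t = g t) ->
  antider a b f F -> antider a b g F.
Proof. by move=> fg aF t tab; rewrite -fg//; exact: aF. Qed.

Lemma cantider_eq (a b : R) f g F : (forall t, a <= t <= b -> f t = g t) ->
  cantider a b f F -> cantider a b g F.
Proof.
by move=> fg [h1 h2]; split; [apply: antider_eq h1|apply: antider_eq h2];
   move=> t tab; rewrite fg.
Qed.

Lemma eq_cint (a b : R) phi psi : a <= b -> cts_on a b phi ->
  (forall t, a <= t <= b -> phi t = psi t) -> cint a b phi = cint a b psi.
Proof.
move=> ab /cantider_exists[F aF] e; rewrite (cintE ab aF).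
by rewrite (cintE ab (cantider_eq e aF)).
Qed.

Lemma antider_ext (a b : R) f g F G : (forall t, g t = f t) -> (forall t, G t = F t) ->
  antider a b f F -> antider a b g G.
Proof. by move=> /funext-> /funext->. Qed.

Lemma cantiderD (a b : R) f g F G : cantider a b f F -> cantider a b g G ->
  cantider a b (fun t => f t + g t) (fun t => F t + G t).
Proof.
have reD (u v : C) : complex.Re (u + v) = complex.Re u + complex.Re v by case: u v => [? ?] [? ?].
have imD (u v : C) : complex.Im (u + v) = complex.Im u + complex.Im v by case: u v => [? ?] [? ?].
move=> [h1 h2] [k1 k2]; split.
  by apply: (antider_ext _ _ (antiderD h1 k1)) => t; rewrite reD.
by apply: (antider_ext _ _ (antiderD h2 k2)) => t; rewrite imD.
Qed.

Lemma cantiderZ (a b : R) (k : C) f F : cantider a b f F ->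
  cantider a b (fun t => k * f t) (fun t => k * F t).
Proof.
have reM (u v : C) : complex.Re (u * v) =
  complex.Re u * complex.Re v + - complex.Im u * complex.Im v.
  by case: u v => [? ?] [? ?] /=; rewrite mulNr.
have imM (u v : C) : complex.Im (u * v) =
  complex.Re u * complex.Im v + complex.Im u * complex.Re v.
  by case: u v => [? ?] [? ?] /=.
move=> [h1 h2]; split.
  apply: (antider_ext _ _ (antiderD (antiderZ (complex.Re k) h1)
    (antiderZ (- complex.Im k) h2))) => t; exact: reM.
apply: (antider_ext _ _ (antiderD (antiderZ (complex.Re k) h2)
    (antiderZ (complex.Im k) h1))) => t; exact: imM.
Qed.

Lemma cintD (a b : R) phi psi : a <= b -> cts_on a b phi -> cts_on a b psi ->
  cint a b (fun t => phi t + psi t) = cint a b phi + cint a b psi.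
Proof.
move=> ab /cantider_exists[F aF] /cantider_exists[G aG].
by rewrite (cintE ab aF) (cintE ab aG) (cintE ab (cantiderD aF aG)); ring.
Qed.

Lemma cintZ (a b : R) (k : C) phi : a <= b -> cts_on a b phi ->
  cint a b (fun t => k * phi t) = k * cint a b phi.
Proof.
move=> ab /cantider_exists[F aF].
by rewrite (cintE ab aF) (cintE ab (cantiderZ k aF)); ring.
Qed.

Lemma cantider_sub (a b c d : R) phi Phi : a <= c -> d <= b ->
  cantider a b phi Phi -> cantider c d phi Phi.
Proof.
move=> ac db [h1 h2]; split=> t /andP[ct td]; [apply: h1|apply: h2];
  by rewrite (le_trans ac ct) (le_trans td db).
Qed.

Lemma cint_split (a c b : R) phi : a <= c -> c <= b -> cts_on a b phi ->
  cint a b phi = cint a c phi + cint c b phi.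
Proof.
move=> ac cb /cantider_exists[F aF].
rewrite (cintE (le_trans ac cb) aF) (cintE ac (cantider_sub (lexx a) cb aF)).
by rewrite (cintE cb (cantider_sub ac (lexx b) aF)); ring.
Qed.

(** The factor 2 comes from bounding real and imaginary parts separately. *)
Lemma cint_bound (a b M : R) phi : a <= b -> cts_on a b phi ->
  (forall t, a <= t <= b -> modulus (phi t) <= M) ->
  modulus (cint a b phi) <= 2 * M * (b - a).
Proof.
move=> ab /cantider_exists[F [aF aG]] pM.
rewrite (cintE ab (conj aF aG)) (le_trans (modulus_le_ReIm _))//.
rewrite mulrAC mulrDl mulrDl mul1r [_ * M]mulrC ReB ImB.
rewrite (_ : M * _ + _ = M * (b - a) + M * (b - a)); last by ring.
rewrite lerD//.
  by apply: antider_bound ab aF _ => t /pM; apply: le_trans; exact: Re_le_modulus.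
by apply: antider_bound ab aG _ => t /pM; apply: le_trans; exact: Im_le_modulus.
Qed.

Lemma cint_Im_ge (a b m : R) (phi : R -> C) : a <= b -> cts_on a b phi ->
  (forall t, a <= t <= b -> m <= complex.Im (phi t)) ->
  m * (b - a) <= complex.Im (cint a b phi).
Proof.
move=> ab /cantider_exists[F [aF aG]] pM.
by rewrite (cintE ab (conj aF aG)) ImB; exact: (antider_ge ab aG pM).
Qed.

Lemma cint_Re_ge (a b m : R) (phi : R -> C) : a <= b -> cts_on a b phi ->
  (forall t, a <= t <= b -> m <= complex.Re (phi t)) ->
  m * (b - a) <= complex.Re (cint a b phi).
Proof.
move=> ab /cantider_exists[F [aF aG]] pM.
by rewrite (cintE ab (conj aF aG)) ReB; exact: (antider_ge ab aF pM).
Qed.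

End Integral.

(** * Cauchy's theorem for rectangles *)
Section Goursat.
Variable R : realType.
Local Notation C := (cplx R).
Implicit Types f g F : C -> C.

Definition rect (x1 x2 y1 y2 : R) : set C :=
  [set z | x1 <= complex.Re z <= x2 /\ y1 <= complex.Im z <= y2].

Definition rint f (x1 x2 y1 y2 : R) : C :=
  cint x1 x2 (fun t => f (t +i* y1)) - cint x1 x2 (fun t => f (t +i* y2))
  + 'i * cint y1 y2 (fun t => f (x2 +i* t)) - 'i * cint y1 y2 (fun t => f (x1 +i* t)).

Definition cts_rect f x1 x2 y1 y2 :=
  forall z, rect x1 x2 y1 y2 z -> {for z, continuous f}.

Lemma rect_sub (x1 x2 y1 y2 a1 a2 b1 b2 : R) :
  x1 <= a1 -> a2 <= x2 -> y1 <= b1 -> b2 <= y2 ->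
  rect a1 a2 b1 b2 `<=` rect x1 x2 y1 y2.
Proof.
move=> h1 h2 h3 h4 z [/andP[u1 u2] /andP[v1 v2]].
by split; apply/andP; split; [apply: le_trans u1|apply: le_trans h2|apply: le_trans v1|apply: le_trans h4].
Qed.

Lemma cts_rect_sub f (x1 x2 y1 y2 a1 a2 b1 b2 : R) :
  x1 <= a1 -> a2 <= x2 -> y1 <= b1 -> b2 <= y2 ->
  cts_rect f x1 x2 y1 y2 -> cts_rect f a1 a2 b1 b2.
Proof. by move=> h1 h2 h3 h4 H z /(rect_sub h1 h2 h3 h4)/H. Qed.

Lemma cts_horizontal f x1 x2 y1 y2 y : cts_rect f x1 x2 y1 y2 -> y1 <= y <= y2 ->
  cts_on x1 x2 (fun t => f (t +i* y)).
Proof.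
move=> H yy t tx; apply: (@continuous_comp _ _ _ ((fun t => t +i* y) : R -> C) f).
  by apply: cvg_Complex; [exact: cvg_id|exact: cvg_cst].
exact: H.
Qed.

Lemma cts_vertical f x1 x2 y1 y2 x : cts_rect f x1 x2 y1 y2 -> x1 <= x <= x2 ->
  cts_on y1 y2 (fun t => f (x +i* t)).
Proof.
move=> H yy t tx; apply: (@continuous_comp _ _ _ ((fun t => x +i* t) : R -> C) f).
  by apply: cvg_Complex; [exact: cvg_cst|exact: cvg_id].
exact: H.
Qed.

Lemma rint_splitx f (x1 c x2 y1 y2 : R) : x1 <= c -> c <= x2 -> y1 <= y2 ->
  cts_rect f x1 x2 y1 y2 ->
  rint f x1 x2 y1 y2 = rint f x1 c y1 y2 + rint f c x2 y1 y2.
Proof.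
move=> xc cx yy H; rewrite /rint.
rewrite (cint_split xc cx (cts_horizontal H _)) ?lexx ?yy//.
by rewrite (cint_split xc cx (cts_horizontal H _)) ?lexx ?yy//; ring.
Qed.

Lemma rint_splity f (x1 x2 y1 c y2 : R) : x1 <= x2 -> y1 <= c -> c <= y2 ->
  cts_rect f x1 x2 y1 y2 ->
  rint f x1 x2 y1 y2 = rint f x1 x2 y1 c + rint f x1 x2 c y2.
Proof.
move=> xx yc cy H; rewrite /rint.
rewrite (cint_split yc cy (cts_vertical H _)) ?lexx ?xx//.
by rewrite (cint_split yc cy (cts_vertical H _)) ?lexx ?xx//; ring.
Qed.

(** Only the values on the boundary matter for [rint]; this is the continuity
   available for integrands that are singular inside the rectangle. *)
Definition cts_bd f x1 x2 y1 y2 :=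
  [/\ cts_on x1 x2 (fun t => f (t +i* y1)), cts_on x1 x2 (fun t => f (t +i* y2)),
      cts_on y1 y2 (fun t => f (x1 +i* t)) & cts_on y1 y2 (fun t => f (x2 +i* t))].

Lemma cts_rect_bd f x1 x2 y1 y2 : x1 <= x2 -> y1 <= y2 ->
  cts_rect f x1 x2 y1 y2 -> cts_bd f x1 x2 y1 y2.
Proof.
by move=> xx yy cf; split;
  [apply: cts_horizontal cf _|apply: cts_horizontal cf _|apply: cts_vertical cf _|
   apply: cts_vertical cf _]; rewrite lexx ?xx ?yy.
Qed.

Lemma rintD f g (x1 x2 y1 y2 : R) : x1 <= x2 -> y1 <= y2 ->
  cts_bd f x1 x2 y1 y2 -> cts_bd g x1 x2 y1 y2 ->
  rint (fun w => f w + g w) x1 x2 y1 y2 = rint f x1 x2 y1 y2 + rint g x1 x2 y1 y2.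
Proof.
move=> xx yy [f1 f2 f3 f4] [g1 g2 g3 g4]; rewrite /rint.
by rewrite (cintD xx f1 g1) (cintD xx f2 g2) (cintD yy f3 g3) (cintD yy f4 g4); ring.
Qed.

Lemma rintZ f k (x1 x2 y1 y2 : R) : x1 <= x2 -> y1 <= y2 ->
  cts_bd f x1 x2 y1 y2 ->
  rint (fun w => k * f w) x1 x2 y1 y2 = k * rint f x1 x2 y1 y2.
Proof.
move=> xx yy [f1 f2 f3 f4]; rewrite /rint.
by rewrite (cintZ k xx f1) (cintZ k xx f2) (cintZ k yy f3) (cintZ k yy f4); ring.
Qed.

Lemma rint_bound f (M x1 x2 y1 y2 : R) : x1 <= x2 -> y1 <= y2 ->
  cts_rect f x1 x2 y1 y2 -> (forall z, rect x1 x2 y1 y2 z -> modulus (f z) <= M) ->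
  modulus (rint f x1 x2 y1 y2) <= 4 * M * ((x2 - x1) + (y2 - y1)).
Proof.
move=> xx yy cf fM; rewrite /rint.
have b1 : modulus (cint x1 x2 (fun t => f (t +i* y1))) <= 2 * M * (x2 - x1).
  by apply: cint_bound => //; [apply: cts_horizontal cf _|move=> t tx; apply: fM];
     rewrite ?/rect/= ?lexx ?yy.
have b2 : modulus (cint x1 x2 (fun t => f (t +i* y2))) <= 2 * M * (x2 - x1).
  by apply: cint_bound => //; [apply: cts_horizontal cf _|move=> t tx; apply: fM];
     rewrite ?/rect/= ?lexx ?yy.
have b3 : modulus (cint y1 y2 (fun t => f (x2 +i* t))) <= 2 * M * (y2 - y1).
  by apply: cint_bound => //; [apply: cts_vertical cf _|move=> t tx; apply: fM];
     rewrite ?/rect/= ?lexx ?xx.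
have b4 : modulus (cint y1 y2 (fun t => f (x1 +i* t))) <= 2 * M * (y2 - y1).
  by apply: cint_bound => //; [apply: cts_vertical cf _|move=> t tx; apply: fM];
     rewrite ?/rect/= ?lexx ?xx.
rewrite (le_trans (modulusD _ _))// modulusN modulusM modulus_i mul1r.
rewrite (le_trans (lerD (modulusD _ _) (lexx _)))// modulusM modulus_i mul1r.
rewrite (le_trans (lerD (lerD (modulusD _ _) (lexx _)) (lexx _)))// modulusN.
apply: le_trans (lerD (lerD (lerD b1 b2) b3) b4) _; lra.
Qed.

Lemma derdir_horizontal (h : C -> R) (x y a : R) :
  derdir h 0 (x +i* y) a -> is_derive x (1 : R) (fun t => h (t +i* y)) a.
Proof.
move=> H; apply: rder_shift; move: H; rewrite /derdir /dir eqxx.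
rewrite (_ : (fun t => h (x +i* y + t%:C * 1)) = (fun s => h ((x + s) +i* y)))//.
by apply/funext => s; congr h; simpc.
Qed.

Lemma derdir_vertical (h : C -> R) (x y a : R) :
  derdir h 1 (x +i* y) a -> is_derive y (1 : R) (fun t => h (x +i* t)) a.
Proof.
move=> H; apply: rder_shift; move: H; rewrite /derdir /dir /=.
rewrite (_ : (fun t => h (x +i* y + t%:C * 'i)) = (fun s => h (x +i* (y + s))))//.
by apply/funext => s; congr h; simpc.
Qed.

Lemma cantider_horizontal F f (x1 x2 y : R) :
  (forall t, x1 <= t <= x2 -> is_derive (t +i* y : C) (1 : C) F (f (t +i* y))) ->
  cantider x1 x2 (fun t => f (t +i* y)) (fun t => F (t +i* y)).
Proof.
move=> H; split=> t /H h.
  by apply: (derdir_horizontal (rdiff_derdir 0 (rdiff_Re h))).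
by apply: (derdir_horizontal (rdiff_derdir 0 (rdiff_Im h))).
Qed.

Lemma cantider_vertical F f (x y1 y2 : R) :
  (forall t, y1 <= t <= y2 -> is_derive (x +i* t : C) (1 : C) F (f (x +i* t))) ->
  cantider y1 y2 (fun t => 'i * f (x +i* t)) (fun t => F (x +i* t)).
Proof.
move=> H; split=> t /H h.
  have := derdir_vertical (rdiff_derdir 1 (rdiff_Re h)).
  by case: (f _) => u v /=; rewrite mul0r mul1r sub0r.
have := derdir_vertical (rdiff_derdir 1 (rdiff_Im h)).
by case: (f _) => u v /=; rewrite mul0r mul1r add0r.
Qed.

Lemma rint_primitive F f (x1 x2 y1 y2 : R) : x1 <= x2 -> y1 <= y2 ->
  cts_rect f x1 x2 y1 y2 ->
  (forall z, rect x1 x2 y1 y2 z -> is_derive z (1 : C) F (f z)) ->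
  rint f x1 x2 y1 y2 = 0.
Proof.
move=> xx yy cf dF; rewrite /rint.
rewrite -(cintZ _ yy (cts_vertical cf _)) ?lexx ?xx//.
rewrite -(cintZ _ yy (cts_vertical cf _)) ?lexx ?xx//.
rewrite (cintE (Phi := fun t => F (t +i* y1)) xx); last first.
  by apply: cantider_horizontal => t tx; apply: dF; rewrite /rect /= lexx yy.
rewrite (cintE (Phi := fun t => F (t +i* y2)) xx); last first.
  by apply: cantider_horizontal => t tx; apply: dF; rewrite /rect /= lexx yy.
rewrite (cintE (Phi := fun t => F (x2 +i* t)) yy); last first.
  by apply: cantider_vertical => t tx; apply: dF; rewrite /rect /= lexx xx.
rewrite (cintE (Phi := fun t => F (x1 +i* t)) yy); last first.
  by apply: cantider_vertical => t tx; apply: dF; rewrite /rect /= lexx xx.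
by ring.
Qed.

Lemma continuous_affine (al be : C) : continuous ((fun w => al + be * w) : C -> C).
Proof.
move=> z; apply/(@cvg_modulus _ _ (nbhs z)) => e e0.
have M0 : 0 < modulus be + 1 by rewrite ltr_wpDl// modulus_ge0.
apply/nbhs_modulus; exists (e / (modulus be + 1)); first by rewrite divr_gt0.
move=> w; rewrite ltr_pdivlMr// => wz.
rewrite (_ : _ - _ = be * (w - z)); last by ring.
by rewrite modulusM; apply: le_lt_trans wz; rewrite mulrDr mulr1 mulrC lerDl modulus_ge0.
Qed.

Lemma rint_affine (al be : C) (x1 x2 y1 y2 : R) : x1 <= x2 -> y1 <= y2 ->
  rint (fun w => al + be * w) x1 x2 y1 y2 = 0.
Proof.
move=> xx yy; apply: (@rint_primitive (fun w => al * w + be / 2 * (w * w))) => //.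
  by move=> z _; exact: continuous_affine.
move=> z _; apply: is_derive_eq; last first.
  rewrite (_ : al + be * z = al * 1 + be / 2 * (z * 1 + z * 1)); first by [].
  by field.
Qed.

End Goursat.

Section GoursatTheorem.
Variable R : realType.
Local Notation C := (cplx R).
Implicit Types f g F : C -> C.

Lemma nested_segments (a b : nat -> R) :
  (forall n, a n <= a n.+1) -> (forall n, b n.+1 <= b n) -> (forall n, a n <= b n) ->
  exists p, forall n, a n <= p <= b n.
Proof.
move=> ha hb hab.
have ma n k : a n <= a (n + k)%N.
  by elim: k => [|k IH]; rewrite ?addn0// addnS (le_trans IH).
have mb n k : b (n + k)%N <= b n.
  by elim: k => [|k IH]; rewrite ?addn0// addnS (le_trans _ IH).
have ub m n : a m <= b n.
  by rewrite (le_trans (ma m n))// (le_trans (hab _))// addnC mb.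
have sa : has_sup (range a).
  by split; [exists (a 0%N), 0%N|exists (b 0%N) => _ [m _ <-]].
exists (sup (range a)) => n; apply/andP; split.
  by apply: sup_upper_bound => //; exists n.
by apply: sup_le_ub => [|_ [m _ <-]//]; exists (a 0%N), 0%N.
Qed.

(** A rectangle on which the boundary integral is at least [k] times the area
   contains a quarter with the same property; the nested quarters converge to
   a point, where the first order expansion of [f] makes the integral
   negligible with respect to the area. *)
Theorem goursat f (x1 x2 y1 y2 : R) : x1 <= x2 -> y1 <= y2 ->
  (forall z, rect x1 x2 y1 y2 z -> derivable f z 1) -> rint f x1 x2 y1 y2 = 0.
Proof.
move=> xx yy df.
have cf : cts_rect f x1 x2 y1 y2.
  by move=> z /df dz; apply: (@cder_continuous _ f z ('D_1 f z)); apply: derivableP.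
have c0 (x : R) (phi : R -> C) : cint x x phi = 0 by rewrite /cint /oint /= !subrr.
have [x12|x12] := eqVneq x1 x2; first by rewrite /rint x12 !c0; ring.
have [y12|y12] := eqVneq y1 y2; first by rewrite /rint y12 !c0; ring.
have {x12 xx} xx : x1 < x2 by rewrite lt_neqAle x12.
have {y12 yy} yy : y1 < y2 by rewrite lt_neqAle y12.
apply/eqP; rewrite -modulus_eq0; apply/negPn/negP => I0.
have {I0} I0 : 0 < modulus (rint f x1 x2 y1 y2) by rewrite lt_neqAle eq_sym I0 modulus_ge0.
pose k := modulus (rint f x1 x2 y1 y2) / ((x2 - x1) * (y2 - y1)).
have ar0 : 0 < (x2 - x1) * (y2 - y1) by rewrite mulr_gt0 ?subr_gt0.
have k0 : 0 < k by rewrite divr_gt0.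
pose bad (r : (R * R) * (R * R)) := [/\ r.1.1 < r.1.2, r.2.1 < r.2.2,
  x1 <= r.1.1 /\ r.1.2 <= x2, y1 <= r.2.1 /\ r.2.2 <= y2 &
  k * ((r.1.2 - r.1.1) * (r.2.2 - r.2.1)) <= modulus (rint f r.1.1 r.1.2 r.2.1 r.2.2)].
have step (r : {r | bad r}) : exists r' : {r | bad r},
   [/\ (sval r).1.1 <= (sval r').1.1, (sval r').1.2 <= (sval r).1.2,
       (sval r').1.2 - (sval r').1.1 = ((sval r).1.2 - (sval r).1.1) / 2 &
   [/\ (sval r).2.1 <= (sval r').2.1, (sval r').2.2 <= (sval r).2.2 &
       (sval r').2.2 - (sval r').2.1 = ((sval r).2.2 - (sval r).2.1) / 2]].
  case: r => -[[a1 a2] [b1 b2]] [/= h1 h2 [h3 h4] [h5 h6] h7].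
  pose c := (a1 + a2) / 2; pose d := (b1 + b2) / 2.
  have [ac ca bd db] : [/\ a1 < c, c < a2, b1 < d & d < b2].
    by split; rewrite /c /d; lra.
  have cfr : cts_rect f a1 a2 b1 b2 by apply: cts_rect_sub cf.
  have cfr1 : cts_rect f a1 c b1 b2 by apply: cts_rect_sub cfr; lra.
  have cfr2 : cts_rect f c a2 b1 b2 by apply: cts_rect_sub cfr; lra.
  have Q0 : rint f a1 a2 b1 b2 = (rint f a1 c b1 d + rint f a1 c d b2) +
            (rint f c a2 b1 d + rint f c a2 d b2).
    rewrite (rint_splitx (ltW ac) (ltW ca) (ltW h2) cfr).
    rewrite (rint_splity (ltW ac) (ltW bd) (ltW db) cfr1).
    by rewrite (rint_splity (ltW ca) (ltW bd) (ltW db) cfr2).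
  have [H|] := pselect (exists2 r : (R * R) * (R * R),
      bad r & [/\ a1 <= r.1.1, r.1.2 <= a2, r.1.2 - r.1.1 = (a2 - a1) / 2 &
              [/\ b1 <= r.2.1, r.2.2 <= b2 & r.2.2 - r.2.1 = (b2 - b1) / 2]]).
    by case: H => r br hr; exists (exist _ r br).
  move=> N; exfalso.
  pose q := k * ((a2 - a1) / 2 * ((b2 - b1) / 2)).
  have small (u v : R * R) : a1 <= u.1 -> u.2 <= a2 -> u.2 - u.1 = (a2 - a1) / 2 ->
      b1 <= v.1 -> v.2 <= b2 -> v.2 - v.1 = (b2 - b1) / 2 ->
      modulus (rint f u.1 u.2 v.1 v.2) < q.
    move=> u1 u2 u3 v1 v2 v3; rewrite ltNge; apply/negP => qu; apply: N.
    by exists (u, v) => //=; split; rewrite /= ?u3 ?v3//;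
      [rewrite -subr_gt0 u3|rewrite -subr_gt0 v3|split; [exact: le_trans u1|exact: le_trans h4]
      |split; [exact: le_trans v1|exact: le_trans h6]]; rewrite ?divr_gt0 ?subr_gt0.
  have ec1 : c - a1 = (a2 - a1) / 2 by rewrite /c; field.
  have ec2 : a2 - c = (a2 - a1) / 2 by rewrite /c; field.
  have ed1 : d - b1 = (b2 - b1) / 2 by rewrite /d; field.
  have ed2 : b2 - d = (b2 - b1) / 2 by rewrite /d; field.
  have s1 := small (a1, c) (b1, d) (lexx _) (ltW ca) ec1 (lexx _) (ltW db) ed1.
  have s2 := small (a1, c) (d, b2) (lexx _) (ltW ca) ec1 (ltW bd) (lexx _) ed2.
  have s3 := small (c, a2) (b1, d) (ltW ac) (lexx _) ec2 (lexx _) (ltW db) ed1.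
  have s4 := small (c, a2) (d, b2) (ltW ac) (lexx _) ec2 (ltW bd) (lexx _) ed2.
  have := le_lt_trans (le_trans h7 (le_trans (eq_ind_r (fun u => modulus u <= _) (modulusD _ _) Q0)
     (lerD (modulusD _ _) (modulusD _ _)))) (ltrD (ltrD s1 s2) (ltrD s3 s4)).
  by rewrite [k * _](_ : _ = q + q + (q + q)) ?ltxx// /q; field.
have [nxt nxtP] := choice step.
have bad0 : bad ((x1, x2), (y1, y2)).
  by split => //=; rewrite /k divfK ?gt_eqF.
pose s n := iter n nxt (exist _ _ bad0).
have w2 n : (sval (s n)).1.2 - (sval (s n)).1.1 = (x2 - x1) / 2 ^+ n.
  elim: n => [|n IH]; first by rewrite /= divr1.
  by case: (nxtP (s n)) => _ _ /= -> _; rewrite IH exprSr invfM mulrA.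
have h2 n : (sval (s n)).2.2 - (sval (s n)).2.1 = (y2 - y1) / 2 ^+ n.
  elim: n => [|n IH]; first by rewrite /= divr1.
  by case: (nxtP (s n)) => _ _ _ /= [_ _ ->]; rewrite IH exprSr invfM mulrA.
have [|||p pP] := @nested_segments (fun n => (sval (s n)).1.1) (fun n => (sval (s n)).1.2).
- by move=> n; case: (nxtP (s n)).
- by move=> n; case: (nxtP (s n)).
- by move=> n; case: (svalP (s n)) => /ltW.
have [|||q qP] := @nested_segments (fun n => (sval (s n)).2.1) (fun n => (sval (s n)).2.2).
- by move=> n; case: (nxtP (s n)) => _ _ _ [].
- by move=> n; case: (nxtP (s n)) => _ _ _ [].
- by move=> n; case: (svalP (s n)) => _ /ltW.
have pqQ : rect x1 x2 y1 y2 (p +i* q) by split => /=; [exact: (pP 0%N)|exact: (qP 0%N)].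
pose L := (x2 - x1) + (y2 - y1); have L0 : 0 < L by rewrite addr_gt0 ?subr_gt0.
pose e := k * ((x2 - x1) * (y2 - y1)) / (8 * (L * L)).
have e0 : 0 < e by rewrite divr_gt0 ?(mulr_gt0 k0 ar0)// !mulr_gt0.
have /derivableP/cderP/(_ e e0)[d d0 dP] := df _ pqQ.
set l := 'D_1 f _ in dP.
have [n nd] : exists n, L / 2 ^+ n < d.
  have [n /= Hn] : exists n : nat, L / d < n%:R by exists (Num.bound (L / d)); apply: archi_boundP; rewrite divr_ge0 ?ltW.
  exists n; rewrite ltr_pdivrMr ?exprn_gt0// mulrC -ltr_pdivrMr//.
  by apply: lt_trans Hn _; rewrite -natrX ltr_nat ltn_expl.
move: (svalP (s n)) (pP n) (qP n) (w2 n) (h2 n).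
case: (sval (s n)) => -[a1 a2] [b1 b2] [/= u1 u2 [u3 u4] [u5 u6] u7] /andP[p1 p2] /andP[q1 q2] wa hb.
have aff : rint f a1 a2 b1 b2 = rint (fun w => (f w - f (p +i* q) - l * (w - (p +i* q)))) a1 a2 b1 b2.
  have c1 : cts_rect f a1 a2 b1 b2 by apply: cts_rect_sub cf.
  have c2 : cts_rect (fun w => (l * (p +i* q) - f (p +i* q)) + (- l) * w) a1 a2 b1 b2.
    by move=> z _; exact: continuous_affine.
  have := rintD (ltW u1) (ltW u2) (cts_rect_bd (ltW u1) (ltW u2) c1) (cts_rect_bd (ltW u1) (ltW u2) c2); rewrite rint_affine ?ltW// addr0 => <-.
  have alg (u v P w : C) : u + ((l * P - v) + - l * w) = u - v - l * (w - P) by ring.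
  apply: (congr1 (fun h => rint h a1 a2 b1 b2)); apply/funext => w; exact: alg.
have small w : rect a1 a2 b1 b2 w -> modulus (w - (p +i* q)) <= L / 2 ^+ n.
  move=> [/andP[v1 v2] /andP[v3 v4]]; rewrite (le_trans (modulus_le_ReIm _))// ReB ImB /=.
  have dist (x y a b : R) : a <= x <= b -> a <= y <= b -> `|x - y| <= b - a.
    by move=> /andP[h1 h2'] /andP[h3 h4]; rewrite ler_norml opprB; apply/andP; split; apply: lerB.
  by rewrite /L mulrDl -wa -hb lerD// dist// ?v1 ?v3 ?p1 ?q1.
have cg : cts_rect (fun w => (f w - f (p +i* q) - l * (w - (p +i* q)))) a1 a2 b1 b2.
  move=> z rz; rewrite (_ : (fun w => _) = (fun w => f w + ((l * (p +i* q) - f (p +i* q)) + (- l) * w))); last first.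
    by apply/funext => w; ring.
  have cz : {for z, continuous f}.
    by apply: cf; apply: rect_sub rz.
  exact: (@continuousD _ _ _ f (fun w : C => (l * (p +i* q) - f (p +i* q)) + (- l) * w) z cz (@continuous_affine _ _ _ z)).
have bd : modulus (rint f a1 a2 b1 b2) <= 4 * (e * (L / 2 ^+ n)) * ((a2 - a1) + (b2 - b1)).
  rewrite aff; apply: rint_bound; rewrite ?ltW// => w rw.
  have sw := small _ rw; rewrite (le_trans (dP w _))//; first exact: le_lt_trans nd.
  by rewrite ler_wpM2l// ltW.
have := le_trans u7 bd; rewrite wa hb -mulrDl -/L => fin.
have N0 : 0 < (2 ^+ n : R) by rewrite exprn_gt0.
have := ler_wpM2r (ltW (mulr_gt0 N0 N0)) fin.
rewrite [X in X <= _](_ : _ = k * ((x2 - x1) * (y2 - y1))); last by field; rewrite gt_eqF.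
rewrite [X in _ <= X](_ : _ = k * ((x2 - x1) * (y2 - y1)) / 2); last first.
  by rewrite /e; field; rewrite !gt_eqF.
have := mulr_gt0 k0 ar0; lra.
Qed.

(** The exceptional point is isolated in a small rectangle, where the
   integrand is bounded. *)
Lemma goursat_punctured f (x1 x2 y1 y2 : R) (z0 : C) :
  x1 < complex.Re z0 < x2 -> y1 < complex.Im z0 < y2 -> cts_rect f x1 x2 y1 y2 ->
  (forall z, rect x1 x2 y1 y2 z -> z != z0 -> derivable f z 1) ->
  rint f x1 x2 y1 y2 = 0.
Proof.
move=> /andP[xz zx] /andP[yz zy] cf df.
have rz : rect x1 x2 y1 y2 z0 by split; apply/andP; split; apply/ltW.
apply/eqP; rewrite -modulus_eq0; apply/negPn/negP => I0.
have {I0} I0 : 0 < modulus (rint f x1 x2 y1 y2) by rewrite lt_neqAle eq_sym I0 modulus_ge0.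
have /(@cvg_modulus _ _ (nbhs z0))/(_ 1 ltr01)/nbhs_modulus[d d0 dP] := cf _ rz.
pose M := modulus (f z0) + 1; have M0 : 0 < M by rewrite ltr_wpDl// modulus_ge0.
set I := modulus _ in I0.
pose u := complex.Re z0; pose v := complex.Im z0.
pose t := Num.min (Num.min (Num.min (u - x1) (x2 - u)) (Num.min (v - y1) (y2 - v)))
  (Num.min (d / 4) (I / (32 * M))).
have : 0 < t by rewrite !lt_min !subr_gt0 xz zx yz zy !divr_gt0// mulr_gt0.
have := lexx t; rewrite {2}/t !le_min => /andP[/andP[/andP[t1 t2] /andP[t3 t4]] /andP[t5 t6]] t0.
pose s := t / 2; have s0 : 0 < s by rewrite /s; lra.
have zero a1 a2 b1 b2 : x1 <= a1 -> a1 <= a2 -> a2 <= x2 -> y1 <= b1 -> b1 <= b2 -> b2 <= y2 ->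
   [|| u < a1, a2 < u, v < b1 | b2 < v] -> rint f a1 a2 b1 b2 = 0.
  move=> h1 h2 h3 h4 h5 h6 out; apply: goursat => // z rz'; apply: df; first exact: rect_sub rz'.
  apply: contraTneq out => zz0; rewrite zz0 in rz'; move: rz' => [/andP[] + + /andP[]] /=.
  by rewrite -/u -/v => k1 k2 k3 k4; rewrite !ltNge k1 k2 k3 k4.
have [E1 [E2 [E3 E4]]] : [/\ x1 <= u - s, u + s <= x2 & y1 <= v - s /\ v + s <= y2] /\ True /\ True /\ True.
  by split => //; rewrite /s; split; [| |split]; lra.
move: E1 => [h1 h2 [h3 h4]] {E2 E3 E4}.
have c1 : cts_rect f (u - s) x2 y1 y2 by apply: cts_rect_sub cf.
have c2 : cts_rect f (u - s) (u + s) y1 y2 by apply: cts_rect_sub cf; lra.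
have c3 : cts_rect f (u - s) (u + s) (v - s) y2 by apply: cts_rect_sub cf; lra.
have c4 : cts_rect f (u - s) (u + s) (v - s) (v + s) by apply: cts_rect_sub cf; lra.
have E : rint f x1 x2 y1 y2 = rint f (u - s) (u + s) (v - s) (v + s).
  have e1 : u - s < u by lra.
  have e2 : u < u + s by lra.
  have e3 : v - s < v by lra.
  have e4 : v < v + s by lra.
  rewrite (@rint_splitx _ f x1 (u - s) x2 y1 y2); [|lra|lra|lra|done].
  rewrite (@zero x1 (u - s) y1 y2) ?e1 ?orbT//; [|lra|lra].
  rewrite add0r (@rint_splitx _ f (u - s) (u + s) x2 y1 y2); [|lra|lra|lra|done].
  rewrite (@zero (u + s) x2 y1 y2) ?e2 ?orbT//; [|lra|lra].
  rewrite addr0 (@rint_splity _ f (u - s) (u + s) y1 (v - s) y2); [|lra|lra|lra|done].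
  rewrite (@zero (u - s) (u + s) y1 (v - s)) ?e3 ?orbT//; [|lra|lra].
  rewrite add0r (@rint_splity _ f (u - s) (u + s) (v - s) (v + s) y2); [|lra|lra|lra|done].
  by rewrite (@zero (u - s) (u + s) (v + s) y2) ?e4 ?orbT ?addr0//; lra.
have bd : modulus (rint f (u - s) (u + s) (v - s) (v + s)) <= 4 * M * ((u + s - (u - s)) + (v + s - (v - s))).
  apply: rint_bound => //; [lra|lra|move=> w [/andP[k1 k2] /andP[k3 k4]]].
  rewrite -[f w](subrK (f z0)) addrC (le_trans (modulusD _ _))// lerD// ltW//.
  apply: dP; rewrite (le_lt_trans (modulus_le_ReIm _))// ReB ImB -/u -/v.
  have k5 : `|complex.Re w - u| <= s by rewrite ler_norml; apply/andP; split; lra.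
  have k6 : `|complex.Im w - v| <= s by rewrite ler_norml; apply/andP; split; lra.
  by rewrite /s in k5 k6; lra.
have E5 : I = modulus (rint f (u - s) (u + s) (v - s) (v + s)) by rewrite /I E.
have : I <= 4 * M * ((u + s - (u - s)) + (v + s - (v - s))) by rewrite E5.
have := t6; rewrite ler_pdivlMr ?mulr_gt0// => t7.
rewrite [4 * M * _](_ : _ = (t * (32 * M)) / 4); last by rewrite /s; field.
by move=> fin; lra.
Qed.

End GoursatTheorem.

Section Cauchy.
Variable R : realType.
Local Notation C := (cplx R).
Implicit Types f g F : C -> C.

Lemma near_continuous (X Y : topologicalType) (f g : X -> Y) (x : X) :
  (\forall y \near x, f y = g y) -> {for x, continuous f} -> {for x, continuous g}.
Proof.
move=> fg cf; rewrite /prop_for /continuous_at -(nbhs_singleton fg).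
exact: cvg_trans (near_eq_cvg fg) cf.
Qed.

Lemma rdiff_cder F z (l : C) :
  rdiff (fun w => complex.Re (F w)) z (complex.Re l) (- complex.Im l) ->
  rdiff (fun w => complex.Im (F w)) z (complex.Im l) (complex.Re l) ->
  is_derive z (1 : C) F l.
Proof.
move=> dR dI; apply/cderP => e e0; have e2 : 0 < e / 2 by rewrite divr_gt0.
have [d1 d10 d1P] := dR _ e2; have [d2 d20 d2P] := dI _ e2.
exists (Num.min d1 d2); first by rewrite lt_min d10.
move=> w; rewrite lt_min => /andP[/d1P h1 /d2P h2].
rewrite (le_trans (modulus_le_ReIm _))// (splitr e) mulrDl lerD//.
  move: h1; congr (`| _ | <= _).
  by case: (l) (w) (z) (F w) (F z) => [? ?] [? ?] [? ?] [? ?] [? ?] /=; ring.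
move: h2; congr (`| _ | <= _).
by case: (l) (w) (z) (F w) (F z) => [? ?] [? ?] [? ?] [? ?] [? ?] /=; ring.
Qed.

Lemma cauchy_riemann F f (U : set C) z : open U -> U z -> {for z, continuous f} ->
  (forall w, U w -> [/\ derdir (fun v => complex.Re (F v)) 0 w (complex.Re (f w)),
     derdir (fun v => complex.Re (F v)) 1 w (- complex.Im (f w)),
     derdir (fun v => complex.Im (F v)) 0 w (complex.Im (f w)) &
     derdir (fun v => complex.Im (F v)) 1 w (complex.Re (f w))]) ->
  is_derive z (1 : C) F (f z).
Proof.
move=> oU Uz cf H.
have nU : \forall w \near z, U w by apply: open_nbhs_nbhs.
have two (k : 'I_2) : k = 0 \/ k = 1 by case: k => -[|[|//]] ?; [left|right]; apply/val_inj.
have cR : {for z, continuous (fun w => complex.Re (f w))}.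
  by apply: continuous_comp cf _; exact: continuous_Re.
have cI : {for z, continuous (fun w => complex.Im (f w))}.
  by apply: continuous_comp cf _; exact: continuous_Im.
have trans (h k : C -> R) : (forall w, U w -> h w = k w) -> {for z, continuous k} -> {for z, continuous h}.
  by move=> hk; apply: near_continuous; apply: filterS nU => w Uw; rewrite hk.
have [h1 h2 h3 h4] := H z Uz.
apply: rdiff_cder.
  rewrite -(derdirP h1) -(derdirP h2); apply: (C1_rdiff oU Uz).
    by move=> w k Uw; have [k1 k2 k3 k4] := H w Uw; case: (two k) => ->; [case: k1|case: k2].
  move=> k; case: (two k) => ->.
    by apply: trans cR => w /H[/derdirP].
  apply: (trans _ (fun w => - complex.Im (f w))); first by move=> w /H[_ /derdirP].
  exact: (@continuousN _ _ _ (fun w => complex.Im (f w)) z cI).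
rewrite -(derdirP h3) -(derdirP h4); apply: (C1_rdiff oU Uz).
  by move=> w k Uw; have [k1 k2 k3 k4] := H w Uw; case: (two k) => ->; [case: k3|case: k4].
move=> k; case: (two k) => ->.
  by apply: trans cI => w /H[_ _ /derdirP].
by apply: trans cR => w /H[_ _ _ /derdirP].
Qed.

Lemma open_box (x1 x2 y1 y2 : R) :
  open [set z : C | x1 < complex.Re z < x2 /\ y1 < complex.Im z < y2].
Proof.
have oR (a b : R) : open [set z : C | a < complex.Re z < b].
  rewrite (_ : [set z | _] = @complex.Re R @^-1` `]a, b[).
    apply: open_comp; last exact: itv_open.
    by move=> z _; exact: continuous_Re.
  by apply/seteqP; split => z /=; rewrite in_itv.
have oI (a b : R) : open [set z : C | a < complex.Im z < b].
  rewrite (_ : [set z | _] = @complex.Im R @^-1` `]a, b[).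
    apply: open_comp; last exact: itv_open.
    by move=> z _; exact: continuous_Im.
  by apply/seteqP; split => z /=; rewrite in_itv.
exact: openI (oR x1 x2) (oI y1 y2).
Qed.

Lemma disc_box (z0 z : C) (h : R) : modulus (z - z0) < h ->
  complex.Re z0 - h < complex.Re z < complex.Re z0 + h /\
  complex.Im z0 - h < complex.Im z < complex.Im z0 + h.
Proof.
move=> zh; have := le_lt_trans (Re_le_modulus _) zh; have := le_lt_trans (Im_le_modulus _) zh.
rewrite ReB ImB !ltr_norml => /andP[h1 h2] /andP[h3 h4].
by split; apply/andP; split; lra.
Qed.

Lemma square_disc (z0 z : C) (h : R) :
  rect (complex.Re z0 - h) (complex.Re z0 + h) (complex.Im z0 - h) (complex.Im z0 + h) z ->
  modulus (z - z0) <= h + h.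
Proof.
move=> [/andP[h1 h2] /andP[h3 h4]].
rewrite (le_trans (modulus_le_ReIm _))// ReB ImB lerD// ler_norml; apply/andP; split; lra.
Qed.

(** Integrate along two sides of a rectangle; by Goursat's theorem either order
   of the sides gives the same value. *)
Lemma holomorphic_primitive (U : set C) f z0 : open U -> U z0 -> holomorphic_on U f ->
  exists2 r : R, 0 < r & exists F, forall z, modulus (z - z0) < r ->
    is_derive z (1 : C) F (f z).
Proof.
move=> oU Uz0 hf; have [d d0 dU] := open_modulus oU Uz0.
pose h := d / 3; have h0 : 0 < h by rewrite divr_gt0.
pose x1 := complex.Re z0 - h; pose x2 := complex.Re z0 + h.
pose y1 := complex.Im z0 - h; pose y2 := complex.Im z0 + h.
have QU z : rect x1 x2 y1 y2 z -> U z.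
  by move=> /square_disc zh; apply: dU; apply: le_lt_trans zh _; rewrite /h; lra.
have cf : cts_rect f x1 x2 y1 y2.
  by move=> z /QU Uz; apply: (@cder_continuous _ f z ('D_1 f z)); apply: derivableP; apply: hf.
exists h => //.
pose F z := cint x1 (complex.Re z) (fun t => f (t +i* y1)) +
  'i * cint y1 (complex.Im z) (fun t => f (complex.Re z +i* t)).
exists F => z zh.
pose B := [set z : C | x1 < complex.Re z < x2 /\ y1 < complex.Im z < y2].
have oB : open B by exact: open_box.
have Bz : B z by exact: disc_box.
have BQ w : B w -> rect x1 x2 y1 y2 w.
  by move=> [/andP[h1 h2] /andP[h3 h4]]; split; apply/andP; split; exact: ltW.
have FE w : B w -> F w = cint x1 (complex.Re w) (fun t => f (t +i* complex.Im w)) +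
    'i * cint y1 (complex.Im w) (fun t => f (x1 +i* t)).
  move=> [/andP[h1 h2] /andP[h3 h4]].
  have := @goursat R f x1 (complex.Re w) y1 (complex.Im w) (ltW h1) (ltW h3).
  rewrite /rint => G; apply/eqP; rewrite -subr_eq0; apply/eqP; rewrite -[RHS]G; first by rewrite /F; ring.
  by move=> v rv; apply: hf; apply: QU; apply: rect_sub rv; rewrite // ltW.
have cfz : {for z, continuous f} by apply: cf; exact: BQ.
apply: (cauchy_riemann oB Bz cfz) => {cfz zh Bz} w Bw.
have [/andP[h1 h2] /andP[h3 h4]] := Bw.
have nB : \forall v \near w, B v by apply: open_nbhs_nbhs.
(* along the imaginary direction *)
have [Phi [aR aI]] : exists Phi, cantider y1 y2 (fun t => f (complex.Re w +i* t)) Phi.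
  by apply: cantider_exists; apply: (cts_vertical cf); apply/andP; split; exact: ltW.
have [Psi [bR bI]] : exists Psi, cantider x1 x2 (fun t => f (t +i* complex.Im w)) Psi.
  by apply: cantider_exists; apply: (cts_horizontal cf); apply/andP; split; exact: ltW.
have V (p : C -> R) : (forall u v, p (u + v) = p u + p v) -> forall a,
    is_derive (complex.Im w) (1 : R) (fun t => p ('i * Phi t)) a ->
    derdir (fun v => p (F v)) 1 w a.
  move=> hD a da.
  pose K := p (cint x1 (complex.Re w) (fun t => f (t +i* y1)) - 'i * Phi y1).
  have dt : is_derive (0 : R) (1 : R) (fun t : R => K + p ('i * Phi (complex.Im w + t))) a.
    have -> : a = 0 + a by rewrite add0r.
    apply: is_deriveD.
    have : is_derive (complex.Im w + 0) (1 : R) (fun t => p ('i * Phi t)) a by rewrite addr0.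
    move=> /rderP H; apply/rderP => e /H[e' e'0 e'P]; exists e' => // y.
    by have := e'P (complex.Im w + y); rewrite addr0 subr0 addrAC subrr add0r.
  apply: near_eq_is_derive dt; have := near_line 1 nB; apply: filterS => t.
  have -> : w + t%:C * dir R 1 = complex.Re w +i* (complex.Im w + t).
    by rewrite /dir; case: (w) => ? ?; simpc.
  move=> [_ /andP[/= k1 k2]]; rewrite /F /= /K -hD; congr p.
  have cP : cantider y1 (complex.Im w + t) (fun t => f (complex.Re w +i* t)) Phi.
    by apply: (cantider_sub (lexx y1) (ltW k2)); split.
  by rewrite (cintE (ltW k1) cP); ring.
have Hz (p : C -> R) : (forall u v, p (u + v) = p u + p v) -> forall a,
    is_derive (complex.Re w) (1 : R) (fun t => p (Psi t)) a ->
    derdir (fun v => p (F v)) 0 w a.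
  move=> hD a da.
  pose K := p ('i * cint y1 (complex.Im w) (fun t => f (x1 +i* t)) - Psi x1).
  have dt : is_derive (0 : R) (1 : R) (fun t : R => K + p (Psi (complex.Re w + t))) a.
    have -> : a = 0 + a by rewrite add0r.
    apply: is_deriveD.
    have : is_derive (complex.Re w + 0) (1 : R) (fun t => p (Psi t)) a by rewrite addr0.
    move=> /rderP H; apply/rderP => e /H[e' e'0 e'P]; exists e' => // y.
    by have := e'P (complex.Re w + y); rewrite addr0 subr0 addrAC subrr add0r.
  apply: near_eq_is_derive dt; have := near_line 0 nB; apply: filterS => t.
  have -> : w + t%:C * dir R 0 = (complex.Re w + t) +i* complex.Im w.
    by rewrite /dir eqxx; case: (w) => ? ?; simpc.
  move=> Bt; rewrite FE//; move: Bt => [/andP[/= k1 k2] _]; rewrite /K -hD; congr p.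
  have cP : cantider x1 (complex.Re w + t) (fun t => f (t +i* complex.Im w)) Psi.
    by apply: (cantider_sub (lexx x1) (ltW k2)); split.
  by rewrite (cintE (ltW k1) cP); ring.
have Ew : w = complex.Re w +i* complex.Im w by case: (w).
have reD (u v : C) : complex.Re (u + v) = complex.Re u + complex.Re v by case: u v => [? ?] [? ?].
have imD (u v : C) : complex.Im (u + v) = complex.Im u + complex.Im v by case: u v => [? ?] [? ?].
have i1 : y1 <= complex.Im w <= y2 by apply/andP; split; exact: ltW.
have i2 : x1 <= complex.Re w <= x2 by apply/andP; split; exact: ltW.
split.
- by apply: Hz => //; have := bR _ i2; rewrite -Ew.
- apply: V => //; have := aI _ i1; rewrite -Ew => d1.
  rewrite (_ : (fun t => _) = (fun t => - complex.Im (Phi t))).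
    exact: (@is_deriveN _ _ _ (fun t => complex.Im (Phi t))).
  by apply/funext => t; case: (Phi t) => ? ? /=; rewrite mul0r mul1r sub0r.
- by apply: Hz => //; have := bI _ i2; rewrite -Ew.
- apply: V => //; have := aR _ i1; rewrite -Ew => d1.
  rewrite (_ : (fun t => _) = (fun t => complex.Re (Phi t)))//.
  by apply/funext => t; case: (Phi t) => ? ? /=; rewrite mul0r mul1r add0r.
Qed.

End Cauchy.

(** * Cauchy's formula and the derivatives of holomorphic functions *)
Section CauchyFormula.
Variable R : realType.
Local Notation C := (cplx R).
Implicit Types f g F : C -> C.

(** Differentiation under the integral sign, in the presence of a uniform
   second order Taylor bound. *)
Lemma cder_cint (a b d M : R) (psi : C -> R -> C) (psi' : R -> C) (z : C) :
  a <= b -> 0 < d -> (forall w, modulus (w - z) < d -> cts_on a b (psi w)) ->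
  cts_on a b psi' ->
  (forall w t, modulus (w - z) < d -> a <= t <= b ->
    modulus (psi w t - psi z t - (w - z) * psi' t) <= M * modulus (w - z) ^+ 2) ->
  is_derive z (1 : C) (fun w => cint a b (psi w)) (cint a b psi').
Proof.
move=> ab d0 cpsi cpsi' H; apply/cderP => e e0.
pose N := 2 * M * (b - a); have N0 : 0 < `|N| + 1 by rewrite ltr_wpDl.
exists (Num.min d (e / (`|N| + 1))); first by rewrite lt_min d0 divr_gt0.
move=> w; rewrite lt_min ltr_pdivlMr// => /andP[wd we].
have cz : cts_on a b (psi z) by apply: cpsi; rewrite subrr modulus0.
have cw := cpsi w wd.
have cN (phi : R -> C) k : cts_on a b phi -> cts_on a b (fun t => k * phi t).
  move=> cphi t tab.
  rewrite (_ : (fun t => k * phi t) = (fun v : C => 0 + k * v) \o phi); last first.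
    by apply/funext => s; rewrite /= add0r.
  by apply: continuous_comp (cphi t tab) _; exact: continuous_affine.
have cD (phi chi : R -> C) : cts_on a b phi -> cts_on a b chi -> cts_on a b (fun t => phi t + chi t).
  by move=> c1 c2 t tab; exact: (@continuousD _ _ _ phi chi t (c1 t tab) (c2 t tab)).
have E : cint a b (fun t => psi w t + (-1 * psi z t + - (w - z) * psi' t)) =
   cint a b (psi w) - cint a b (psi z) - cint a b psi' * (w - z).
  have c1 := cN _ (-1) cz; have c2 := cN _ (- (w - z)) cpsi'.
  by rewrite (cintD ab cw (cD _ _ c1 c2)) (cintD ab c1 c2) (cintZ _ ab cz) (cintZ _ ab cpsi'); ring.
rewrite -E.
have cE : cts_on a b (fun t => psi w t + (-1 * psi z t + - (w - z) * psi' t)).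
  exact: (cD _ _ cw (cD _ _ (cN _ (-1) cz) (cN _ (- (w - z)) cpsi'))).
have bound t : a <= t <= b -> modulus (psi w t + (-1 * psi z t + - (w - z) * psi' t)) <= M * modulus (w - z) ^+ 2.
  move=> tab; have := H w t wd tab; congr (modulus _ <= _); ring.
apply: le_trans (cint_bound ab cE bound) _.
rewrite (_ : 2 * _ * _ = N * modulus (w - z) * modulus (w - z)); last by rewrite /N; ring.
rewrite ler_wpM2r ?modulus_ge0//; apply: le_trans (ltW we).
rewrite mulrC ler_wpM2l ?modulus_ge0//.
by rewrite (le_trans (ler_norm _))// lerDl.
Qed.

Lemma cts_on_bounded (a b : R) (phi : R -> C) : a <= b -> cts_on a b phi ->
  exists2 M : R, 0 <= M & forall t, a <= t <= b -> modulus (phi t) <= M.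
Proof.
move=> ab cphi.
have [|c _ cP] := @EVT_max R (fun t => modulus (phi t)) a b ab.
  apply: continuous_in_subspaceT => t; rewrite inE /= in_itv /= => tab.
  by apply: continuous_comp (cphi t tab) _; exact: continuous_modulus.
exists (modulus (phi c)); first exact: modulus_ge0.
by move=> t tab; apply: cP; rewrite in_itv.
Qed.

Lemma ctsM (a b : R) (phi chi : R -> C) : cts_on a b phi -> cts_on a b chi ->
  cts_on a b (fun t => phi t * chi t).
Proof. by move=> c1 c2 t tab; exact: (@continuousM _ _ phi chi t (c1 t tab) (c2 t tab)). Qed.

Lemma ctsZ (a b : R) (k : C) (phi : R -> C) : cts_on a b phi ->
  cts_on a b (fun t => k * phi t).
Proof. exact: (@ctsM a b (fun=> k) phi (fun t _ => cvg_cst k)). Qed.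

Lemma continuous_inv_at (z : C) : z != 0 -> {for z, continuous (fun w : C => w^-1)}.
Proof.
by move=> z0; apply: (@cder_continuous _ _ z (- z ^- 2 * 1)); apply: (@cderV _ id).
Qed.

Lemma ctsV (a b : R) (phi : R -> C) : cts_on a b phi ->
  (forall t, a <= t <= b -> phi t != 0) -> cts_on a b (fun t => (phi t)^-1).
Proof.
by move=> c1 n0 t tab; apply: continuous_comp (c1 t tab) _; apply: continuous_inv_at; exact: n0.
Qed.

Lemma cts_subz (a b : R) (gam : R -> C) (z : C) : cts_on a b gam -> cts_on a b (fun t => gam t - z).
Proof.
by move=> c1 t tab; apply: (@continuousB _ _ _ gam (fun=> z) t (c1 t tab)); exact: cvg_cst.
Qed.

Lemma cts_kernel (a b : R) (phi gam : R -> C) (z : C) n : cts_on a b phi -> cts_on a b gam ->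
  (forall t, a <= t <= b -> gam t != z) ->
  cts_on a b (fun t => phi t / (gam t - z) ^+ n).
Proof.
move=> c1 c2 n0.
have cX : cts_on a b (fun t => (gam t - z) ^+ n).
  elim: n => [|n IH]; first by move=> t _; exact: cvg_cst.
  rewrite (_ : (fun t => (gam t - z) ^+ n.+1) = (fun t => (gam t - z) * (gam t - z) ^+ n)).
    exact: (ctsM (cts_subz c2) IH).
  by apply/funext => t; rewrite exprS.
have cV : cts_on a b (fun t => ((gam t - z) ^+ n)^-1).
  by apply: (ctsV cX) => t /n0 gz; rewrite expf_neq0// subr_eq0.
exact: (ctsM c1 cV).
Qed.

Lemma kernel_taylor1 (u h : C) (d : R) : 0 < d -> d <= modulus u -> modulus h < d / 2 ->
  modulus ((u - h)^-1 - u^-1 - h / u ^+ 2) <= 2 / d ^+ 3 * modulus h ^+ 2.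
Proof.
move=> d0 du hd.
have uh : d / 2 <= modulus (u - h) by rewrite (le_trans _ (modulusB _ _))//; lra.
have u0 : u != 0 by rewrite -modulus_gt0; lra.
have uh0 : u - h != 0 by rewrite -modulus_gt0; lra.
rewrite (_ : _ - _ - _ = h ^+ 2 / (u ^+ 2 * (u - h))); last by field; rewrite u0 uh0.
rewrite modulusM modulusV modulusX mulrC ler_wpM2r ?exprn_ge0 ?modulus_ge0//.
rewrite (_ : 2 / d ^+ 3 = (d ^+ 2 * (d / 2))^-1); last by field; rewrite gt_eqF.
rewrite lef_pV2 ?posrE ?modulus_gt0 ?mulf_neq0 ?expf_neq0//; last by rewrite mulr_gt0 ?exprn_gt0//; lra.
rewrite modulusM modulusX ler_pM//; [by rewrite exprn_ge0// ltW|lra|].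
by rewrite ler_sqr ?nnegrE ?modulus_ge0// ltW.
Qed.

Lemma kernel_taylor2 (u h : C) (d : R) : 0 < d -> d <= modulus u -> modulus h < d / 2 ->
  modulus ((u - h) ^- 2 - u ^- 2 - h * (2 / u ^+ 3)) <= 16 / d ^+ 4 * modulus h ^+ 2.
Proof.
move=> d0 du hd.
have uh : d / 2 <= modulus (u - h) by rewrite (le_trans _ (modulusB _ _))//; lra.
have u0 : u != 0 by rewrite -modulus_gt0; lra.
have uh0 : u - h != 0 by rewrite -modulus_gt0; lra.
rewrite (_ : _ - _ - _ = h ^+ 2 * ((3 * u - 2 * h) / u) / (u ^+ 2 * (u - h) ^+ 2));
  last by field; rewrite u0 uh0.
have k4 : modulus ((3 * u - 2 * h) / u) <= 4.
  rewrite modulusM modulusV ler_pdivrMr ?modulus_gt0// (le_trans (modulusD _ _))//.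
  rewrite modulusN !modulusM.
  rewrite (_ : modulus (3 : C) = 3); last by rewrite -(rmorph_nat (real_complex R) 3) modulus_real normr_nat.
  rewrite (_ : modulus (2 : C) = 2); last by rewrite -(rmorph_nat (real_complex R) 2) modulus_real normr_nat.
  lra.
rewrite modulusM modulusV modulusM modulusX.
rewrite (_ : 16 / d ^+ 4 * _ = modulus h ^+ 2 * 4 * (d ^+ 2 * (d / 2) ^+ 2)^-1); last by field; rewrite gt_eqF.
rewrite ler_pM ?mulr_ge0 ?invr_ge0 ?exprn_ge0 ?modulus_ge0//.
  by rewrite ler_wpM2l// exprn_ge0// modulus_ge0.
rewrite lef_pV2 ?posrE ?modulus_gt0 ?mulf_neq0 ?expf_neq0//; last by rewrite mulr_gt0 ?exprn_gt0//; lra.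
have hd0 : 0 <= d by exact: ltW.
have hd2 : 0 <= d / 2 by rewrite divr_ge0.
by rewrite modulusM !modulusX ler_pM ?exprn_ge0 ?lerXn2r ?nnegrE ?modulus_ge0.
Qed.

Lemma cder_kernel (a b d : R) (phi gam : R -> C) (z : C) : a <= b -> 0 < d ->
  cts_on a b phi -> cts_on a b gam ->
  (forall t, a <= t <= b -> d <= modulus (gam t - z)) ->
  is_derive z (1 : C) (fun w => cint a b (fun t => phi t / (gam t - w) ^+ 1))
                      (cint a b (fun t => phi t / (gam t - z) ^+ 2)) /\
  is_derive z (1 : C) (fun w => cint a b (fun t => phi t / (gam t - w) ^+ 2))
                      (2 * cint a b (fun t => phi t / (gam t - z) ^+ 3)).
Proof.
move=> ab d0 cphi cgam gd.
have [M M0 phiM] := cts_on_bounded ab cphi.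
have d2 : 0 < d / 2 by rewrite divr_gt0.
have nz w t : modulus (w - z) < d / 2 -> a <= t <= b -> gam t != w.
  move=> wz /gd gt; rewrite -subr_eq0 -modulus_gt0.
  rewrite (_ : gam t - w = (gam t - z) - (w - z)); last by ring.
  by apply: lt_le_trans (modulusB _ _); lra.
have nzz t : a <= t <= b -> gam t != z by apply: nz; rewrite subrr modulus0.
have ck w n : modulus (w - z) < d / 2 -> cts_on a b (fun t => phi t / (gam t - w) ^+ n).
  by move=> wz; apply: (@cts_kernel a b phi gam w n cphi cgam) => t; exact: nz.
have zz : modulus (z - z) < d / 2 by rewrite subrr modulus0.
split.
  have H w t : modulus (w - z) < d / 2 -> a <= t <= b ->
      modulus (phi t / (gam t - w) ^+ 1 - phi t / (gam t - z) ^+ 1 - (w - z) * (phi t / (gam t - z) ^+ 2))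
      <= M * (2 / d ^+ 3) * modulus (w - z) ^+ 2.
    move=> wz tab; rewrite !expr1.
    have := kernel_taylor1 d0 (gd t tab) wz.
    rewrite (_ : gam t - z - (w - z) = gam t - w); last by ring.
    move=> K; rewrite (_ : _ - _ - _ = phi t * ((gam t - w)^-1 - (gam t - z)^-1 - (w - z) / (gam t - z) ^+ 2)); last by ring.
    by rewrite modulusM -mulrA ler_pM ?modulus_ge0//; exact: phiM.
  exact: (@cder_cint a b (d / 2) _ (fun w t => phi t / (gam t - w) ^+ 1) _ z ab d2 (fun w => ck w 1%N) (ck z 2%N zz) H).
rewrite -(cintZ 2 ab (ck z 3%N zz)).
have c3 : cts_on a b (fun t => 2 * (phi t / (gam t - z) ^+ 3)).
  by have := ctsM (fun t _ => cvg_cst (2 : C)) (ck z 3%N zz); apply.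
have H w t : modulus (w - z) < d / 2 -> a <= t <= b ->
    modulus (phi t / (gam t - w) ^+ 2 - phi t / (gam t - z) ^+ 2 - (w - z) * (2 * (phi t / (gam t - z) ^+ 3)))
    <= M * (16 / d ^+ 4) * modulus (w - z) ^+ 2.
  move=> wz tab.
  have := kernel_taylor2 d0 (gd t tab) wz.
  rewrite (_ : gam t - z - (w - z) = gam t - w); last by ring.
  move=> K; rewrite (_ : _ - _ - _ = phi t * ((gam t - w) ^- 2 - (gam t - z) ^- 2 - (w - z) * (2 / (gam t - z) ^+ 3))); last by ring.
  by rewrite modulusM -mulrA ler_pM ?modulus_ge0//; exact: phiM.
exact: (@cder_cint a b (d / 2) _ (fun w t => phi t / (gam t - w) ^+ 2) _ z ab d2 (fun w => ck w 2%N) c3 H).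
Qed.

End CauchyFormula.

Section HolomorphicSmooth.
Variable R : realType.
Local Notation C := (cplx R).
Implicit Types f g F : C -> C.

Lemma cderD f g z a b : is_derive z (1 : C) f a -> is_derive z (1 : C) g b ->
  is_derive z (1 : C) (fun w => f w + g w) (a + b).
Proof. exact: is_deriveD. Qed.

Lemma cderB f g z a b : is_derive z (1 : C) f a -> is_derive z (1 : C) g b ->
  is_derive z (1 : C) (fun w => f w - g w) (a - b).
Proof. exact: is_deriveB. Qed.

Lemma cderZ f k z a : is_derive z (1 : C) f a ->
  is_derive z (1 : C) (fun w => k * f w) (k * a).
Proof. exact: is_deriveZ. Qed.

Section Square.
Variables (z0 : C) (h : R).
Hypothesis h0 : 0 < h.
Let x1 := complex.Re z0 - h.
Let x2 := complex.Re z0 + h.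
Let y1 := complex.Im z0 - h.
Let y2 := complex.Im z0 + h.

Let xx : x1 <= x2. Proof. by rewrite /x1 /x2; move: h0 => ?; lra. Qed.
Let yy : y1 <= y2. Proof. by rewrite /y1 /y2; move: h0 => ?; lra. Qed.

Let P n f z := rint (fun w => f w / (w - z) ^+ n) x1 x2 y1 y2.

Lemma boundary_dist z w : modulus (z - z0) < h / 2 ->
  [|| complex.Re w == x1, complex.Re w == x2, complex.Im w == y1 | complex.Im w == y2] ->
  h / 2 <= modulus (w - z).
Proof.
move=> zh; have := le_lt_trans (Re_le_modulus _) zh; have := le_lt_trans (Im_le_modulus _) zh.
rewrite ReB ImB !ltr_norml => /andP[h1 h2] /andP[h3 h4].
have hR := Re_le_modulus (w - z); have hI := Im_le_modulus (w - z).
rewrite ReB ler_norml in hR; rewrite ImB ler_norml in hI.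
move: hR hI => /andP[k1 k2] /andP[k3 k4].
by move=> /or4P[] /eqP e; rewrite e /x1 /x2 /y1 /y2 in k1 k2 k3 k4; lra.
Qed.

Lemma cder_rint_kernel f z : cts_rect f x1 x2 y1 y2 -> modulus (z - z0) < h / 2 ->
  is_derive z (1 : C) (P 1 f) (P 2 f z) /\ is_derive z (1 : C) (P 2 f) (2 * P 3 f z).
Proof.
move=> cf zh; have d0 : 0 < h / 2 by rewrite divr_gt0.
have [c1 c2 c3 c4] := cts_rect_bd xx yy cf.
have H (x y : R) : cts_on x1 x2 (fun t => t +i* y : C) /\ cts_on y1 y2 (fun t => x +i* t : C).
  split=> t _; apply: cvg_Complex; (exact: cvg_cst || exact: cvg_id).
have bot t : x1 <= t <= x2 -> h / 2 <= modulus ((t +i* y1 : C) - z).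
  by move=> _; apply: boundary_dist => //=; rewrite eqxx ?orbT.
have top t : x1 <= t <= x2 -> h / 2 <= modulus ((t +i* y2 : C) - z).
  by move=> _; apply: boundary_dist => //=; rewrite eqxx ?orbT.
have lef t : y1 <= t <= y2 -> h / 2 <= modulus ((x1 +i* t : C) - z).
  by move=> _; apply: boundary_dist => //=; rewrite eqxx ?orbT.
have rig t : y1 <= t <= y2 -> h / 2 <= modulus ((x2 +i* t : C) - z).
  by move=> _; apply: boundary_dist => //=; rewrite eqxx ?orbT.
have [b1 b2] := @cder_kernel R x1 x2 (h / 2) _ (fun t => t +i* y1) z xx d0 c1 (H 0 y1).1 bot.
have [t1 t2] := @cder_kernel R x1 x2 (h / 2) _ (fun t => t +i* y2) z xx d0 c2 (H 0 y2).1 top.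
have [l1 l2] := @cder_kernel R y1 y2 (h / 2) _ (fun t => x1 +i* t) z yy d0 c3 (H x1 0).2 lef.
have [r1 r2] := @cder_kernel R y1 y2 (h / 2) _ (fun t => x2 +i* t) z yy d0 c4 (H x2 0).2 rig.
split; first exact: (cderB (cderD (cderB b1 t1) (cderZ 'i r1)) (cderZ 'i l1)).
have := (cderB (cderD (cderB b2 t2) (cderZ 'i r2)) (cderZ 'i l2)).
by rewrite (_ : _ - _ = 2 * P 3 f z)// /P /rint; ring.
Qed.

(** The winding number of the square around its centre does not vanish: each
   side contributes a positive imaginary part. *)
Lemma winding_neq0 : P 1 (fun=> 1) z0 != 0.
Proof.
have kap : 0 < (h + h)^-1 by rewrite invr_gt0 addr_gt0.
have bnd (s : R) : - h <= s <= h -> (h + h)^-1 <= h / (h ^+ 2 + s ^+ 2).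
  move=> /andP[s1 s2]; rewrite ler_pdivlMr; last by rewrite ltr_wpDr ?sqr_ge0// exprn_gt0.
  rewrite mulrC ler_pdivrMr ?addr_gt0// mulrDr -expr2 lerD2l.
  rewrite -subr_ge0 (_ : _ - _ = (h - s) * (h + s)); last by ring.
  by rewrite mulr_ge0//; lra.
have sq0 (s : R) : h ^+ 2 + s ^+ 2 != 0 by rewrite gt_eqF// ltr_wpDr ?sqr_ge0// exprn_gt0.
have d0 : modulus (z0 - z0) < h / 2 by rewrite subrr modulus0 divr_gt0.
have nz w : [|| complex.Re w == x1, complex.Re w == x2, complex.Im w == y1 | complex.Im w == y2] ->
    w != z0.
  move=> /(boundary_dist d0); apply: contraTneq => ->; rewrite subrr modulus0 -ltNge.
  by rewrite divr_gt0.
have H (x y : R) : cts_on x1 x2 (fun t => t +i* y : C) /\ cts_on y1 y2 (fun t => x +i* t : C).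
  split=> t _; apply: cvg_Complex; (exact: cvg_cst || exact: cvg_id).
have one a b : cts_on a b (fun=> 1 : C) by move=> t _; exact: cvg_cst.
have bot : cts_on x1 x2 (fun t => 1 / ((t +i* y1 : C) - z0) ^+ 1).
  by apply: (cts_kernel (@one _ _) (H 0 y1).1) => t tx; apply: nz; rewrite /= eqxx ?orbT.
have top : cts_on x1 x2 (fun t => 1 / ((t +i* y2 : C) - z0) ^+ 1).
  by apply: (cts_kernel (@one _ _) (H 0 y2).1) => t tx; apply: nz; rewrite /= eqxx ?orbT.
have lef : cts_on y1 y2 (fun t => 1 / ((x1 +i* t : C) - z0) ^+ 1).
  by apply: (cts_kernel (@one _ _) (H x1 0).2) => t tx; apply: nz; rewrite /= eqxx ?orbT.
have rig : cts_on y1 y2 (fun t => 1 / ((x2 +i* t : C) - z0) ^+ 1).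
  by apply: (cts_kernel (@one _ _) (H x2 0).2) => t tx; apply: nz; rewrite /= eqxx ?orbT.
have m1 (phi : R -> C) a b : cts_on a b phi -> cts_on a b (fun t => -1 * phi t).
  by move=> cp; exact: (ctsM (fun t _ => cvg_cst (-1 : C)) cp).
have i0 : complex.Im (P 1 (fun=> 1) z0) =
    complex.Im (cint x1 x2 (fun t => 1 / ((t +i* y1 : C) - z0) ^+ 1)) +
    complex.Im (cint x1 x2 (fun t => -1 * (1 / ((t +i* y2 : C) - z0) ^+ 1))) +
    complex.Re (cint y1 y2 (fun t => 1 / ((x2 +i* t : C) - z0) ^+ 1)) +
    complex.Re (cint y1 y2 (fun t => -1 * (1 / ((x1 +i* t : C) - z0) ^+ 1))).
  rewrite /P /rint (cintZ _ xx top) (cintZ _ yy lef).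
  move: (cint _ _ _) (cint _ _ _) (cint _ _ _) (cint _ _ _) => [? ?] [? ?] [? ?] [? ?] /=; ring.
have inv (x y : R) :
   (x +i* y : C)^-1 = (x / (x ^+ 2 + y ^+ 2)) +i* (- y / (x ^+ 2 + y ^+ 2)).
  by rewrite mulNr.
have L : 0 < h + h by rewrite addr_gt0.
have e1 : (h + h)^-1 * (x2 - x1) <= complex.Im (cint x1 x2 (fun t => 1 / ((t +i* y1 : C) - z0) ^+ 1)).
  apply: (cint_Im_ge xx bot) => t /andP[k1 k2]; rewrite expr1 div1r.
  rewrite (_ : (t +i* y1 : C) - z0 = (t - complex.Re z0) +i* (- h)); last first.
    by apply/eqP; rewrite eq_complex /= /y1; case: (z0) => ? ? /=; apply/andP; split; apply/eqP; ring.
  rewrite inv /= sqrrN opprK [X in _ / X]addrC; apply: bnd; rewrite /x1 /x2 in k1 k2; apply/andP; split; lra.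
have e2 : (h + h)^-1 * (x2 - x1) <= complex.Im (cint x1 x2 (fun t => -1 * (1 / ((t +i* y2 : C) - z0) ^+ 1))).
  apply: (cint_Im_ge xx (m1 _ _ _ top)) => t /andP[k1 k2]; rewrite expr1 div1r.
  rewrite (_ : (t +i* y2 : C) - z0 = (t - complex.Re z0) +i* h); last first.
    by apply/eqP; rewrite eq_complex /= /y2; case: (z0) => ? ? /=; apply/andP; split; apply/eqP; ring.
  rewrite mulN1r inv /= mulNr opprK [X in _ / X]addrC.
  apply: bnd; rewrite /x1 /x2 in k1 k2; apply/andP; split; lra.
have e3 : (h + h)^-1 * (y2 - y1) <= complex.Re (cint y1 y2 (fun t => 1 / ((x2 +i* t : C) - z0) ^+ 1)).
  apply: (cint_Re_ge yy rig) => t /andP[k1 k2]; rewrite expr1 div1r.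
  rewrite (_ : (x2 +i* t : C) - z0 = h +i* (t - complex.Im z0)); last first.
    by apply/eqP; rewrite eq_complex /= /x2; case: (z0) => ? ? /=; apply/andP; split; apply/eqP; ring.
  rewrite inv //=; apply: bnd; rewrite /y1 /y2 in k1 k2; apply/andP; split; lra.
have e4 : (h + h)^-1 * (y2 - y1) <= complex.Re (cint y1 y2 (fun t => -1 * (1 / ((x1 +i* t : C) - z0) ^+ 1))).
  apply: (cint_Re_ge yy (m1 _ _ _ lef)) => t /andP[k1 k2]; rewrite expr1 div1r.
  rewrite (_ : (x1 +i* t : C) - z0 = (- h) +i* (t - complex.Im z0)); last first.
    by apply/eqP; rewrite eq_complex /= /x1; case: (z0) => ? ? /=; apply/andP; split; apply/eqP; ring.
  rewrite mulN1r inv /= sqrrN mulNr opprK.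
  by apply: bnd; rewrite /y1 /y2 in k1 k2; apply/andP; split; lra.
have w1 : (h + h)^-1 * (x2 - x1) = 1 by rewrite /x1 /x2; field; rewrite gt_eqF.
have w2 : (h + h)^-1 * (y2 - y1) = 1 by rewrite /y1 /y2; field; rewrite gt_eqF.
have : 0 < complex.Im (P 1 (fun=> 1) z0) by rewrite i0; rewrite w1 in e1 e2; rewrite w2 in e3 e4; lra.
by apply: contraTneq => ->; rewrite ltxx.
Qed.

Lemma eq_rint f g : cts_bd f x1 x2 y1 y2 ->
  (forall w, [|| complex.Re w == x1, complex.Re w == x2, complex.Im w == y1 | complex.Im w == y2] ->
     f w = g w) ->
  rint f x1 x2 y1 y2 = rint g x1 x2 y1 y2.
Proof.
move=> [c1 c2 c3 c4] fg; rewrite /rint; congr (_ - _ + 'i * _ - 'i * _); apply: eq_cint => // t _;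
  by apply: fg; rewrite /= eqxx ?orbT.
Qed.

Lemma cauchy_formula f z : (forall w, rect x1 x2 y1 y2 w -> derivable f w 1) ->
  modulus (z - z0) < h / 2 -> P 1 f z = f z * P 1 (fun=> 1) z.
Proof.
move=> df zh.
have cf : cts_rect f x1 x2 y1 y2.
  by move=> w /df dw; apply: (@cder_continuous _ f w ('D_1 f w)); apply: derivableP.
have := le_lt_trans (Re_le_modulus _) zh; have := le_lt_trans (Im_le_modulus _) zh.
rewrite ReB ImB !ltr_norml => /andP[h1 h2] /andP[h3 h4].
have z1 : x1 < complex.Re z < x2 by rewrite /x1 /x2; apply/andP; split; lra.
have z2 : y1 < complex.Im z < y2 by rewrite /y1 /y2; apply/andP; split; lra.
have rz : rect x1 x2 y1 y2 z by split; apply/andP; split; apply: ltW; move: z1 z2 => /andP[? ?] /andP[? ?].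
pose k w := if w == z then 'D_1 f z else (f w - f z) / (w - z).
have /derivableP dz := df z rz.
have dk w : rect x1 x2 y1 y2 w -> w != z -> derivable k w 1.
  move=> rw wz; have /derivableP dw := df w rw.
  have nwz : \forall v \near w, v != z.
    apply/nbhs_modulus; exists (modulus (w - z)); first by rewrite modulus_gt0 subr_eq0.
    by move=> v; apply: contraTneq => ->; rewrite modulusBC ltxx.
  apply: near_eq_derivable; first by apply: filterS nwz => v vz; rewrite /k (negbTE vz).
  have d1 := cderB dw (is_derive_cst (f z) w (1 : C)).
  have d2 := cderB (is_derive_id w (1 : C)) (is_derive_cst z w (1 : C)).
  have wz0 : w - z != 0 by rewrite subr_eq0.
  by case: (cderM d1 (cderV (f := fun v => v - z) wz0 d2)).
have ck : cts_rect k x1 x2 y1 y2.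
  move=> w rw; have [->|wz] := eqVneq w z; last first.
    by apply: (@cder_continuous _ k w ('D_1 k w)); apply: derivableP; exact: dk.
  apply/(@cvg_modulus _ _ (nbhs z)) => e e0.
  have kz : k z = 'D_1 f z by rewrite /k eqxx.
  have e2 : 0 < e / 2 by rewrite divr_gt0.
  move: dz => /cderP/(_ _ e2)[d d0 dP]; apply/nbhs_modulus; exists d => // v /dP.
  rewrite kz /k; case: eqVneq => [-> _|vz]; first by rewrite subrr modulus0.
  have vz0 : v - z != 0 by rewrite subr_eq0.
  rewrite (_ : f v - f z - _ = ((f v - f z) / (v - z) - 'D_1 f z) * (v - z)); last by rewrite mulrBl divfK.
  rewrite modulusM ler_pM2r ?modulus_gt0// => /le_lt_trans; apply; lra.
have K0 := goursat_punctured z1 z2 ck dk.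
have nz w : [|| complex.Re w == x1, complex.Re w == x2, complex.Im w == y1 | complex.Im w == y2] ->
    w != z.
  move=> /(boundary_dist zh); apply: contraTneq => ->; rewrite subrr modulus0 -ltNge.
  by rewrite divr_gt0.
have H (x y : R) : cts_on x1 x2 (fun t => t +i* y : C) /\ cts_on y1 y2 (fun t => x +i* t : C).
  split=> t _; apply: cvg_Complex; (exact: cvg_cst || exact: cvg_id).
have bd g : cts_rect g x1 x2 y1 y2 -> cts_bd (fun w => g w / (w - z) ^+ 1) x1 x2 y1 y2.
  move=> /(cts_rect_bd xx yy)[c1 c2 c3 c4]; split.
  - by apply: (cts_kernel c1 (H 0 y1).1) => t tx; apply: nz; rewrite /= eqxx ?orbT.
  - by apply: (cts_kernel c2 (H 0 y2).1) => t tx; apply: nz; rewrite /= eqxx ?orbT.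
  - by apply: (cts_kernel c3 (H x1 0).2) => t tx; apply: nz; rewrite /= eqxx ?orbT.
  - by apply: (cts_kernel c4 (H x2 0).2) => t tx; apply: nz; rewrite /= eqxx ?orbT.
have c1 : cts_rect (fun=> 1 : C) x1 x2 y1 y2 by move=> w _; exact: (@cvg_cst C 1 _ (nbhs w)).
have b1 := bd _ c1; have bf := bd _ cf.
have bz : cts_bd (fun w => - f z * (1 / (w - z) ^+ 1)) x1 x2 y1 y2.
  by case: b1 => [u1 u2 u3 u4]; split;
    [exact: (ctsZ (k := - f z) u1)|exact: (ctsZ (k := - f z) u2)|exact: (ctsZ (k := - f z) u3)|exact: (ctsZ (k := - f z) u4)].
have := rintD xx yy bf bz; rewrite (rintZ (- f z) xx yy b1) => E.
have E2 : rint k x1 x2 y1 y2 = P 1 f z + - f z * P 1 (fun=> 1) z.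
  rewrite -E; apply: eq_rint; first exact: (cts_rect_bd xx yy ck).
  by move=> w /nz wz; rewrite /k (negbTE wz) expr1 div1r mulrBl mulNr.
by move: E2; rewrite K0 mulNr => /eqP; rewrite eq_sym subr_eq0 => /eqP.
Qed.

End Square.

(** Cauchy's formula on a square. The constant in it is the integral of
   [1 / (w - z0)], of which only [winding_neq0] is used. *)
Theorem holomorphic_derive1 (U : set C) f : open U -> holomorphic_on U f ->
  holomorphic_on U (derive1 f).
Proof.
move=> oU hf z0 Uz0; have [d d0 dU] := open_modulus oU Uz0.
pose h := d / 3; have h0 : 0 < h by rewrite divr_gt0.
have df w : rect (complex.Re z0 - h) (complex.Re z0 + h) (complex.Im z0 - h) (complex.Im z0 + h) w ->
    derivable f w 1.
  by move=> /square_disc wh; apply: hf; apply: dU; apply: le_lt_trans wh _; rewrite /h; lra.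
have cf : cts_rect f (complex.Re z0 - h) (complex.Re z0 + h) (complex.Im z0 - h) (complex.Im z0 + h).
  by move=> w /df dw; apply: (@cder_continuous _ f w ('D_1 f w)); apply: derivableP.
have c1 : cts_rect (fun=> 1 : C) (complex.Re z0 - h) (complex.Re z0 + h) (complex.Im z0 - h) (complex.Im z0 + h).
  by move=> w _; exact: (@cvg_cst C 1 _ (nbhs w)).
pose P n g z := rint (fun w => g w / (w - z) ^+ n)
  (complex.Re z0 - h) (complex.Re z0 + h) (complex.Im z0 - h) (complex.Im z0 + h) : C.
have h2 : 0 < h / 2 by rewrite divr_gt0.
have zz : modulus (z0 - z0) < h / 2 by rewrite subrr modulus0.
have N0 : P 1%N (fun=> 1) z0 != 0 by exact: winding_neq0.
have K g z : cts_rect g (complex.Re z0 - h) (complex.Re z0 + h) (complex.Im z0 - h) (complex.Im z0 + h) ->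
    modulus (z - z0) < h / 2 ->
    is_derive z (1 : C) (P 1%N g) (P 2%N g z) /\ is_derive z (1 : C) (P 2%N g) (2 * P 3%N g z).
  by move=> cg; exact: cder_rint_kernel.
have CF z : modulus (z - z0) < h / 2 -> P 1%N f z = f z * P 1%N (fun=> 1) z.
  by move=> zh; exact: cauchy_formula.
clearbody P.
have nN : \forall z \near z0, P 1%N (fun=> 1) z != 0.
  have cN := cder_continuous (K _ _ c1 zz).1.
  have m0 : 0 < modulus (P 1%N (fun=> 1) z0) by rewrite modulus_gt0.
  have /(@cvg_modulus _ _ (nbhs z0))/(_ _ m0) := cN.
  by apply: filterS => z; apply: contraTneq => ->; rewrite sub0r modulusN ltxx.
have [r r0 rP] : exists2 r : R, 0 < r & forall z, modulus (z - z0) < r ->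
    modulus (z - z0) < h / 2 /\ P 1%N (fun=> 1) z != 0.
  apply/nbhs_modulus; have nz := near_modulus z0 h2.
  by apply: filterS2 nz nN.
have oD := @open_disc R z0 r.
have nD z : modulus (z - z0) < r -> \forall w \near z, modulus (w - z0) < r.
  by move=> zr; apply: open_nbhs_nbhs; split.
pose der z := P 1%N f z * (- (P 1%N (fun=> 1) z) ^- 2 * P 2%N (fun=> 1) z) + (P 1%N (fun=> 1) z)^-1 * P 2%N f z.
have dfE z : modulus (z - z0) < r -> is_derive z (1 : C) f (der z).
  move=> zr; have [zh Nz] := rP _ zr.
  have ne : \forall w \near z, P 1%N f w * (P 1%N (fun=> 1) w)^-1 = f w.
    by apply: filterS (nD _ zr) => w /rP[wh Nw]; rewrite CF// mulfK.
  exact: (near_cder ne (cderM (K _ _ cf zh).1 (cderV Nz (K _ _ c1 zh).1))).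
have [k1 k2] := K _ _ cf zz; have [k3 k4] := K _ _ c1 zz.
have k5 := cderV N0 k3.
have N2 : P 1%N (fun=> 1) z0 * P 1%N (fun=> 1) z0 != 0 by rewrite mulf_neq0.
have k9 := cderD (cderM k1 (cderM (cderZ (-1) (@cderV R (fun z => P 1%N (fun=> 1) z * P 1%N (fun=> 1) z) z0 _ N2 (cderM k3 k3))) k4)) (cderM k5 k2).
have dd : derivable der z0 1.
  rewrite (_ : der = fun z => P 1%N f z * (-1 * (P 1%N (fun=> 1) z * P 1%N (fun=> 1) z)^-1 * P 2%N (fun=> 1) z)
     + (P 1%N (fun=> 1) z)^-1 * P 2%N f z); first by case: k9.
  by apply/funext => z; rewrite /der expr2; ring.
have zr : modulus (z0 - z0) < r by rewrite subrr modulus0.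
have ne : \forall w \near z0, der w = derive1 f w.
  by apply: filterS (nD _ zr) => w wr; rewrite (cder_derive1 (dfE w wr)).
exact: (near_eq_derivable ne dd).
Qed.

End HolomorphicSmooth.

(** * Smooth functions *)
Section Smooth.
Variable R : realType.
Local Notation C := (cplx R).

Lemma ord2 (k : 'I_2) : k = 0 \/ k = 1.
Proof. by case: k => -[|[|//]] ?; [left|right]; apply/val_inj. Qed.

Lemma derdirD (f g : C -> R) k z a b : derdir f k z a -> derdir g k z b ->
  derdir (fun w => f w + g w) k z (a + b).
Proof. exact: is_deriveD. Qed.

Lemma derdir_cst k z (c : R) : derdir (fun _ : C => c) k z 0.
Proof. exact: is_derive_cst. Qed.

Lemma line0 z (k : 'I_2) : z + (0 : R)%:C * dir R k = z.
Proof. by rewrite mul0r addr0. Qed.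

Lemma derdirM (f g : C -> R) k z a b : derdir f k z a -> derdir g k z b ->
  derdir (fun w => f w * g w) k z (f z * b + g z * a).
Proof.
move=> df dg; have := is_deriveM df dg; rewrite /= !line0; exact.
Qed.

Lemma derdirV (f : C -> R) k z a : f z != 0 -> derdir f k z a ->
  derdir (fun w => (f w)^-1) k z (- (f z) ^- 2 * a).
Proof.
move=> f0 [df <-].
have f1 : (fun t : R => f (z + t%:C * dir R k)) 0 != 0 by rewrite /= line0.
apply: DeriveDef; first exact: derivableV f1 df.
by rewrite (deriveV f1 df) /= line0.
Qed.

(** Iterated partial derivatives are handled for all the expressions in this
   class at once: it is closed under partial derivatives, and its members are
   continuous. *)
Inductive smooth_expr (U : set C) : (C -> R) -> Prop :=
| smooth_expr_base f : smooth_on U f -> smooth_expr U f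
| smooth_expr_cst c : smooth_expr U (fun=> c)
| smooth_exprD f g : smooth_expr U f -> smooth_expr U g -> smooth_expr U (fun w => f w + g w)
| smooth_exprM f g : smooth_expr U f -> smooth_expr U g -> smooth_expr U (fun w => f w * g w)
| smooth_exprV f : smooth_expr U f -> (forall z, U z -> f z != 0) ->
    smooth_expr U (fun w => (f w)^-1)
| smooth_expr_Re phi : holomorphic_on U phi -> smooth_expr U (fun w => complex.Re (phi w))
| smooth_expr_Im phi : holomorphic_on U phi -> smooth_expr U (fun w => complex.Im (phi w))
| smooth_expr_comp V g phi : open V -> smooth_on V g -> holomorphic_on U phi ->
    (forall z, U z -> V (phi z)) -> smooth_expr U (g \o phi).

Lemma smooth_on_partial U (f : C -> R) k : smooth_on U f -> smooth_on U (partial k f).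
Proof. by move=> sf s z Uz; have := sf (rcons s k) z Uz; rewrite foldr_rcons. Qed.

Lemma smooth_on_derdir U (f : C -> R) k z : smooth_on U f -> U z ->
  derdir f k z (partial k f z).
Proof.
move=> sf Uz; have [_ /(_ k)] := sf [::] z Uz.
by rewrite /derdir /partial derive1E; exact: derivableP.
Qed.

Lemma smooth_on_continuous U (f : C -> R) z : smooth_on U f -> U z ->
  {for z, continuous f}.
Proof. by move=> sf Uz; have [] := sf [::] z Uz. Qed.

Lemma smooth_on_rdiff U (f : C -> R) z : open U -> smooth_on U f -> U z ->
  rdiff f z (partial 0 f z) (partial 1 f z).
Proof.
move=> oU sf Uz; apply: (C1_rdiff oU Uz) => [w k Uw|k].
  by have [_] := sf [::] w Uw.
exact: smooth_on_continuous (smooth_on_partial k sf) Uz.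
Qed.

Lemma smooth_expr_step U f : open U -> smooth_expr U f ->
  (forall z, U z -> {for z, continuous f}) /\
  forall k, exists2 g, smooth_expr U g & forall z, U z -> derdir f k z (g z).
Proof.
move=> oU; elim => {f} [f sf|c|f g _ [cf df] _ [cg dg]|f g sf [cf df] sg [cg dg]|f sf [cf df] f0
  |phi hp|phi hp|V g phi oV sg hp pV].
- split=> [z Uz|k]; first exact: smooth_on_continuous sf Uz.
  exists (partial k f); first exact/smooth_expr_base/smooth_on_partial.
  by move=> z Uz; exact: smooth_on_derdir sf Uz.
- split=> [z Uz|k]; first exact: (@cvg_cst _ c _ (nbhs (z : C))).
  exists (fun=> 0); first exact: smooth_expr_cst.
  by move=> z _; exact: derdir_cst.
- split=> [z Uz|k]; first exact: (@continuousD _ _ _ f g z (cf z Uz) (cg z Uz)).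
  have [f' sf' df'] := df k; have [g' sg' dg'] := dg k.
  exists (fun w => f' w + g' w); first exact: smooth_exprD.
  by move=> z Uz; exact: derdirD (df' z Uz) (dg' z Uz).
- split=> [z Uz|k]; first exact: (@continuousM _ _ f g z (cf z Uz) (cg z Uz)).
  have [f' sf' df'] := df k; have [g' sg' dg'] := dg k.
  exists (fun w => f w * g' w + g w * f' w).
    by apply: smooth_exprD; apply: smooth_exprM.
  by move=> z Uz; exact: derdirM (df' z Uz) (dg' z Uz).
- split=> [z Uz|k]; first exact: (@continuousV _ _ f z (f0 z Uz) (cf z Uz)).
  have [f' sf' df'] := df k.
  exists (fun w => (-1 * ((f w)^-1 * (f w)^-1)) * f' w).
    apply: smooth_exprM => //; apply: smooth_exprM; first exact: smooth_expr_cst.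
    by apply: smooth_exprM; apply: smooth_exprV.
  move=> z Uz; have := derdirV (f0 z Uz) (df' z Uz).
  by rewrite expr2 invfM mulN1r.
- have hp' := holomorphic_derive1 oU hp; split=> [z Uz|k].
    by apply: continuous_comp; [exact: (cder_continuous (holomorphic_cder hp Uz))|exact: continuous_Re].
  have H z Uz := rdiff_derdir k (rdiff_Re (@holomorphic_cder _ _ _ z hp Uz)).
  case: (ord2 k) H => -> H; first by exists (fun w => complex.Re (derive1 phi w)) => //; exact: smooth_expr_Re.
  exists (fun w => -1 * complex.Im (derive1 phi w)); last by move=> z Uz; rewrite mulN1r; exact: H.
  by apply: smooth_exprM; [exact: smooth_expr_cst|exact: smooth_expr_Im].
- have hp' := holomorphic_derive1 oU hp; split=> [z Uz|k].
    by apply: continuous_comp; [exact: (cder_continuous (holomorphic_cder hp Uz))|exact: continuous_Im].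
  have H z Uz := rdiff_derdir k (rdiff_Im (@holomorphic_cder _ _ _ z hp Uz)).
  case: (ord2 k) H => -> H; first by exists (fun w => complex.Im (derive1 phi w)) => //; exact: smooth_expr_Im.
  by exists (fun w => complex.Re (derive1 phi w)) => //; exact: smooth_expr_Re.
- have hp' := holomorphic_derive1 oU hp; split=> [z Uz|k].
    apply: continuous_comp; first exact: (cder_continuous (holomorphic_cder hp Uz)).
    by apply: smooth_on_continuous sg _; exact: pV.
  have H z Uz := rdiff_derdir k (rdiff_comp (smooth_on_rdiff oV sg (pV z Uz))
    (@holomorphic_cder _ _ _ z hp Uz)).
  have c0 := smooth_expr_comp oV (smooth_on_partial 0 sg) hp pV.
  have c1 := smooth_expr_comp oV (smooth_on_partial 1 sg) hp pV.
  have r := smooth_expr_Re hp'; have i := smooth_expr_Im hp'.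
  case: (ord2 k) H => -> H.
    exists (fun w => (partial 0 g \o phi) w * complex.Re (derive1 phi w) +
                     (partial 1 g \o phi) w * complex.Im (derive1 phi w)) => //.
    by apply: smooth_exprD; apply: smooth_exprM.
  exists (fun w => (partial 1 g \o phi) w * complex.Re (derive1 phi w) +
                   -1 * ((partial 0 g \o phi) w * complex.Im (derive1 phi w))).
    apply: smooth_exprD; apply: smooth_exprM => //; first exact: smooth_expr_cst.
    exact: smooth_exprM.
  by move=> z Uz; rewrite mulN1r; exact: H.
Qed.

Lemma open_near (T : topologicalType) (U : set T) z : open U -> U z -> \forall w \near z, U w.
Proof. by move=> oU Uz; apply: open_nbhs_nbhs. Qed.

Lemma smooth_exprP (U : set C) f : open U -> smooth_expr U f -> smooth_on U f.
Proof.
move=> oU sf.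
have H s : exists2 g, smooth_expr U g & forall z, U z -> foldr (@partial R) f s z = g z.
  elim: s => [|k s [g sg fg]]; first by exists f.
  have [_ /(_ k)[g' sg' dg]] := smooth_expr_step oU sg.
  exists g' => // z Uz /=; rewrite -(derdirP (dg z Uz)).
  by apply: near_partial; apply: filterS (open_near oU Uz) => w; exact: fg.
move=> s z Uz; have [g sg fg] := H s; have [cg dg] := smooth_expr_step oU sg.
have gf : \forall w \near z, g w = foldr (@partial R) f s w.
  by apply: filterS (open_near oU Uz) => w Uw; rewrite fg.
split; first exact: near_continuous gf (cg z Uz).
move=> k; have [g' _ dg'] := dg k.
by case: (near_derdir gf (dg' z Uz)).
Qed.

Lemma eq_smooth_on (U : set C) (f g : C -> R) : open U ->
  (forall z, U z -> f z = g z) -> smooth_on U f -> smooth_on U g.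
Proof.
move=> oU fg sf s.
have H z : U z -> foldr (@partial R) f s z = foldr (@partial R) g s z.
  elim: s z => [|k s IH] z Uz /=; first exact: fg.
  by apply: near_partial; apply: filterS (open_near oU Uz).
move=> z Uz; have [cf df] := sf s z Uz.
have gf : \forall w \near z, foldr (@partial R) f s w = foldr (@partial R) g s w.
  exact: filterS (open_near oU Uz).
split; first exact: near_continuous gf cf.
by move=> k; exact: near_eq_derivable (near_line k gf) (df k).
Qed.

Lemma smooth_on_sub (U V : set C) (f : C -> R) : V `<=` U -> smooth_on U f -> smooth_on V f.
Proof. by move=> VU sf s z /VU; exact: sf. Qed.

End Smooth.

(** * Wirtinger calculus *)
Section Wirtinger.
Variable R : realType.
Local Notation C := (cplx R).
Implicit Types f g : C -> C.

Definition cdir f k z (a : C) :=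
  derdir (fun w => complex.Re (f w)) k z (complex.Re a) /\
  derdir (fun w => complex.Im (f w)) k z (complex.Im a).

Lemma cdirP f k z a : cdir f k z a -> cpartial k f z = a.
Proof. by move=> [/derdirP h1 /derdirP h2]; rewrite /cpartial h1 h2; case: (a). Qed.

(** [p] and [q] are the derivatives of [f] with respect to z and its conjugate. *)
Definition wder f z (p q : C) := cdir f 0 z (p + q) /\ cdir f 1 z ('i * (p - q)).

Lemma wder_dz f z p q : wder f z p q -> d_z f z = p.
Proof.
move=> [/cdirP h0 /cdirP h1]; rewrite /d_z h0 h1 mulrA -expr2 sqr_i; by field.
Qed.

Lemma wder_dzbar f z p q : wder f z p q -> d_zbar f z = q.
Proof.
move=> [/cdirP h0 /cdirP h1]; rewrite /d_zbar h0 h1 mulrA -expr2 sqr_i; by field.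
Qed.

Lemma near_cdir f g k z a : (\forall w \near z, f w = g w) -> cdir f k z a -> cdir g k z a.
Proof.
by move=> fg [h1 h2]; split; [apply: near_derdir h1|apply: near_derdir h2];
   apply: filterS fg => w ->.
Qed.

Lemma near_wder f g z p q : (\forall w \near z, f w = g w) -> wder f z p q -> wder g z p q.
Proof. by move=> fg [h1 h2]; split; [exact: near_cdir h1|exact: near_cdir h2]. Qed.

Lemma eq_derdir (f g : C -> R) k z a b : (forall w, f w = g w) -> a = b ->
  derdir f k z a -> derdir g k z b.
Proof. by move=> /funext-> ->. Qed.

Lemma cdirD f g k z a b : cdir f k z a -> cdir g k z b ->
  cdir (fun w => f w + g w) k z (a + b).
Proof.
move=> [f1 f2] [g1 g2]; split.
  by apply: (eq_derdir _ _ (derdirD f1 g1)) => [w|]; [case: (f w) (g w) => ? ? []|case: (a) (b) => ? ? []].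
by apply: (eq_derdir _ _ (derdirD f2 g2)) => [w|]; [case: (f w) (g w) => ? ? []|case: (a) (b) => ? ? []].
Qed.

Lemma derdirB (f g : C -> R) k z a b : derdir f k z a -> derdir g k z b ->
  derdir (fun w => f w - g w) k z (a - b).
Proof. exact: is_deriveB. Qed.

Lemma cdirM f g k z a b : cdir f k z a -> cdir g k z b ->
  cdir (fun w => f w * g w) k z (f z * b + g z * a).
Proof.
move=> [f1 f2] [g1 g2]; split.
  apply: (eq_derdir _ _ (derdirB (derdirM f1 g1) (derdirM f2 g2))) => [w|].
    by case: (f w) (g w) => ? ? [].
  by case: (a) (b) (f z) (g z) => ? ? [? ?] [? ?] [? ?] /=; ring.
apply: (eq_derdir _ _ (derdirD (derdirM f1 g2) (derdirM f2 g1))) => [w|].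
  by case: (f w) (g w) => ? ? [].
by case: (a) (b) (f z) (g z) => ? ? [? ?] [? ?] [? ?] /=; ring.
Qed.

Lemma derdirN (f : C -> R) k z a : derdir f k z a -> derdir (fun w => - f w) k z (- a).
Proof. exact: is_deriveN. Qed.

Lemma cdir_conj f k z a : cdir f k z a -> cdir (fun w => conjc (f w)) k z (conjc a).
Proof.
move=> [f1 f2]; split.
  by apply: (eq_derdir _ _ f1) => [w|]; [case: (f w)|case: (a)].
by apply: (eq_derdir _ _ (derdirN f2)) => [w|]; [case: (f w)|case: (a)].
Qed.

Lemma cdir_cst (c : C) k z : cdir (fun=> c) k z 0.
Proof. by split; exact: derdir_cst. Qed.

Lemma sqmod_neq0 (z : C) : (complex.Re z ^+ 2 + complex.Im z ^+ 2 != 0) = (z != 0).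
Proof. by rewrite -[X in X != 0]/(sqmod z) -modulus_sqr sqrf_eq0 modulus_eq0. Qed.

Lemma cdirV f k z a : f z != 0 -> cdir f k z a ->
  cdir (fun w => (f w)^-1) k z (- (f z) ^- 2 * a).
Proof.
move=> f0 [f1 f2]; rewrite expr2 invfM.
have n0 := f0; rewrite -sqmod_neq0 !expr2 in n0.
have N := derdirV n0 (derdirD (derdirM f1 f1) (derdirM f2 f2)).
have n1 := f0; rewrite -sqmod_neq0 in n1.
split.
  apply: (eq_derdir _ _ (derdirM f1 N)) => [w|].
    by case: (f w) => u v /=; rewrite !expr2.
  by move: n1; case: (a) (f z) => ? ? [u v] /= n1; rewrite /=; field; rewrite -?expr2.
apply: (eq_derdir _ _ (derdirN (derdirM f2 N))) => [w|].
  by case: (f w) => u v /=; rewrite !expr2.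
by move: n1; case: (a) (f z) => ? ? [u v] /= n1; rewrite /=; field; rewrite -?expr2.
Qed.

Lemma wderD f g z p q p' q' : wder f z p q -> wder g z p' q' ->
  wder (fun w => f w + g w) z (p + p') (q + q').
Proof.
move=> [f0 f1] [g0 g1]; split.
  by have := cdirD f0 g0; congr cdir; ring.
by have := cdirD f1 g1; congr cdir; ring.
Qed.

Lemma wderM f g z p q p' q' : wder f z p q -> wder g z p' q' ->
  wder (fun w => f w * g w) z (f z * p' + g z * p) (f z * q' + g z * q).
Proof.
move=> [f0 f1] [g0 g1]; split.
  by have := cdirM f0 g0; congr cdir; ring.
by have := cdirM f1 g1; congr cdir; ring.
Qed.

Lemma wderV f z p q : f z != 0 -> wder f z p q ->
  wder (fun w => (f w)^-1) z (- (f z) ^- 2 * p) (- (f z) ^- 2 * q).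
Proof.
move=> fz [f0 f1]; split.
  by have := cdirV fz f0; congr cdir; ring.
by have := cdirV fz f1; congr cdir; ring.
Qed.

Lemma wder_cst (c : C) z : wder (fun=> c) z 0 0.
Proof. by split; have := cdir_cst c _ z; rewrite ?addr0 ?subr0 ?mulr0; apply. Qed.

Lemma wder_conj f z p q : wder f z p q ->
  wder (fun w => conjc (f w)) z (conjc q) (conjc p).
Proof.
move=> [f0 f1]; split.
  by have := cdir_conj f0; congr cdir; rewrite rmorphD addrC.
have := cdir_conj f1; congr cdir; case: (p) (q) => [? ?] [? ?].
by apply/eqP; rewrite eq_complex /=; apply/andP; split; apply/eqP; ring.
Qed.

Lemma wderZ (c : C) f z p q : wder f z p q -> wder (fun w => c * f w) z (c * p) (c * q).
Proof.
by move=> df; have := wderM (wder_cst c z) df; rewrite !mulr0 !addr0.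
Qed.

Lemma wderN f z p q : wder f z p q -> wder (fun w => - f w) z (- p) (- q).
Proof.
move=> /(wderZ (-1)); rewrite !mulN1r (_ : (fun w => -1 * f w) = (fun w => - f w))//.
by apply/funext => w; rewrite mulN1r.
Qed.

Lemma wderB f g z p q p' q' : wder f z p q -> wder g z p' q' ->
  wder (fun w => f w - g w) z (p - p') (q - q').
Proof. by move=> df /wderN dg; exact: wderD. Qed.

Lemma cder_wder f z l : is_derive z (1 : C) f l -> wder f z l 0.
Proof.
move=> df; have r := rdiff_Re df; have i := rdiff_Im df.
split; split.
- by have := rdiff_derdir 0 r; rewrite eqxx addr0.
- by have := rdiff_derdir 0 i; rewrite eqxx addr0.
- by have := rdiff_derdir 1 r; rewrite subr0; case: (l) => u v /=; rewrite mul0r mul1r sub0r.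
- by have := rdiff_derdir 1 i; rewrite subr0; case: (l) => u v /=; rewrite mul0r mul1r add0r.
Qed.

Lemma csmooth_wder (U : set C) f z : csmooth_on U f -> U z ->
  wder f z (d_z f z) (d_zbar f z).
Proof.
move=> [sr si] Uz.
have H k : cdir f k z (cpartial k f z).
  by split; [exact: smooth_on_derdir sr Uz|exact: smooth_on_derdir si Uz].
split; [have := H 0|have := H 1]; congr cdir; rewrite /d_z /d_zbar.
  by field.
rewrite (_ : 'i * _ = - ('i * 'i) * cpartial 1 f z); last by field.
by rewrite -expr2 sqr_i opprK mul1r.
Qed.

Lemma wder_comp (V : set C) f (phi : C -> C) z l p q : open V -> csmooth_on V f -> V (phi z) ->
  wder f (phi z) p q -> is_derive z (1 : C) phi l ->
  wder (f \o phi) z (p * l) (q * conjc l).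
Proof.
move=> oV [sr si] Vz [[h1 h2] [h3 h4]] dphi.
have r := rdiff_comp (smooth_on_rdiff oV sr Vz) dphi.
have i := rdiff_comp (smooth_on_rdiff oV si Vz) dphi.
rewrite (derdirP h1) (derdirP h3) in r; rewrite (derdirP h2) (derdirP h4) in i.
split; split.
- have := rdiff_derdir 0 r; rewrite eqxx; congr derdir.
  by case: (l) (p) (q) => [? ?] [? ?] [? ?] /=; ring.
- have := rdiff_derdir 0 i; rewrite eqxx; congr derdir.
  by case: (l) (p) (q) => [? ?] [? ?] [? ?] /=; ring.
- have := rdiff_derdir 1 r; congr derdir.
  by case: (l) (p) (q) => [? ?] [? ?] [? ?] /=; ring.
- have := rdiff_derdir 1 i; congr derdir.
  by case: (l) (p) (q) => [? ?] [? ?] [? ?] /=; ring.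
Qed.

End Wirtinger.

Section SmoothClosure.
Variable R : realType.
Local Notation C := (cplx R).
Implicit Types f g : C -> C.
Variable U : set C.
Hypothesis oU : open U.

Lemma smoothD (f g : C -> R) : smooth_on U f -> smooth_on U g -> smooth_on U (fun w => f w + g w).
Proof. by move=> sf sg; apply: (smooth_exprP oU); apply: smooth_exprD; apply: smooth_expr_base. Qed.

Lemma smoothM (f g : C -> R) : smooth_on U f -> smooth_on U g -> smooth_on U (fun w => f w * g w).
Proof. by move=> sf sg; apply: (smooth_exprP oU); apply: smooth_exprM; apply: smooth_expr_base. Qed.

Lemma smoothV (f : C -> R) : smooth_on U f -> (forall z, U z -> f z != 0) ->
  smooth_on U (fun w => (f w)^-1).
Proof. by move=> sf f0; apply: (smooth_exprP oU); apply: smooth_exprV => //; apply: smooth_expr_base. Qed.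

Lemma smooth_cst (c : R) : smooth_on U (fun=> c).
Proof. by apply: (smooth_exprP oU); apply: smooth_expr_cst. Qed.

Lemma smoothZ (c : R) (f : C -> R) : smooth_on U f -> smooth_on U (fun w => c * f w).
Proof. by move=> sf; exact: smoothM (smooth_cst c) sf. Qed.

Lemma smoothN (f : C -> R) : smooth_on U f -> smooth_on U (fun w => - f w).
Proof. by move=> /(smoothZ (-1)); apply: (eq_smooth_on oU) => z _; rewrite mulN1r. Qed.

Lemma smoothB (f g : C -> R) : smooth_on U f -> smooth_on U g -> smooth_on U (fun w => f w - g w).
Proof. by move=> sf /smoothN; exact: smoothD. Qed.

Lemma eq_csmooth f g : (forall z, U z -> f z = g z) -> csmooth_on U f -> csmooth_on U g.
Proof. by move=> fg [h1 h2]; split; [apply: eq_smooth_on h1|apply: eq_smooth_on h2] => // z Uz; rewrite fg. Qed.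

Lemma csmoothD f g : csmooth_on U f -> csmooth_on U g -> csmooth_on U (fun w => f w + g w).
Proof.
move=> [f1 f2] [g1 g2]; split.
  by apply: (eq_smooth_on oU) (smoothD f1 g1) => z _; case: (f z) (g z) => ? ? [].
by apply: (eq_smooth_on oU) (smoothD f2 g2) => z _; case: (f z) (g z) => ? ? [].
Qed.

Lemma csmoothM f g : csmooth_on U f -> csmooth_on U g -> csmooth_on U (fun w => f w * g w).
Proof.
move=> [f1 f2] [g1 g2]; split.
  by apply: (eq_smooth_on oU) (smoothB (smoothM f1 g1) (smoothM f2 g2)) => z _; case: (f z) (g z) => ? ? [].
apply: (eq_smooth_on oU) (smoothD (smoothM f1 g2) (smoothM f2 g1)) => z _.
by case: (f z) (g z) => ? ? [].
Qed.

Lemma csmooth_cst (c : C) : csmooth_on U (fun=> c).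
Proof. by split; exact: smooth_cst. Qed.

Lemma csmoothN f : csmooth_on U f -> csmooth_on U (fun w => - f w).
Proof.
by move=> /(csmoothM (csmooth_cst (-1))); apply: eq_csmooth => z _; rewrite mulN1r.
Qed.

Lemma csmoothB f g : csmooth_on U f -> csmooth_on U g -> csmooth_on U (fun w => f w - g w).
Proof. by move=> sf /csmoothN; exact: csmoothD. Qed.

Lemma csmooth_conj f : csmooth_on U f -> csmooth_on U (fun w => conjc (f w)).
Proof.
move=> [f1 f2]; split; first by apply: (eq_smooth_on oU) f1 => z _; case: (f z).
by apply: (eq_smooth_on oU) (smoothN f2) => z _; case: (f z).
Qed.

Lemma csmoothV f : csmooth_on U f -> (forall z, U z -> f z != 0) ->
  csmooth_on U (fun w => (f w)^-1).
Proof.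
move=> [f1 f2] f0.
have sV : smooth_on U (fun w => (complex.Re (f w) * complex.Re (f w) + complex.Im (f w) * complex.Im (f w))^-1).
  by apply: smoothV (smoothD (smoothM f1 f1) (smoothM f2 f2)) _ => z /f0; rewrite -sqmod_neq0 !expr2.
split; first by apply: (eq_smooth_on oU) (smoothM f1 sV) => z _; case: (f z) => ? ?; rewrite /= !expr2.
by apply: (eq_smooth_on oU) (smoothN (smoothM f2 sV)) => z _; case: (f z) => ? ?; rewrite /= !expr2.
Qed.

Lemma csmooth_holomorphic f : holomorphic_on U f -> csmooth_on U f.
Proof.
by move=> hf; split; apply: (smooth_exprP oU); [exact: smooth_expr_Re|exact: smooth_expr_Im].
Qed.

Lemma csmooth_comp (V : set C) f (phi : C -> C) : open V -> csmooth_on V f ->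
  holomorphic_on U phi -> (forall z, U z -> V (phi z)) -> csmooth_on U (f \o phi).
Proof.
move=> oV [f1 f2] hp pV; split; apply: (smooth_exprP oU).
  exact: (smooth_expr_comp oV f1 hp pV).
exact: (smooth_expr_comp oV f2 hp pV).
Qed.

Lemma csmooth_real (f : C -> R) : smooth_on U f -> csmooth_on U (fun w => (f w)%:C).
Proof. by move=> sf; split => //; exact: smooth_cst. Qed.

Lemma csmooth_d_z f : csmooth_on U f -> csmooth_on U (d_z f).
Proof.
move=> [f1 f2]; have s1 k := smooth_on_partial k f1; have s2 k := smooth_on_partial k f2.
have sp k : csmooth_on U (cpartial k f) by split; [exact: s1|exact: s2].
exact: (csmoothM (csmooth_cst 2^-1) (csmoothB (sp 0) (csmoothM (csmooth_cst 'i) (sp 1)))).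
Qed.

Lemma csmooth_d_zbar f : csmooth_on U f -> csmooth_on U (d_zbar f).
Proof.
move=> [f1 f2]; have s1 k := smooth_on_partial k f1; have s2 k := smooth_on_partial k f2.
have sp k : csmooth_on U (cpartial k f) by split; [exact: s1|exact: s2].
exact: (csmoothM (csmooth_cst 2^-1) (csmoothD (sp 0) (csmoothM (csmooth_cst 'i) (sp 1)))).
Qed.

Lemma eq_d_z f g z : U z -> (forall w, U w -> f w = g w) -> d_z f z = d_z g z.
Proof.
move=> Uz fg; rewrite /d_z; congr (_ * (_ - _ * _)); rewrite /cpartial; congr (_ +i* _);
  by apply: near_partial; apply: filterS (open_near oU Uz) => w /fg ->.
Qed.

Lemma eq_d_zbar f g z : U z -> (forall w, U w -> f w = g w) -> d_zbar f z = d_zbar g z.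
Proof.
move=> Uz fg; rewrite /d_zbar; congr (_ * (_ + _ * _)); rewrite /cpartial; congr (_ +i* _);
  by apply: near_partial; apply: filterS (open_near oU Uz) => w /fg ->.
Qed.

Lemma eq_wder f g z p q : U z -> (forall w, U w -> f w = g w) -> wder f z p q -> wder g z p q.
Proof. by move=> Uz fg; apply: near_wder; apply: filterS (open_near oU Uz). Qed.

Lemma real_wder f z p q : U z -> (forall w, U w -> conjc (f w) = f w) -> wder f z p q ->
  q = conjc p.
Proof.
move=> Uz fr df; have := eq_wder Uz fr (wder_conj df).
by move=> /wder_dzbar; rewrite (wder_dzbar df).
Qed.

End SmoothClosure.

(** * Local analysis of the Hermitian-Einstein equation *)
Section Matrices.
Variable R : realType.
Local Notation C := (cplx R).

Lemma mx2E (M : 'M[R[i]]_2) : M = mx2 (M 0 0) (M 0 1) (M 1 0) (M 1 1).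
Proof.
by apply/matrixP => k l; rewrite mxE; case: (ord2 k) => ->; case: (ord2 l) => ->.
Qed.

Lemma mx2_entries (a b c d : R[i]) : [/\ mx2 a b c d 0 0 = a, mx2 a b c d 0 1 = b,
  mx2 a b c d 1 0 = c & mx2 a b c d 1 1 = d].
Proof. by split; rewrite mxE. Qed.

Lemma mulmx_mx2 (a b c d a' b' c' d' : R[i]) : mx2 a b c d *m mx2 a' b' c' d' =
  mx2 (a * a' + b * c') (a * b' + b * d') (c * a' + d * c') (c * b' + d * d').
Proof.
apply/matrixP => k l; rewrite !mxE !big_ord_recl big_ord0 !mxE /=.
by case: (ord2 k) => ->; case: (ord2 l) => -> /=; rewrite addr0.
Qed.

Lemma mx2_unit (a b c d : R[i]) : a * d - b * c != 0 -> mx2 a b c d \in unitmx.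
Proof.
move=> D0; have : mx2 a b c d *m mx2 (d / (a * d - b * c)) (- b / (a * d - b * c))
   (- c / (a * d - b * c)) (a / (a * d - b * c)) = 1%:M.
  rewrite mulmx_mx2 [RHS]mx2E !mxE /=.
  by congr mx2; field.
by case/mulmx1_unit.
Qed.

Lemma invmx_mul (G M N : 'M[R[i]]_2) : G \in unitmx -> G *m N = M -> invmx G *m M = N.
Proof. by move=> Gu <-; rewrite mulKmx. Qed.

Lemma conj_mx2 (a b c d : R[i]) :
  (map_mx conjc (mx2 a b c d))^T = mx2 (conjc a) (conjc c) (conjc b) (conjc d).
Proof.
by apply/matrixP => k l; rewrite !mxE; case: (ord2 k) => ->; case: (ord2 l) => ->.
Qed.

Lemma hform_mx2 (a b c d : R[i]) (v : 'cV[R[i]]_2) :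
  hform (mx2 a b c d) v = conjc (v 0 0) * (a * v 0 0 + b * v 1 0) +
                          conjc (v 1 0) * (c * v 0 0 + d * v 1 0).
Proof.
rewrite /hform !mxE !big_ord_recl big_ord0 !mxE !big_ord_recl !big_ord0 !mxE /=.
rewrite !addr0 (_ : lift ord0 ord0 = 1 :> 'I_2); last exact/val_inj.
rewrite -[Num.conj_op (v 0 0)]/(conjc (v 0 0)) -[Num.conj_op (v 1 0)]/(conjc (v 1 0)); ring.
Qed.

Definition col2 (x y : R[i]) : 'cV[R[i]]_2 := \col_k if k == 0 then x else y.

Lemma col2E x y : col2 x y 0 0 = x /\ col2 x y 1 0 = y.
Proof. by split; rewrite mxE. Qed.

Lemma col2_neq0 x y : (x != 0) || (y != 0) -> col2 x y != 0.
Proof.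
move=> xy; apply/eqP => /matrixP H; have := H 0 0; have := H 1 0; rewrite !mxE /= => y0 x0.
by move: xy; rewrite x0 y0 eqxx.
Qed.

Lemma conjc_fixed (z : R[i]) : conjc z = z -> z = (complex.Re z)%:C.
Proof.
by case: z => a b [] /eqP; rewrite eq_sym -addr_eq0 -mulr2n mulrn_eq0 /= => /eqP ->.
Qed.

(** A Hermitian metric on a plane: the first vector of the frame, and its
   orthogonal projection, are real parameters. *)
Lemma hermitian_posdefE (G : 'M[R[i]]_2) : hermitian_posdef G ->
  [/\ 0 < complex.Re (G 0 0), G 0 0 = (complex.Re (G 0 0))%:C, G 1 1 = (complex.Re (G 1 1))%:C,
      G 1 0 = conjc (G 0 1) &
      sqmod (G 0 1 : C) < complex.Re (G 0 0) * complex.Re (G 1 1)].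
Proof.
move=> [hG pG].
have e k l : conjc (G l k) = G k l by rewrite -{2}hG !mxE.
have r0 := conjc_fixed (e 0 0); have r1 := conjc_fixed (e 1 1).
have G10 : G 1 0 = conjc (G 0 1) by rewrite -e.
have a0 : 0 < complex.Re (G 0 0).
  have n0 : col2 1 0 != 0 by apply: col2_neq0; rewrite oner_eq0.
  have := pG _ n0; rewrite [G in hform G _]mx2E hform_mx2 (col2E 1 0).1 (col2E 1 0).2.
  rewrite conjc1 conjc0 !mulr0 mul0r !addr0 mul1r mulr1.
  by rewrite r0 ltcR.
split => //.
have n0 : col2 (- G 0 1) (G 0 0) != 0.
  by apply: col2_neq0; rewrite r0 orbC (_ : _ != 0)// -(rmorph0 (real_complex R)) (inj_eq (@complexI R)) gt_eqF.
have := pG _ n0; rewrite [G in hform G _]mx2E hform_mx2 (col2E _ _).1 (col2E _ _).2.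
rewrite G10 r0 r1; case: (G 0 1) => u v; set al := complex.Re _ in a0 *; set de := complex.Re _.
rewrite (_ : _ + _ = (al * (al * de - sqmod (u +i* v : C)))%:C).
  by rewrite ltcR pmulr_rgt0// subr_gt0.
by apply/eqP; rewrite eq_complex /sqmod /=; apply/andP; split; apply/eqP; ring.
Qed.

End Matrices.

Section Conjugation.
Variable R : realType.
Local Notation C := (cplx R).
Implicit Types z w : C.

Lemma cjD z w : conjc (z + w) = conjc z + conjc w :> C. Proof. exact: rmorphD. Qed.
Lemma cjN z : conjc (- z) = - conjc z :> C. Proof. exact: rmorphN. Qed.
Lemma cjM z w : conjc (z * w) = conjc z * conjc w :> C. Proof. exact: rmorphM. Qed.
Lemma cjV z : conjc z^-1 = (conjc z)^-1 :> C. Proof. exact: fmorphV. Qed.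
Lemma cjX z n : conjc (z ^+ n) = (conjc z) ^+ n :> C. Proof. exact: rmorphXn. Qed.
Lemma cj_nat n : conjc (n%:R : C) = n%:R :> C. Proof. exact: rmorph_nat. Qed.
Definition cjE := (cjD, cjN, cjM, cjV, cjX, cj_nat).

End Conjugation.

Section HermitianEinsteinLocal.
Variable R : realType.
Local Notation C := (cplx R).
Variables (U : set C) (G : C -> 'M[R[i]]_2) (a : C -> C).
Hypothesis oU : open U.
Hypothesis pG : forall z, U z -> hermitian_posdef (G z).
Hypothesis sG : forall k l, csmooth_on U (fun z => G z k l).
Hypothesis eqG : forall z, U z ->
  let phi := mx2 0 (a z) 2^-1 0 in
  chern_curvature G z + (phi *m hadjoint (G z) phi - hadjoint (G z) phi *m phi) = 0.

Definition he_tau (w : C) : C := G w 0 1 / G w 0 0.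
Definition he_rho (w : C) : C := (G w 0 0 * G w 1 1 - G w 0 1 * G w 1 0) / G w 0 0 ^+ 2.
Let A (w : C) : C := G w 0 0.
Let tau := he_tau.
Let rho := he_rho.
Let sig (w : C) : C := conjc (tau w).

Lemma rho_gt0 z : U z -> exists2 r : R, 0 < r & rho z = r%:C.
Proof.
move=> /pG/hermitian_posdefE[a0 E0 E1 E2 D].
exists ((complex.Re (G z 0 0) * complex.Re (G z 1 1) - sqmod (G z 0 1 : C)) / complex.Re (G z 0 0) ^+ 2).
  by rewrite divr_gt0 ?subr_gt0// exprn_gt0.
rewrite /rho /he_rho E2 E0 E1 fmorph_div rmorphXn rmorphB rmorphM /=; congr ((_ - _) / _).
by case: (G z 0 1) => u v; apply/eqP; rewrite eq_complex /sqmod /=; apply/andP; split; apply/eqP; ring.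
Qed.

Lemma A_gt0 z : U z -> exists2 r : R, 0 < r & A z = r%:C.
Proof. by move=> /pG/hermitian_posdefE[a0 E0 _ _ _]; exists (complex.Re (G z 0 0)). Qed.

Let real_neq0 (r : R) : 0 < r -> (r%:C : C) != 0.
Proof. by move=> r0; rewrite -(rmorph0 (real_complex R)) (inj_eq (@complexI R)) gt_eqF. Qed.

Lemma A_neq0 z : U z -> A z != 0.
Proof. by move=> /A_gt0[r r0 ->]; exact: real_neq0. Qed.

Lemma rho_neq0 z : U z -> rho z != 0.
Proof. by move=> /rho_gt0[r r0 ->]; exact: real_neq0. Qed.

Lemma gram_tau_rho z : U z ->
  G z = mx2 (A z) (A z * tau z) (A z * sig z) (A z * (tau z * sig z + rho z)).
Proof.
move=> Uz; have A0 := A_neq0 Uz; have [_ E0 E1 E2 _] := hermitian_posdefE (pG Uz).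
have sE : sig z = G z 1 0 / A z.
  by rewrite /sig /tau /he_tau fmorph_div /= E2 /A E0 conjc_real.
rewrite [LHS]mx2E; congr mx2; rewrite ?sE /rho /he_rho /tau /he_tau -/(A z); field; exact: A0.
Qed.

Lemma csmooth_A : csmooth_on U A. Proof. exact: sG. Qed.

Lemma csmooth_tau : csmooth_on U tau.
Proof. by apply: (csmoothM oU (sG 0 1)); apply: (csmoothV oU csmooth_A); exact: A_neq0. Qed.

Lemma csmooth_sig : csmooth_on U sig.
Proof. exact: (csmooth_conj oU csmooth_tau). Qed.

Lemma csmooth_rho : csmooth_on U rho.
Proof.
have := csmoothM oU (csmoothB oU (csmoothM oU (sG 0 0) (sG 1 1)) (csmoothM oU (sG 0 1) (sG 1 0)))
  (csmoothV oU (csmoothM oU csmooth_A csmooth_A) _).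
by apply => z Uz; rewrite mulf_neq0// A_neq0.
Qed.

Let dA z Uz := csmooth_wder csmooth_A Uz : wder A z _ _.
Let dtau z Uz := csmooth_wder csmooth_tau Uz : wder tau z _ _.
Let drho z Uz := csmooth_wder csmooth_rho Uz : wder rho z _ _.
Let dsig z (Uz : U z) : wder sig z (conjc (d_zbar tau z)) (conjc (d_z tau z)).
Proof. exact: wder_conj (dtau Uz). Qed.

Lemma rho_bar z : U z -> d_zbar rho z = conjc (d_z rho z).
Proof.
move=> Uz; apply: (real_wder oU Uz _ (drho Uz)) => w /rho_gt0[r _ ->].
by rewrite conjc_real.
Qed.

Let N z : 'M[R[i]]_2 := invmx (G z) *m d_zM G z.
Let n10 z : C := conjc (d_zbar tau z) / rho z.
Let n01 z : C := d_z tau z - tau z ^+ 2 * n10 z - tau z * d_z rho z / rho z.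
Let n00 z : C := d_z A z / A z - tau z * n10 z.
Let n11 z : C := tau z * n10 z + d_z A z / A z + d_z rho z / rho z.

Lemma chern_connection z : U z -> N z = mx2 (n00 z) (n01 z) (n10 z) (n11 z).
Proof.
move=> Uz; have A0 := A_neq0 Uz; have r0 := rho_neq0 Uz.
have gE := gram_tau_rho.
apply: invmx_mul.
  rewrite gE//; apply: mx2_unit.
  rewrite (_ : _ - _ = A z * A z * rho z); last by ring.
  exact: (mulf_neq0 (mulf_neq0 A0 A0) r0).
have E k l (f : C -> C) p q : (forall w, U w -> G w k l = f w) -> wder f z p q ->
    d_zM G z k l = p.
  by move=> e df; rewrite mxE (eq_d_z oU Uz e) (wder_dz df).
have e00 := E 0 0 A _ _ (fun w _ => erefl) (dA Uz).
have e01 := E 0 1 (fun w => A w * tau w) _ _ _ (wderM (dA Uz) (dtau Uz)).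
have e10 := E 1 0 (fun w => A w * sig w) _ _ _ (wderM (dA Uz) (dsig Uz)).
have e11 := E 1 1 (fun w => A w * (tau w * sig w + rho w)) _ _ _
  (wderM (dA Uz) (wderD (wderM (dtau Uz) (dsig Uz)) (drho Uz))).
rewrite [RHS]mx2E e00 e01 ?e10 ?e11; first last.
- by move=> w Uw; rewrite gE//; case: (mx2_entries (A w) (A w * tau w) (A w * sig w) (A w * (tau w * sig w + rho w))).
- by move=> w Uw; rewrite gE//; case: (mx2_entries (A w) (A w * tau w) (A w * sig w) (A w * (tau w * sig w + rho w))).
- by move=> w Uw; rewrite gE//; case: (mx2_entries (A w) (A w * tau w) (A w * sig w) (A w * (tau w * sig w + rho w))).
rewrite gE// mulmx_mx2 /n00 /n01 /n11 /n10.
by congr mx2; field; rewrite A0 r0.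
Qed.

Let gam z := tau z * sig z + rho z.
Let s00 z : C := (gam z * sig z / 2 - tau z * conjc (a z)) / rho z.
Let s01 z : C := (gam z ^+ 2 / 2 - tau z ^+ 2 * conjc (a z)) / rho z.
Let s10 z : C := (conjc (a z) - sig z ^+ 2 / 2) / rho z.
Let s11 z : C := (conjc (a z) * tau z - sig z * gam z / 2) / rho z.

Lemma hadjointE z : U z ->
  hadjoint (G z) (mx2 0 (a z) 2^-1 0) = mx2 (s00 z) (s01 z) (s10 z) (s11 z).
Proof.
move=> Uz; have A0 := A_neq0 Uz; have r0 := rho_neq0 Uz.
rewrite /hadjoint -mulmxA; apply: invmx_mul.
  rewrite gram_tau_rho//; apply: mx2_unit.
  rewrite (_ : _ - _ = A z * A z * rho z); last by ring.
  exact: (mulf_neq0 (mulf_neq0 A0 A0) r0).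
rewrite (_ : (mx2 0 (a z) 2^-1 0 ^t*)%sesqui = mx2 0 2^-1 (conjc (a z)) 0); last first.
  have c2 : conjc (2^-1 : R[i]) = 2^-1 by rewrite fmorphV rmorph_nat.
  have := conj_mx2 0 (a z) 2^-1 0; rewrite conjc0 c2 => <-.
  by apply/matrixP => k l; rewrite !mxE.
rewrite gram_tau_rho// !mulmx_mx2 /s00 /s01 /s10 /s11 /gam.
by congr mx2; field; rewrite r0.
Qed.

Lemma chern_entries z k l : U z ->
  d_zbar (fun w => N w k l) z =
  mx2 (a z * s10 z - s01 z / 2) (a z * (s11 z - s00 z)) ((s00 z - s11 z) / 2)
      (s01 z / 2 - a z * s10 z) k l.
Proof.
move=> Uz; have := eqG Uz; rewrite /= hadjointE// !mulmx_mx2 /chern_curvature -/N => /eqP.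
rewrite addrC addr_eq0 opprK => /eqP/matrixP/(_ k l); rewrite [in RHS]mxE => <-.
by rewrite !mxE; case: (ord2 k) => ->; case: (ord2 l) => -> /=; field.
Qed.

Lemma N_entry z k l : U z -> N z k l = mx2 (n00 z) (n01 z) (n10 z) (n11 z) k l.
Proof. by move=> Uz; rewrite chern_connection. Qed.

Lemma csmooth_n10 : csmooth_on U n10.
Proof.
by apply: (csmoothM oU (csmooth_conj oU (csmooth_d_zbar oU csmooth_tau)));
   apply: (csmoothV oU csmooth_rho); exact: rho_neq0.
Qed.

Lemma csmooth_logrho : csmooth_on U (fun z => d_z rho z / rho z).
Proof.
by apply: (csmoothM oU (csmooth_d_z oU csmooth_rho)); apply: (csmoothV oU csmooth_rho); exact: rho_neq0.
Qed.

Lemma csmooth_n01 : csmooth_on U n01.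
Proof.
apply: (eq_csmooth (f := fun z => d_z tau z - tau z * tau z * n10 z - tau z * (d_z rho z / rho z)) oU).
  by move=> z _; rewrite /n01 expr2 mulrA.
apply: (csmoothB oU) => //; last exact: (csmoothM oU csmooth_tau csmooth_logrho).
apply: (csmoothB oU); first exact: (csmooth_d_z oU csmooth_tau).
exact: (csmoothM oU (csmoothM oU csmooth_tau csmooth_tau) csmooth_n10).
Qed.

Lemma n10_bar z : U z -> d_zbar n10 z = (s00 z - s11 z) / 2.
Proof.
move=> Uz; rewrite (eq_d_zbar oU Uz (g := fun w => N w 1 0)); first by rewrite chern_entries// mxE.
by move=> w Uw; rewrite N_entry// mxE.
Qed.

Lemma n01_bar z : U z -> d_zbar n01 z = a z * (s11 z - s00 z).
Proof.
move=> Uz; rewrite (eq_d_zbar oU Uz (g := fun w => N w 0 1)); first by rewrite chern_entries// mxE.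
by move=> w Uw; rewrite N_entry// mxE.
Qed.

(** The squared hyperbolic sine of the distance, in the space of Hermitian
   forms, from the metric to the geodesic of diagonal metrics. *)
Definition he_defect (w : C) : C := he_tau w * conjc (he_tau w) / he_rho w.

Lemma csmooth_defect : csmooth_on U he_defect.
Proof.
apply: (csmoothM oU (csmoothM oU csmooth_tau csmooth_sig)).
by apply: (csmoothV oU csmooth_rho); exact: rho_neq0.
Qed.

(** The last square comes from the bracket of the Higgs field with its adjoint,
   the others from the derivatives of the metric. *)
Lemma defect_laplacian z : U z ->
  let t := d_z tau z in let u := d_zbar tau z in let r := d_z rho z in
  let k := t - tau z * r / rho z in
  let m := 2 * a z * sig z - tau z * (tau z * sig z + rho z) in
  d_zbar (d_z he_defect) z =
   k * conjc k / rho z + u * conjc u / rho z +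
   2 * (tau z * sig z) * (u * conjc u) / rho z ^+ 2 + m * conjc m / (2 * rho z ^+ 2).
Proof.
move=> Uz; cbv zeta.
have E w : U w -> (sig w / rho w) * n01 w + (tau w * tau w * (sig w / rho w) + tau w) * n10 w = d_z he_defect w.
  move=> Uw; have r0 := rho_neq0 Uw.
  rewrite (wder_dz (wderM (wderM (dtau Uw) (dsig Uw)) (wderV r0 (drho Uw)))) /n01 /n10.
  by field.
rewrite -(eq_d_zbar oU Uz E).
have r0 := rho_neq0 Uz.
have dn01 := csmooth_wder csmooth_n01 Uz; rewrite n01_bar// in dn01.
have dn10 := csmooth_wder csmooth_n10 Uz; rewrite n10_bar// in dn10.
have dsr := wderM (dsig Uz) (wderV r0 (drho Uz)).
rewrite (wder_dzbar (wderD (wderM dsr dn01) (wderM (wderD (wderM (wderM (dtau Uz) (dtau Uz)) dsr) (dtau Uz)) dn10))).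
rewrite rho_bar// /s00 /s11 /n01 /n10 /gam.
have rr : conjc (rho z) = rho z by have [r _ ->] := rho_gt0 Uz; rewrite conjc_real.
rewrite /sig; move: (d_z tau z) (d_zbar tau z) (d_z rho z) (tau z) (rho z) (a z) rr r0.
move=> t u r T P w rr P0.
by rewrite !cjE rr !conjcK; field.
Qed.

End HermitianEinsteinLocal.

(** * The scalar equation *)
Section Laplacian.
Variable R : realType.
Local Notation C := (cplx R).

Definition lap (f : C -> R) (z : C) : R := partial 0 (partial 0 f) z + partial 1 (partial 1 f) z.

Lemma lap_dzbar (U : set C) (F : C -> C) (f : C -> R) z : open U -> smooth_on U f ->
  (forall w, U w -> F w = (f w)%:C) -> U z ->
  complex.Re (d_zbar (d_z F) z) = lap f z / 4.
Proof.
move=> oU sf Ff Uz.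
have sF : csmooth_on U F.
  by apply: (eq_csmooth oU _ (csmooth_real oU sf)) => w /Ff.
have h2 : (2^-1 : C) = (2^-1 : R)%:C by rewrite fmorphV rmorph_nat.
have dzF w : U w -> d_z F w = (2^-1 * partial 0 f w) +i* (- (2^-1 * partial 1 f w)).
  move=> Uw; rewrite (eq_d_z oU Uw Ff) /d_z /cpartial /= h2.
  rewrite (derdirP (derdir_cst 0 w 0)) (derdirP (derdir_cst 1 w 0)).
  by apply/eqP; rewrite eq_complex /=; apply/andP; split; apply/eqP; ring.
rewrite (eq_d_zbar oU Uz dzF).
have d k l : derdir (fun w => 2^-1 * partial l f w) k z (2^-1 * partial k (partial l f) z).
  have := derdirM (derdir_cst k z 2^-1) (smooth_on_derdir k (smooth_on_partial l sf) Uz).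
  by rewrite mulr0 addr0.
have c k : cpartial k (fun w => (2^-1 * partial 0 f w) +i* (- (2^-1 * partial 1 f w)) : C) z =
    (2^-1 * partial k (partial 0 f) z) +i* (- (2^-1 * partial k (partial 1 f) z)).
  by apply: cdirP; split; [exact: d|apply: derdirN; exact: d].
rewrite /d_zbar !c h2 /lap.
move: (partial 0 (partial 0 f) z) (partial 0 (partial 1 f) z) (partial 1 (partial 0 f) z)
  (partial 1 (partial 1 f) z) => p q r s {d c dzF}.
by rewrite /=; field.
Qed.

Lemma eq_lap (U : set C) (f g : C -> R) z : open U -> U z -> (forall w, U w -> f w = g w) ->
  lap f z = lap g z.
Proof.
move=> oU Uz fg; have E k w : U w -> partial k f w = partial k g w.
  by move=> Uw; apply: (near_partial k); exact: filterS fg (open_near oU Uw).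
have n k : \forall w \near z, partial k f w = partial k g w.
  exact: filterS (E k) (open_near oU Uz).
by rewrite /lap (near_partial 0 (n 0)) (near_partial 1 (n 1)).
Qed.

End Laplacian.

Section Toda.
Variable R : realType.
Local Notation C := (cplx R).
Implicit Types (a : C -> C) (g : C -> R) (U : set C).

(** The equation satisfied by the induced conformal metric [g |dz|^2]; for
   [a = 0] it says that this metric has curvature -1. *)
Definition toda U a g :=
  [/\ smooth_on U g, forall z, U z -> 0 < g z &
      forall z, U z -> d_zbar (fun w => d_z (fun v => (g v)%:C) w / (g w)%:C) z =
        (g z)%:C / 2 - 2 * a z * conjc (a z) / (g z)%:C].

Lemma real_complexM (x y : R) : (x * y)%:C = x%:C * y%:C :> C.
Proof. exact: rmorphM. Qed.

Lemma real_complexD (x y : R) : (x + y)%:C = x%:C + y%:C :> C.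
Proof. exact: rmorphD. Qed.

Lemma real_complexB (x y : R) : (x - y)%:C = x%:C - y%:C :> C.
Proof. exact: rmorphB. Qed.

Lemma real_complexV (x : R) : (x^-1)%:C = (x%:C)^-1 :> C.
Proof. exact: fmorphV. Qed.

Lemma real_complexX (x : R) n : (x ^+ n)%:C = x%:C ^+ n :> C.
Proof. exact: rmorphXn. Qed.

Lemma real_complex_neq0 (r : R) : r != 0 -> (r%:C : C) != 0.
Proof. by move=> r0; rewrite -(rmorph0 (real_complex R)) (inj_eq (@complexI R)). Qed.

(** A holomorphic change of coordinates adds a harmonic function to [log g]. *)
Lemma toda_comp U V a g phi : open U -> open V -> toda V a g ->
  holomorphic_on U phi -> (forall z, U z -> V (phi z)) ->
  (forall z, U z -> derive1 phi z != 0) ->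
  toda U (fun z => a (phi z) * derive1 phi z ^+ 2) (fun z => g (phi z) * sqmod (derive1 phi z)).
Proof.
move=> oU oV [sg g0 eqg] hp pV dp0.
have hp' := holomorphic_derive1 oU hp; have hp'' := holomorphic_derive1 oU hp'.
have cG := csmooth_real oV sg.
have cphi := csmooth_comp oU oV cG hp pV.
have sq (w : C) : (sqmod w)%:C = w * conjc w.
  by case: w => u v; apply/eqP; rewrite eq_complex /sqmod /=; apply/andP; split; apply/eqP; ring.
split.
- have c' := csmooth_holomorphic oU hp'.
  have [] : csmooth_on U (fun z => (g (phi z))%:C * (derive1 phi z * conjc (derive1 phi z))).
    exact: (csmoothM oU cphi (csmoothM oU c' (csmooth_conj oU c'))).
  by move=> sR _; apply: (eq_smooth_on oU _ sR) => z _; rewrite -sq -real_complexM.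
- move=> z Uz; rewrite mulr_gt0 ?g0//; first exact: pV.
  by rewrite -modulus_sqr exprn_gt0// modulus_gt0 dp0.
move=> z Uz.
pose h v : R := g (phi v) * sqmod (derive1 phi v).
change (d_zbar (fun w => d_z (fun v => (h v)%:C) w / (h w)%:C) z = (h z)%:C / 2 -
  2 * (a (phi z) * derive1 phi z ^+ 2) * conjc (a (phi z) * derive1 phi z ^+ 2) / (h z)%:C).
pose L v : C := d_z (fun v => (g v)%:C) v / (g v)%:C.
have gn0 w : V w -> (g w)%:C != 0 :> C by move=> /g0 gw; rewrite real_complex_neq0// gt_eqF.
have cL : csmooth_on V L.
  by apply: (csmoothM oV (csmooth_d_z oV cG)); apply: (csmoothV oV cG).
have E w : U w -> (L \o phi) w * derive1 phi w + derive1 (derive1 phi) w / derive1 phi w =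
    d_z (fun v => (h v)%:C) w / (h w)%:C.
  move=> Uw.
  have hE : forall v, U v -> (g (phi v))%:C * (derive1 phi v * conjc (derive1 phi v)) = (h v)%:C.
    by move=> v Uv; rewrite /h real_complexM sq.
  have d1 := wder_comp oV cG (pV w Uw) (csmooth_wder cG (pV w Uw)) (holomorphic_cder hp Uw).
  have d2 := cder_wder (holomorphic_cder hp' Uw).
  rewrite -(eq_d_z oU Uw hE) (wder_dz (wderM d1 (wderM d2 (wder_conj d2)))) -hE// !compE /L conjc0.
  have := gn0 _ (pV w Uw); have := dp0 w Uw.
  have : conjc (derive1 phi w) != 0 :> C by rewrite conjc_eq0 dp0.
  set q := derive1 (derive1 phi) w; set p := derive1 phi w; set c := conjc p.
  set r := (g (phi w))%:C; set e := d_z _ _ => c0 p0 r0.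
  clearbody q c p r e; by field; rewrite c0 p0 r0.
rewrite -(eq_d_zbar oU Uz E).
have d1 := wder_comp oV cL (pV z Uz) (csmooth_wder cL (pV z Uz)) (holomorphic_cder hp Uz).
have d2 := cder_wder (holomorphic_cder hp' Uz).
have d3 := cder_wder (holomorphic_cder hp'' Uz).
rewrite (wder_dzbar (wderD (wderM d1 d2) (wderM d3 (wderV (dp0 z Uz) d2)))).
have -> : d_zbar L (phi z) = (g (phi z))%:C / 2 - 2 * a (phi z) * conjc (a (phi z)) / (g (phi z))%:C.
  exact: eqg (pV z Uz).
rewrite /h real_complexM sq !cjE.
have := gn0 _ (pV z Uz); have := dp0 z Uz.
have : conjc (derive1 phi z) != 0 :> C by rewrite conjc_eq0 dp0.
set q := derive1 (derive1 phi) z; set p := derive1 phi z; set c := conjc p.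
set r := (g (phi z))%:C; set x := a (phi z); set y := conjc x => c0 p0 r0.
clearbody q c p r y x; by field; rewrite c0 p0 r0.
Qed.

Lemma toda_lap U a g z : open U -> toda U a g -> U z ->
  g z * lap g z - (partial 0 g z ^+ 2 + partial 1 g z ^+ 2) =
  2 * g z ^+ 3 - 8 * sqmod (a z) * g z.
Proof.
move=> oU [sg g0 eqg] Uz; have cG := csmooth_real oU sg.
have gn0 w : U w -> (g w)%:C != 0 :> C by move=> /g0 gw; rewrite real_complex_neq0// gt_eqF.
have d1 := csmooth_wder cG Uz; have d2 := csmooth_wder (csmooth_d_z oU cG) Uz.
have := eqg z Uz; rewrite (wder_dzbar (wderM d2 (wderV (gn0 z Uz) d1))) => E.
have {E} E : (g z)%:C * d_zbar (d_z (fun w => (g w)%:C)) z - d_z (fun w => (g w)%:C) z * d_zbar (fun w => (g w)%:C) z =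
   (g z)%:C ^+ 3 / 2 - 2 * a z * conjc (a z) * (g z)%:C.
  have := congr1 (fun x => x * (g z)%:C ^+ 2) E => /= {}E.
  rewrite [in RHS](_ : _ - _ = ((g z)%:C / 2 - 2 * a z * conjc (a z) / (g z)%:C) * (g z)%:C ^+ 2); last first.
    by field; exact: gn0.
  by rewrite -E; field; exact: gn0.
have := congr1 (@complex.Re R) E.
have -> : (g z)%:C ^+ 3 / 2 - 2 * a z * conjc (a z) * (g z)%:C = (g z ^+ 3 / 2 - 2 * sqmod (a z) * g z)%:C.
  have h2 : (2 : C) = (2 : R)%:C by rewrite rmorph_nat.
  rewrite h2 -fmorphV; case: (a z) => u v; apply/eqP; rewrite eq_complex /sqmod /=.
  by apply/andP; split; apply/eqP; ring.
have -> : d_z (fun w => (g w)%:C) z * d_zbar (fun w => (g w)%:C) z =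
    ((partial 0 g z ^+ 2 + partial 1 g z ^+ 2) / 4)%:C.
  have c k : cpartial k (fun w => (g w)%:C) z = (partial k g z)%:C.
    by apply: cdirP; split; [exact: smooth_on_derdir sg Uz|exact: derdir_cst].
  have h2 : (2 : C) = (2 : R)%:C by rewrite rmorph_nat.
  rewrite /d_z /d_zbar !c h2 -fmorphV; move: (partial 0 g z) (partial 1 g z) => u v.
  by apply/eqP; rewrite eq_complex /=; apply/andP; split; apply/eqP; field.
move: (lap_dzbar oU sg (fun w _ => erefl) Uz).
move: (d_zbar _ _) (lap g z) (partial 0 g z) (partial 1 g z) => [W1 W2] l gx gy /= ->.
rewrite mul0r subr0 => /eqP; rewrite -subr_eq0 => /eqP H; apply/eqP; rewrite -subr_eq0; apply/eqP.
have := congr1 (fun x => 4 * x) H; rewrite mulr0 => <-; by field.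
Qed.

Lemma sqmodC (w : C) : (sqmod w)%:C = w * conjc w :> C.
Proof.
by case: w => u v; apply/eqP; rewrite eq_complex /sqmod /=; apply/andP; split; apply/eqP; ring.
Qed.

(** At the value 1 the form [|2 a dz + g dzbar|^2 / g] degenerates. *)
Definition toda_ratio a g (z : C) : R := 4 * sqmod (a z) / g z ^+ 2.

Lemma smooth_sqmod U a : open U -> csmooth_on U a -> smooth_on U (fun z => sqmod (a z)).
Proof.
move=> oU sa; have [s1 s2] := csmoothM oU sa (csmooth_conj oU sa).
by apply: (eq_smooth_on oU _ s1) => z _; rewrite -sqmodC.
Qed.

Lemma smooth_ratio U a g : open U -> holomorphic_on U a -> toda U a g ->
  smooth_on U (toda_ratio a g).
Proof.
move=> oU ha [sg g0 _]; apply: (smoothM oU).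
  apply: (smoothZ oU); apply: (smooth_sqmod oU); exact: csmooth_holomorphic.
apply: (smoothV oU); first by have := smoothM oU sg sg; apply: (eq_smooth_on oU) => z _; rewrite expr2.
by move=> z Uz; rewrite expf_neq0// gt_eqF// g0.
Qed.

(** Away from the zeros of [a] the logarithm of the ratio [s] has the Laplacian
   [4 g (s - 1)], and [Lap s >= s Lap (log s)]; written for [s], the inequality
   extends to the zeros. *)
Lemma ratio_lap U a g z : open U -> holomorphic_on U a -> toda U a g -> U z ->
  4 * g z * (toda_ratio a g z * (toda_ratio a g z - 1)) <= lap (toda_ratio a g) z.
Proof.
move=> oU ha tg Uz; have [sg g0 eqg] := tg; have cG := csmooth_real oU sg.
have ha' := holomorphic_derive1 oU ha.
pose G w : C := (g w)%:C.
have gn0 w : U w -> G w != 0 by move=> /g0 gw; rewrite real_complex_neq0// gt_eqF.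
pose L w : C := d_z G w / G w.
have cL : csmooth_on U L.
  by apply: (csmoothM oU (csmooth_d_z oU cG)); apply: (csmoothV oU cG).
have dL := csmooth_wder cL Uz.
have LE : d_zbar L z = G z / 2 - 2 * a z * conjc (a z) / G z by exact: eqg.
rewrite LE in dL.
have h4 : (4 : C) = (4 : R)%:C by rewrite rmorph_nat.
have SE w : U w -> (toda_ratio a g w)%:C = 4 * (a w * conjc (a w)) * (G w * G w)^-1.
  move=> Uw; rewrite /toda_ratio /G h4 -sqmodC -!real_complexM expr2.
  by rewrite -[((g w * g w)%:C)^-1](fmorphV (real_complex R)) -real_complexM.
have dG w (Uw : U w) : wder G w _ _ := csmooth_wder cG Uw.
have da w (Uw : U w) := cder_wder (holomorphic_cder ha Uw).
have SzE w : U w -> 4 * conjc (a w) * (G w * G w)^-1 * (derive1 a w - 2 * a w * L w) =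
    d_z (fun v => (toda_ratio a g v)%:C) w.
  move=> Uw; have n0 := gn0 w Uw; have n1 := mulf_neq0 n0 n0.
  rewrite (eq_d_z oU Uw SE) (wder_dz (wderM (wderZ 4 (wderM (da w Uw) (wder_conj (da w Uw))))
    (@wderV R (fun v => G v * G v) w _ _ n1 (wderM (dG w Uw) (dG w Uw))))) conjc0 /L.
  set c := conjc (a w); set e := d_z G w; clearbody c e; by field.
have n0 := gn0 z Uz; have n1 := mulf_neq0 n0 n0.
have Gr : d_zbar G z = conjc (d_z G z).
  by apply: (real_wder oU Uz _ (dG z Uz)) => w _; rewrite /G conjc_real.
have key : d_zbar (d_z (fun v => (toda_ratio a g v)%:C)) z =
   ((g z * (toda_ratio a g z * (toda_ratio a g z - 1)))%:C +
    4 * (derive1 a z - 2 * a z * L z) * conjc (derive1 a z - 2 * a z * L z) / (G z * G z)).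
  have -> : (g z * (toda_ratio a g z * (toda_ratio a g z - 1)))%:C =
     G z * (4 * (a z * conjc (a z)) * (G z * G z)^-1 * (4 * (a z * conjc (a z)) * (G z * G z)^-1 - 1)).
    rewrite 2!real_complexM -SE// /G; congr (_ * (_ * _)).
    by rewrite (rmorphB (real_complex R)) rmorph1.
  rewrite -(eq_d_zbar oU Uz SzE).
  have d1 := cder_wder (holomorphic_cder ha' Uz).
  rewrite (wder_dzbar (wderM (wderM (wderZ 4 (wder_conj (da z Uz))) (@wderV R (fun v => G v * G v) z _ _ n1 (wderM (dG z Uz) (dG z Uz))))
    (wderB d1 (wderM (wderZ 2 (da z Uz)) dL)))) Gr /L.
  have Gc : conjc (G z) = G z by rewrite /G conjc_real.
  rewrite !cjE Gc.
  set c := conjc (a z); set e := d_z G z; set e' := conjc e; set d := derive1 a z; set d' := conjc d.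
  clearbody e' d' c e d; by field.
have sr := smooth_ratio oU ha tg.
have := lap_dzbar oU sr (fun w _ => erefl) Uz; rewrite key.
rewrite (_ : 4 * _ * _ / _ = (4 * sqmod (derive1 a z - 2 * a z * L z) / (g z * g z))%:C); last first.
  have iv : (((g z * g z)^-1)%:C : C) = (G z * G z)^-1.
    by rewrite /G -real_complexM; exact: fmorphV.
  by rewrite 2!real_complexM iv sqmodC h4 !mulrA.
move=> H; have : complex.Re ((g z * (toda_ratio a g z * (toda_ratio a g z - 1)))%:C +
   (4 * sqmod (derive1 a z - 2 * a z * L z) / (g z * g z))%:C) =
   g z * (toda_ratio a g z * (toda_ratio a g z - 1)) + 4 * sqmod (derive1 a z - 2 * a z * L z) / (g z * g z).
  by [].
rewrite H => H2.
have : 0 <= 4 * sqmod (derive1 a z - 2 * a z * L z) / (g z * g z).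
  apply: divr_ge0; last by rewrite -expr2 sqr_ge0.
  by apply: mulr_ge0 => //; rewrite -modulus_sqr sqr_ge0.
lra.
Qed.

End Toda.

Section HermitianEinsteinConsequences.
Variable R : realType.
Local Notation C := (cplx R).
Variables (U : set C) (G : C -> 'M[R[i]]_2) (a : C -> C).
Hypothesis oU : open U.
Hypothesis pG : forall z, U z -> hermitian_posdef (G z).
Hypothesis sG : forall k l, csmooth_on U (fun z => G z k l).
Hypothesis eqG : forall z, U z ->
  let phi := mx2 0 (a z) 2^-1 0 in
  chern_curvature G z + (phi *m hadjoint (G z) phi - hadjoint (G z) phi *m phi) = 0.

Lemma mx2_00 (x y z t : R[i]) : mx2 x y z t 0 0 = x. Proof. by rewrite mxE. Qed.
Lemma mx2_11 (x y z t : R[i]) : mx2 x y z t 1 1 = t. Proof. by rewrite mxE. Qed.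

Lemma sqmod_ge0 (z : C) : 0 <= sqmod z.
Proof. by rewrite -modulus_sqr sqr_ge0. Qed.

Lemma sqmod_eq0 (z : C) : (sqmod z == 0) = (z == 0).
Proof. by rewrite -modulus_sqr sqrf_eq0 modulus_eq0. Qed.

Lemma sqmodM (z w : C) : sqmod (z * w) = sqmod z * sqmod w.
Proof. by rewrite -!modulus_sqr modulusM exprMn. Qed.

(** [tr (H^-1 H')/2 - 1], up to a factor 2, for the metric [H'] obtained from
   [H] by changing the sign of the second vector of the frame. *)
Definition defect (M : 'M[R[i]]_2) : R :=
  sqmod (M 0 1 : C) / (complex.Re (M 0 0) * complex.Re (M 1 1) - sqmod (M 0 1 : C)).

Lemma defectE z : U z -> he_defect G z = (defect (G z))%:C.
Proof.
move=> Uz; have [A0 E0 E1 E2 D] := hermitian_posdefE (pG Uz).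
rewrite /he_defect /he_tau /he_rho /defect E2.
have -> : G z 0 0 = (complex.Re (G z 0 0))%:C :> C by [].
have -> : G z 1 1 = (complex.Re (G z 1 1))%:C :> C by [].
move: A0 D; set A := complex.Re (G z 0 0); set B := G z 0 1; set c := complex.Re (G z 1 1) => A0 D.
have An0 : A%:C != 0 :> C by rewrite real_complex_neq0// gt_eqF.
have Dn0 : (A * c - sqmod (B : C)) != 0 by rewrite gt_eqF// subr_gt0.
have D' : A%:C * c%:C - (B : C) * conjc B = (A * c - sqmod (B : C))%:C.
  by rewrite -sqmodC -real_complexM -real_complexB.
have Dn0' : A%:C * c%:C - (B : C) * conjc B != 0 by rewrite D' real_complex_neq0.
rewrite real_complexM real_complexV -D' sqmodC.
rewrite cjM cjV conjc_real.
by field; rewrite An0 Dn0'.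
Qed.

Lemma smooth_defect : smooth_on U (fun z => defect (G z)).
Proof.
have [s1 _] := csmooth_defect oU pG sG.
by apply: (eq_smooth_on oU _ s1) => z Uz; rewrite defectE.
Qed.

(** The Laplacian is a sum of squares; if it vanishes where the metric is not
   diagonal, the square coming from the Higgs field gives [2 |a|] the value of
   the induced metric. *)
Lemma defect_lap z : U z -> 0 <= lap (fun w => defect (G w)) z /\
  (lap (fun w => defect (G w)) z = 0 -> G z 0 1 != 0 ->
   4 * sqmod (a z) * complex.Re (G z 0 0) ^+ 2 = complex.Re (G z 1 1) ^+ 2).
Proof.
move=> Uz; have := defect_laplacian oU pG sG eqG Uz; cbv zeta.
have [r r0 rE] := rho_gt0 pG Uz.
set k := d_z _ _ - _; set u := d_zbar (he_tau G) z; set m := 2 * a z * _ - _.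
have -> : he_tau G z * conjc (he_tau G z) = (sqmod (he_tau G z))%:C by rewrite sqmodC.
rewrite rE -!sqmodC => H.
have h2 : (2 : C) = (2 : R)%:C by rewrite rmorph_nat.
have {}H : d_zbar (d_z (he_defect G)) z = (sqmod k / r + sqmod u / r +
    2 * sqmod (he_tau G z) * sqmod u / r ^+ 2 + sqmod m / (2 * r ^+ 2))%:C.
  have t1 x : (x / r)%:C = x%:C / r%:C :> C by rewrite real_complexM real_complexV.
  have t3 x y : (2 * x * y / r ^+ 2)%:C = 2 * x%:C * y%:C / r%:C ^+ 2 :> C.
    by rewrite 3!real_complexM real_complexV real_complexX -h2.
  have t4 x : (x / (2 * r ^+ 2))%:C = x%:C / (2 * r%:C ^+ 2) :> C.
    by rewrite real_complexM real_complexV real_complexM real_complexX -h2.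
  by rewrite H -t3 -t4 -!t1 -!real_complexD.
have HL : sqmod k / r + sqmod u / r + 2 * sqmod (he_tau G z) * sqmod u / r ^+ 2 +
    sqmod m / (2 * r ^+ 2) = lap (fun w => defect (G w)) z / 4.
  by have := lap_dzbar oU smooth_defect defectE Uz; rewrite {}H.
have p1 : 0 <= sqmod k / r by rewrite divr_ge0 ?sqmod_ge0// ltW.
have p2 : 0 <= sqmod u / r by rewrite divr_ge0 ?sqmod_ge0// ltW.
have p3 : 0 <= 2 * sqmod (he_tau G z) * sqmod u / r ^+ 2.
  by rewrite divr_ge0 ?sqr_ge0// !mulr_ge0 ?sqmod_ge0.
have p4 : 0 <= sqmod m / (2 * r ^+ 2) by rewrite divr_ge0 ?sqmod_ge0// mulr_ge0 ?sqr_ge0.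
split; first by lra.
move=> L0; rewrite L0 in HL; have {}p4 : sqmod m / (2 * r ^+ 2) = 0 by lra.
have m0 : m = 0.
  apply/eqP; rewrite -sqmod_eq0; move/eqP: p4.
  by rewrite mulf_eq0 invr_eq0 mulf_eq0 sqrf_eq0 pnatr_eq0 /= (gt_eqF r0) orbF.
have [A0 E0 E1 E2 D] := hermitian_posdefE (pG Uz) => B0.
have An0 : G z 0 0 != 0 :> C by rewrite E0 real_complex_neq0// gt_eqF.
have t0 : he_tau G z != 0 by exact: (mulf_neq0 B0 (invr_neq0 An0)).
have := congr1 (@sqmod R) (subr0_eq m0).
rewrite [sqmod (2 * _ * _)]sqmodM [sqmod (2 * _)]sqmodM [sqmod (he_tau G z * _)]sqmodM.
have sc (w : C) : sqmod (conjc w) = sqmod w by case: w => x y; rewrite /sqmod /= sqrrN.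
rewrite sc; have s2 : sqmod (2 : C) = 4 by rewrite h2 /sqmod /= expr0n addr0 -natrX.
rewrite s2.
have -> : he_tau G z * conjc (he_tau G z) + he_rho G z = G z 1 1 / G z 0 0.
  have sE : conjc (he_tau G z) = G z 1 0 / G z 0 0 :> C.
    by rewrite /he_tau cjM cjV E2 E0 conjc_real.
  rewrite sE /he_rho /he_tau; by field.
move=> Q; have {}Q : 4 * sqmod (a z) = sqmod (G z 1 1 / G z 0 0 : C).
  have st : sqmod (he_tau G z) != 0 by rewrite sqmod_eq0.
  by apply: (mulIf st); rewrite Q; exact: mulrC.
have sqr (w : C) : w = (complex.Re w)%:C -> complex.Re w ^+ 2 = sqmod w.
  by case: w => x y [->]; rewrite /sqmod /= expr0n addr0.
rewrite (sqr _ E0) (sqr _ E1).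
by rewrite Q -sqmodM divfK.
Qed.

(** For a diagonal metric the difference of the two diagonal entries of the
   equation is the scalar equation. *)
Lemma diagonal_toda : (forall z, U z -> G z 0 1 = 0) ->
  toda U a (fun z => complex.Re (G z 1 1) / complex.Re (G z 0 0)).
Proof.
move=> B0.
have pos z : U z -> 0 < complex.Re (G z 0 0) /\ 0 < complex.Re (G z 1 1).
  move=> Uz; have [A0 E0 E1 E2 D] := hermitian_posdefE (pG Uz); split => //.
  by rewrite -(pmulr_rgt0 _ A0); apply: le_lt_trans D; exact: sqmod_ge0.
have An0 z : U z -> G z 0 0 != 0 :> C.
  move=> Uz; have [A0 E0 _ _ _] := hermitian_posdefE (pG Uz).
  by rewrite E0 real_complex_neq0// gt_eqF.
have tau0 z : U z -> he_tau G z = 0 by move=> Uz; rewrite /he_tau B0// mul0r.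
have rhoE z : U z -> he_rho G z = (complex.Re (G z 1 1) / complex.Re (G z 0 0))%:C.
  move=> Uz; have [A0 E0 E1 _ _] := hermitian_posdefE (pG Uz).
  rewrite /he_rho B0// mul0r subr0 real_complexM real_complexV -E0 -E1.
  by field; exact: An0.
split.
- have [sr _] := csmooth_rho oU pG sG; apply: (eq_smooth_on oU _ sr) => z Uz.
  by rewrite rhoE.
- by move=> z /pos[h1 h2]; rewrite divr_gt0.
move=> z Uz.
have dtau w : U w -> d_z (he_tau G) w = 0 /\ d_zbar (he_tau G) w = 0.
  move=> Uw; rewrite (eq_d_z oU Uw tau0) (eq_d_zbar oU Uw tau0).
  by rewrite (wder_dz (wder_cst 0 w)) (wder_dzbar (wder_cst 0 w)).
have E w : U w -> d_z (fun v => (complex.Re (G v 1 1) / complex.Re (G v 0 0))%:C) w /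
    (complex.Re (G w 1 1) / complex.Re (G w 0 0))%:C = (invmx (G w) *m d_zM G w) 1 1 - (invmx (G w) *m d_zM G w) 0 0.
  move=> Uw; rewrite -rhoE// -(eq_d_z oU Uw rhoE) !(chern_connection oU pG sG Uw).
  by rewrite ?mx2_00 ?mx2_11 (dtau w Uw).2 conjc0 mul0r mulr0 !subr0 add0r addrC addKr.
rewrite (eq_d_zbar oU Uz E).
have sN k : csmooth_on U (fun w => (invmx (G w) *m d_zM G w) k k).
  have sA : csmooth_on U (fun w => d_z (fun v => G v 0 0 : C) w / G w 0 0).
    by apply: (csmoothM oU (csmooth_d_z oU (sG 0 0))); apply: (csmoothV oU (sG 0 0)).
  have sr := csmooth_logrho oU pG sG.
  case: (ord2 k) => ->.
    apply: (eq_csmooth oU _ sA) => w Uw; rewrite (chern_connection oU pG sG Uw) ?mx2_00 ?mx2_11.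
    by rewrite tau0// mul0r subr0.
  apply: (eq_csmooth oU _ (csmoothD oU sA sr)) => w Uw; rewrite (chern_connection oU pG sG Uw) ?mx2_00 ?mx2_11.
  by rewrite tau0// mul0r add0r.
have d1 := csmooth_wder (sN 1) Uz; have d0 := csmooth_wder (sN 0) Uz.
rewrite (wder_dzbar (wderB d1 d0)).
rewrite !(chern_entries pG eqG)// ?mx2_00 ?mx2_11 -rhoE// tau0// conjc0.
have := rho_neq0 pG Uz; move: (he_rho G z) (a z) => P x P0.
set y := conjc x; clearbody y.
by field.
Qed.

End HermitianEinsteinConsequences.

(** * Gaussian curvature *)
Section Curvature.
Variable R : realType.
Local Notation C := (cplx R).
Variables (U : set C) (M : C -> 'M[R]_2) (E F G : C -> R).
Hypothesis oU : open U.
Hypothesis sE : smooth_on U E.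
Hypothesis sF : smooth_on U F.
Hypothesis sG : smooth_on U G.
Hypothesis M00 : forall w, U w -> M w 0 0 = E w.
Hypothesis M01 : forall w, U w -> M w 0 1 = F w.
Hypothesis M10 : forall w, U w -> M w 1 0 = F w.
Hypothesis M11 : forall w, U w -> M w 1 1 = G w.
Hypothesis det0 : forall w, U w -> E w * G w - F w ^+ 2 != 0.

Lemma sum2 (f : 'I_2 -> R) : \sum_(q < 2) f q = f 0 + f 1.
Proof. by rewrite big_ord_recl big_ord1; congr (_ + f _); apply/val_inj. Qed.

Lemma det2 (N : 'M[R]_2) : \det N = N 0 0 * N 1 1 - N 0 1 * N 1 0.
Proof.
rewrite (expand_det_row _ 0) sum2 /cofactor !det_mx11 !mxE /=.
by rewrite expr0 expr1 mul1r mulN1r mulrN; congr (_ * N _ _ - _ * N _ _); apply/val_inj.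
Qed.

Lemma invmx2 w : U w -> [/\ invmx (M w) 0 0 = G w / (E w * G w - F w ^+ 2),
  invmx (M w) 0 1 = - F w / (E w * G w - F w ^+ 2),
  invmx (M w) 1 0 = - F w / (E w * G w - F w ^+ 2) &
  invmx (M w) 1 1 = E w / (E w * G w - F w ^+ 2)].
Proof.
move=> Uw; have D0 := det0 Uw; set D := E w * G w - F w ^+ 2 in D0 *.
pose N : 'M[R]_2 := \matrix_(k, l) if k == 0 then (if l == 0 then G w / D else - F w / D)
   else (if l == 0 then - F w / D else E w / D).
have MN : M w *m N = 1%:M.
  apply/matrixP => k l; rewrite mxE sum2 !mxE /=.
  case: (ord2 k) => ->; case: (ord2 l) => -> /=; rewrite ?(M00 Uw) ?(M01 Uw) ?(M10 Uw) ?(M11 Uw) /D;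
    by field.
have [Mu _] := mulmx1_unit MN.
have -> : invmx (M w) = N by rewrite -[N](mulKmx Mu) MN mulmx1.
by split; rewrite mxE.
Qed.

Let dE k w (Uw : U w) : partial k (fun v => M v 0 0) w = partial k E w.
Proof. by apply: near_partial; exact: filterS M00 (open_near oU Uw). Qed.
Let dF k w (Uw : U w) : partial k (fun v => M v 0 1) w = partial k F w.
Proof. by apply: near_partial; exact: filterS M01 (open_near oU Uw). Qed.
Let dF' k w (Uw : U w) : partial k (fun v => M v 1 0) w = partial k F w.
Proof. by apply: near_partial; exact: filterS M10 (open_near oU Uw). Qed.
Let dG k w (Uw : U w) : partial k (fun v => M v 1 1) w = partial k G w.
Proof. by apply: near_partial; exact: filterS M11 (open_near oU Uw). Qed.

Let chr w l j k : U w -> christoffel M l j k w = 2^-1 *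
  (invmx (M w) l 0 * (partial j (fun v => M v k 0) w + partial k (fun v => M v j 0) w - partial 0 (fun v => M v j k) w) +
   invmx (M w) l 1 * (partial j (fun v => M v k 1) w + partial k (fun v => M v j 1) w - partial 1 (fun v => M v j k) w)).
Proof. by rewrite /christoffel sum2. Qed.

Lemma brioschi z : U z ->
  gauss_curvature M z = ((partial 0 (partial 1 F) z - partial 0 (partial 0 G) z / 2 - partial 1 (partial 1 E) z / 2) *
     (E z * G z - F z ^+ 2)
   - partial 0 E z / 2 * ((partial 1 F z - partial 0 G z / 2) * G z - F z * partial 1 G z / 2)
   + (partial 0 F z - partial 1 E z / 2) * ((partial 1 F z - partial 0 G z / 2) * F z - E z * partial 1 G z / 2)
   + partial 1 E z / 2 * (partial 1 E z * G z - F z * partial 0 G z) / 2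
   - partial 0 G z / 2 * (partial 1 E z * F z - E z * partial 0 G z) / 2) / (E z * G z - F z ^+ 2) ^+ 2.
Proof.
move=> Uz.
pose D w := E w * G w - F w ^+ 2.
have sD : smooth_on U D.
  by apply: (smoothB oU (smoothM oU sE sG)); apply: (eq_smooth_on oU _ (smoothM oU sF sF)) => w _; rewrite expr2.
have sV := smoothV oU sD det0.
have s1 := smooth_on_partial.
pose c011 w := 2^-1 * ((G w * (2 * partial 1 F w - partial 0 G w) - F w * partial 1 G w) * (D w)^-1).
pose c111 w := 2^-1 * ((E w * partial 1 G w - F w * (2 * partial 1 F w - partial 0 G w)) * (D w)^-1).
pose c001 w := 2^-1 * ((G w * partial 1 E w - F w * partial 0 G w) * (D w)^-1).
pose c101 w := 2^-1 * ((E w * partial 0 G w - F w * partial 1 E w) * (D w)^-1).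
have sm f k := fun sf => @s1 R U f k sf.
have sE1 := sm _ 1 sE; have sF1 := sm _ 1 sF; have sG0 := sm _ 0 sG; have sG1 := sm _ 1 sG.
have sH : smooth_on U (fun w => 2 * partial 1 F w - partial 0 G w) := smoothB oU (smoothZ oU 2 sF1) sG0.
have sc011 : smooth_on U c011 :=
  smoothZ oU 2^-1 (smoothM oU (smoothB oU (smoothM oU sG sH) (smoothM oU sF sG1)) sV).
have sc111 : smooth_on U c111 :=
  smoothZ oU 2^-1 (smoothM oU (smoothB oU (smoothM oU sE sG1) (smoothM oU sF sH)) sV).
have sc001 : smooth_on U c001 :=
  smoothZ oU 2^-1 (smoothM oU (smoothB oU (smoothM oU sG sE1) (smoothM oU sF sG0)) sV).
have sc101 : smooth_on U c101 :=
  smoothZ oU 2^-1 (smoothM oU (smoothB oU (smoothM oU sE sG0) (smoothM oU sF sE1)) sV).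
have ch w : U w -> [/\ christoffel M 0 1 1 w = c011 w, christoffel M 1 1 1 w = c111 w,
     christoffel M 0 0 1 w = c001 w & christoffel M 1 0 1 w = c101 w].
  move=> Uw; have [i00 i01 i10 i11] := invmx2 Uw; have := det0 Uw.
  split; rewrite chr// ?i00 ?i01 ?i10 ?i11 !(dE,dF,dF',dG)// /c011 /c111 /c001 /c101 /D; by field.
have chs w : U w -> christoffel M 0 1 0 w = c001 w /\ christoffel M 1 1 0 w = c101 w.
  move=> Uw; have [i00 i01 i10 i11] := invmx2 Uw; have := det0 Uw.
  split; rewrite chr// ?i00 ?i01 ?i10 ?i11 !(dE,dF,dF',dG)// /c001 /c101 /D; by field.
have [i00 i01 i10 i11] := invmx2 Uz.
have n k (f g : C -> R) : (forall w, U w -> f w = g w) -> partial k f z = partial k g z.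
  by move=> fg; apply: near_partial; exact: filterS fg (open_near oU Uz).
have lo0 w : U w -> E w * c011 w + F w * c111 w = partial 1 F w - 2^-1 * partial 0 G w.
  by move=> Uw; have := det0 Uw; rewrite /c011 /c111 /D => ?; field.
have lo1 w : U w -> E w * c001 w + F w * c101 w = 2^-1 * partial 1 E w.
  by move=> Uw; have := det0 Uw; rewrite /c001 /c101 /D => ?; field.
have dd f k (sf : smooth_on U f) := smooth_on_derdir k sf Uz.
have H0 : E z * partial 0 c011 z + c011 z * partial 0 E z + (F z * partial 0 c111 z + c111 z * partial 0 F z) =
    partial 0 (partial 1 F) z - 2^-1 * partial 0 (partial 0 G) z.
  have e := derdirP (derdirD (derdirM (dd _ 0 sE) (dd _ 0 sc011)) (derdirM (dd _ 0 sF) (dd _ 0 sc111))).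
  rewrite -e (n _ _ _ lo0); apply: derdirP; apply: derdirB; first exact: (dd _ 0 (sm _ 1 sF)).
  have := derdirM (derdir_cst 0 z 2^-1) (dd _ 0 (sm _ 0 sG)); by rewrite mulr0 addr0.
have H1 : E z * partial 1 c001 z + c001 z * partial 1 E z + (F z * partial 1 c101 z + c101 z * partial 1 F z) =
    2^-1 * partial 1 (partial 1 E) z.
  have e := derdirP (derdirD (derdirM (dd _ 1 sE) (dd _ 1 sc001)) (derdirM (dd _ 1 sF) (dd _ 1 sc101))).
  rewrite -e (n _ _ _ lo1); apply: derdirP.
  have := derdirM (derdir_cst 1 z 2^-1) (dd _ 1 (sm _ 1 sE)); by rewrite mulr0 addr0.
have [e1 e2 e3 e4] := ch z Uz; have [e5 e6] := chs z Uz.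
rewrite /gauss_curvature sum2 det2 M00// M01// M10// M11// /riemann011 !sum2 e1 e2 e3 e4 e5 e6.
rewrite (n 0 (christoffel M 0 1 1) c011) => [|w /ch[]//]; rewrite (n 0 (christoffel M 1 1 1) c111) => [|w /ch[]//].
rewrite (n 1 (christoffel M 0 0 1) c001) => [|w /ch[]//]; rewrite (n 1 (christoffel M 1 0 1) c101) => [|w /ch[]//].
have l00 : E z * christoffel M 0 0 0 z + F z * christoffel M 1 0 0 z = 2^-1 * partial 0 E z.
  by rewrite !chr// i00 i01 i10 i11 !(dE,dF,dF',dG)//; have := det0 Uz => ?; field.
have := l00; move: (christoffel M 0 0 0 z) (christoffel M 1 0 0 z) => k0 k1 {}l00.
have D0 := det0 Uz; rewrite -[E z * G z - F z * F z]/(E z * G z - F z ^+ 2) -/(D z).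
transitivity ((E z * partial 0 c011 z + c011 z * partial 0 E z + (F z * partial 0 c111 z + c111 z * partial 0 F z)
   - (E z * partial 1 c001 z + c001 z * partial 1 E z + (F z * partial 1 c101 z + c101 z * partial 1 F z))
  - (c011 z * partial 0 E z + c111 z * partial 0 F z) + (c001 z * partial 1 E z + c101 z * partial 1 F z)
  + (c011 z * (E z * k0 + F z * k1) + c111 z * (E z * c001 z + F z * c101 z)
   - c001 z * (E z * c001 z + F z * c101 z) - c101 z * (E z * c011 z + F z * c111 z))) / D z).
  move: (partial 0 c011 z) (partial 0 c111 z) (partial 1 c001 z) (partial 1 c101 z) => a1 a2 a3 a4.
  move: (c011 z) (c111 z) (c001 z) (c101 z) (E z) (F z) (D z) => b1 b2 b3 b4 e f d.
  move: (partial 0 E z) (partial 1 E z) (partial 0 F z) (partial 1 F z) => u1 u2 y1 y2.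
  congr (_ / _); clear; ring.
rewrite H0 H1 l00 (lo0 z Uz) (lo1 z Uz) /c011 /c111 /c001 /c101.
move: D0; rewrite -/(D z); move: (D z) (E z) (F z) (G z) => d e f g d0.
move: (partial 0 (partial 1 F) z) (partial 0 (partial 0 G) z) (partial 1 (partial 1 E) z) => h1 h2 h3.
move: (partial 0 E z) (partial 1 E z) (partial 0 F z) (partial 1 F z) (partial 0 G z) (partial 1 G z) => u1 u2 y1 y2 z1 z2.
field; exact: d0.
Qed.

End Curvature.

Lemma pullback_curvature_identity (R : realType) (g p q a b x y G0 G1 c d : R) : g != 0 ->
  g ^+ 2 - 4 * (p ^+ 2 + q ^+ 2) != 0 ->
  g * (G0 + G1) - (x ^+ 2 + y ^+ 2) = 2 * g ^+ 3 - 8 * (p ^+ 2 + q ^+ 2) * g ->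
  let S := g + 4 * (p ^+ 2 + q ^+ 2) / g in
  let S0 := x + (8 * (p * a + q * b) / g - 4 * (p ^+ 2 + q ^+ 2) * x / g ^+ 2) in
  let S1 := y + (8 * (p * - b + q * a) / g - 4 * (p ^+ 2 + q ^+ 2) * y / g ^+ 2) in
  let S00 := G0 + (8 * (a ^+ 2 + p * c + b ^+ 2 + q * d) / g - 16 * (p * a + q * b) * x / g ^+ 2
     - 4 * (p ^+ 2 + q ^+ 2) * G0 / g ^+ 2 + 8 * (p ^+ 2 + q ^+ 2) * x ^+ 2 / g ^+ 3) in
  let S11 := G1 + (8 * ((- b) ^+ 2 + p * - c + a ^+ 2 + q * - d) / g - 16 * (p * - b + q * a) * y / g ^+ 2
     - 4 * (p ^+ 2 + q ^+ 2) * G1 / g ^+ 2 + 8 * (p ^+ 2 + q ^+ 2) * y ^+ 2 / g ^+ 3) in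
  let D := ((g ^+ 2 - 4 * (p ^+ 2 + q ^+ 2)) / g) ^+ 2 in
  ((- 4 * c - (S00 - 4 * c) / 2 - (S11 + 4 * - c) / 2) * D
   - (S0 + 4 * a) / 2 * ((- 4 * a - (S0 - 4 * a) / 2) * (S - 4 * p) - - 4 * q * (S1 - 4 * - b) / 2)
   + (- 4 * b - (S1 + 4 * - b) / 2) * ((- 4 * a - (S0 - 4 * a) / 2) * (- 4 * q) - (S + 4 * p) * (S1 - 4 * - b) / 2)
   + (S1 + 4 * - b) / 2 * ((S1 + 4 * - b) * (S - 4 * p) - - 4 * q * (S0 - 4 * a)) / 2
   - (S0 - 4 * a) / 2 * ((S1 + 4 * - b) * (- 4 * q) - (S + 4 * p) * (S0 - 4 * a)) / 2) / D ^+ 2 = -1.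
Proof.
move=> g0 n0 T; cbv zeta.
have {T} -> : G1 = (2 * g ^+ 3 - 8 * (p ^+ 2 + q ^+ 2) * g + (x ^+ 2 + y ^+ 2)) / g - G0.
  by apply: (mulfI g0); rewrite -T; field.
by field; rewrite g0 n0.
Qed.

Section HarmonicPullback.
Variable R : realType.
Local Notation C := (cplx R).
Variables (U : set C) (f : C -> C) (g : C -> R).
Hypothesis oU : open U.
Hypothesis hf : holomorphic_on U f.
Hypothesis tg : toda U f g.

Lemma derdir_Re_holomorphic (h : C -> C) z : holomorphic_on U h -> U z ->
  derdir (fun w => complex.Re (h w)) 0 z (complex.Re (derive1 h z)) /\
  derdir (fun w => complex.Re (h w)) 1 z (- complex.Im (derive1 h z)).
Proof.
move=> hh Uz; have [[h1 _] [h2 _]] := cder_wder (holomorphic_cder hh Uz).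
move: h1 h2; rewrite addr0 subr0; case: (derive1 h z) => x y /= h1 h2; split=> //.
by move: h2; rewrite /= mul0r mul1r sub0r.
Qed.

Lemma derdir_Im_holomorphic (h : C -> C) z : holomorphic_on U h -> U z ->
  derdir (fun w => complex.Im (h w)) 0 z (complex.Im (derive1 h z)) /\
  derdir (fun w => complex.Im (h w)) 1 z (complex.Re (derive1 h z)).
Proof.
move=> hh Uz; have [[_ h1] [_ h2]] := cder_wder (holomorphic_cder hh Uz).
move: h1 h2; rewrite addr0 subr0; case: (derive1 h z) => x y /= h1 h2; split=> //.
by move: h2; rewrite /= mul0r mul1r add0r.
Qed.

Let f1 := derive1 f.
Let f2 := derive1 f1.
Let hf1 : holomorphic_on U f1 := holomorphic_derive1 oU hf.
Let p w := complex.Re (f w).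
Let q w := complex.Im (f w).

Let near_eq k (u v : C -> R) z : U z -> (forall w, U w -> u w = v w) -> partial k u z = partial k v z.
Proof. by move=> Uz fg; apply: near_partial; exact: filterS fg (open_near oU Uz). Qed.

Let g0 w : U w -> g w != 0.
Proof. by move=> Uw; have [_ /(_ w Uw) h _] := tg; rewrite gt_eqF. Qed.

(** [S |dz|^2] is the (1,1) part of the pull-back metric. *)
Definition energy w := g w + 4 * (p w ^+ 2 + q w ^+ 2) / g w.

Let sg : smooth_on U g. Proof. by case: tg. Qed.
Let sp : smooth_on U p. Proof. by have [] := csmooth_holomorphic oU hf. Qed.
Let sq : smooth_on U q. Proof. by have [] := csmooth_holomorphic oU hf. Qed.

Let dp k z : U z -> derdir p k z (if k == 0 then complex.Re (f1 z) else - complex.Im (f1 z)).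
Proof. by move=> Uz; have [d0 d1] := derdir_Re_holomorphic hf Uz; case: (ord2 k) => ->. Qed.
Let dq k z : U z -> derdir q k z (if k == 0 then complex.Im (f1 z) else complex.Re (f1 z)).
Proof. by move=> Uz; have [d0 d1] := derdir_Im_holomorphic hf Uz; case: (ord2 k) => ->. Qed.

Let ddp k z : U z -> partial k (partial k p) z = if k == 0 then complex.Re (f2 z) else - complex.Re (f2 z).
Proof.
move=> Uz; have E w : U w -> partial k p w = if k == 0 then complex.Re (f1 w) else - complex.Im (f1 w).
  by move=> Uw; exact: derdirP (dp k Uw).
rewrite (near_eq k Uz E); apply: derdirP.
have [r0 r1] := derdir_Re_holomorphic hf1 Uz; have [i0 i1] := derdir_Im_holomorphic hf1 Uz.
by case: (ord2 k) => -> //=; exact: derdirN.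
Qed.

Let ddq' k z : U z -> partial k (partial k q) z = if k == 0 then complex.Im (f2 z) else - complex.Im (f2 z).
Proof.
move=> Uz; have E w : U w -> partial k q w = if k == 0 then complex.Im (f1 w) else complex.Re (f1 w).
  by move=> Uw; exact: derdirP (dq k Uw).
rewrite (near_eq k Uz E); apply: derdirP.
have [r0 r1] := derdir_Re_holomorphic hf1 Uz; have [i0 i1] := derdir_Im_holomorphic hf1 Uz.
by case: (ord2 k) => -> //=; exact: derdirN.
Qed.

Let ddq z : U z -> partial 0 (partial 1 q) z = complex.Re (f2 z).
Proof.
move=> Uz; have E w : U w -> partial 1 q w = complex.Re (f1 w).
  by move=> Uw; exact: derdirP (dq 1 Uw).
rewrite (near_eq 0 Uz E); apply: derdirP.
by have [r0 r1] := derdir_Re_holomorphic hf1 Uz.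
Qed.

Definition energy1 k w : R := partial k g w +
  (8 * (p w * partial k p w + q w * partial k q w) / g w - 4 * (p w ^+ 2 + q w ^+ 2) * partial k g w / g w ^+ 2).

Let denergy k z : U z -> derdir energy k z (energy1 k z).
Proof.
move=> Uz; have dg := smooth_on_derdir k sg Uz.
have d1 := smooth_on_derdir k sp Uz; have d2 := smooth_on_derdir k sq Uz.
have := derdirD dg (derdirM (derdirM (derdir_cst k z 4) (derdirD (derdirM d1 d1) (derdirM d2 d2))) (derdirV (g0 Uz) dg)).
apply: eq_derdir => [w|]; first by rewrite /energy !expr2.
by rewrite /energy1; have := g0 Uz; move: (p z) (q z) (g z) (partial k p z) (partial k q z) (partial k g z) => a b c d e h n; field.
Qed.

Let ddenergy k z : U z -> partial k (partial k energy) z =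
  partial k (partial k g) z + (8 * (partial k p z ^+ 2 + p z * partial k (partial k p) z +
    partial k q z ^+ 2 + q z * partial k (partial k q) z) / g z
  - 16 * (p z * partial k p z + q z * partial k q z) * partial k g z / g z ^+ 2
  - 4 * (p z ^+ 2 + q z ^+ 2) * partial k (partial k g) z / g z ^+ 2
  + 8 * (p z ^+ 2 + q z ^+ 2) * partial k g z ^+ 2 / g z ^+ 3).
Proof.
move=> Uz; have E w : U w -> partial k energy w = energy1 k w.
  by move=> Uw; exact: derdirP (denergy k Uw).
rewrite (near_eq k Uz E); apply: derdirP.
have dg := smooth_on_derdir k sg Uz; have d1 := smooth_on_derdir k sp Uz.
have d2 := smooth_on_derdir k sq Uz.
have dg' := smooth_on_derdir k (smooth_on_partial k sg) Uz.
have d1' := smooth_on_derdir k (smooth_on_partial k sp) Uz.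
have d2' := smooth_on_derdir k (smooth_on_partial k sq) Uz.
have iV := derdirV (g0 Uz) dg.
have c c1 := derdir_cst k z c1.
have := derdirD dg' (derdirB (derdirM (derdirM (c 8) (derdirD (derdirM d1 d1') (derdirM d2 d2'))) iV)
  (derdirM (derdirM (derdirM (c 4) (derdirD (derdirM d1 d1) (derdirM d2 d2))) dg') (derdirM iV iV))).
apply: eq_derdir => [w|]; first by rewrite /energy1 !expr2 invfM.
have := g0 Uz; move: (p z) (q z) (g z) (partial k (partial k g) z) (partial k (partial k p) z) (partial k (partial k q) z).
move: (partial k p z) (partial k q z) (partial k g z) => a b c1 d e h u v w n; by field.
Qed.

Lemma pullback_curvature (M : C -> 'M[R]_2) z :
  (forall w, U w -> M w 0 0 = energy w + 4 * p w) ->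
  (forall w, U w -> M w 0 1 = - 4 * q w) ->
  (forall w, U w -> M w 1 0 = - 4 * q w) ->
  (forall w, U w -> M w 1 1 = energy w - 4 * p w) ->
  (forall w, U w -> g w ^+ 2 - 4 * (p w ^+ 2 + q w ^+ 2) != 0) ->
  U z -> gauss_curvature M z = -1.
Proof.
move=> M00 M01 M10 M11 nd Uz.
have sen : smooth_on U energy.
  have s2 := smoothD oU (smoothM oU sp sp) (smoothM oU sq sq).
  have := smoothD oU sg (smoothM oU (smoothZ oU 4 s2) (smoothV oU sg g0)).
  by apply: (eq_smooth_on oU) => w _; rewrite /energy !expr2.
have det w : U w -> (energy w + 4 * p w) * (energy w - 4 * p w) - (- 4 * q w) ^+ 2 =
    ((g w ^+ 2 - 4 * (p w ^+ 2 + q w ^+ 2)) / g w) ^+ 2.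
  by move=> Uw; have := g0 Uw; rewrite /energy; move: (g w) (p w) (q w) => a b c n; field.
have det0 w : U w -> (energy w + 4 * p w) * (energy w - 4 * p w) - (- 4 * q w) ^+ 2 != 0.
  by move=> Uw; rewrite det// expf_neq0// mulf_neq0 ?invr_neq0// ?nd// g0.
have sE := smoothD oU sen (smoothZ oU 4 sp); have sG := smoothB oU sen (smoothZ oU 4 sp).
have sF := smoothZ oU (-4) sq.
rewrite (brioschi oU sE sF sG M00 M01 M10 M11 det0 Uz).
have cM (k : 'I_2) (c : R) (u : C -> R) u' w : derdir u k w u' -> derdir (fun v => c * u v) k w (c * u').
  by move=> du; have := derdirM (derdir_cst k w c) du; rewrite mulr0 addr0.
have pE k w : U w -> partial k (fun v => energy v + 4 * p v) w = partial k energy w + 4 * partial k p w.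
  move=> Uw; apply: derdirP; apply: derdirD; first exact: smooth_on_derdir sen Uw.
  by apply: cM; exact: smooth_on_derdir sp Uw.
have pG k w : U w -> partial k (fun v => energy v - 4 * p v) w = partial k energy w - 4 * partial k p w.
  move=> Uw; apply: derdirP; apply: derdirB; first exact: smooth_on_derdir sen Uw.
  by apply: cM; exact: smooth_on_derdir sp Uw.
have pF k w : U w -> partial k (fun v => - 4 * q v) w = - 4 * partial k q w.
  by move=> Uw; apply: derdirP; apply: cM; exact: smooth_on_derdir sq Uw.
have dde k := smooth_on_derdir k (smooth_on_partial k sen) Uz.
have ddp1 k := smooth_on_derdir k (smooth_on_partial k sp) Uz.
rewrite (near_eq 0 Uz (pF 1)) (near_eq 0 Uz (pG 0)) (near_eq 1 Uz (pE 1)).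
rewrite (derdirP (derdirD (dde 1) (cM _ 4 _ _ _ (ddp1 1)))) (derdirP (derdirB (dde 0) (cM _ 4 _ _ _ (ddp1 0)))).
rewrite (derdirP (cM _ (-4) _ _ _ (smooth_on_derdir 0 (smooth_on_partial 1 sq) Uz))).
rewrite !pE// !pF// !pG// det// !ddenergy// ddq// !ddp// !ddq'// !(derdirP (denergy _ Uz)).
have T := toda_lap oU tg Uz.
rewrite /energy1 !(derdirP (dp _ Uz)) !(derdirP (dq _ Uz)) /= /energy.
exact: pullback_curvature_identity (g0 Uz) (nd z Uz) T.
Qed.

End HarmonicPullback.

(** * Maximum principles *)
Section Extrema.
Variables (R : realType) (T : topologicalType).

Lemma compact_min (A : set T) (f : T -> R) : A !=set0 -> compact A ->
  (forall x, A x -> {for x, continuous f}) -> exists2 c, A c & forall x, A x -> f c <= f x.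
Proof.
move=> A0 cA cf; have [|c cA' cP] := @compact_EVT_min T R f A A0 cA.
  by apply: continuous_in_subspaceT => x; rewrite inE; exact: cf.
by exists c; [move: cA'; rewrite inE|move=> x Ax; apply: cP; rewrite inE].
Qed.

Lemma compact_max (A : set T) (f : T -> R) : A !=set0 -> compact A ->
  (forall x, A x -> {for x, continuous f}) -> exists2 c, A c & forall x, A x -> f x <= f c.
Proof.
move=> A0 cA cf; have [|c cA' cP] := @compact_EVT_max T R f A A0 cA.
  by apply: continuous_in_subspaceT => x; rewrite inE; exact: cf.
by exists c; [move: cA'; rewrite inE|move=> x Ax; apply: cP; rewrite inE].
Qed.

Lemma compact_zeros (A : set T) (f : T -> R) : hausdorff_space T -> compact A ->
  (forall x, A x -> {for x, continuous f}) -> compact (A `&` [set x | f x = 0]).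
Proof.
move=> hT cA cf; apply: (subclosed_compact _ cA) => [|x []//].
move=> x clx; have Ax : A x.
  by apply: (compact_closed hT cA) => B /clx[y [[Ay _] By]]; exists y.
split=> //=; apply: contrapT => /eqP fx.
have /clx[y [[_ /= fy]]] : nbhs x [set y | f y != 0].
  apply: (cf x Ax [set t | t != 0]); exact: open_nbhs_nbhs (conj (@open_neq R 0) fx).
by rewrite /= fy eqxx.
Qed.

End Extrema.

Section MaximumPrinciple.
Variable R : realType.
Local Notation C := (cplx R).

(** Stated at one point, so as to cover comparison functions that are singular
   elsewhere. *)
Definition has_lap (f : C -> R) (z : C) (l : R) := exists (f1 : 'I_2 -> C -> R) (f2 : 'I_2 -> R),
  (forall k, (\forall w \near z, derdir f k w (f1 k w)) /\ derdir (f1 k) k z (f2 k)) /\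
  l = f2 0 + f2 1.

Lemma has_lap_smooth (U : set C) f z : open U -> smooth_on U f -> U z -> has_lap f z (lap f z).
Proof.
move=> oU sf Uz; exists (fun k => partial k f), (fun k => partial k (partial k f) z); split; last by [].
move=> k; split.
  by apply: filterS (open_near oU Uz) => w Uw; exact: (smooth_on_derdir k sf Uw).
exact: (smooth_on_derdir k (smooth_on_partial k sf) Uz).
Qed.

Lemma has_lapD f g z l m (c : R) : has_lap f z l -> has_lap g z m ->
  has_lap (fun w => f w + c * g w) z (l + c * m).
Proof.
move=> [f1 [f2 [hf ->]]] [g1 [g2 [hg ->]]].
have cM (k : 'I_2) (u : C -> R) u' w : derdir u k w u' -> derdir (fun v => c * u v) k w (c * u').
  by move=> du; have := derdirM (derdir_cst k w c) du; rewrite mulr0 addr0.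
exists (fun k w => f1 k w + c * g1 k w), (fun k => f2 k + c * g2 k); split; last by ring.
move=> k; have [nf df] := hf k; have [ng dg] := hg k; split.
  by apply: filterS2 nf ng => w h1 h2; apply: derdirD => //; exact: cM.
by apply: derdirD => //; exact: cM.
Qed.

Lemma derivative_at_max (h h' : R -> R) (l : R) :
  (\forall t \near (0 : R), is_derive t (1 : R) h (h' t)) -> is_derive (0 : R) (1 : R) h' l ->
  (\forall t \near (0 : R), h t <= h 0) -> h' 0 = 0 /\ l <= 0.
Proof.
move=> dh dh' hm.
have [e /= e0 eP] : nbhs (0 : R) [set t | is_derive t (1 : R) h (h' t) /\ h t <= h 0].
  by apply: filterS2 dh hm.
have ball t : `|t| < e -> is_derive t (1 : R) h (h' t) /\ h t <= h 0.
  by move=> te; apply: eP; rewrite /ball /= sub0r normrN.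
have h0 : h' 0 = 0.
  have dab : is_derive (0 : R) (1 : R) h 0.
    apply: (@derive1_at_max R h (- e) e 0); first by lra.
    - by move=> t; rewrite in_itv /= => /andP[t1 t2]; have [|[]] := ball t; rewrite // ltr_norml t1.
    - by rewrite in_itv /= oppr_lt0 e0.
    - by move=> t; rewrite in_itv /= => /andP[t1 t2]; have [|] := ball t; rewrite // ltr_norml t1.
  by have [|[_ <-] _] := ball 0; [rewrite normr0|case: dab].
split=> //; rewrite leNgt; apply/negP => l0.
have l2 : 0 < l / 2 by rewrite divr_gt0.
have [d d0 dP] := (rderP h' 0 l).1 dh' (l / 2) l2.
pose t := Num.min d e / 2.
have t0 : 0 < t by rewrite divr_gt0// lt_min d0.
have tm : t < Num.min d e by rewrite /t; move: t0; rewrite /t; lra.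
have [td te] : t < d /\ t < e by split; apply: lt_le_trans tm _; rewrite ge_min lexx ?orbT.
have [| |c] := @MVT R h h' 0 t t0.
- move=> x; rewrite in_itv /= => /andP[x0 xt].
  by have [] := ball x; first by rewrite gtr0_norm// (lt_trans xt).
- apply: continuous_in_subspaceT => x; rewrite inE /= in_itv /= => /andP[x0 xt].
  have [|dx _] := ball x; first by rewrite ger0_norm// (le_lt_trans xt).
  by apply: differentiable_continuous; apply/derivable1_diffP; case: dx.
rewrite in_itv /= subr0 => /andP[c0 ct] E.
have [|_] := ball t; first by rewrite gtr0_norm.
have : 0 < h' c.
  have := dP c; rewrite h0 !subr0 gtr0_norm// => /(_ (lt_trans ct td)).
  rewrite ler_norml => /andP[+ _]; have := mulr_gt0 l0 c0; lra.
by move=> hc; have := mulr_gt0 hc t0; rewrite -E; lra.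
Qed.

Lemma has_lap_max f z l : has_lap f z l -> (\forall w \near z, f w <= f z) -> l <= 0.
Proof.
move=> [f1 [f2 [hf ->]]] fm.
suff H k : f2 k <= 0 by have := H 0; have := H 1; lra.
have [nf df] := hf k.
have := @derivative_at_max (fun t => f (z + t%:C * dir R k)) (fun t => f1 k (z + t%:C * dir R k)) (f2 k).
move=> H; apply: (H _ df _).2; last first.
  by apply: filterS (near_line k fm) => t; rewrite line0.
apply: filterS (near_line k nf) => t dt; apply: rder_shift.
rewrite (_ : (fun s : R => _) = (fun s => f (z + t%:C * dir R k + s%:C * dir R k))); first exact: dt.
by apply/funext => s; rewrite real_complexD mulrDl addrA.
Qed.

Lemma has_lap_min f z l : has_lap f z l -> (\forall w \near z, f z <= f w) -> 0 <= l.
Proof.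
move=> hf fm; have h0 : has_lap (fun=> 0) z 0.
  exists (fun _ _ => 0), (fun=> 0); split; last by rewrite addr0.
  by move=> k; split; [exact: (@filterE _ (nbhs z) _ _ (fun w => derdir_cst k w 0))|exact: derdir_cst].
suff : 0 + -1 * l <= 0 by lra.
by apply: (has_lap_max (has_lapD (-1) h0 hf)); apply: filterS fm => w; rewrite !add0r !mulN1r lerN2.
Qed.

Lemma has_lap_radial (F F1 : R -> R) (l : R) c z : z != c ->
  (forall t : R, 0 < t -> is_derive t (1 : R) F (F1 t)) ->
  is_derive (sqmod (z - c)) (1 : R) F1 l ->
  has_lap (fun w => F (sqmod (w - c))) z (4 * (sqmod (z - c) * l + F1 (sqmod (z - c)))).
Proof.
move=> zc dF dF1.
pose x (k : 'I_2) (w : C) : R := if k == 0 then complex.Re (w - c) else complex.Im (w - c).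
have dx k w : derdir (x k) k w 1.
  have E : (fun t : R => x k (w + t%:C * dir R k)) = (fun t => x k w + t).
    apply/funext => t; rewrite /x /dir; case: (ord2 k) => ->; rewrite /=;
    by case: (w) (c) => ? ? [? ?] /=; ring.
  rewrite /derdir E; have := is_deriveD (is_derive_cst (x k w) (0 : R) (1 : R)) (is_derive_id (0 : R) (1 : R)).
  by rewrite add0r.
have dq k w : derdir (fun v => sqmod (v - c)) k w (2 * x k w).
  have E : (fun t : R => sqmod (w + t%:C * dir R k - c)) = (fun t => sqmod (w - c) + (2 * x k w * t + t * t)).
    apply/funext => t; rewrite /x /dir /sqmod; case: (ord2 k) => ->; rewrite /=;
    by case: (w) (c) => ? ? [? ?] /=; ring.
  have i0 := is_derive_id (0 : R) (1 : R); have c0 := is_derive_cst (2 * x k w) (0 : R) (1 : R).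
  rewrite /derdir E.
  apply: (is_derive_eq (is_deriveD (is_derive_cst (sqmod (w - c)) (0 : R) (1 : R)) (is_deriveD (is_deriveM c0 i0) (is_deriveM i0 i0)))).
  by rewrite /GRing.scale /=; ring.
have comp G G' k w : is_derive (sqmod (w - c)) (1 : R) G G' ->
    derdir (fun v => G (sqmod (v - c))) k w (G' * (2 * x k w)).
  move=> dG; apply: is_derive1_comp; last exact: dq.
  by rewrite line0.
exists (fun k w => F1 (sqmod (w - c)) * (2 * x k w)).
exists (fun k => F1 (sqmod (z - c)) * 2 + 2 * x k z * (l * (2 * x k z))); split.
  move=> k; split.
    have zc0 : 0 < modulus (z - c) by rewrite modulus_gt0 subr_eq0.
    apply: filterS (near_modulus z zc0) => w wz; apply: comp; apply: dF.
    rewrite -modulus_sqr exprn_gt0// modulus_gt0 subr_eq0; apply/eqP => wc.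
    by move: wz; rewrite wc modulusBC ltxx.
  have := derdirM (comp _ _ k z dF1) (derdirM (derdir_cst k z 2) (dx k z)).
  by rewrite mulr0 addr0 mulr1.
rewrite /x /= /sqmod; ring.
Qed.

End MaximumPrinciple.

Section StrongMaximumPrinciple.
Variable R : realType.
Local Notation C := (cplx R).

Lemma continuous_dist_at (c z : C) : {for z, continuous (fun w : C => modulus (w - c))}.
Proof. exact: continuous_dist. Qed.

Lemma continuous_cst_at (r : R) (z : C) : {for z, continuous (fun _ : C => r)}.
Proof. exact: (@cst_continuous C R r z). Qed.

Lemma compact_annulus (c : C) (r1 r2 : R) : compact [set w : C | r1 <= modulus (w - c) <= r2].
Proof.
have -> : [set w : C | r1 <= modulus (w - c) <= r2] = [set w : C | modulus (w - c) <= r2] `&`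
    [set w | Num.max (r1 - modulus (w - c)) 0 = 0].
  apply/seteqP; split=> w /=.
    by move=> /andP[h ->]; split=> //; apply/max_idPr; rewrite subr_le0.
  by move=> [-> /max_idPr]; rewrite subr_le0 => ->.
apply: compact_zeros; [exact: norm_hausdorff|exact: compact_disc|] => x _.
have cc : {for x, continuous (fun w : C => r1 - modulus (w - c))}.
  exact: (continuousB (@continuous_cst_at r1 x) (@continuous_dist_at c x)).
exact: (continuous_max cc (@continuous_cst_at 0 x)).
Qed.

(** Comparison on an annulus around [c] with the multiples of 1/|z - c|^2 - 1/rho^2,
   whose Laplacian 4/|z - c|^4 is large near [c]. *)
Lemma annulus_comparison (U : set C) (w : C -> R) c (rho K e : R) : open U -> smooth_on U w ->
  0 < rho -> 0 <= K -> K * rho ^+ 2 < 4 -> 0 < e ->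
  (forall z, modulus (z - c) <= rho -> U z /\ 0 <= w z /\ lap w z <= K * w z) ->
  (forall z, modulus (z - c) <= rho / 2 -> 3 * e / rho ^+ 2 <= w z) ->
  forall z, rho / 2 <= modulus (z - c) <= rho -> e * ((sqmod (z - c))^-1 - (rho ^+ 2)^-1) <= w z.
Proof.
move=> oU sw r0 K0 Kr e0 wP wi z zA.
pose v (z : C) := w z + - e * ((sqmod (z - c))^-1 - (rho ^+ 2)^-1).
have vE y : v y = w y - (e * (sqmod (y - c))^-1 - e * (rho ^+ 2)^-1) by rewrite /v mulNr mulrBr.
have r20 : 0 < rho ^+ 2 by rewrite exprn_gt0.
have mid y : rho / 2 <= modulus (y - c) -> y != c.
  by move=> h; apply/eqP => yc; move: h; rewrite yc subrr modulus0; lra.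
have lapv y : rho / 2 <= modulus (y - c) -> U y -> has_lap v y (lap w y + - e * (4 * (sqmod (y - c)) ^- 2)).
  move=> h1 Uy; have yc := mid _ h1.
  have q0 : sqmod (y - c) != 0 by rewrite sqmod_eq0 subr_eq0.
  have dV (t : R) : t != 0 -> is_derive t (1 : R) (fun x : R => x^-1 - (rho ^+ 2)^-1) (- t ^- 2).
    move=> t0; have := is_deriveB (@is_deriveV R id t 1 1 t0 (is_derive_id t 1)) (is_derive_cst ((rho ^+ 2)^-1) t (1 : R)).
    by rewrite subr0 /GRing.scale /= mulr1.
  have dV2 (t : R) : t != 0 -> is_derive t (1 : R) (fun x : R => - x ^- 2) (2 * t ^- 3).
    move=> t0; have t2 : t ^+ 2 != 0 by rewrite expf_neq0.
    have i := is_derive_id t (1 : R).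
    rewrite (_ : (fun x : R => - x ^- 2) = - (fun x => (x * x)^-1)); last by apply/funext => x; rewrite expr2.
    apply: (is_derive_eq (is_deriveN (@is_deriveV R (fun x => x * x) t _ 1 (mulf_neq0 t0 t0) (is_deriveM i i)))).
    rewrite /GRing.scale /= !mulr1; field.
    exact: t0.
  have Hr := @has_lap_radial R (fun x => x^-1 - (rho ^+ 2)^-1) (fun x => - x ^- 2) (2 * (sqmod (y - c)) ^- 3) c y yc.
  have {}Hr := Hr (fun t t0 => dV t (lt0r_neq0 t0)) (dV2 _ q0).
  have -> : 4 * sqmod (y - c) ^- 2 = 4 * (sqmod (y - c) * (2 * sqmod (y - c) ^- 3) + - sqmod (y - c) ^- 2) by field.
  exact: (has_lapD (- e) (has_lap_smooth oU sw Uy) Hr).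
have cv y : [set y | rho / 2 <= modulus (y - c) <= rho] y -> {for y, continuous v}.
  move=> /= /andP[h1 h2]; have [Uy _] := wP y h2; have yc := mid _ h1.
  have sE : (fun y : C => sqmod (y - c)) = (fun y => modulus (y - c) * modulus (y - c)).
    by apply/funext => u; rewrite -modulus_sqr expr2.
  have cs : {for y, continuous (fun y : C => sqmod (y - c))}.
    by rewrite sE; exact: (continuousM (@continuous_dist_at c y) (@continuous_dist_at c y)).
  have q0 : sqmod (y - c) != 0 by rewrite sqmod_eq0 subr_eq0.
  have cV : {for y, continuous (fun y : C => (sqmod (y - c))^-1)} := @continuousV R C _ y q0 cs.
  have cB := continuousB cV (@continuous_cst_at (rho ^+ 2)^-1 y).
  exact: (continuousD (smooth_on_continuous sw Uy) (continuousM (@continuous_cst_at (- e) y) cB)).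
have [y /= /andP[y1 y2] ymin] := compact_min (ex_intro _ z zA) (@compact_annulus c (rho / 2) rho) cv.
suff vy : 0 <= v y by move: vy (ymin z zA); rewrite !vE mulrBr; lra.
rewrite leNgt; apply/negP => vy0.
have [Uy [wy0 lw]] := wP y y2.
have q0 : 0 < sqmod (y - c) by rewrite -modulus_sqr exprn_gt0// modulus_gt0 subr_eq0 mid.
have lo : rho / 2 < modulus (y - c).
  rewrite lt_neqAle y1 andbT; apply/eqP => yr.
  have := wi y; rewrite -yr lexx => /(_ isT) hw.
  have E : v y = w y - 3 * e / rho ^+ 2.
    by rewrite vE -modulus_sqr -yr; field; rewrite gt_eqF.
  by move: vy0; rewrite E; lra.
have hi : modulus (y - c) < rho.
  rewrite lt_neqAle y2 andbT; apply/eqP => yr.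
  by move: vy0; rewrite vE -modulus_sqr yr; lra.
have nm : \forall u \near y, v y <= v u.
  have d0 : 0 < Num.min (modulus (y - c) - rho / 2) (rho - modulus (y - c)) by rewrite lt_min !subr_gt0 lo.
  apply: filterS (near_modulus y d0) => u; rewrite lt_min => /andP[u1 u2]; apply: ymin.
  have := modulusB (y - c) (u - c); have := modulusB (u - c) (y - c).
  rewrite (_ : u - c - (y - c) = u - y); last by ring.
  rewrite (_ : y - c - (u - c) = - (u - y)); last by ring.
  by rewrite modulusN => h1 h2; apply/andP; split; lra.
have := has_lap_min (lapv y y1 Uy) nm.
have qr : sqmod (y - c) <= rho ^+ 2 by rewrite -modulus_sqr lerXn2r// nnegrE ?modulus_ge0// ltW.
have wb : w y < e / sqmod (y - c).
  have : 0 < (rho ^+ 2)^-1 by rewrite invr_gt0.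
  by move=> /(mulr_gt0 e0); move: vy0; rewrite vE; lra.
suff : K * w y < e * (4 * sqmod (y - c) ^- 2) by lra.
have h : K * w y <= K * sqmod (y - c) * (e / sqmod (y - c) ^+ 2).
  rewrite -mulrA ler_wpM2l// (_ : _ * _ = e / sqmod (y - c)) ?ltW//; field; exact: lt0r_neq0.
apply: le_lt_trans h _; rewrite mulrCA ltr_pM2l// ltr_pM2r ?invr_gt0 ?exprn_gt0//.
by apply: le_lt_trans Kr; rewrite ler_wpM2l.
Qed.

(** Hopf's argument: at a zero of [w] that is nearest to a point where [w] is
   positive, the comparison on an annulus gives [w] a positive slope, whereas
   [w] has a minimum there. *)
Lemma strong_minimum (U : set C) (w : C -> R) (K : R) z1 : open U -> smooth_on U w -> 0 <= K ->
  (forall z, U z -> 0 <= w z /\ lap w z <= K * w z) -> U z1 -> w z1 = 0 ->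
  \forall z \near z1, w z = 0.
Proof.
move=> oU sw K0 wP Uz1 w1.
have [d d0 dU] := open_modulus oU Uz1.
pose r0 := Num.min (d / 4) (1 + K)^-1.
have K1 : 0 < 1 + K by lra.
have r00 : 0 < r0 by rewrite lt_min invr_gt0 K1 andbT; lra.
have [rd rK] : r0 <= d / 4 /\ r0 <= (1 + K)^-1 by rewrite !ge_min !lexx orbT.
apply: filterS (near_modulus z1 r00) => z2 z2r; apply: contrapT => /eqP w2.
have Uin z : modulus (z - z2) < 3 * r0 -> U z.
  move=> h; apply: dU; have := modulusD (z - z2) (z2 - z1).
  by rewrite (_ : z - z2 + (z2 - z1) = z - z1); [lra|ring].
have cw z : modulus (z - z2) < 3 * r0 -> {for z, continuous w}.
  by move=> /Uin Uz; exact: smooth_on_continuous sw Uz.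
have {}w2 : 0 < w z2.
  by rewrite lt_neqAle eq_sym w2; apply: (wP _ _).1; apply: Uin; rewrite subrr modulus0; lra.
pose r1 := modulus (z1 - z2); have r1r : r1 < r0 by rewrite /r1 modulusBC.
pose A := [set z : C | modulus (z - z2) <= r1] `&` [set z | w z = 0].
have cA : compact A.
  apply: compact_zeros; [exact: norm_hausdorff|exact: compact_disc|] => x /= xr.
  by apply: cw; apply: le_lt_trans xr _; lra.
have A0 : A !=set0 by exists z1; split => /=.
have [z3 [/= z3r w3] z3P] := compact_min A0 cA (fun x _ => @continuous_dist_at z2 x).
pose rho := modulus (z3 - z2).
have rho0 : 0 < rho.
  by rewrite modulus_gt0 subr_eq0; apply/eqP => z32; move: w2; rewrite -z32 w3 ltxx.
have wpos z : modulus (z - z2) < rho -> 0 < w z.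
  move=> h; rewrite lt_neqAle (wP _ _).1 ?andbT; last by apply: Uin; rewrite -/rho in z3r; lra.
  rewrite eq_sym; apply/eqP => wz; have : A z by split=> //=; rewrite -/rho in z3r; lra.
  by move=> /z3P; rewrite -/rho; lra.
have D0 : [set z : C | modulus (z - z2) <= rho / 2] !=set0 by exists z2; rewrite /= subrr modulus0; lra.
have [|z4 /= z4r z4P] := compact_min D0 (@compact_disc R z2 (rho / 2)) (f := w).
  by move=> x /= xr; apply: cw; rewrite -/rho in z3r; lra.
have w4 : 0 < w z4 by apply: wpos; lra.
have r20 : 0 < rho ^+ 2 by rewrite exprn_gt0.
pose e := w z4 * rho ^+ 2 / 3; have e0 : 0 < e by rewrite divr_gt0// mulr_gt0.
have Kr : K * rho ^+ 2 < 4.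
  have r0K : K * r0 <= 1.
    have : (1 + K) * r0 <= 1 by rewrite -ler_pdivlMl// mulr1.
    by lra.
  have rr : rho <= 1 by apply: le_trans (_ : (1 + K)^-1 <= _); [rewrite -/rho in z3r; lra|rewrite invf_le1//; lra].
  have : K * rho * rho <= 1 * 1.
    apply: ler_pM => //; [by rewrite mulr_ge0// ltW|exact: ltW|].
    by apply: le_trans r0K; rewrite ler_wpM2l//; rewrite -/rho in z3r; lra.
  by rewrite expr2 mulrA; lra.
have cmp := annulus_comparison oU sw rho0 K0 Kr e0.
have {cmp} cmp : forall z, rho / 2 <= modulus (z - z2) <= rho -> e * ((sqmod (z - z2))^-1 - (rho ^+ 2)^-1) <= w z.
  apply: cmp => z zr.
    by have Uz : U z by [apply: Uin; rewrite -/rho in z3r; lra]; split=> //; exact: wP.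
  rewrite (_ : 3 * e / _ = w z4) ?z4P// /e; field; exact: lt0r_neq0.
(* along the segment towards z2, the lower bound has a positive slope at z3,
   whereas w has a minimum there *)
have Uz3 : U z3 by apply: Uin; rewrite -/rho in z3r *; lra.
have := smooth_on_rdiff oU sw Uz3; set a := partial 0 w z3; set b := partial 1 w z3 => df.
pose u := z2 - z3; have um : modulus u = rho by rewrite /u modulusBC.
pose l := a * complex.Re u + b * complex.Im u.
have ee : 0 < e / (2 * rho ^+ 3) by rewrite divr_gt0// mulr_gt0// exprn_gt0.
have [dd dd0 ddP] := df _ ee.
have line (t : R) : `|t| * rho < dd -> `|w (z3 + t%:C * u) - l * t| <= e / (2 * rho ^+ 2) * `|t|.
  move=> td; have := ddP (z3 + t%:C * u); rewrite (addrC z3) addrK modulusM modulus_real um => /(_ td).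
  rewrite w3 subr0 (_ : a * _ + b * _ = l * t); last first.
    by rewrite /l; case: (u) => ux uy /=; ring.
  move/le_trans; apply; rewrite le_eqVlt; apply/orP; left; apply/eqP.
  by field; exact: lt0r_neq0.
pose t := Num.min (1 / 2) (dd / (2 * rho)).
have t0 : 0 < t by rewrite lt_min divr_gt0// divr_gt0// mulr_gt0.
have [t1 t2] : t <= 1 / 2 /\ t <= dd / (2 * rho) by rewrite !ge_min !lexx orbT.
have trd : t * rho < dd.
  have : t * (2 * rho) <= dd by rewrite -ler_pdivlMr// mulr_gt0.
  by have := mulr_gt0 t0 rho0; lra.
have lp := line t; rewrite gtr0_norm// in lp; have {lp} := lp trd; rewrite ler_norml => /andP[_ lp].
have ln := line (- t); rewrite normrN gtr0_norm// in ln; have {ln} := ln trd; rewrite ler_norml => /andP[_ ln].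
have wn : 0 <= w (z3 + (- t)%:C * u).
  apply: (wP _ _).1; apply: Uin.
  rewrite (_ : _ - z2 = - (1 + t)%:C * u); last by rewrite /u (rmorphN (real_complex R)) real_complexD; ring.
  rewrite modulusM modulusN modulus_real um ger0_norm; last by lra.
  have : t * rho <= 1 / 2 * rho by rewrite ler_wpM2r// ltW.
  by rewrite -/rho in z3r; lra.
have E : modulus (z3 + t%:C * u - z2) = (1 - t) * rho.
  rewrite (_ : _ - z2 = - (1 - t)%:C * u); last by rewrite /u real_complexB; ring.
  by rewrite modulusM modulusN modulus_real um ger0_norm//; lra.
have := cmp (z3 + t%:C * u); rewrite -modulus_sqr E.
have -> : rho / 2 <= (1 - t) * rho <= rho.
  have h1 := ler_wpM2r (ltW rho0) t1; have h2 := mulr_gt0 t0 rho0.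
  by apply/andP; split; lra.
move=> /(_ isT).
have -> : ((1 - t) * rho) ^- 2 - (rho ^+ 2)^-1 = (2 * t + (3 * t ^+ 2 - 2 * t ^+ 3) / (1 - t) ^+ 2) / rho ^+ 2.
  have t3 : 1 - t != 0 by rewrite gt_eqF//; lra.
  by field; rewrite (lt0r_neq0 rho0) t3.
have p1 : 0 <= (3 * t ^+ 2 - 2 * t ^+ 3) / (1 - t) ^+ 2.
  rewrite divr_ge0 ?sqr_ge0// (_ : _ - _ = t ^+ 2 * (3 - 2 * t)); last by ring.
  by rewrite mulr_ge0 ?sqr_ge0//; lra.
have q0 : 0 < e / rho ^+ 2 by rewrite divr_gt0.
have -> : e * ((2 * t + (3 * t ^+ 2 - 2 * t ^+ 3) / (1 - t) ^+ 2) / rho ^+ 2) =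
   e / rho ^+ 2 * (2 * t) + e / rho ^+ 2 * ((3 * t ^+ 2 - 2 * t ^+ 3) / (1 - t) ^+ 2) by ring.
have p2 := mulr_ge0 (ltW q0) p1.
have p3 := mulr_gt0 q0 t0.
have eh : e / (2 * rho ^+ 2) * t = e / rho ^+ 2 * t / 2 by field; exact: lt0r_neq0.
by rewrite eh in lp ln; lra.
Qed.

End StrongMaximumPrinciple.

Section RemovableMaximum.
Variable R : realType.
Local Notation C := (cplx R).

(** A bounded subharmonic function on a punctured disc is bounded by its values
   on the outer circle: compare with small multiples of a strictly
   superharmonic function that tends to infinity at the puncture. *)
Lemma puncture_bound (U : set C) (f : C -> R) c (r0 B M : R) : open U -> smooth_on U f -> 0 < r0 ->
  (forall z, 0 < modulus (z - c) <= r0 -> [/\ U z, 0 <= lap f z & f z <= B]) ->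
  (forall z, modulus (z - c) = r0 -> f z <= M) ->
  forall z, 0 < modulus (z - c) <= r0 -> f z <= M.
Proof.
move=> oU sf r00 fP fM z zr.
pose F (t : R) := - ln t - t + (ln (r0 ^+ 2) + r0 ^+ 2).
have r20 : 0 < r0 ^+ 2 by rewrite exprn_gt0.
pose h (z : C) := F (sqmod (z - c)).
have sq y : 0 < modulus (y - c) <= r0 -> 0 < sqmod (y - c) <= r0 ^+ 2.
  move=> /andP[h1 h2]; rewrite -modulus_sqr exprn_gt0//=.
  by rewrite lerXn2r// nnegrE ?modulus_ge0// ltW.
have h0 y : 0 < modulus (y - c) <= r0 -> 0 <= h y.
  move=> /sq/andP[h1 h2]; rewrite /h /F; have : ln (sqmod (y - c)) <= ln (r0 ^+ 2) by rewrite ler_ln ?posrE.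
  lra.
have laph y : 0 < modulus (y - c) <= r0 -> has_lap h y (- 4).
  move=> yr; have /andP[q0 _] := sq y yr.
  have yc : y != c by move: yr => /andP[+ _]; rewrite modulus_gt0 subr_eq0.
  have dF (t : R) : 0 < t -> is_derive t (1 : R) F (- t^-1 - 1).
    move=> t0; have i := is_derive_id t (1 : R).
    have := is_deriveD (is_deriveB (is_deriveN (is_derive1_ln t0)) i) (is_derive_cst (ln (r0 ^+ 2) + r0 ^+ 2) t (1 : R)).
    by rewrite addr0.
  have dF1 (t : R) : 0 < t -> is_derive t (1 : R) (fun t : R => - t^-1 - 1) (t ^- 2).
    move=> t0; have i := is_derive_id t (1 : R).
    apply: (is_derive_eq (is_deriveB (is_deriveN (@is_deriveV R id t _ 1 (lt0r_neq0 t0) i)) (is_derive_cst (1 : R) t (1 : R)))).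
    by rewrite /GRing.scale /= subr0 mulr1 opprK.
  have := has_lap_radial yc dF (dF1 _ q0).
  rewrite (_ : 4 * _ = - 4) //; field; exact: lt0r_neq0.
apply/ler_addgt0Pr => e e0.
have hz := h0 z zr; have hz1 : 0 < h z + 1 by lra.
pose d := e / (h z + 1); have d0 : 0 < d by rewrite divr_gt0.
have de : d * h z <= e.
  by rewrite /d mulrAC ler_pdivrMr//; rewrite ler_wpM2l ?ltW//; lra.
suff : f z - d * h z <= M by lra.
pose T := `|B - M| / d + `|ln (r0 ^+ 2)|.
have zr0 : 0 < modulus (z - c) by case/andP: zr.
pose n := Num.min (modulus (z - c)) (expR (- T)).
have n0 : 0 < n by rewrite lt_min zr0 expR_gt0.
have [n1 n2] : n <= modulus (z - c) /\ n <= expR (- T) by rewrite !ge_min !lexx orbT.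
have zA : [set w : C | n <= modulus (w - c) <= r0] z by rewrite /= n1; case/andP: zr.
pose v (y : C) := f y + - d * h y.
have inA y : n <= modulus (y - c) <= r0 -> 0 < modulus (y - c) <= r0.
  by move=> /andP[h1 ->]; rewrite (lt_le_trans n0 h1).
have cv y : [set w : C | n <= modulus (w - c) <= r0] y -> {for y, continuous v}.
  move=> /= /inA yr; have [Uy _ _] := fP y yr; have /andP[q0 _] := sq y yr.
  have sE : (fun y : C => sqmod (y - c)) = (fun y => modulus (y - c) * modulus (y - c)).
    by apply/funext => u; rewrite -modulus_sqr expr2.
  have cs : {for y, continuous (fun y : C => sqmod (y - c))}.
    by rewrite sE; exact: (continuousM (@continuous_dist_at R c y) (@continuous_dist_at R c y)).
  have cl : {for y, continuous (fun y : C => ln (sqmod (y - c)))}.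
    by apply: (@continuous_comp _ _ _ (fun y : C => sqmod (y - c)) (@ln R)) => //; exact: continuous_ln.
  have ch : {for y, continuous h}.
    exact: (continuousD (continuousB (continuousN cl) cs) (@continuous_cst_at R (ln (r0 ^+ 2) + r0 ^+ 2) y)).
  exact: (continuousD (smooth_on_continuous sf Uy) (continuousM (@continuous_cst_at R (- d) y) ch)).
have [y /= yA ymax] := compact_max (ex_intro _ z zA) (@compact_annulus R c n r0) cv.
suff vy : v y <= M by move: vy (ymax z zA); rewrite /v !mulNr; lra.
have yr := inA y yA; have [Uy ly By] := fP y yr; have /andP[q0 q1] := sq y yr.
rewrite leNgt; apply/negP => vM.
have /andP[y1 y2] := yA.
have lo : n < modulus (y - c).
  rewrite lt_neqAle y1 andbT; apply/eqP => ny.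
  have hT : T - `|ln (r0 ^+ 2)| <= h y.
    have nq : sqmod (y - c) = n ^+ 2 by rewrite ny modulus_sqr.
    rewrite /h /F nq (lnXn 2 n0) mulr2n.
    have : ln n <= - T by rewrite -[- T]expRK ler_ln// posrE expR_gt0.
    have : - `|ln (r0 ^+ 2)| <= ln (r0 ^+ 2) by rewrite lerNl ler_normr lexx orbT.
    have : 0 <= T by rewrite addr_ge0// divr_ge0// ltW.
    by rewrite nq in q1; lra.
  have : d * (`|B - M| / d) <= d * h y by apply: (ler_wpM2l (ltW d0)); move: hT; rewrite /T addrK.
  have -> : d * (`|B - M| / d) = `|B - M| by field; exact: lt0r_neq0.
  have := ler_norm (B - M).
  by move: vM; rewrite /v mulNr; lra.
have hi : modulus (y - c) < r0.
  rewrite lt_neqAle y2 andbT; apply/eqP => yr0.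
  have := fM y yr0; have := mulr_ge0 (ltW d0) (h0 y yr).
  by move: vM; rewrite /v mulNr; lra.
have nm : \forall u \near y, v u <= v y.
  have d1 : 0 < Num.min (modulus (y - c) - n) (r0 - modulus (y - c)) by rewrite lt_min !subr_gt0 lo.
  apply: filterS (near_modulus y d1) => u; rewrite lt_min => /andP[u1 u2]; apply: ymax.
  have := modulusB (y - c) (u - c); have := modulusB (u - c) (y - c).
  rewrite (_ : u - c - (y - c) = u - y); last by ring.
  rewrite (_ : y - c - (u - c) = - (u - y)); last by ring.
  by rewrite modulusN => h1 h2; apply/andP; split; lra.
by have := has_lap_max (has_lapD (- d) (has_lap_smooth oU sf Uy) (laph y yr)) nm; lra.
Qed.

End RemovableMaximum.

(** * Charts and the punctured surface *)
Section Charts.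
Variables (R : realType) (X : topologicalType).
Local Notation C := (cplx R).
Implicit Types (c : chart R X) (x : X) (z : C).

Lemma chart_inv c z : (cmap c @` cdom c) z -> cdom c (cinv c z) /\ cmap c (cinv c z) = z.
Proof. by move=> [x dx <-]; rewrite cmapK. Qed.

Lemma chart_mem c x : cdom c x -> (cmap c @` cdom c) (cmap c x).
Proof. by move=> dx; exists x. Qed.

Lemma crangeP c (A : set X) z : crange c A z <-> (cmap c @` cdom c) z /\ A (cinv c z).
Proof.
split=> [[x [dx Ax] <-]|[/[dup] rz /chart_inv[dz zz] Az]].
  by rewrite cmapK//; split=> //; exact: chart_mem.
by exists (cinv c z).
Qed.

Lemma crange_mem c (A : set X) x : cdom c x -> A x -> crange c A (cmap c x).
Proof. by move=> dx Ax; exists x. Qed.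

Lemma near_cinv c x (Q : set X) : cdom c x -> (\forall y \near x, Q y) ->
  \forall z \near cmap c x, (cmap c @` cdom c) z /\ Q (cinv c z).
Proof.
move=> dx Qx; have rx := chart_mem dx.
have h1 := open_near (@crange_open R X c) rx.
have h2 : \forall z \near cmap c x, Q (cinv c z).
  by apply: (cinv_continuous rx); rewrite cmapK.
by apply: filterS2 h1 h2.
Qed.

Lemma near_cmap c x (Q : set C) : cdom c x -> (\forall z \near cmap c x, Q z) ->
  \forall y \near x, cdom c y /\ Q (cmap c y).
Proof.
move=> dx Qx; have h1 := open_near (@cdom_open R X c) dx.
have h2 : \forall y \near x, Q (cmap c y) by exact: (cmap_continuous dx).
by apply: filterS2 h1 h2.
Qed.

Lemma open_crange c (A : set X) : open A -> open (crange c A).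
Proof.
move=> oA; rewrite openE => z /crangeP[rz Az]; have [dz zz] := chart_inv rz.
have := near_cinv dz (open_near oA Az); rewrite zz.
by apply: filterS => w [h1 h2]; apply/crangeP.
Qed.

Lemma near_chart c x (Q : set X) : cdom c x ->
  (\forall z \near cmap c x, Q (cinv c z)) -> \forall y \near x, Q y.
Proof.
move=> dx /(near_cmap dx); apply: filterS => y [dy]; by rewrite cmapK.
Qed.

End Charts.

Section Segments.
Variable R : realType.
Local Notation C := (cplx R).

Lemma unit_interval_clopen (P : R -> Prop) : P 0 ->
  (forall t, 0 <= t <= 1 -> P t -> \forall s \near t, P s) ->
  (forall t, 0 <= t <= 1 -> ~ P t -> \forall s \near t, ~ P s) ->
  forall t, 0 <= t <= 1 -> P t.
Proof.
move=> P0 Po Pc.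
have I0 : [set` `[0 : R, 1]] 0 by rewrite /= in_itv /= lexx ler01.
have conn := @segment_connected R 0 1.
have : [set` `[0 : R, 1]] `&` [set t | \forall s \near t, P s] = [set` `[0 : R, 1]].
  apply: conn.
  - by exists 0; split=> //=; apply: Po => //; rewrite lexx ler01.
  - exists [set t | \forall s \near t, P s] => //.
    by rewrite openE => t /= Pt; exact: (nbhs_interior Pt).
  - exists (~` [set t | \forall s \near t, ~ P s]).
      apply: open_closedC; rewrite openE => t /= Pt; exact: (nbhs_interior Pt).
    apply/seteqP; split=> t [It Pt]; split=> //=.
      by move=> Pn; have [] := nbhs_singleton Pn; exact: nbhs_singleton Pt.
    move: It => /=; rewrite in_itv /= => It.
    by apply: (Po _ It); apply: contrapT => /(Pc _ It).
move=> E t tI; have : [set` `[0 : R, 1]] t by rewrite /= in_itv.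
by rewrite -E => -[_ /= /nbhs_singleton].
Qed.

Lemma continuous_segment (a b : C) (t : R) :
  {for t, continuous (fun s : R => a + s%:C * (b - a))}.
Proof.
apply: cvgD; first exact: cvg_cst.
by apply: cvgM; [exact: continuous_real_complex|exact: cvg_cst].
Qed.

Lemma segment_clopen (P : set C) (a b : C) : P a ->
  (forall t : R, 0 <= t <= 1 -> P (a + t%:C * (b - a)) -> \forall z \near a + t%:C * (b - a), P z) ->
  (forall t : R, 0 <= t <= 1 -> ~ P (a + t%:C * (b - a)) -> \forall z \near a + t%:C * (b - a), ~ P z) ->
  P b.
Proof.
move=> Pa Po Pc.
have := @unit_interval_clopen (fun t => P (a + t%:C * (b - a))).
rewrite mul0r addr0 => /(_ Pa) H.
have -> : b = a + (1 : R)%:C * (b - a) by rewrite mul1r addrC subrK.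
apply: H; last by rewrite ler01 lexx.
  by move=> t tI Pt; exact: (continuous_segment (Po t tI Pt)).
by move=> t tI Pt; exact: (continuous_segment (Pc t tI Pt)).
Qed.

(** A punctured disc is connected: two of its points can be joined through a
   third one that is on a line through the centre with neither of them. *)
Lemma punctured_disc_clopen (P : set C) (c : C) (r : R) :
  (forall z, 0 < modulus (z - c) < r -> P z -> \forall w \near z, P w) ->
  (forall z, 0 < modulus (z - c) < r -> ~ P z -> \forall w \near z, ~ P w) ->
  forall a b, 0 < modulus (a - c) < r -> 0 < modulus (b - c) < r -> P a -> P b.
Proof.
move=> Po Pc.
have step (a b : C) : 0 < modulus (a - c) < r -> 0 < modulus (b - c) < r ->
    (complex.Re (a - c) * complex.Im (b - c) != complex.Im (a - c) * complex.Re (b - c)) -> P a -> P b.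
  move=> aD bD ab Pa.
  have seg (t : R) : 0 <= t <= 1 -> 0 < modulus (a + t%:C * (b - a) - c) < r.
    move=> /andP[t0 t1]; have -> : a + t%:C * (b - a) - c = (1 - t)%:C * (a - c) + t%:C * (b - c).
      by rewrite real_complexB; ring.
    apply/andP; split.
      rewrite modulus_gt0; apply: contraNneq ab => /eqP; rewrite eq_complex /=.
      case: (a - c) (b - c) => a1 a2 [b1 b2] /= /andP[/eqP e1 /eqP e2]; apply/eqP.
      have f1 : (1 - t) * a1 + t * b1 = 0 by rewrite -[RHS]e1; ring.
      have f2 : (1 - t) * a2 + t * b2 = 0 by rewrite -[RHS]e2; ring.
      have g1 : (1 - t) * (a1 * b2 - a2 * b1) = 0.
        rewrite (_ : _ * _ = ((1 - t) * a1 + t * b1) * b2 - ((1 - t) * a2 + t * b2) * b1); last by ring.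
        by rewrite f1 f2; ring.
      have g2 : t * (a1 * b2 - a2 * b1) = 0.
        rewrite (_ : _ * _ = ((1 - t) * a2 + t * b2) * a1 - ((1 - t) * a1 + t * b1) * a2); last by ring.
        by rewrite f1 f2; ring.
      have : (1 - t) * (a1 * b2 - a2 * b1) + t * (a1 * b2 - a2 * b1) = a1 * b2 - a2 * b1 by ring.
      by rewrite g1 g2; lra.
    apply: le_lt_trans (modulusD _ _) _; rewrite !modulusM !modulus_real !ger0_norm//; last by lra.
    move: aD bD => /andP[_ h1] /andP[_ h2].
    have [t00|t00] := leP t 0; first by rewrite (_ : t = 0); [lra|lra].
    have h3 : t * modulus (b - c) < t * r by rewrite ltr_pM2l.
    have h4 : (1 - t) * modulus (a - c) <= (1 - t) * r by apply: ler_wpM2l; [lra|exact: ltW].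
    by lra.
  by apply: (segment_clopen Pa) => t tI; [apply: Po|apply: Pc]; exact: seg.
move=> a b aD bD Pa.
have r0 : 0 < r by case/andP: aD => h1 h2; exact: lt_trans h1 h2.
pose q k : C := (r / 4)%:C * (if k is 0%N then 1 else if k is 1%N then 'i else 1 + 'i).
have qD k : 0 < modulus (c + q k - c) < r.
  have -> : c + q k - c = q k by rewrite addrC addKr.
  have m12 : modulus (1 + 'i : C) <= 2.
    by apply: le_trans (modulusD _ _) _; rewrite modulus1 modulus_i.
  have m10 : 0 < modulus (1 + 'i : C).
    by rewrite modulus_gt0 eq_complex /= addr0 oner_eq0.
  rewrite /q modulusM modulus_real gtr0_norm; last by lra.
  case: k => [|[|k]]; rewrite ?modulus1 ?modulus_i ?mulr1; try by apply/andP; split; lra.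
  have := mulr_gt0 r0 m10; have := ler_wpM2l (ltW r0) m12.
  by move=> h1 h2; apply/andP; split; lra.
suff [k k1 k2] : exists2 k, complex.Re (a - c) * complex.Im (c + q k - c) != complex.Im (a - c) * complex.Re (c + q k - c) &
    complex.Re (c + q k - c) * complex.Im (b - c) != complex.Im (c + q k - c) * complex.Re (b - c).
  exact: (step _ _ (qD k) bD k2 (step _ _ aD (qD k) k1 Pa)).
have qE k : c + q k - c = q k by rewrite addrC addKr.
have {aD} : a - c != 0 by rewrite -modulus_gt0; case/andP: aD.
have {bD} : b - c != 0 by rewrite -modulus_gt0; case/andP: bD.
have r4 : r / 4 != 0 by rewrite gt_eqF// divr_gt0.
case: (a - c) (b - c) => a1 a2 [b1 b2]; rewrite !eq_complex /= => bn an.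
have red k (v1 v2 : R) : complex.Re (q k) = r / 4 * v1 -> complex.Im (q k) = r / 4 * v2 ->
   a1 * v2 != a2 * v1 -> v1 * b2 != v2 * b1 ->
   exists2 k, a1 * complex.Im (c + q k - c) != a2 * complex.Re (c + q k - c) &
     complex.Re (c + q k - c) * b2 != complex.Im (c + q k - c) * b1.
  move=> e1 e2 h1 h2; exists k; rewrite qE e1 e2.
    by rewrite mulrCA [X in _ != X]mulrCA (inj_eq (mulfI r4)).
  by rewrite -[X in X != _]mulrA -[X in _ != X]mulrA (inj_eq (mulfI r4)).
have e1 : complex.Re (q 0%N) = r / 4 * 1 by rewrite /q /=; ring.
have e1' : complex.Im (q 0%N) = r / 4 * 0 by rewrite /q /=; ring.
have e2 : complex.Re (q 1%N) = r / 4 * 0 by rewrite /q /=; ring.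
have e2' : complex.Im (q 1%N) = r / 4 * 1 by rewrite /q /=; ring.
have e3 : complex.Re (q 2%N) = r / 4 * 1 by rewrite /q /=; ring.
have e3' : complex.Im (q 2%N) = r / 4 * 1 by rewrite /q /=; ring.
have R0 (h1 : a2 != 0) (h2 : b2 != 0) := red 0%N 1 0 e1 e1' (ltac:(by rewrite mulr0 mulr1 eq_sym)) (ltac:(by rewrite mul1r mul0r)).
have R1 (h1 : a1 != 0) (h2 : b1 != 0) := red 1%N 0 1 e2 e2' (ltac:(by rewrite mulr0 mulr1)) (ltac:(by rewrite mul1r mul0r eq_sym)).
have R2 (h1 : a1 != a2) (h2 : b1 != b2) := red 2%N 1 1 e3 e3' (ltac:(by rewrite !mulr1)) (ltac:(by rewrite !mul1r eq_sym)).
have [a20|a20] := eqVneq a2 0; have [b20|b20] := eqVneq b2 0; last exact: R0.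
- by rewrite a20 eqxx andbT in an; rewrite b20 eqxx andbT in bn; exact: R1.
- have a10 : a1 != 0 by move: an; rewrite a20 eqxx andbT.
  have [b10|] := eqVneq b1 0; last exact: R1.
  by apply: R2; rewrite ?a20 ?b10// eq_sym.
- have b10 : b1 != 0 by move: bn; rewrite b20 eqxx andbT.
  have [a10|a10] := eqVneq a1 0; last exact: R1.
  by apply: R2; rewrite ?b20 ?a10// eq_sym.
Qed.

End Segments.

Section PuncturedSurface.
Variables (R : realType) (X : topologicalType).
Local Notation C := (cplx R).
Variable S : compact_riemann_surface R X.
Variables (m : nat) (p : 'I_m -> X).

Lemma closed_finite_image (P : set 'I_m) : closed (p @` P).
Proof.
apply: (accessible_finite_set_closed.1 (hausdorff_accessible (surface_hausdorff S))).
by apply: finite_image; exact: finite_finset.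
Qed.

Lemma open_punctured : open (punctured p).
Proof. by rewrite /punctured openC; exact: (@closed_finite_image [set: 'I_m]). Qed.

Lemma near_puncture i : \forall x \near p i, x != p i -> punctured p x.
Proof.
have oI := closed_openC (@closed_finite_image [set k | p k != p i]).
have Ii : (~` (p @` [set k | p k != p i])) (p i) by move=> [k /= kp ki]; rewrite ki eqxx in kp.
apply: filterS (open_near oI Ii) => x xP xi [k _ kx]; apply: xP; exists k => //=.
by rewrite kx.
Qed.

Lemma puncture_disc i (c : chart R X) : cdom c (p i) -> exists2 r : R, 0 < r &
  forall z, modulus (z - cmap c (p i)) < r -> (cmap c @` cdom c) z /\
    (z != cmap c (p i) -> punctured p (cinv c z)).
Proof.
move=> dp; have /nbhs_modulus[r r0 rP] := near_cinv dp (near_puncture i).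
exists r => // z /rP[rz H]; split=> // zp; apply: H; apply: contraNneq zp => zi.
by rewrite -(chart_inv rz).2 zi.
Qed.

Lemma punctured_clopen (P : set X) :
  (forall x, punctured p x -> P x -> \forall y \near x, P y) ->
  (forall x, punctured p x -> ~ P x -> \forall y \near x, ~ P y) ->
  forall x0, punctured p x0 -> P x0 -> forall x, punctured p x -> P x.
Proof.
move=> Po Pc x0 px0 Px0.
pose O : set X := [set x : X | \forall y \near x, punctured p y -> P y].
have oO : open O.
  by rewrite openE => x Ox; exact: (nbhs_interior Ox).
have O1 y : O y -> punctured p y -> P y by move=> /nbhs_singleton.
have cO : open (~` O).
  rewrite openE => x nOx; rewrite /interior.
  have [px|npx] := pselect (punctured p x).
    have nPx : ~ P x.
      by move=> Px; apply: nOx; apply: filterS (Po x px Px) => y Py _.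
    apply: filterS2 (Pc x px nPx) (open_near open_punctured px) => y nPy py Oy.
    exact: nPy (O1 y Oy py).
  have {npx} [i _ ix] : range p x by apply: contrapT.
  subst x; have [c _ dc] := atlas_cover S (p i).
  have [r r0 rP] := puncture_disc dc.
  pose D (z : C) := 0 < modulus (z - cmap c (p i)) < r.
  have Dp z : D z -> (cmap c @` cdom c) z /\ punctured p (cinv c z).
    by move=> /andP[z0 /rP[rz H]]; split=> //; apply: H; rewrite modulus_gt0 subr_eq0 in z0.
  have nP z : D z -> ~ P (cinv c z).
    move=> Dz Pz; apply: nOx.
    have all w : D w -> P (cinv c w).
      move=> Dw; apply: (@punctured_disc_clopen R (fun w => P (cinv c w)) _ r _ _ z w Dz Dw Pz).
        move=> u /Dp[ru pu] Pu; have [du uu] := chart_inv ru.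
        by have := near_cinv du (Po _ pu Pu); rewrite uu; apply: filterS => v [].
      move=> u /Dp[ru pu] Pu; have [du uu] := chart_inv ru.
      by have := near_cinv du (Pc _ pu Pu); rewrite uu; apply: filterS => v [].
    apply: filterS (near_cmap dc (near_modulus (cmap c (p i)) r0)) => y [dy yr] py.
    rewrite -(cmapK dy); apply: all; rewrite /D yr andbT modulus_gt0 subr_eq0.
    apply/eqP => e; apply: py; exists i => //.
    by rewrite -(cmapK dc) -e cmapK.
  apply: filterS (near_cmap dc (near_modulus (cmap c (p i)) r0)) => y [dy yr].
  have [-> //|yp] := eqVneq y (p i).
  have Dy : D (cmap c y).
    rewrite /D yr andbT modulus_gt0 subr_eq0; apply: contraNneq yp => e.
    by rewrite -(cmapK dc) -e cmapK.
  by move=> Oy; have [_ py] := Dp _ Dy; apply: (nP _ Dy); rewrite cmapK//; apply: O1 => //; rewrite cmapK in py.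
have : O = [set: X].
  apply: (surface_connected S).
  - by exists x0; apply: filterS (Po _ px0 Px0) => y Py _.
  - by exists O => //; rewrite setTI.
  - exists O; last by rewrite setTI.
    by rewrite -(setCK O); exact: open_closedC.
by move=> OT x px; apply: O1 => //; rewrite OT.
Qed.

Lemma compact_uniform (Q : R -> X -> Prop) :
  (forall (e e' : R) (x : X), 0 < e' <= e -> Q e x -> Q e' x) ->
  (forall x : X, exists2 e, 0 < e & \forall y \near x, Q e y) ->
  exists2 e, 0 < e & forall x, Q e x.
Proof.
move=> mono loc.
have := (compact_near_coveringP [set: X]).1 (surface_compact S) R (0^'+) Q _.
move=> H; have {H} : \forall e \near 0^'+, [set: X] `<=` Q e.
  apply: H => x _; have [e e0 eP] := loc x.
  exists ([set y | Q e y], [set i | 0 < i <= e]) => /=.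
    split=> //; near=> i; apply/andP; split; first by near: i; exact: nbhs_right_gt.
    by near: i; exact: nbhs_right_le.
  by move=> [y i] [/= Qy ie]; exact: mono Qy.
move=> H; have [e [eP e0]] : exists e : R, ([set: X] `<=` Q e) /\ 0 < e.
  have H2 : \forall e \near (0 : R)^'+, ([set: X] `<=` Q e) /\ 0 < e.
    by apply: filterS2 H (nbhs_right_gt 0).
  have PF : ProperFilter ((0 : R)^'+) := at_right_proper_filter 0.
  by have [e He] := @filter_ex _ _ PF _ H2; exists e.
by exists e => // x; exact: eP.
Unshelve. all: end_near. Qed.

Lemma has_lapP (f : C -> R) z l : has_lap f z l -> lap f z = l.
Proof.
move=> [f1 [f2 [hf ->]]]; suff E k : partial k (partial k f) z = f2 k by rewrite /lap !E.
have [nf df] := hf k.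
rewrite (near_partial (g := f1 k) k) ?(derdirP df)//.
by apply: filterS nf => w /derdirP.
Qed.

(** If the supremum is attained, it is so on a set that is open and closed by
   the strong maximum principle. Otherwise, by compactness, it could only be
   approached at a puncture, which [puncture_bound] excludes. *)
Lemma subharmonic_constant (f : X -> R) :
  (forall x, punctured p x -> exists c : chart R X, [/\ cdom c x,
     smooth_on (crange c (punctured p)) (f \o cinv c) &
     forall z, crange c (punctured p) z -> 0 <= lap (f \o cinv c) z]) ->
  (forall i, exists c : chart R X, [/\ cdom c (p i),
     smooth_on (crange c (punctured p)) (f \o cinv c) &
     forall z, crange c (punctured p) z -> 0 <= lap (f \o cinv c) z]) ->
  (forall i, exists B, \forall x \near p i, x != p i -> f x <= B) ->
  forall x y, punctured p x -> punctured p y -> f x = f y.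
Proof.
move=> cov covp bnd.
have op := open_punctured.
have cont x : punctured p x -> forall e, 0 < e -> \forall y \near x, `|f y - f x| < e.
  move=> px e e0; have [c [dx sf _]] := cov x px.
  have Uz := crange_mem dx px.
  have := (continuous_modulusP _ _).1 (smooth_on_continuous sf Uz) e e0.
  move=> [d d0 dP]; apply: (near_chart dx); apply: filterS (near_modulus _ d0) => z /dP.
  by rewrite /= cmapK.
suff const x0 : punctured p x0 -> exists M, forall x, punctured p x -> f x = M.
  by move=> x y px py; have [M MP] := const x px; rewrite !MP.
move=> px0.
pose Q (e : R) x := punctured p x -> f x <= e^-1.
have [e e0 eP] : exists2 e, 0 < e & forall x, Q e x.
  apply: compact_uniform.
    move=> e e' x /andP[e'0 ee'] H px; apply: le_trans (H px) _.
    by rewrite lef_pV2// posrE (lt_le_trans e'0).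
  have bd (B : R) : exists2 e, 0 < e & B <= e^-1.
    exists (`|B| + 1)^-1; first by rewrite invr_gt0 ltr_wpDl.
    by rewrite invrK; have := ler_norm B; lra.
  move=> x; have [px|npx] := pselect (punctured p x).
    have [e e0 eB] := bd (f x + 1); exists e => //.
    by apply: filterS (cont x px _ ltr01) => y; rewrite ltr_norml => /andP[_ h] _; lra.
  have {npx} [i _ ix] : range p x by apply: contrapT.
  subst x; have [B nB] := bnd i; have [e e0 eB] := bd B; exists e => //.
  apply: filterS nB => y H py; apply: le_trans eB; apply: H.
  by apply/eqP => yi; apply: py; exists i.
pose V := f @` punctured p; pose M := sup V.
have supV : has_sup V.
  split; first by exists (f x0), x0.
  by exists e^-1 => _ [x px <-]; exact: eP.
have fM x : punctured p x -> f x <= M.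
  by move=> px; apply: ub_le_sup; [case: supV|exists x].
exists M; have [[x1 px1 fx1]|nM] := pselect (exists2 x, punctured p x & f x = M).
  apply: (@punctured_clopen (fun x => f x = M) _ _ x1) => //.
    move=> x px fx; have [c [dx sf lf]] := cov x px.
    have oU := @open_crange R X c _ op; have Uz := crange_mem dx px.
    pose w z := M + -1 * (f \o cinv c) z.
    have sw : smooth_on (crange c (punctured p)) w := smoothD oU (smooth_cst oU M) (smoothZ oU (-1) sf).
    apply: (near_chart dx).
    have := @strong_minimum R _ w 0 (cmap c x) oU sw (lexx 0) _ Uz.
    move=> H; apply: filterS (H _ _) => [z|z Uz'|].
    - by rewrite /w /=; lra.
    - rewrite mul0r; split.
        by have [_ /fM] := (crangeP _ _ _).1 Uz'; rewrite /w /=; lra.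
      have hc : has_lap (fun=> M) z 0.
        exists (fun _ _ => 0), (fun=> 0); split; last by rewrite addr0.
        by move=> k; split; [exact: (@filterE _ (nbhs z) _ _ (fun w => derdir_cst k w M))|exact: derdir_cst].
      have := has_lapP (has_lapD (-1) hc (has_lap_smooth oU sf Uz')).
      by rewrite -/w => ->; have := lf z Uz'; lra.
    - by rewrite /w /= cmapK// fx; ring.
  move=> x px fx; have d0 : 0 < `|f x - M| by rewrite normr_gt0 subr_eq0; apply/eqP.
  by apply: filterS (cont x px _ d0) => y + fy; rewrite fy distrC ltxx.
pose Q' (e : R) x := punctured p x -> f x <= M - e.
have [e' e'0 e'P] : exists2 e, 0 < e & forall x, Q' e x.
  apply: compact_uniform.
    by move=> t t' x /andP[t'0 tt'] H px; apply: le_trans (H px) _; lra.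
  have lt x : punctured p x -> f x < M.
    by move=> px; rewrite lt_neqAle fM// andbT; apply/eqP => fx; apply: nM; exists x.
  move=> x; have [px|npx] := pselect (punctured p x).
    have d0 : 0 < (M - f x) / 2 by rewrite divr_gt0// subr_gt0 lt.
    exists ((M - f x) / 2) => //.
    by apply: filterS (cont x px _ d0) => y; rewrite ltr_norml => /andP[_ h] _; lra.
  have {npx} [i _ ix] : range p x by apply: contrapT.
  subst x; have [c [dc sf lf]] := covp i; have [B nB] := bnd i.
  have oU := @open_crange R X c _ op.
  have [r r0 rP] := puncture_disc dc.
  have /nbhs_modulus[d d0 dP] := near_cinv dc nB.
  pose r1 := Num.min r d / 2.
  have mn : 0 < Num.min r d by rewrite lt_min r0.
  have r10 : 0 < r1 by rewrite divr_gt0.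
  have [r1r r1d] : r1 < r /\ r1 < d.
    by split; apply: (@lt_le_trans _ _ (Num.min r d)); rewrite ?ge_min ?lexx ?orbT// /r1; lra.
  have inU z : 0 < modulus (z - cmap c (p i)) <= r1 -> crange c (punctured p) z.
    move=> /andP[z0 zr]; have [rz pz] := rP z (le_lt_trans zr r1r).
    by apply/crangeP; split=> //; apply: pz; rewrite modulus_gt0 subr_eq0 in z0.
  have A0 : [set w : C | r1 <= modulus (w - cmap c (p i)) <= r1] !=set0.
    exists (cmap c (p i) + r1%:C); rewrite /= addrC addKr modulus_real gtr0_norm//.
    by rewrite lexx.
  have Ac z : [set w : C | r1 <= modulus (w - cmap c (p i)) <= r1] z -> crange c (punctured p) z.
    by move=> /= /andP[h1 h2]; apply: inU; rewrite h2 (lt_le_trans r10 h1).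
  have [z1 /= z1A z1P] := compact_max A0 (@compact_annulus R _ r1 r1) (fun z Az => smooth_on_continuous sf (Ac z Az)).
  have fz1 : f (cinv c z1) < M by apply: lt; have /crangeP[] := Ac z1 z1A.
  exists (M - f (cinv c z1)); first by rewrite subr_gt0.
  apply: filterS (near_cmap dc (near_modulus (cmap c (p i)) r10)) => y [dy yr] py.
  rewrite opprB addrCA subrr addr0 -(cmapK dy).
  have y0 : 0 < modulus (cmap c y - cmap c (p i)).
    rewrite modulus_gt0 subr_eq0; apply/eqP => e1; apply: py; exists i => //.
    by rewrite -(cmapK dc) -e1 cmapK.
  apply: (@puncture_bound R _ (f \o cinv c) (cmap c (p i)) r1 B (f (cinv c z1)) oU sf r10).
  - move=> z zr; have Uz := inU z zr; split=> //; first exact: lf.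
    have /andP[z0 z1r] := zr; have [_ H] := dP z (le_lt_trans z1r r1d); apply: H.
    apply: contraTneq z0 => zi; have /crangeP[rz _] := Uz.
    by rewrite -(chart_inv rz).2 zi subrr modulus0 ltxx.
  - by move=> z zr; apply: z1P; rewrite /= zr lexx.
  - by rewrite y0 ltW.
have : M <= M - e'.
  by apply: ge_sup; [case: supV|move=> _ [x px <-]; exact: e'P].
lra.
Qed.

End PuncturedSurface.

Section PunctureEstimates.
Variable R : realType.
Local Notation C := (cplx R).

Lemma hform_real (al ga : R) (b x y : C) :
  hform (mx2 al%:C b (conjc b) ga%:C) (col2 x y) =
  (al * sqmod x + ga * sqmod y + 2 * complex.Re (conjc x * (b * y)))%:C.
Proof.
rewrite hform_mx2 (col2E x y).1 (col2E x y).2.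
case: x y b => [x1 x2] [y1 y2] [b1 b2]; apply/eqP; rewrite eq_complex /sqmod /=.
by apply/andP; split; apply/eqP; ring.
Qed.

Lemma sandwich_entries (G : 'M[R[i]]_2) (m1 m2 K : R) (z : C) : hermitian_posdef G ->
  0 < m1 -> 0 < m2 -> 0 < K -> z != 0 ->
  let T := mx2 1 0 0 z in
  (forall v : 'cV[R[i]]_2, K^-1%:C * hform (mx2 m1%:C 0 0 m2%:C) v <=
     hform ((map_mx conjc T)^T *m G *m T) v <= K%:C * hform (mx2 m1%:C 0 0 m2%:C) v) ->
  [/\ complex.Re (G 0 0) <= K * m1, m2 / K <= complex.Re (G 1 1) * sqmod z,
      complex.Re (G 1 1) * sqmod z <= K * m2 &
      m1 * m2 / K ^+ 2 <= (complex.Re (G 0 0) * complex.Re (G 1 1) - sqmod (G 0 1 : C)) * sqmod z].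
Proof.
move=> pG m10 m20 K0 z0 T H.
have [A0 E0 E1 E2 D] := hermitian_posdefE pG.
set al := complex.Re (G 0 0) in A0 E0 D *; set ga := complex.Re (G 1 1) in E1 D *.
set b := G 0 1 in E2 D *.
have GE : (map_mx conjc T)^T *m G *m T = mx2 al%:C (b * z) (conjc (b * z)) (ga * sqmod z)%:C.
  rewrite conj_mx2 [G]mx2E !mulmx_mx2 E0 E1 E2 -/b; rewrite conjc0 conjc1.
  rewrite !(mul1r, mul0r, mulr1, mulr0, add0r, addr0); congr mx2.
    by rewrite cjM mulrC.
  by rewrite real_complexM sqmodC; ring.
have {}H (x y : C) : K^-1 * (m1 * sqmod x + m2 * sqmod y) <=
    al * sqmod x + ga * sqmod z * sqmod y + 2 * complex.Re (conjc x * (b * z * y)) <=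
    K * (m1 * sqmod x + m2 * sqmod y).
  have := H (col2 x y); rewrite GE hform_real.
  have -> : hform (mx2 m1%:C 0 0 m2%:C) (col2 x y) = (m1 * sqmod x + m2 * sqmod y)%:C.
    have := @hform_real m1 m2 0 x y; rewrite conjc0 => ->.
    by rewrite mul0r mulr0 /= mulr0 addr0.
  have c1 := real_complexM K^-1 (m1 * sqmod x + m2 * sqmod y).
  have c2 := real_complexM K (m1 * sqmod x + m2 * sqmod y).
  by rewrite -[X in X <= _ <= _]c1 -[X in _ <= _ <= X]c2 !lecR.
have s1 : sqmod (1 : C) = 1 by rewrite /sqmod /= expr0n addr0 expr1n.
have s0 : sqmod (0 : C) = 0 by rewrite /sqmod /= expr0n addr0.
have /andP[h1 h2] : K^-1 * m1 <= al <= K * m1.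
  by have := H 1 0; rewrite s1 s0 (_ : complex.Re _ = 0) ?mulr0 ?mulr1 ?addr0// !mulr0.
have /andP[h3 h4] : K^-1 * m2 <= ga * sqmod z <= K * m2.
  by have := H 0 1; rewrite s1 s0 (_ : complex.Re _ = 0) ?mulr0 ?mulr1 ?addr0 ?add0r// conjc0 mul0r.
split=> //; first by rewrite mulrC.
have z20 : 0 < sqmod z by rewrite -modulus_sqr exprn_gt0// modulus_gt0.
pose x : C := - (b * z) / al%:C.
have aln : al%:C != 0 :> C by rewrite real_complex_neq0// gt_eqF.
have sx : sqmod x = sqmod (b : C) * sqmod z / al ^+ 2.
  rewrite /x sqmodM -[in LHS]modulus_sqr modulusN modulus_sqr sqmodM; congr (_ * _).
  by rewrite -modulus_sqr modulusV modulus_real gtr0_norm// exprVn.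
have cx : complex.Re (conjc x * (b * z * 1)) = - (sqmod (b : C) * sqmod z / al).
  have -> : conjc x * (b * z * 1) = - ((sqmod (b : C))%:C * (sqmod z)%:C * (al%:C)^-1).
    rewrite /x cjM cjV cjN cjM conjc_real !sqmodC.
    by move: aln; set cb := conjc b; set cz := conjc z; set l := al%:C; clearbody cb cz l => l0; field.
  by rewrite -real_complexV -!real_complexM.
have /andP[h5 _] := H x 1.
rewrite sx cx s1 !mulr1 in h5.
have key : al * (sqmod (b : C) * sqmod z / al ^+ 2) + ga * sqmod z + 2 * - (sqmod (b : C) * sqmod z / al) =
   (al * ga - sqmod (b : C)) * sqmod z / al by field; rewrite gt_eqF.
rewrite key in h5.
have p0 : 0 <= m1 * (sqmod (b : C) * sqmod z / al ^+ 2).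
  by rewrite mulr_ge0 ?(ltW m10)// divr_ge0 ?sqr_ge0// mulr_ge0 ?sqmod_ge0.
have h6 : m2 / K <= (al * ga - sqmod (b : C)) * sqmod z / al.
  by apply: le_trans h5; rewrite mulrC ler_wpM2l ?invr_ge0 ?(ltW K0)//; lra.
rewrite ler_pdivlMr// in h6; apply: le_trans h6.
have -> : m1 * m2 / K ^+ 2 = m2 / K * (K^-1 * m1) by field; rewrite gt_eqF.
by rewrite ler_wpM2l// divr_ge0// ltW.
Qed.

(** The metric |dz|^2 m2/(m1 |z|^2) of the model dominates |z|^-1 |dz|^2; this is where
   the weights below 1/2 enter. *)
Lemma model_ratio (t e : R) : 0 <= t < 2^-1 -> 0 < e -> exists2 d, 0 < d &
  forall r, 0 < r < d -> exists m1 m2 : R, [/\ 0 < m1, 0 < m2,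
    model_metric t r = mx2 m1%:C 0 0 m2%:C & m1 * r <= e * m2].
Proof.
move=> /andP[t0 t1] e0; rewrite /model_metric; have [t00|t00] := eqVneq t 0.
  pose d := Num.min 1 ((e / 16) ^+ 2); exists d.
    by rewrite lt_min ltr01 exprn_gt0// divr_gt0.
  move=> r /andP[r0]; rewrite lt_min => /andP[r1 rd].
  have l0 : ln r < 0 by apply: ln_lt0; rewrite r0.
  exists (- r * ln r), (- r / ln r); split=> //.
  - by rewrite mulNr oppr_gt0 pmulr_rlt0.
  - by rewrite mulNr oppr_gt0 pmulr_rlt0// invr_lt0.
  pose s := Num.sqrt (Num.sqrt r).
  have s0 : 0 < s by rewrite !sqrtr_gt0.
  have sE : r = s ^+ 4.
    by rewrite (_ : 4 = 2 * 2)%N// exprM !sqr_sqrtr ?sqrtr_ge0// ltW.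
  have l1 : - ln r < 4 * s^-1.
    have -> : - ln r = 4 * ln s^-1 by rewrite lnV ?posrE// sE (lnXn 4 s0) -mulr_natl; ring.
    by rewrite ltr_pM2l//; apply: ln_sublinear; rewrite invr_gt0.
  have se : s ^+ 2 <= e / 16.
    rewrite -(@ler_pXn2r _ 2)// ?nnegrE ?sqr_ge0//; last by rewrite divr_ge0// ltW.
    by rewrite -exprM -sE ltW.
  have l2 : ln r ^+ 2 <= 16 * s ^- 2.
    rewrite -sqrrN (_ : 16 * _ = (4 * s^-1) ^+ 2); last by rewrite exprMn exprVn -natrX.
    apply: lerXn2r (ltW l1); rewrite nnegrE; first by rewrite oppr_ge0 ltW.
    by rewrite mulr_ge0// invr_ge0 ltW.
  suff h : r * ln r ^+ 2 <= e.
    have -> : - r * ln r * r = (r * ln r ^+ 2) * (- r / ln r) by field; rewrite lt_eqF.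
    by rewrite ler_wpM2r// ltW// mulNr oppr_gt0 pmulr_rlt0// invr_lt0.
  have h1 := ler_wpM2l (ltW r0) l2; apply: le_trans h1 _.
  have -> : r * (16 * s ^- 2) = 16 * s ^+ 2 by rewrite {1}sE; field; rewrite gt_eqF.
  lra.
have tp : 0 < t by rewrite lt_neqAle eq_sym t00.
have f0 : fracpart t = t.
  by rewrite /fracpart (@floor_def _ t 0) ?subr0// t0/=; lra.
rewrite f0; have q0 : 0 < 1 - 2 * t by lra.
exists (e `^ (1 - 2 * t)^-1); first by rewrite powR_gt0.
move=> r /andP[r0 rd]; exists (r `^ (1 - t)), (r `^ (1 + t)); split; rewrite ?powR_gt0//.
have -> : r `^ (1 - t) * r = r `^ (1 - 2 * t) * r `^ (1 + t).
  rewrite -{2}[r]powRr1 ?ltW// -!powRD; last by rewrite (gt_eqF r0) implybT.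
    by congr (_ `^ _); ring.
  by rewrite (gt_eqF r0) implybT.
rewrite ler_wpM2r ?powR_ge0//.
have := @ge0_ler_powR R (1 - 2 * t) (ltW q0) r (e `^ (1 - 2 * t)^-1).
rewrite !nnegrE powR_ge0 (ltW r0) (ltW rd) => /(_ isT isT isT).
by rewrite -powRrM mulVf ?gt_eqF// powRr1// ltW.
Qed.

End PunctureEstimates.

(** * The Hermitian-Einstein metric on the surface *)
Section Jacobians.
Variables (R : realType) (X : topologicalType) (S : compact_riemann_surface R X).
Local Notation C := (cplx R).

Lemma transition_cder c d x : atlas S c -> atlas S d -> cdom c x -> cdom d x ->
  is_derive (cmap d x) (1 : C) (cmap c \o cinv d) (jac c d x).
Proof.
move=> ac ad dc dd; have [hol _] := atlas_compatible ac ad.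
exact: (holomorphic_cder hol (crange_mem dd dc)).
Qed.

Lemma jac_comp c d e x : atlas S c -> atlas S d -> atlas S e -> cdom c x -> cdom d x -> cdom e x ->
  jac c e x = jac c d x * jac d e x.
Proof.
move=> ac ad ae dc dd de.
have h1 := transition_cder ac ad dc dd; have h2 := transition_cder ad ae dd de.
have h1' : is_derive ((cmap d \o cinv e) (cmap e x)) (1 : C) (cmap c \o cinv d) (jac c d x).
  by rewrite /= cmapK.
apply: cder_derive1; apply: near_cder (cder_comp h1' h2).
have := near_cinv de (open_near (@cdom_open R X d) dd).
by apply: filterS => z [rz dz]; rewrite /= cmapK.
Qed.

Lemma jac_refl (c : chart R X) x : cdom c x -> jac c c x = 1.
Proof.
move=> dc; apply: cder_derive1; have := is_derive_id (cmap c x) (1 : C).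
apply: near_cder; have := open_near (@crange_open R X c) (chart_mem dc).
by apply: filterS => z /chart_inv[].
Qed.

Lemma jac_neq0 c d x : atlas S c -> atlas S d -> cdom c x -> cdom d x -> jac c d x != 0.
Proof.
move=> ac ad dc dd; have := jac_comp ac ad ac dc dd dc; rewrite jac_refl// => /eqP.
by apply: contraTneq => ->; rewrite mul0r oner_eq0.
Qed.

End Jacobians.

Section HermitianEinsteinSurface.
Variables (R : realType) (X : topologicalType).
Variables (S : compact_riemann_surface R X) (L : half_canonical S).
Variables (m : nat) (p : 'I_m -> X) (theta : 'I_m -> R).
Local Notation C := (cplx R).
Hypothesis p_inj : injective p.
Hypothesis theta_small : forall i, 0 <= theta i < 2^-1.
Variables (a : chart R X -> X -> C) (lam : chart R X -> X -> R) (A : R).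
Variable H : half_index L -> X -> 'M[R[i]]_2.
Hypothesis qa : quadratic_differential S (div_D p) a.
Hypothesis hH : hermitian_einstein p theta a lam A H.

Lemma floor_theta i : Num.floor (theta i) = 0.
Proof. by apply: floor_def; have /andP[-> /=] := theta_small i; lra. Qed.

Lemma fracpart_theta i : fracpart (theta i) = theta i.
Proof. by rewrite /fracpart floor_theta subr0. Qed.

Lemma slope_theta : slope theta = 0.
Proof.
rewrite /slope /parabolic_degree /degree_E0.
rewrite (eq_bigr (fun=> - 1)) => [|i _]; last by rewrite floor_theta.
rewrite [X in _ + X](eq_bigr (fun=> 1)) => [|i _]; last first.
  by rewrite /weight1 /weight2; field.
by rewrite !sumr_const card_ord mulNrn rmorphN rmorphMn /= addNr mul0r.
Qed.

Lemma div_D_punctured x : punctured p x -> div_D p x = 0.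
Proof.
move=> px; rewrite /div_D /point_divisor big_pred0// => i.
by apply/eqP => ix; apply: px; exists i.
Qed.

Lemma div_D_puncture i : div_D p (p i) = 1.
Proof.
rewrite /div_D /point_divisor (bigD1 i)//= big_pred0 ?addr0// => k.
by rewrite (inj_eq p_inj) andbN.
Qed.

Let op : open (punctured p) := open_punctured S p.

Lemma quadratic_holomorphic c : atlas S c -> holomorphic_on (crange c (punctured p)) (a c \o cinv c).
Proof.
move=> ac z /crangeP[rz pz]; have [_ /(_ c ac) hol _] := qa; apply: hol.
by apply/crangeP; split=> //; exact: div_D_punctured.
Qed.

Lemma quadratic_transition c d x : atlas S c -> atlas S d -> cdom c x -> cdom d x -> punctured p x ->
  a d x = a c x * jac c d x ^+ 2.
Proof. by move=> ac ad dc dd px; have [H1 _ _] := qa; apply: H1 => //; exact: div_D_punctured. Qed.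

Let U j := crange (half_chart (h := L) j) (punctured p).
Let G j z := H j (cinv (half_chart j) z).
Let aj j := a (half_chart (h := L) j) \o cinv (half_chart j).

Let oU j : open (U j). Proof. exact: open_crange. Qed.

Let pG j z : U j z -> hermitian_posdef (G j z).
Proof.
move=> /crangeP[/chart_inv[dz _] pz]; have [[h _ _] _ _] := hH; exact: h.
Qed.

Let sG j k l : csmooth_on (U j) (fun z => G j z k l).
Proof. by have [[_ _ h] _ _] := hH; exact: h. Qed.

Let eqG j z : U j z -> let phi := mx2 0 (aj j z) 2^-1 0 in
  chern_curvature (G j) z + (phi *m hadjoint (G j z) phi - hadjoint (G j z) phi *m phi) = 0.
Proof.
move=> /crangeP[/chart_inv[dz zz] pz]; have [_ h _] := hH.
have := h j _ dz pz; rewrite /= zz => ->.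
by rewrite slope_theta mul0r mulr0 mul0r raddf0.
Qed.

(** The quantities entering the estimates do not depend on the local frame. *)
Lemma metric_transition j k x : cdom (half_chart (h := L) j) x -> cdom (half_chart k) x -> punctured p x ->
  let s := sqmod (half_trans j k x) in
  [/\ s != 0, s ^+ 2 = sqmod (jac (half_chart j) (half_chart k) x),
      complex.Re (H j x 0 0) = s * complex.Re (H k x 0 0),
      complex.Re (H j x 1 1) = complex.Re (H k x 1 1) / s &
      sqmod (H j x 0 1 : C) = sqmod (H k x 0 1 : C)].
Proof.
move=> dj dk px; have [[pos trans _] _ _] := hH.
have := trans j k x dj dk px; set t := half_trans j k x => E; cbv zeta.
have tsq : t ^+ 2 = jac (half_chart j) (half_chart k) x by exact: half_trans_square.
have t0 : t != 0.
  have := jac_neq0 (half_chart_atlas j) (half_chart_atlas k) dj dk.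
  by rewrite -tsq expf_eq0.
have [A0 E0 E1 E2 _] := hermitian_posdefE (pos k x dk px).
have {E} E : H j x = (map_mx conjc (mx2 t 0 0 t^-1))^T *m H k x *m mx2 t 0 0 t^-1.
  by rewrite E; congr (_ *m _ *m _); apply/matrixP => u v; rewrite !mxE.
rewrite conj_mx2 conjc0 [H k x]mx2E !mulmx_mx2 !(mul0r, mulr0, add0r, addr0) in E.
have s0 : sqmod t != 0 by rewrite sqmod_eq0.
have ct0 : conjc t != 0 :> C by rewrite conjc_eq0.
rewrite E; split=> //.
- by rewrite -tsq -!modulus_sqr modulusX.
- rewrite mx2_00 E0 (_ : _ * _ * _ = (sqmod t * complex.Re (H k x 0 0))%:C)//.
  by rewrite real_complexM sqmodC; ring.
- rewrite mx2_11 E1 (_ : _ * _ * _ = (complex.Re (H k x 1 1) / sqmod t)%:C)//.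
  by rewrite real_complexM real_complexV sqmodC (cjV t); field; rewrite t0 ct0.
rewrite (_ : mx2 _ _ _ _ 0 1 = conjc t * H k x 0 1 * t^-1); last by rewrite mxE.
rewrite !sqmodM -[sqmod (conjc t)]modulus_sqr modulus_conj -[sqmod t^-1]modulus_sqr modulusV.
by rewrite mulrAC exprVn divff ?mul1r// sqrf_eq0 modulus_eq0.
Qed.

Definition defect_at x := defect (H (sval (cid (half_cover L x))) x).

Lemma defect_atE j x : cdom (half_chart j) x -> punctured p x -> defect_at x = defect (H j x).
Proof.
move=> dj px; rewrite /defect_at; case: cid => k dk /=.
have [s0 _ e0 e1 e2] := metric_transition dk dj px.
rewrite /defect e0 e1 e2; congr (_ / (_ - _)); by field.
Qed.

Definition ratio_at x := let j := sval (cid (half_cover L x)) in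
  4 * sqmod (a (half_chart j) x) * complex.Re (H j x 0 0) ^+ 2 / complex.Re (H j x 1 1) ^+ 2.

Lemma entries_gt0 j x : cdom (half_chart j) x -> punctured p x ->
  0 < complex.Re (H j x 0 0) /\ 0 < complex.Re (H j x 1 1).
Proof.
move=> dj px; have [[pos _ _] _ _] := hH.
have [A0 _ _ _ D] := hermitian_posdefE (pos j x dj px); split=> //.
by rewrite -(pmulr_rgt0 _ A0); apply: le_lt_trans D; exact: sqmod_ge0.
Qed.

Lemma ratio_atE j x : cdom (half_chart j) x -> punctured p x -> ratio_at x =
  4 * sqmod (a (half_chart j) x) * complex.Re (H j x 0 0) ^+ 2 / complex.Re (H j x 1 1) ^+ 2.
Proof.
move=> dj px; rewrite /ratio_at; case: cid => k dk /=.
have [s0 sj e0 e1 e2] := metric_transition dk dj px.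
have [A0 C0] := entries_gt0 dj px.
rewrite (quadratic_transition (half_chart_atlas k) (half_chart_atlas j) dk dj px).
rewrite sqmodM -[sqmod (_ ^+ 2)]modulus_sqr modulusX modulus_sqr -sj e0 e1.
by field; rewrite s0 gt_eqF.
Qed.

Lemma puncture_entries i : exists (j : half_index L) (K : R), [/\ cdom (half_chart j) (p i), 0 < K &
  forall e, 0 < e -> \forall x \near p i, x != p i ->
    let z := cmap (half_chart j) x - cmap (half_chart j) (p i) in
    [/\ punctured p x, cdom (half_chart j) x, z != 0 & exists m1 m2 : R,
      [/\ 0 < m1, 0 < m2, m1 * modulus z <= e * m2 &
        [/\ complex.Re (H j x 0 0) <= K * m1, m2 / K <= complex.Re (H j x 1 1) * sqmod z,
         complex.Re (H j x 1 1) * sqmod z <= K * m2 &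
         m1 * m2 / K ^+ 2 <= (complex.Re (H j x 0 0) * complex.Re (H j x 1 1) - sqmod (H j x 0 1 : C)) * sqmod z]]]].
Proof.
have [j dj] := half_cover L (p i); have [[pos _ _] _ ad] := hH.
have [K K0 nK] := ad i j dj.
exists j, K; split=> // e e0.
have [d d0 dP] := model_ratio (theta_small i) e0.
have n1 := near_cmap dj (near_modulus (cmap (half_chart j) (p i)) d0).
apply: filterS3 nK n1 (near_puncture S p i) => x H1 [dx xd] H2 xp.
have px := H2 xp; have {}H1 := H1 xp.
set z := cmap _ x - _ in H1 xd *; have z0 : z != 0.
  rewrite subr_eq0; apply: contraNneq xp => e1.
  by rewrite -(cmapK dj) -e1 cmapK.
have [|m1 [m2 [m10 m20 mE me]]] := dP (modulus z); first by rewrite modulus_gt0 z0.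
split=> //; exists m1, m2; split=> //.
apply: (sandwich_entries (pos j x dx px) m10 m20 K0 z0) => v.
have := H1 v; rewrite mE floor_theta subr0 expr1z.
set T := mx2 1 0 0 z; have -> // : (T^t*)%sesqui = (map_mx conjc T)^T.
by apply/matrixP => k l; rewrite !mxE.
Qed.

Lemma defect_bounded i : exists B, \forall x \near p i, x != p i -> defect_at x <= B.
Proof.
have [j [K [dj K0 est]]] := puncture_entries i; exists (K ^+ 4).
apply: filterS (est 1 ltr01) => x H1 xp; have [px dx z0 [m1 [m2 [m10 m20 _ [h1 h2 h3 h4]]]]] := H1 xp.
have [A0 C0] := entries_gt0 dx px.
have [[pos _ _] _ _] := hH; have [_ _ _ _ D] := hermitian_posdefE (pos j x dx px).
rewrite (defect_atE dx px) /defect; set b2 := sqmod (H j x 0 1 : C) in D h4 *.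
have b0 : 0 <= b2 by exact: sqmod_ge0.
set al := complex.Re (H j x 0 0) in A0 D h1 h4 *; set ga := complex.Re (H j x 1 1) in C0 D h2 h3 h4 *.
set z := cmap _ _ - _ in z0 h2 h3 h4.
have z20 : 0 < sqmod z by rewrite -modulus_sqr exprn_gt0// modulus_gt0.
rewrite ler_pdivrMr ?subr_gt0// -(ler_pM2r z20).
apply: (@le_trans _ _ (al * (ga * sqmod z))).
  by rewrite mulrA ler_pM2r// ltW.
apply: (@le_trans _ _ (K * m1 * (K * m2))).
  by apply: ler_pM => //; [exact: ltW|rewrite mulr_ge0 ?ltW].
have -> : K * m1 * (K * m2) = K ^+ 4 * (m1 * m2 / K ^+ 2) by field; rewrite gt_eqF.
by rewrite -[leRHS]mulrA ler_pM2l ?exprn_gt0.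
Qed.

Lemma quadratic_bounded i (c : chart R X) : atlas S c -> cdom c (p i) -> exists2 M : R, 0 <= M &
  \forall x \near p i, x != p i -> sqmod (a c x) * sqmod (cmap c x - cmap c (p i)) <= M.
Proof.
move=> ac dc; have [_ _ pole] := qa.
have [|u du uE] := pole c (p i) ac dc; first by rewrite div_D_puncture.
have cu : {for cmap c (p i), continuous u}.
  exact: cder_continuous (derivableP (nbhs_singleton du)).
have cm : {for cmap c (p i), continuous (fun z => modulus (u z))}.
  by apply: (@continuous_comp _ _ _ u (@modulus R)) => //; exact: continuous_modulus.
have [d d0 dP] := (continuous_modulusP _ _).1 cm 1 ltr01.
exists ((modulus (u (cmap c (p i))) + 1) ^+ 2); first exact: sqr_ge0.
have n1 := near_cmap dc (near_modulus _ d0); have n2 := near_cmap dc uE.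
apply: filterS2 n1 n2 => x [dx xd] [_ xE] xp.
have zn : cmap c x != cmap c (p i).
  by apply: contraNneq xp => e1; rewrite -(cmapK dc) -e1 cmapK.
have := xE zn; rewrite (cmapK dx) div_D_puncture exprN1 => ->.
have wn : cmap c x - cmap c (p i) != 0 by rewrite subr_eq0.
rewrite -sqmodM mulrC mulVKf// -modulus_sqr lerXn2r// ?nnegrE ?modulus_ge0//.
  by rewrite addr_ge0// modulus_ge0.
by have := dP _ xd; rewrite ltr_norml => /andP[_ h]; rewrite /= in h; lra.
Qed.

Lemma ratio_small i (e : R) : 0 < e -> \forall x \near p i, x != p i -> ratio_at x <= e.
Proof.
move=> e0; have [j [K [dj K0 est]]] := puncture_entries i.
have [M M0 nM] := quadratic_bounded (half_chart_atlas j) dj.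
pose N := 4 * (M + 1) * K ^+ 4; have N0 : 0 < N by rewrite !mulr_gt0 ?exprn_gt0//; lra.
pose e' := Num.min 1 (e / N); have e'0 : 0 < e' by rewrite lt_min ltr01 divr_gt0.
have [e1 e2] : e' <= 1 /\ e' <= e / N by rewrite !ge_min !lexx orbT.
apply: filterS2 (est e' e'0) nM => x H1 aM xp; have {}aM := aM xp.
have [px dx z0 [m1 [m2 [m10 m20 me [h1 h2 h3 h4]]]]] := H1 xp.
have [A0 C0] := entries_gt0 dx px.
rewrite (ratio_atE dx px) {h3 h4}.
set al := complex.Re (H j x 0 0) in A0 h1 *; set ga := complex.Re (H j x 1 1) in C0 h2 *.
set z := cmap _ _ - _ in z0 h2 me aM.
have z0' : 0 < modulus z by rewrite modulus_gt0.
have z20 : 0 < sqmod z by rewrite -modulus_sqr exprn_gt0.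
have hb : al <= K ^+ 2 * e' * ga * modulus z.
  rewrite -(ler_pM2r z0').
  have -> : K ^+ 2 * e' * ga * modulus z * modulus z = K * e' * (K * (ga * sqmod z)).
    by rewrite -modulus_sqr; ring.
  apply: (@le_trans _ _ (K * m1 * modulus z)); first by rewrite ler_pM2r.
  apply: (@le_trans _ _ (K * (e' * m2))); first by rewrite -mulrA ler_pM2l.
  rewrite -[leRHS]mulrA ler_pM2l// ler_pM2l// -ler_pdivrMl// mulrC; exact: h2.
have sa := sqmod_ge0 (a (half_chart j) x : C).
rewrite ler_pdivrMr ?exprn_gt0//.
have hb2 : al ^+ 2 <= K ^+ 4 * e' ^+ 2 * ga ^+ 2 * sqmod z.
  have -> : K ^+ 4 * e' ^+ 2 * ga ^+ 2 * sqmod z = (K ^+ 2 * e' * ga * modulus z) ^+ 2.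
    by rewrite -modulus_sqr; ring.
  by rewrite lerXn2r// nnegrE; [exact: ltW|rewrite !mulr_ge0 ?exprn_ge0 ?modulus_ge0 ?ltW].
apply: (@le_trans _ _ (4 * sqmod (a (half_chart j) x) * (K ^+ 4 * e' ^+ 2 * ga ^+ 2 * sqmod z))).
  by rewrite ler_wpM2l// mulr_ge0.
have -> : 4 * sqmod (a (half_chart j) x) * (K ^+ 4 * e' ^+ 2 * ga ^+ 2 * sqmod z) =
   4 * (sqmod (a (half_chart j) x) * sqmod z) * K ^+ 4 * e' ^+ 2 * ga ^+ 2 by ring.
rewrite ler_wpM2r ?sqr_ge0//.
apply: (@le_trans _ _ (N * e')); last by rewrite mulrC -ler_pdivlMr.
have -> : N * e' = 4 * (M + 1) * K ^+ 4 * (e' * 1) by rewrite /N mulr1.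
apply: ler_pM.
- by rewrite !mulr_ge0 ?exprn_ge0 ?sqmod_ge0 ?ltW.
- exact: sqr_ge0.
- by apply: ler_wpM2r; [rewrite exprn_ge0// ltW|lra].
by rewrite expr2 ler_pM2l.
Qed.

Lemma puncture_limit_point i (Q : set X) : (\forall x \near p i, x != p i -> Q x) ->
  exists2 x, punctured p x & Q x.
Proof.
move=> nQ; have [j dj] := half_cover L (p i).
have [r r0 rP] := @puncture_disc _ _ S _ p i _ dj; have /nbhs_modulus[d d0 dP] := near_cinv dj nQ.
pose e := Num.min r d / 2; pose z := cmap (half_chart j) (p i) + e%:C.
have mn : 0 < Num.min r d by rewrite lt_min r0.
have e0 : 0 < e by rewrite divr_gt0.
have [er ed] : e < r /\ e < d.
  by split; apply: (@lt_le_trans _ _ (Num.min r d)); rewrite ?ge_min ?lexx ?orbT// /e; lra.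
have ze : modulus (z - cmap (half_chart j) (p i)) = e by rewrite /z addrC addKr modulus_real gtr0_norm.
have zn : z != cmap (half_chart j) (p i) by rewrite -subr_eq0 -modulus_gt0 ze.
have [rz pz] := rP z (eq_ind_r (fun t => t < r) er ze).
have [_ Qz] := dP z (eq_ind_r (fun t => t < d) ed ze).
exists (cinv (half_chart j) z); [exact: pz|apply: Qz].
by apply: contraNneq zn => zi; rewrite -(chart_inv rz).2 zi.
Qed.

Lemma no_puncture : (forall x, punctured p x -> ratio_at x = 1) -> m = 0%N.
Proof.
move=> r1; apply/eqP; rewrite -leqn0 leqNgt; apply/negP => m0.
have e0 : 0 < 1 / 2 :> R by lra.
have [x /r1 ->] := puncture_limit_point (ratio_small (Ordinal m0) e0); lra.
Qed.

(** In the remaining case the quadratic differential has no zeros and no poles. *)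
Definition nowhere_zero := m = 0%N /\ forall j x, cdom (half_chart (h := L) j) x -> a (half_chart j) x != 0.

Lemma ratio_one_nowhere_zero : (forall x, punctured p x -> ratio_at x = 1) -> nowhere_zero.
Proof.
move=> r1; have m0 := no_puncture r1; split=> // j x dj.
have px : punctured p x by move=> [i _ _]; case: i => i; rewrite m0.
have := r1 x px; rewrite (ratio_atE dj px) => E; apply/eqP => a0.
move: E; rewrite a0 /sqmod /= expr0n addr0 mulr0 !mul0r => /eqP.
by rewrite eq_sym oner_eq0.
Qed.

Let defectU j z : U j z -> defect (G j z) = (defect_at \o cinv (half_chart j)) z.
Proof. by move=> /crangeP[/chart_inv[dz _] pz]; rewrite /= (defect_atE dz pz). Qed.

(** The defect is subharmonic and bounded, hence constant; a nonzero constant is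
   possible only in the equality case of [defect_lap]. *)
Lemma diagonal_or_flat :
  (forall j x, cdom (half_chart j) x -> punctured p x -> H j x 0 1 = 0) \/ nowhere_zero.
Proof.
have chartP x : exists c : chart R X, [/\ cdom c x,
     smooth_on (crange c (punctured p)) (defect_at \o cinv c) &
     forall z, crange c (punctured p) z -> 0 <= lap (defect_at \o cinv c) z].
  have [j dj] := half_cover L x; exists (half_chart j); split=> //.
    exact: (eq_smooth_on (oU (j := j)) (@defectU j) (smooth_defect (oU (j := j)) (@pG j) (@sG j))).
  move=> z Uz; rewrite -(eq_lap (oU (j := j)) Uz (@defectU j)).
  by have [] := defect_lap (oU (j := j)) (@pG j) (@sG j) (@eqG j) Uz.
have cst := subharmonic_constant S (fun x _ => chartP x) (fun i => chartP (p i)) defect_bounded.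
have [|nd] := pselect (forall j x, cdom (half_chart j) x -> punctured p x -> H j x 0 1 = 0); first by left.
right; apply: ratio_one_nowhere_zero.
have [j0 [x0 [dx0 px0 /eqP B0]]] : exists j x, [/\ cdom (half_chart (h := L) j) x, punctured p x & H j x 0 1 <> 0].
  apply: contrapT => ne; apply: nd => j x dj px; apply: contrapT => B0; apply: ne.
  by exists j, x.
have [[pos _ _] _ _] := hH.
have k0 : defect_at x0 != 0.
  rewrite (defect_atE dx0 px0); have [_ _ _ _ D] := hermitian_posdefE (pos _ _ dx0 px0).
  by rewrite mulf_neq0// ?invr_neq0 ?sqmod_eq0// gt_eqF// subr_gt0.
move=> x px; have [j dj] := half_cover L x.
have Uz : U j (cmap (half_chart j) x) by exact: crange_mem.
have [_ eqn] := defect_lap (oU (j := j)) (@pG j) (@sG j) (@eqG j) Uz.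
have GE : G j (cmap (half_chart j) x) = H j x by rewrite /G cmapK.
have L0 : lap (fun w => defect (G j w)) (cmap (half_chart j) x) = 0.
  rewrite (@eq_lap R _ _ (fun=> defect_at x0) _ (oU (j := j)) Uz).
    apply: has_lapP; exists (fun _ _ => 0), (fun=> 0); split; last by rewrite addr0.
    by move=> k; split; [exact: (@filterE _ (nbhs _) _ _ (fun w => derdir_cst k w _))|exact: derdir_cst].
  move=> w /[dup] Uw /crangeP[/chart_inv[dw _] pw].
  by rewrite defectU//=; exact: cst.
have B1 : H j x 0 1 != 0.
  have E := cst _ _ px px0; rewrite (defect_atE dj px) in E.
  by apply: contra_neqN k0 => /eqP b0; rewrite -E /defect b0 /sqmod /= expr0n addr0 mul0r.
have := eqn L0; rewrite GE => /(_ B1); rewrite /aj /= cmapK// => E.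
have [A0 C0] := entries_gt0 dj px.
by rewrite (ratio_atE dj px) E divff// expf_neq0// gt_eqF.
Qed.

Hypothesis diag : forall j x, cdom (half_chart j) x -> punctured p x -> H j x 0 1 = 0.

Let g j z := complex.Re (G j z 1 1) / complex.Re (G j z 0 0).

Lemma half_chart_toda j : toda (U j) (aj j) (g j).
Proof.
apply: (diagonal_toda (oU (j := j)) (@pG j) (@sG j) (@eqG j)) => z /crangeP[/chart_inv[dz _] pz].
exact: diag.
Qed.

Let ratioU j z : U j z -> toda_ratio (aj j) (g j) z = ratio_at (cinv (half_chart j) z).
Proof.
move=> /crangeP[/chart_inv[dz _] pz]; rewrite (ratio_atE dz pz) /toda_ratio /g /aj /=.
have [A0 C0] := entries_gt0 dz pz.
by field; rewrite !gt_eqF.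
Qed.

Let haj j : holomorphic_on (U j) (aj j).
Proof. exact: (quadratic_holomorphic (half_chart_atlas j)). Qed.

Lemma ratio_continuous x : punctured p x -> forall e, 0 < e -> \forall y \near x, `|ratio_at y - ratio_at x| < e.
Proof.
move=> px e e0; have [j dj] := half_cover L x.
have Uz : U j (cmap (half_chart j) x) by exact: crange_mem.
have sr := smooth_ratio (oU (j := j)) (@haj j) (half_chart_toda j).
have [d d0 dP] := (continuous_modulusP _ _).1 (smooth_on_continuous sr Uz) e e0.
apply: (near_chart dj); apply: filterS2 (open_near (oU (j := j)) Uz) (near_modulus _ d0) => z Uw /dP.
by rewrite !ratioU// cmapK.
Qed.

(** The ratio tends to 0 at the punctures, hence has a maximum; there [ratio_lap]
   leaves no room for a value above 1. *)
Lemma ratio_le1 x : punctured p x -> ratio_at x <= 1.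
Proof.
move=> px; rewrite leNgt; apply/negP => r1.
pose s x := if pselect (punctured p x) then ratio_at x else 0.
have sE y : punctured p y -> s y = ratio_at y by rewrite /s; case: pselect.
have s0 y : ~ punctured p y -> s y = 0 by rewrite /s; case: pselect.
have r0 y : punctured p y -> 0 <= ratio_at y.
  move=> py; have [j dj] := half_cover L y; rewrite (ratio_atE dj py).
  by rewrite divr_ge0 ?sqr_ge0// mulr_ge0 ?sqr_ge0// mulr_ge0// sqmod_ge0.
have cs y : [set: X] y -> {for y, continuous s}.
  move=> _; apply/cvgrPdist_lt => e e0.
  have [py|npy] := pselect (punctured p y).
    apply: filterS2 (ratio_continuous py e0) (open_near op py) => w.
    by rewrite (sE y py) distrC => + /sE ->.
  have {npy} [i _ iy] : range p y by apply: contrapT.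
  have e2 : 0 < e / 2 by rewrite divr_gt0.
  subst y; apply: filterS2 (ratio_small i e2) (near_puncture S p i) => w h1 h2.
  have sp : s (p i) = 0 by apply: s0 => np; apply: np; exists i.
  rewrite sp sub0r normrN; have [->|wp] := eqVneq w (p i); first by rewrite sp normr0.
  rewrite (sE _ (h2 wp)) ger0_norm; last by apply: r0; exact: h2.
  by apply: le_lt_trans (h1 wp) _; rewrite ltr_pdivrMr// ltr_pMr// ltr1n.
have T0 : [set: X] !=set0 by exists x.
have [y _ ymax] := compact_max T0 (surface_compact S) cs.
have sy : 1 < s y by apply: lt_le_trans (ymax x I); rewrite sE.
have py : punctured p y by apply: contrapT => npy; move: sy; rewrite s0//; lra.
have [j dj] := half_cover L y; have Uz : U j (cmap (half_chart j) y) by exact: crange_mem.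
have sr := smooth_ratio (oU (j := j)) (@haj j) (half_chart_toda j).
have nm : \forall w \near cmap (half_chart j) y, toda_ratio (aj j) (g j) w <= toda_ratio (aj j) (g j) (cmap (half_chart j) y).
  apply: filterS (open_near (oU (j := j)) Uz) => w /[dup] Uw /crangeP[_ pw].
  by rewrite !ratioU// cmapK// -!sE//; exact: ymax.
have l0 := has_lap_max (has_lap_smooth (oU (j := j)) sr Uz) nm.
have := ratio_lap (oU (j := j)) (@haj j) (half_chart_toda j) Uz.
have [_ /(_ _ Uz) g0 _] := half_chart_toda j.
move: l0; rewrite ratioU// cmapK// -(sE y py) => l0 h.
have : 0 < 4 * g j (cmap (half_chart j) y) * (s y * (s y - 1)).
  have a1 : 0 < s y - 1 by rewrite subr_gt0.
  have a2 : 0 < s y := lt_trans (@ltr01 R) sy.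
  exact: (mulr_gt0 (mulr_gt0 (ltr0Sn R 3) g0) (mulr_gt0 a2 a1)).
by rewrite ltNge (le_trans h l0).
Qed.

(** Near a point where the ratio [s] is 1, [w = 1 - s] satisfies [Lap w <= K w]:
   the strong minimum principle makes the set where [s = 1] open. *)
Lemma ratio_lt1_or_flat : (forall x, punctured p x -> ratio_at x < 1) \/ nowhere_zero.
Proof.
have [|nl] := pselect (forall x, punctured p x -> ratio_at x < 1); first by left.
right; apply: ratio_one_nowhere_zero.
have [x0 px0 x01] : exists2 x, punctured p x & ratio_at x = 1.
  apply: contrapT => ne; apply: nl => x px; rewrite lt_neqAle ratio_le1// andbT.
  by apply/eqP => x1; apply: ne; exists x.
apply: (@punctured_clopen _ _ S _ p (fun x => ratio_at x = 1) _ _ x0 px0 x01) => x px x1; last first.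
  have d0 : 0 < `|ratio_at x - 1| by rewrite normr_gt0 subr_eq0; apply/eqP.
  by apply: filterS (ratio_continuous px d0) => y + y1; rewrite y1 distrC ltxx.
have [j dj] := half_cover L x; have Uz : U j (cmap (half_chart j) x) by exact: crange_mem.
have tg := half_chart_toda j; have [sg g0 _] := tg.
have sr := smooth_ratio (oU (j := j)) (@haj j) tg.
have [d1 d10 d1P] := open_modulus (oU (j := j)) Uz.
have [d2 d20 d2P] := (continuous_modulusP _ _).1 (smooth_on_continuous sg Uz) 1 ltr01.
set z0 := cmap _ x in Uz d1P d2P.
pose V := [set z : C | modulus (z - z0) < Num.min d1 d2].
have oV : open V by exact: open_disc.
have VU z : V z -> U j z by rewrite /V /= lt_min => /andP[/d1P].
pose w z := 1 + -1 * toda_ratio (aj j) (g j) z.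
have sV := smooth_on_sub VU sr.
have sw : smooth_on V w := smoothD oV (smooth_cst oV 1) (smoothZ oV (-1) sV).
pose K := 4 * (g j z0 + 1); have K0 : 0 <= K by have := g0 _ Uz; rewrite /K; lra.
have Vz : V z0 by rewrite /V /= subrr modulus0 lt_min d10.
have n := @strong_minimum R V w K z0 oV sw K0 _ Vz.
apply: (near_chart dj); apply: filterS2 (open_near oV Vz) (n _ _) => [z Vz' | z Vz' | ].
- by rewrite /w (ratioU (VU _ Vz')); lra.
- have Uz' := VU _ Vz'; have h := ratio_lap (oU (j := j)) (@haj j) tg Uz'.
  have hc : has_lap (fun=> 1 : R) z 0.
    exists (fun _ _ => 0), (fun=> 0); split; last by rewrite addr0.
    by move=> k; split; [exact: (@filterE _ (nbhs _) _ _ (fun w => derdir_cst k w _))|exact: derdir_cst].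
  have lw := has_lapP (has_lapD (-1) hc (has_lap_smooth (oU (j := j)) sr Uz')).
  have pz : punctured p (cinv (half_chart j) z) by have /crangeP[] := Uz'.
  have := ratio_le1 pz; rewrite -ratioU// => le1.
  rewrite -/w in lw; rewrite lw /w; split; first by rewrite mulN1r subr_ge0.
  have ge0 : 0 <= toda_ratio (aj j) (g j) z.
    by rewrite /toda_ratio divr_ge0 ?sqr_ge0// mulr_ge0 ?sqmod_ge0.
  have gz : g j z < g j z0 + 1.
    have : modulus (z - z0) < d2 by move: Vz'; rewrite /V /= lt_min => /andP[].
    by move=> /d2P; rewrite ltr_norml => /andP[_]; rewrite ltrBlDl.
  have gp := g0 _ Uz'.
  set s := toda_ratio _ _ _ in le1 ge0 h *.
  have e1 : g j z * s * (1 - s) <= (g j z0 + 1) * 1 * (1 - s).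
    by rewrite ler_wpM2r ?subr_ge0// ler_pM// ltW.
  have e2 : 4 * g j z * (s * (s - 1)) = - (4 * (g j z * s * (1 - s))) by ring.
  rewrite e2 in h; rewrite mulr1 in e1; rewrite /K add0r !mulN1r lerNl; apply: le_trans h.
  by rewrite lerN2 -[leRHS]mulrA ler_pM2l.
by rewrite /w ratioU// cmapK// x1; lra.
Qed.

End HermitianEinsteinSurface.

(** * Flat coordinates of a quadratic differential *)
Section LocalInverse.
Variable R : realType.
Local Notation C := (cplx R).

Lemma cder_line (f : C -> C) (w d l : C) (x : R) : is_derive (w + x%:C * d) (1 : C) f l ->
  is_derive x (1 : R) (fun t : R => complex.Re (f (w + t%:C * d))) (complex.Re (l * d)).
Proof.
move=> /cderP df; apply/rderP => e e0.
have d1 : 0 < modulus d + 1 by rewrite ltr_wpDl ?modulus_ge0.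
have [|r r0 rP] := df (e / (modulus d + 1)); first by rewrite divr_gt0.
exists (r / (modulus d + 1)); first by rewrite divr_gt0.
move=> y; rewrite ltr_pdivlMr// => yx.
have E : w + y%:C * d - (w + x%:C * d) = (y - x)%:C * d by rewrite real_complexB; ring.
have := rP (w + y%:C * d); rewrite E modulusM modulus_real.
have dd : `|y - x| * modulus d <= `|y - x| * (modulus d + 1) by rewrite ler_wpM2l//; lra.
move=> /(_ (le_lt_trans dd yx)).
set u := f _ - f _ - _ => hu.
have -> : complex.Re (f (w + y%:C * d)) - complex.Re (f (w + x%:C * d)) - complex.Re (l * d) * (y - x) = complex.Re u.
  by rewrite /u !ReB; congr (_ - _); case: (l) (d) => [? ?] [? ?] /=; ring.
apply: le_trans (Re_le_modulus _) _; apply: le_trans hu _.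
have e1 : 0 <= e / (modulus d + 1) by rewrite divr_ge0// ltW.
have := ler_wpM2l e1 dd; rewrite (_ : e / _ * (`|y - x| * (modulus d + 1)) = e * `|y - x|) //.
by field; rewrite gt_eqF.
Qed.

Lemma disc_segment (c z w : C) (r t : R) : 0 <= t <= 1 -> modulus (z - c) < r -> modulus (w - c) < r ->
  modulus (w + t%:C * (z - w) - c) < r.
Proof.
move=> /andP[t0 t1] zr wr.
have -> : w + t%:C * (z - w) - c = t%:C * (z - c) + (1 - t)%:C * (w - c) by rewrite real_complexB; ring.
apply: le_lt_trans (modulusD _ _) _; rewrite !modulusM !modulus_real !ger0_norm//; last by lra.
have [t00|t00] := leP t 0; first by rewrite (_ : t = 0); [lra|lra].
have h1 : t * modulus (z - c) < t * r by rewrite ltr_pM2l.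
have h2 : (1 - t) * modulus (w - c) <= (1 - t) * r by apply: ler_wpM2l; [lra|exact: ltW].
lra.
Qed.

Lemma cder_lipschitz (f f' : C -> C) (c : C) (r M : R) :
  (forall z, modulus (z - c) < r -> is_derive z (1 : C) f (f' z) /\ modulus (f' z) <= M) ->
  forall z w, modulus (z - c) < r -> modulus (w - c) < r ->
  modulus (f z - f w) <= 2 * M * modulus (z - w).
Proof.
move=> df z w zr wr.
have part (k : C) : modulus k = 1 -> `|complex.Re (k * (f z - f w))| <= M * modulus (z - w).
  move=> k1; pose h (t : R) := complex.Re (k * f (w + t%:C * (z - w))).
  have ah : antider 0 1 (fun t => complex.Re (k * f' (w + t%:C * (z - w)) * (z - w))) h.
    move=> t tI; have [dft _] := df _ (disc_segment tI zr wr).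
    exact: (cder_line (f := fun u => k * f u) (cderZ k dft)).
  have := @antider_bound R 0 1 (M * modulus (z - w)) _ h ler01 ah _.
  rewrite subr0 mulr1 /h mul1r mul0r addr0 -ReB -mulrBr.
  rewrite (_ : w + (z - w) = z); last by ring.
  apply=> t tI; apply: le_trans (Re_le_modulus _) _.
  have [_ Mt] := df _ (disc_segment tI zr wr).
  by rewrite !modulusM k1 mul1r ler_wpM2r ?modulus_ge0.
have h1 := part 1 (@modulus1 R).
have h2 : `|complex.Im (f z - f w)| <= M * modulus (z - w).
  have := part (- 'i); rewrite modulusN modulus_i => /(_ erefl).
  by rewrite (_ : complex.Re (- 'i * (f z - f w)) = complex.Im (f z - f w))//; case: (f z - f w) => ? ? /=; ring.
by rewrite mul1r in h1; apply: le_trans (modulus_le_ReIm _) _; lra.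
Qed.

(** The principal square root. *)
Definition sqroot (w : C) : C := (Num.sqrt (2 * (modulus w + complex.Re w)))^-1%:C * (w + (modulus w)%:C).

Lemma sqroot_sqr w : 0 < modulus w + complex.Re w -> sqroot w ^+ 2 = w.
Proof.
move=> w0; rewrite /sqroot; set q := 2 * _; have q0 : 0 < q by rewrite mulr_gt0.
rewrite exprMn -real_complexX exprVn sqr_sqrtr ?ltW//.
have ms : (modulus w)%:C ^+ 2 = w * conjc w by rewrite -real_complexX modulus_sqr sqmodC.
have rw : (2 * complex.Re w)%:C = w + conjc w.
  by case: (w) => x y; apply/eqP; rewrite eq_complex /=; apply/andP; split; apply/eqP; ring.
have qE : q%:C = 2 * (modulus w)%:C + (w + conjc w).
  rewrite -rw (_ : (2 : C) = (2 : R)%:C); last by rewrite rmorph_nat.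
  by rewrite -real_complexM -real_complexD /q mulrDr.
have -> : (w + (modulus w)%:C) ^+ 2 = w * q%:C by rewrite sqrrD ms qE; ring.
by rewrite mulrCA -real_complexM mulVf ?mulr1// gt_eqF.
Qed.

Lemma continuous_sqroot w : 0 < modulus w + complex.Re w -> {for w, continuous sqroot}.
Proof.
move=> w0.
have c1 : {for w, continuous (fun u : C => 2 * (modulus u + complex.Re u))}.
  apply: continuousM; first exact: (@continuous_cst_at R 2).
  exact: continuousD (@continuous_modulus R w) (@continuous_Re R w).
have c2 : {for w, continuous (fun u : C => Num.sqrt (2 * (modulus u + complex.Re u)))}.
  by apply: (@continuous_comp _ _ _ _ (@Num.sqrt R)) => //; exact: sqrt_continuous.
have n0 : Num.sqrt (2 * (modulus w + complex.Re w)) != 0 by rewrite gt_eqF// sqrtr_gt0 mulr_gt0.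
have c3 : {for w, continuous (fun u : C => (Num.sqrt (2 * (modulus u + complex.Re u)))^-1)}.
  exact: (@continuousV R C _ w n0 c2).
have c4 : {for w, continuous (fun u : C => (Num.sqrt (2 * (modulus u + complex.Re u)))^-1%:C : C)}.
  by apply: (@continuous_comp _ _ _ _ (fun x : R => x%:C : C)) => //; exact: continuous_real_complex.
have c5 : {for w, continuous (fun u : C => (modulus u)%:C : C)}.
  by apply: (@continuous_comp _ _ _ (@modulus R) (fun x : R => x%:C : C)); [exact: continuous_modulus|exact: continuous_real_complex].
have c6 : {for w, continuous (fun u : C => u + (modulus u)%:C)}.
  by apply: (continuousD _ c5); exact: cvg_id.
exact: (continuousM c4 c6).
Qed.

Lemma holomorphic_sqrt (f b : C -> C) z l : b z != 0 -> {for z, continuous b} ->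
  (\forall w \near z, b w ^+ 2 = f w) -> is_derive z (1 : C) f l ->
  is_derive z (1 : C) b (l / (2 * b z)).
Proof.
move=> bz cb bf df.
pose q (w : C) := if w == z then l else (f w - f z) / (w - z).
have two : (2 : C) != 0 by rewrite pnatr_eq0.
have b20 : 2 * b z != 0 by rewrite mulf_neq0.
have fz : b z ^+ 2 = f z by exact: nbhs_singleton bf.
apply/cderP => e e0.
(* (b w - b z) (b w + b z) = f w - f z, and b w + b z is close to 2 b z *)
pose B := modulus (b z); have B0 : 0 < B by rewrite modulus_gt0.
pose M := modulus l + 1; have M0 : 0 < M by rewrite ltr_wpDl ?modulus_ge0.
have /cderP df' := df.
pose e1 := Num.min 1 (e * B / 2); have e10 : 0 < e1 by rewrite lt_min ltr01 !(divr_gt0, mulr_gt0).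
have [d1 d10 d1P] := df' _ e10.
pose e2 := Num.min B (e * B ^+ 2 / M); have e20 : 0 < e2 by rewrite lt_min B0 divr_gt0// mulr_gt0// exprn_gt0.
have /nbhs_modulus[d2 d20 d2P] : \forall w \near z, modulus (b w - b z) < e2.
  exact: (cb _ (near_modulus (b z) e20)).
have /nbhs_modulus[d3 d30 d3P] := bf.
exists (Num.min d1 (Num.min d2 d3)); first by rewrite !lt_min d10 d20.
move=> w; rewrite !lt_min => /and3P[w1 w2 w3].
have h1 := d1P w w1; have h2 := d2P w w2; have h3 := d3P w w3.
have m2B : modulus (2 * b z) = 2 * B.
  by rewrite modulusM (_ : (2 : C) = (2 : R)%:C) ?modulus_real ?ger0_norm// rmorph_nat.
pose s := b w + b z.
have sB : B <= modulus s.
  have : modulus (2 * b z) <= modulus s + modulus (b w - b z).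
    rewrite (modulusBC (b w)) (_ : 2 * b z = s + (b z - b w)); last by rewrite /s; ring.
    exact: modulusD.
  rewrite m2B; have : e2 <= B by rewrite ge_min lexx.
  lra.
have s0 : s != 0 by rewrite -modulus_gt0; exact: lt_le_trans B0 sB.
have key : b w - b z - l / (2 * b z) * (w - z) =
   ((f w - f z - l * (w - z)) - l * (w - z) * (b w - b z) / (2 * b z)) / s.
  rewrite -h3 -fz /s; field.
  by rewrite bz /= s0.
rewrite key modulusM modulusV ler_pdivrMr ?modulus_gt0//.
apply: le_trans (_ : e * modulus (w - z) * B <= _); last by rewrite ler_wpM2l// mulr_ge0 ?modulus_ge0// ltW.
have t1 : modulus (f w - f z - l * (w - z)) <= e * B / 2 * modulus (w - z).
  by apply: le_trans h1 _; rewrite ler_wpM2r ?modulus_ge0// ge_min lexx orbT.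
have t2 : modulus (l * (w - z) * (b w - b z) / (2 * b z)) <= e * B / 2 * modulus (w - z).
  rewrite !(modulusM _ (2 * b z)^-1) modulusV m2B !modulusM.
  rewrite ler_pdivrMr ?mulr_gt0//.
  have u1 : modulus l <= M by rewrite /M; lra.
  have u2 : modulus (b w - b z) <= e * B ^+ 2 / M by apply: le_trans (ltW h2) _; rewrite ge_min lexx orbT.
  have -> : e * B / 2 * modulus (w - z) * (2 * B) = M * modulus (w - z) * (e * B ^+ 2 / M) by field; rewrite gt_eqF.
  by rewrite ler_pM// ?mulr_ge0 ?modulus_ge0// ler_wpM2r ?modulus_ge0.
have := modulusD (f w - f z - l * (w - z)) (- (l * (w - z) * (b w - b z) / (2 * b z))).
by rewrite modulusN; lra.
Qed.

(** [W] is a primitive of a square root of [f]; being close to an affine map, it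
   has a local inverse [V]. *)
Lemma flat_coordinate (U : set C) (f : C -> C) z0 : open U -> U z0 -> holomorphic_on U f -> f z0 != 0 ->
  exists (r : R) (W V : C -> C) (rho : R), [/\ 0 < r, 0 < rho,
   [/\ (forall z, modulus (z - z0) < r -> U z), W z0 = 0,
    (forall z, modulus (z - z0) < r -> exists2 l, is_derive z (1 : C) W l & l ^+ 2 = f z) &
    (forall z w, modulus (z - z0) < r -> modulus (w - z0) < r -> W z = W w -> z = w)] &
   (forall om, modulus om < rho -> [/\ modulus (V om - z0) < r, W (V om) = om &
     exists2 l, is_derive om (1 : C) V l & f (V om) * l ^+ 2 = 1])].
Proof.
move=> oU Uz0 hf fz0.
pose k : C := sqrtC (f z0); have k2 : k ^+ 2 = f z0 by exact: sqrtCK.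
have k0 : k != 0 by apply: contraNneq fz0 => k0; rewrite -k2 k0 expr0n.
pose b z := k * sqroot (f z / f z0).
have cf z : U z -> {for z, continuous f} by move=> Uz; exact: cder_continuous (holomorphic_cder hf Uz).
have ccst (k' z : C) : {for z, continuous (fun _ : C => k')} := @cst_continuous C C k' z.
have cq z : U z -> {for z, continuous (fun w => f w / f z0)}.
  by move=> Uz; exact: (continuousM (cf z Uz) (ccst _ z)).
have one : 0 < modulus (f z0 / f z0) + complex.Re (f z0 / f z0) by rewrite divff// modulus1 /=; lra.
pose P w := 0 < modulus (f w / f z0) + complex.Re (f w / f z0).
have nP : \forall w \near z0, P w.
  have cP : {for f z0 / f z0, continuous (fun u : C => modulus u + complex.Re u)}.
    exact: continuousD (@continuous_modulus R _) (@continuous_Re R _).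
  have := @continuous_comp _ _ _ (fun w => f w / f z0) (fun u : C => modulus u + complex.Re u) z0 (cq z0 Uz0) cP.
  move=> /(_ [set x | 0 < x]); apply.
  exact: open_nbhs_nbhs (conj (@open_gt R 0) one).
have /nbhs_modulus[d1 d10 d1P] := nP.
have [d2 d20 d2P] := open_modulus oU Uz0.
pose V1 := [set z : C | modulus (z - z0) < Num.min d1 d2].
have oV1 : open V1 by exact: open_disc.
have V1U z : V1 z -> U z /\ P z by rewrite /V1 /= lt_min => /andP[/d1P ? /d2P].
have b2 z : V1 z -> b z ^+ 2 = f z.
  by move=> /V1U[_ Pz]; rewrite /b exprMn sqroot_sqr// k2 mulrC divfK.
have cb z : V1 z -> {for z, continuous b}.
  move=> /V1U[Uz Pz].
  have c1 := @continuous_comp _ _ _ (fun w => f w / f z0) sqroot z (cq z Uz) (continuous_sqroot Pz).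
  exact: (continuousM (ccst k z) c1).
have bz0 : b z0 = k.
  rewrite /b divff// /sqroot modulus1 /=.
  have -> : 2 * (1 + 1) = 2 ^+ 2 :> R by ring.
  rewrite sqrtr_sqr ger0_norm// (_ : (1 : C) + 1%:C = (2 : R)%:C); last by rewrite -real_complexD.
  by rewrite -real_complexM mulVf ?pnatr_eq0// mulr1.
have Vz0 : V1 z0 by rewrite /V1 /= subrr modulus0 lt_min d10.
have nb : \forall z \near z0, modulus (b z - k) < modulus k / 4.
  have kk : 0 < modulus k / 4 by rewrite divr_gt0// modulus_gt0.
  by have := cb z0 Vz0 _ (near_modulus (b z0) kk); rewrite bz0.
have /nbhs_modulus[d3 d30 d3P] : \forall z \near z0, V1 z /\ modulus (b z - k) < modulus k / 4.
  exact: filterS2 (open_near oV1 Vz0) nb.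
pose V2 := [set z : C | modulus (z - z0) < d3].
have bn0 z : V2 z -> b z != 0.
  move=> /d3P[_ h]; apply: contraTneq h => ->; rewrite sub0r modulusN -leNgt.
  by have := modulus_ge0 k; lra.
have hb : holomorphic_on V2 b.
  move=> z V2z; have [V1z _] := d3P z V2z; have [Uz _] := V1U z V1z.
  apply: cder_holomorphic (holomorphic_sqrt (bn0 z V2z) (cb z V1z) _ (holomorphic_cder hf Uz)).
  by apply: filterS (open_near oV1 V1z).
have V2z0 : V2 z0 by rewrite /V2 /= subrr modulus0.
have [r1 r10 [F FP]] := holomorphic_primitive (@open_disc R z0 d3) V2z0 hb.
pose r := Num.min r1 d3; have r0 : 0 < r by rewrite lt_min r10.
pose W z := F z - F z0.
have rP z : modulus (z - z0) < r -> [/\ is_derive z (1 : C) W (b z), V1 z, V2 z & modulus (b z - k) < modulus k / 4].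
  rewrite lt_min => /andP[h1 h2]; have [V1z kz] := d3P z h2; split=> //.
  have := cderB (FP z h1) (is_derive_cst (F z0) z (1 : C)); by rewrite subr0.
have lip z w : modulus (z - z0) < r -> modulus (w - z0) < r ->
    modulus (W z - W w - k * (z - w)) <= modulus k / 2 * modulus (z - w).
  move=> zr wr; have := @cder_lipschitz (fun z => W z - k * z) (fun z => b z - k) z0 r (modulus k / 4) _ z w zr wr.
  rewrite (_ : W z - k * z - (W w - k * w) = W z - W w - k * (z - w)); last by ring.
  rewrite (_ : 2 * (modulus k / 4) = modulus k / 2); last by field.
  apply=> u ur; have [du _ _ ku] := rP u ur; split; last exact: ltW.
  have := cderB du (cderZ k (is_derive_id u (1 : C))); by rewrite mulr1.
have km : 0 < modulus k by rewrite modulus_gt0.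
have low z w : modulus (z - z0) < r -> modulus (w - z0) < r -> modulus k / 2 * modulus (z - w) <= modulus (W z - W w).
  move=> zr wr; have h := lip z w zr wr.
  have := modulusB (k * (z - w)) (W z - W w); rewrite (modulusBC (k * _)) => h'.
  have := modulusD (W z - W w) (- (W z - W w - k * (z - w))).
  rewrite modulusN (_ : W z - W w - (W z - W w - k * (z - w)) = k * (z - w)); last by ring.
  by rewrite modulusM; lra.
have W0 : W z0 = 0 by rewrite /W subrr.
pose rho := modulus k * r / 8; have rho0 : 0 < rho by rewrite divr_gt0// mulr_gt0.
have z0r : modulus (z0 - z0) < r by rewrite subrr modulus0.
(* a point of the disc minimising the distance from W to om is a solution *)
have sol om : modulus om < rho -> exists2 z, modulus (z - z0) < r & W z = om.
  move=> omr.
  have D0 : [set z : C | modulus (z - z0) <= r / 2] !=set0 by exists z0; rewrite /= subrr modulus0; lra.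
  have cW z : [set z : C | modulus (z - z0) <= r / 2] z -> {for z, continuous (fun z => modulus (W z - om))}.
    move=> /= zr; have [dz _ _ _] := rP z (ltac:(lra)).
    apply: (@continuous_comp _ _ _ (fun z => W z - om) (@modulus R)); last exact: continuous_modulus.
    exact: (continuousB (cder_continuous dz) (ccst om z)).
  have [z /= zr zmin] := compact_min D0 (@compact_disc R z0 (r / 2)) cW.
  have zr' : modulus (z - z0) < r by lra.
  exists z => //; apply/eqP; rewrite -subr_eq0 -modulus_eq0; apply/negPn/negP => nz.
  pose n := modulus (W z - om); have n0 : 0 < n by rewrite lt_neqAle eq_sym nz modulus_ge0.
  have zin : modulus (z - z0) < r / 2.
    rewrite lt_neqAle zr andbT; apply/eqP => zb.
    have := low z z0 zr' z0r; rewrite W0 subr0 zb => h.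
    have := zmin z0 (ltac:(rewrite subrr modulus0; lra)); rewrite W0 sub0r modulusN.
    have := modulusB (W z) om; rewrite /rho in omr; have := mulr_gt0 km r0; lra.
  have [/cderP dz _ V2z _] := rP z zr'.
  pose h := (om - W z) / b z; have bz := bn0 z V2z.
  have h0 : 0 < modulus h.
    rewrite modulus_gt0 mulf_neq0 ?invr_neq0// -modulus_gt0 modulusBC; exact: n0.
  pose e := n / (2 * modulus h); have e0 : 0 < e by rewrite divr_gt0// mulr_gt0.
  have [d d0 dP] := dz _ e0.
  pose t := Num.min 1 (Num.min (d / 2) ((r / 2 - modulus (z - z0)) / 2) / modulus h).
  have m0 : 0 < Num.min (d / 2) ((r / 2 - modulus (z - z0)) / 2) by rewrite lt_min !divr_gt0// subr_gt0.
  have t0 : 0 < t by rewrite lt_min ltr01 divr_gt0.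
  have [t1 th] : t <= 1 /\ t * modulus h <= Num.min (d / 2) ((r / 2 - modulus (z - z0)) / 2).
    split; first by rewrite ge_min lexx.
    by rewrite -ler_pdivlMr// ge_min lexx orbT.
  move: th; rewrite le_min => /andP[th1 th2].
  have hm : modulus (t%:C * h) = t * modulus h by rewrite modulusM modulus_real gtr0_norm.
  have := dP (z + t%:C * h); rewrite (addrC z) addrK hm => /(_ (ltac:(lra))) h1.
  have := zmin (t%:C * h + z).
  rewrite -/n => /(_ _); move=> H2.
  have {H2} : n <= modulus (W (t%:C * h + z) - om).
    apply: H2; have := modulusD (t%:C * h) (z - z0); rewrite hm addrA; lra.
  have E : W (t%:C * h + z) - om = (W (t%:C * h + z) - W z - b z * (t%:C * h)) + (1 - t)%:C * (W z - om).
    by rewrite /h real_complexB; field.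
  have := modulusD (W (t%:C * h + z) - W z - b z * (t%:C * h)) ((1 - t)%:C * (W z - om)).
  rewrite -E modulusM modulus_real ger0_norm; last by lra.
  have eE : e * (t * modulus h) = n * t / 2 by rewrite /e; field; rewrite gt_eqF.
  by rewrite eE in h1; rewrite -/n mulrBl mul1r; have := mulr_gt0 n0 t0; lra.
pose Vf om := if pselect (exists2 z, modulus (z - z0) < r & W z = om) is left h then s2val (cid2 h) else z0.
have VP om : modulus om < rho -> modulus (Vf om - z0) < r /\ W (Vf om) = om.
  by move=> /sol h; rewrite /Vf; case: pselect => // h'; case: (cid2 h').
exists r, W, Vf, rho; split=> //.
  split=> //.
  - by move=> z /rP[_ /V1U[]].
  - by move=> z /rP[dz V1z _ _]; exists (b z) => //; exact: b2.
  move=> z w zr wr zw; have := low z w zr wr; rewrite zw subrr modulus0 pmulr_rle0 ?divr_gt0// => h.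
  by apply/eqP; rewrite -subr_eq0 -modulus_eq0 eq_le h modulus_ge0.
move=> om omr; have [vr wv] := VP om omr; split=> //.
have [dW V1v V2v _] := rP _ vr; have bv := bn0 _ V2v.
exists (b (Vf om))^-1; last by rewrite -b2// exprVn divff// expf_neq0.
(* the inverse is Lipschitz, whence its derivative *)
apply/cderP => e e0.
pose Lc := 2 / modulus k; have L0 : 0 < Lc by rewrite divr_gt0.
pose Bm := modulus (b (Vf om)); have B0 : 0 < Bm by rewrite modulus_gt0.
have e10 : 0 < e * Bm / Lc by rewrite divr_gt0// mulr_gt0.
have [d d0 dP] := (cderP _ _ _).1 dW _ e10.
exists (Num.min (d / Lc) (rho - modulus om)); first by rewrite lt_min divr_gt0//= subr_gt0.
move=> w; rewrite lt_min => /andP[w1 w2].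
have wr : modulus w < rho.
  by have := modulusD (w - om) om; rewrite subrK; lra.
have [vwr wvw] := VP w wr.
have lip2 : modulus (Vf w - Vf om) <= Lc * modulus (w - om).
  have := low _ _ vwr vr; rewrite wv wvw => h.
  have -> : Lc * modulus (w - om) = (modulus k / 2)^-1 * modulus (w - om) by rewrite /Lc invf_div.
  by rewrite ler_pdivlMl// divr_gt0.
have := dP (Vf w) _; rewrite wv wvw => H.
have {H} h : modulus (w - om - b (Vf om) * (Vf w - Vf om)) <= e * Bm / Lc * modulus (Vf w - Vf om).
  apply: H; apply: le_lt_trans lip2 _.
  by rewrite mulrC -ltr_pdivlMr.
have -> : Vf w - Vf om - (b (Vf om))^-1 * (w - om) = - (w - om - b (Vf om) * (Vf w - Vf om)) / b (Vf om).
  by field.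
rewrite modulusM modulusN modulusV ler_pdivrMr//.
apply: le_trans h _; apply: le_trans (_ : e * Bm / Lc * (Lc * modulus (w - om)) <= _).
  by rewrite ler_wpM2l// ltW.
by rewrite le_eqVlt; apply/orP; left; apply/eqP; rewrite -/Bm; field; rewrite gt_eqF.
Qed.

End LocalInverse.

Section Signs.
Variable R : realType.
Local Notation C := (cplx R).

Lemma sign_modulus (e : C) : e ^+ 2 = 1 -> modulus e = 1.
Proof.
move=> e2; have := congr1 (@modulus R) e2; rewrite modulusX modulus1 => /eqP.
by rewrite sqrf_eq1 => /orP[/eqP//|/eqP en]; have := modulus_ge0 e; rewrite en; lra.
Qed.

Lemma sign_separated (x y : C) : x ^+ 2 = 1 -> y ^+ 2 = 1 -> modulus (x - y) < 1 -> x = y.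
Proof.
move=> x2 y2 xy; have /eqP := etrans x2 (esym y2); rewrite eqf_sqr => /orP[/eqP//|/eqP xn].
move: xy; rewrite xn (_ : - y - y = - (y + y)); last by ring.
have m2 : modulus (2 : C) = 2.
  by rewrite (_ : (2 : C) = (2 : R)%:C) ?modulus_real ?ger0_norm// rmorph_nat.
by rewrite modulusN -mulr2n -mulr_natl modulusM (sign_modulus y2) m2 => h; exfalso; clear x2 y2 xn m2; lra.
Qed.

End Signs.

Section NaturalMaps.
Variables (R : realType) (X : topologicalType) (S : compact_riemann_surface R X).
Local Notation C := (cplx R).
Variable a : chart R X -> X -> C.
Hypothesis aT : forall c d x, atlas S c -> atlas S d -> cdom c x -> cdom d x ->
  a d x = a c x * jac c d x ^+ 2.
Hypothesis aH : forall c, atlas S c -> holomorphic_on (crange c [set: X]) (a c \o cinv c).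
Hypothesis a0 : forall c x, atlas S c -> cdom c x -> a c x != 0.

(** [k] is locally a coordinate in which the quadratic differential is [dz^2]. *)
Definition natural_at (k : C -> X) (z : C) := {for z, continuous k} /\
  forall c, atlas S c -> cdom c (k z) ->
    exists2 l, is_derive z (1 : C) (cmap c \o k) l & a c (k z) * l ^+ 2 = 1.

Lemma natural_chart (k : C -> X) z c l : {for z, continuous k} -> atlas S c -> cdom c (k z) ->
  is_derive z (1 : C) (cmap c \o k) l -> a c (k z) * l ^+ 2 = 1 -> natural_at k z.
Proof.
move=> ck ac dc dk al; split=> // d ad dd.
exists (jac d c (k z) * l).
  have := cder_comp (transition_cder ad ac dd dc : is_derive ((cmap c \o k) z) _ _ _) dk.
  have n : \forall w \near z, cdom c (k w) := ck _ (open_near (@cdom_open R X c) dc).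
  by apply: near_cder; apply: filterS n => w dw; rewrite /= cmapK.
rewrite (aT ac ad dc dd).
have J : jac c d (k z) * jac d c (k z) = 1 by rewrite -(jac_comp ac ad ac dc dd dc) jac_refl.
suff alg (A j j' t : C) : j * j' = 1 -> A * t ^+ 2 = 1 -> A * j ^+ 2 * (j' * t) ^+ 2 = 1 by exact: alg.
move=> jj At; have -> : A * j ^+ 2 * (j' * t) ^+ 2 = A * t ^+ 2 * (j * j') ^+ 2 by ring.
by rewrite jj At expr1n mulr1.
Qed.

Lemma near_natural (k k' : C -> X) z : (\forall w \near z, k w = k' w) -> natural_at k z -> natural_at k' z.
Proof.
move=> kk [ck nk]; have kz : k z = k' z := nbhs_singleton kk.
have ck' : {for z, continuous k'}.
  move=> B; rewrite /= -kz => /ck H.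
  have {}H : \forall w \near z, B (k w) := H.
  have : \forall w \near z, B (k' w) by apply: filterS2 kk H => w <-.
  exact.
split=> // c ac; rewrite -kz => dc; have [l dl al] := nk c ac dc; exists l => //.
by apply: near_cder dl; apply: filterS kk => w; rewrite /= => ->.
Qed.

Lemma natural_affine (k : C -> X) (v e z : C) : e ^+ 2 = 1 -> natural_at k (v + e * z) ->
  natural_at (fun u => k (v + e * u)) z.
Proof.
move=> e2 [ck nk]; have da : is_derive z (1 : C) (fun u => v + e * u) e.
  have := cderD (is_derive_cst v z (1 : C)) (cderZ e (is_derive_id z (1 : C))).
  by rewrite add0r mulr1.
split; first exact: (continuous_comp (cder_continuous da) ck).
move=> c ac dc; have [l dl al] := nk c ac dc; exists (l * e).
  exact: (@cder_comp R (cmap c \o k) (fun u => v + e * u) z l e dl da).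
by rewrite exprMn e2 mulr1.
Qed.

(** In a flat coordinate a natural map is, up to sign, a translation. *)
Lemma natural_flat (k : C -> X) z c (r : R) (W : C -> C) : (\forall w \near z, natural_at k w) ->
  atlas S c -> cdom c (k z) -> 0 < r -> W (cmap c (k z)) = 0 ->
  (forall u, modulus (u - cmap c (k z)) < r -> crange c [set: X] u /\
     exists2 l, is_derive u (1 : C) W l & l ^+ 2 = a c (cinv c u)) ->
  exists e d, [/\ e ^+ 2 = 1, 0 < d & forall u, modulus u < d ->
    [/\ cdom c (k (z + u)), modulus (cmap c (k (z + u)) - cmap c (k z)) < r &
        W (cmap c (k (z + u))) = e * u]].
Proof.
move=> nk ac dc r0 W0 WP; have [ck _] := nbhs_singleton nk.
have n1 := ck _ (near_cmap dc (near_modulus (cmap c (k z)) r0)).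
have /nbhs_modulus[d1 d10 d1P] : \forall w \near z, natural_at k w /\
    (cdom c (k w) /\ modulus (cmap c (k w) - cmap c (k z)) < r).
  exact: filterS2 nk n1.
pose h w := W (cmap c (k w)).
have hd w : modulus (w - z) < d1 -> exists2 l, is_derive w (1 : C) h l & l ^+ 2 = 1.
  move=> /d1P[[_ nw] [dw wr]]; have [_ [l dl l2]] := WP _ wr; have [l' dl' al'] := nw c ac dw.
  exists (l * l'); first exact: (@cder_comp R W (cmap c \o k) w l l' dl dl').
  by rewrite exprMn l2 cmapK.
have hh : holomorphic_on [set w : C | modulus (w - z) < d1] h.
  by move=> w /hd[l dl _]; exact: cder_holomorphic dl.
have zd1 : modulus (z - z) < d1 by rewrite subrr modulus0.
have hh' := holomorphic_derive1 (@open_disc R z d1) hh.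
have dh w : modulus (w - z) < d1 -> derive1 h w ^+ 2 = 1.
  by move=> /hd[l dl l2]; rewrite (cder_derive1 dl).
pose e := derive1 h z.
have ce : {for z, continuous (derive1 h)} := cder_continuous (holomorphic_cder hh' zd1).
have /nbhs_modulus[d2 d20 d2P] := ce _ (near_modulus (derive1 h z) (@ltr01 R)).
have e2 : e ^+ 2 = 1 := dh z zd1.
have me := sign_modulus e2.
pose d := Num.min d1 d2; have d0 : 0 < d by rewrite lt_min d10.
have de w : modulus (w - z) < d -> derive1 h w = e.
  by rewrite lt_min => /andP[h1 h2]; exact: (sign_separated (dh w h1) e2 (d2P w h2)).
exists e, d; split=> // u ud.
have uz : modulus (z + u - z) < d by rewrite addrC addKr.
have ud1 : modulus (z + u - z) < d1 by move: uz; rewrite lt_min => /andP[].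
have [_ [dk kr]] := d1P _ ud1; split=> //.
have zd : modulus (z - z) < d by rewrite subrr modulus0.
have dl w : modulus (w - z) < d -> is_derive w (1 : C) (fun w => h w - e * w) (derive1 h w - e) /\
    modulus (derive1 h w - e) <= 0.
  move=> wd; split; last by rewrite (de w wd) subrr modulus0.
  have wd1 : modulus (w - z) < d1 by move: wd; rewrite lt_min => /andP[].
  have := cderB (holomorphic_cder hh wd1) (cderZ e (is_derive_id w (1 : C))).
  by rewrite mulr1.
have := cder_lipschitz dl uz zd; rewrite mulr0 mul0r => H.
have hz : h z = 0 by [].
have /eqP : modulus (h (z + u) - e * u) = 0.
  apply/eqP; rewrite eq_le modulus_ge0 andbT.
  by rewrite (_ : h (z + u) - e * u = h (z + u) - e * (z + u) - (h z - e * z))// hz; ring.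
by rewrite modulus_eq0 subr_eq0 => /eqP.
Qed.

Lemma flat_chart c x : atlas S c -> cdom c x -> exists (r : R) (W V : C -> C) (rho : R),
  [/\ 0 < r, 0 < rho, [/\ W (cmap c x) = 0,
   (forall u, modulus (u - cmap c x) < r -> crange c [set: X] u /\
     exists2 l, is_derive u (1 : C) W l & l ^+ 2 = a c (cinv c u)) &
   (forall z w, modulus (z - cmap c x) < r -> modulus (w - cmap c x) < r -> W z = W w -> z = w)] &
   (forall om, modulus om < rho -> [/\ modulus (V om - cmap c x) < r, W (V om) = om &
     exists2 l, is_derive om (1 : C) V l & a c (cinv c (V om)) * l ^+ 2 = 1])].
Proof.
move=> ac dc; have oU := @open_crange R X c _ openT.
have Ux : crange c [set: X] (cmap c x) by exact: crange_mem.
have f0 : (a c \o cinv c) (cmap c x) != 0 by rewrite /= cmapK// a0.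
have [r [W [V [rho [r0 rho0 [h1 h2 h3 h4] h5]]]]] := flat_coordinate oU Ux (aH ac) f0.
exists r, W, V, rho; split=> //; split=> // u ur; split; first exact: h1.
exact: h3.
Qed.

(** In a common flat coordinate both maps are, up to sign, translations. *)
Lemma natural_unique (k1 k2 : C -> X) z1 z2 : (\forall w \near z1, natural_at k1 w) ->
  (\forall w \near z2, natural_at k2 w) -> k1 z1 = k2 z2 ->
  exists2 e : C, e = 1 \/ e = -1 & \forall u \near (0 : C), k2 (z2 + u) = k1 (z1 + e * u).
Proof.
move=> n1 n2 E; have [c ac dc] := atlas_cover S (k1 z1).
have [r [W [V [rho [r0 _ [W0 WP Winj] _]]]]] := flat_chart ac dc.
have [e1 [d1 [e12 d10 P1]]] := natural_flat n1 ac dc r0 W0 WP.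
rewrite E in dc W0 WP Winj P1.
have [e2 [d2 [e22 d20 P2]]] := natural_flat n2 ac dc r0 W0 WP.
have e21 : (e1 * e2) ^+ 2 = 1 by rewrite exprMn e12 e22 mulr1.
exists (e1 * e2).
  by move/eqP: e21; rewrite sqrf_eq1 => /orP[]/eqP; [left|right].
have me := sign_modulus e21.
have d0 : 0 < Num.min d1 d2 by rewrite lt_min d10.
apply: filterS (near_modulus 0 d0) => u; rewrite subr0 lt_min => /andP[u1 u2].
have u1' : modulus (e1 * e2 * u) < d1 by rewrite modulusM me mul1r.
have [dk1 r1 w1] := P1 _ u1'; have [dk2 r2 w2] := P2 _ u2.
rewrite -(cmapK dk1) -(cmapK dk2); congr (cinv c _); apply: Winj => //.
by rewrite w1 w2 !mulrA -expr2 e12 mul1r.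
Qed.

Lemma natural_injective (k : C -> X) z : (\forall w \near z, natural_at k w) ->
  exists2 d, 0 < d & forall u v, modulus u < d -> modulus v < d -> k (z + u) = k (z + v) -> u = v.
Proof.
move=> n; have [c ac dc] := atlas_cover S (k z).
have [r [W [V [rho [r0 _ [W0 WP Winj] _]]]]] := flat_chart ac dc.
have [e [d [e2 d0 P]]] := natural_flat n ac dc r0 W0 WP.
exists d => // u v ud vd uv; have [_ _ w1] := P u ud; have [_ _ w2] := P v vd.
have e0 : e != 0 by rewrite -sqrf_eq0 e2 oner_eq0.
by apply: (mulfI e0); rewrite -w1 -w2 uv.
Qed.

(** What is needed of the covering property of the plane: through each of its
   points goes a continuous local section. *)
Lemma natural_section (k : C -> X) z (d : R) : (\forall w \near z, natural_at k w) -> 0 < d ->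
  exists2 q : X -> C, q (k z) = 0 &
    \forall y \near k z, [/\ {for y, continuous q}, modulus (q y) < d & k (z + q y) = y].
Proof.
move=> n d0; have [c ac dc] := atlas_cover S (k z).
have [r [W [V [rho [r0 _ [W0 WP Winj] _]]]]] := flat_chart ac dc.
have [e [d1 [e2 d10 P]]] := natural_flat n ac dc r0 W0 WP.
exists (fun y => e * W (cmap c y)); first by rewrite W0 mulr0.
have me := sign_modulus e2.
have dd : 0 < Num.min d d1 by rewrite lt_min d0.
have [_ [l dl _]] := WP (cmap c (k z)) (ltac:(by rewrite subrr modulus0)).
have nW : \forall u \near cmap c (k z), modulus (W u - W (cmap c (k z))) < Num.min d d1 :=
  cder_continuous dl (near_modulus (W (cmap c (k z))) dd).
have n2 : \forall u \near cmap c (k z), modulus (u - cmap c (k z)) < r /\ modulus (W u - W (cmap c (k z))) < Num.min d d1.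
  exact: filterS2 (near_modulus _ r0) nW.
apply: filterS (near_cmap dc n2) => y [dy [yr]]; rewrite W0 subr0 lt_min => /andP[y1 y2].
have [_ [l' dl' _]] := WP _ yr.
have mq : modulus (e * W (cmap c y)) = modulus (W (cmap c y)) by rewrite modulusM me mul1r.
split.
- have cW : {for y, continuous (fun y => W (cmap c y))}.
    exact: (continuous_comp (cmap_continuous dy) (cder_continuous dl')).
  have ccst : {for y, continuous (fun _ : X => e)} := @cst_continuous X C e y.
  exact: (continuousM ccst cW).
- by rewrite mq.
have [dk kr wk] := P (e * W (cmap c y)) (ltac:(by rewrite mq)).
rewrite -(cmapK dk) -[RHS](cmapK dy); congr (cinv c _); apply: Winj => //.
by rewrite wk mulrA -expr2 e2 mul1r.
Qed.

Lemma natural_exists x : exists2 d : R, 0 < d & exists2 k : C -> X, k 0 = x &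
  forall z, modulus z < d -> natural_at k z.
Proof.
have [c ac dc] := atlas_cover S x.
have [r [W [V [rho [r0 rho0 [W0 WP Winj] VP]]]]] := flat_chart ac dc.
exists rho => //; exists (cinv c \o V).
  rewrite /= -(cmapK dc); congr (cinv c _).
  have [vr wv _] := VP 0 (ltac:(by rewrite modulus0)).
  by apply: Winj => //; rewrite ?subrr ?modulus0// wv W0.
move=> z zr; have [vr wv [l dl al]] := VP z zr; have [/crangeP[rv _] _] := WP _ vr.
have [dv vv] := chart_inv rv.
apply: (@natural_chart _ z c l) => //.
- exact: (continuous_comp (cder_continuous dl) (cinv_continuous rv)).
have n : \forall w \near z, (cmap c @` cdom c) (V w) := cder_continuous dl (open_near (@crange_open R X c) rv).
by apply: near_cder dl; apply: filterS n => w /chart_inv[_]; rewrite /= => ->.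
Qed.

Lemma natural_uniform : exists2 rho : R, 0 < rho & forall x, exists2 k : C -> X, k 0 = x &
  forall z, modulus z < rho -> natural_at k z.
Proof.
apply: (@compact_uniform R X S (fun rho x => exists2 k : C -> X, k 0 = x & forall z, modulus z < rho -> natural_at k z)).
  move=> e e' x /andP[_ ee] [k k0 nk]; exists k => // z zr; apply: nk; exact: lt_le_trans zr ee.
move=> x; have [d d0 [k k0 nk]] := natural_exists x.
have n : \forall w \near (0 : C), natural_at k w.
  by apply: filterS (near_modulus 0 d0) => w; rewrite subr0; exact: nk.
have d2 : 0 < d / 2 by rewrite divr_gt0.
have [q q0 nq] := natural_section n d2; exists (d / 2) => //.
rewrite k0 in nq; apply: filterS nq => y [_ qd ky].
exists (fun z => k (q y + 1 * z)); first by rewrite mulr0 addr0 -{2}ky add0r.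
move=> z zd; apply: natural_affine; first by rewrite expr1n.
by apply: nk; rewrite mul1r; apply: le_lt_trans (modulusD _ _) _; lra.
Qed.

(** Where agreement would end, the maps differ by a half-turn, which moves every
   point but its centre. *)
Lemma natural_identity (k1 k2 : C -> X) (u v : C) :
  (forall t : R, 0 <= t <= 1 -> \forall w \near u + t%:C * (v - u), natural_at k1 w /\ natural_at k2 w) ->
  (\forall w \near u, k1 w = k2 w) -> \forall w \near v, k1 w = k2 w.
Proof.
move=> n Eu.
apply: (@segment_clopen R (fun z => \forall w \near z, k1 w = k2 w) u v Eu) => t tI.
  by move=> H; exact: (nbhs_interior H).
set z := u + _; have nz := n t tI => H.
have [n1 n2] : (\forall w \near z, natural_at k1 w) /\ (\forall w \near z, natural_at k2 w).
  by split; apply: filterS nz => w [].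
have [[c1 _] [c2 _]] := nbhs_singleton nz.
have [E|NE] := pselect (k1 z = k2 z); last first.
  have hX := surface_hausdorff S; rewrite open_hausdorff in hX.
  have [[A B] /= [Az Bz] [oA oB /eqP AB]] := hX _ _ (introN eqP NE).
  rewrite !inE in Az Bz.
  have m1 : \forall w \near z, A (k1 w) := c1 _ (open_near oA Az).
  have m2 : \forall w \near z, B (k2 w) := c2 _ (open_near oB Bz).
  apply: filterS2 m1 m2 => w Aw Bw /nbhs_singleton Ew.
  rewrite Ew in Aw; have AB2 : (A `&` B) (k2 w) := conj Aw Bw.
  by rewrite AB in AB2.
have [e [e1|e1] ne] := natural_unique n1 n2 E; subst e.
  exfalso; apply: H.
  move/nbhs_modulus: ne => [d d0 dP]; apply/nbhs_modulus; exists d => // w wd.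
  have := dP (w - z) (ltac:(by rewrite subr0)); rewrite mul1r (_ : z + (w - z) = w); last by ring.
  exact: esym.
have [d d0 inj] := natural_injective n1.
move/nbhs_modulus: ne => [d1 d10 d1P].
have dd : 0 < Num.min d d1 by rewrite lt_min d0.
apply: filterS (near_modulus z dd) => w; rewrite lt_min => /andP[wd wd1] Hw.
have Ew : k1 w = k2 w := nbhs_singleton Hw.
have := d1P (w - z) (ltac:(by rewrite subr0)); rewrite (_ : z + (w - z) = w); last by ring.
rewrite -Ew -{1}(_ : z + (w - z) = w); last by ring.
move=> /inj -/(_ wd); rewrite mulN1r modulusN => /(_ wd) e1.
have wz : w = z.
  apply/eqP; rewrite -subr_eq0; have : (w - z) * 2 = 0 by rewrite mulr_natr mulr2n {1}e1 addNr.
  by move=> /eqP; rewrite mulf_eq0 pnatr_eq0 orbF.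
by apply: H; rewrite -wz.
Qed.

End NaturalMaps.

(** * The plane over a flat surface *)
Section NaturalPlane.
Variables (R : realType) (X : topologicalType) (S : compact_riemann_surface R X).
Local Notation C := (cplx R).
Variable a : chart R X -> X -> C.
Hypothesis aT : forall c d x, atlas S c -> atlas S d -> cdom c x -> cdom d x ->
  a d x = a c x * jac c d x ^+ 2.
Hypothesis aH : forall c, atlas S c -> holomorphic_on (crange c [set: X]) (a c \o cinv c).
Hypothesis a0 : forall c x, atlas S c -> cdom c x -> a c x != 0.
Local Notation nat_at := (natural_at S a).
Variable rho : R.
Hypothesis rho0 : 0 < rho.
Hypothesis uniform : forall x, exists2 k : C -> X, k 0 = x & forall z, modulus z < rho -> nat_at k z.

(** Natural discs of radius [rho]; the value outside the disc makes equal discs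
   equal functions. *)
Definition natural_disc (k : C -> X) := (forall z, modulus z < rho -> nat_at k z) /\
  forall z, rho <= modulus z -> k z = k 0.

Lemma near_disc (z c : C) (r : R) (P : C -> Prop) : modulus (z - c) < r ->
  (forall w, modulus (w - c) < r -> P w) -> \forall w \near z, P w.
Proof. by move=> zr H; apply: filterS (open_near (@open_disc R c r) zr) => w; exact: H. Qed.

Lemma near_disc0 (z : C) (r : R) (P : C -> Prop) : modulus z < r ->
  (forall w, modulus w < r -> P w) -> \forall w \near z, P w.
Proof. by move=> zr H; apply: (@near_disc z 0 r) => [|w]; rewrite subr0//; exact: H. Qed.

Lemma natural_disc_exists x : exists2 k, natural_disc k & k 0 = x.
Proof.
have [k k0 nk] := uniform x; exists (fun z => if modulus z < rho then k z else k 0); last first.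
  by rewrite modulus0 rho0.
split=> [z zr|z]; last by rewrite modulus0 rho0 ltNge => ->.
by apply: near_natural (nk z zr); apply: near_disc0 zr _ => w ->.
Qed.

Lemma segment0 (t : R) (v : C) : 0 <= t <= 1 -> modulus (t%:C * v) <= modulus v.
Proof. by move=> /andP[t0 t1]; rewrite modulusM modulus_real ger0_norm// ler_piMl ?modulus_ge0. Qed.

Lemma natural_disc_eq k k' : natural_disc k -> natural_disc k' -> (\forall z \near (0 : C), k z = k' z) -> k = k'.
Proof.
move=> [nk ek] [nk' ek'] E; have E0 := nbhs_singleton E.
apply/funext => z; have [zr|zr] := ltP (modulus z) rho; last by rewrite ek// ek'.
suff N : \forall w \near z, k w = k' w by exact: nbhs_singleton N.
apply: (@natural_identity R X S a aH a0 k k' 0 z _ E) => t tI.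
rewrite add0r subr0; apply: near_disc0 (le_lt_trans (segment0 z tI) zr) _ => w wr.
by split; [exact: nk|exact: nk'].
Qed.

(** [k'] is the disc [k] seen from [k v]. *)
Definition shifts (v : C) (k k' : C -> X) := natural_disc k' /\ \forall z \near (0 : C), k' z = k (v + z).

Lemma near_add (v : C) (P : C -> Prop) : (\forall z \near v, P z) -> \forall z \near (0 : C), P (v + z).
Proof.
move=> /nbhs_modulus[d d0 dP]; apply/nbhs_modulus; exists d => // z.
by rewrite subr0 => zd; apply: dP; rewrite addrC addKr.
Qed.

Lemma near_sub (v : C) (P : C -> Prop) : (\forall z \near (0 : C), P (v + z)) -> \forall z \near v, P z.
Proof.
move=> /nbhs_modulus[d d0 dP]; apply/nbhs_modulus; exists d => // z zd.
by rewrite -(subrKC v z); apply: dP; rewrite subr0.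
Qed.

Lemma shift_exists (v : C) k : natural_disc k -> modulus v < rho -> exists k', shifts v k k'.
Proof.
move=> [nk ek] vr; have [k1 [nk1 ek1] k10] := natural_disc_exists (k v).
have n1 : \forall w \near (0 : C), nat_at k1 w.
  by apply: near_disc0 nk1; rewrite modulus0.
have n : \forall w \near v, nat_at k w by exact: near_disc0 vr nk.
have [e e1 ne] := natural_unique aH a0 n n1 (esym k10).
have e2 : e ^+ 2 = 1 by case: e1 => ->; rewrite ?sqrrN expr1n.
have me := sign_modulus e2.
exists (fun z => k1 (0 + e * z)); split.
  split=> z zr; first by apply: natural_affine => //; apply: nk1; rewrite add0r modulusM me mul1r.
  by rewrite mulr0 add0r addr0 ek1// modulusM me mul1r.
have /nbhs_modulus[d d0 dP] := ne; apply/nbhs_modulus; exists d => // z zd.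
have := dP (e * z); rewrite subr0 modulusM me mul1r -(subr0 z) => /(_ zd).
by rewrite subr0 mulrA -expr2 e2 mul1r.
Qed.

Lemma shift_agree (v : C) (k k' : C -> X) (z : C) : natural_disc k -> shifts v k k' -> modulus v < rho -> modulus z < rho ->
  modulus (v + z) < rho -> \forall w \near z, k' w = k (v + w).
Proof.
move=> [nk _] [[nk' _] E] vr zr vzr.
have E1 w : v + 1 * w = v + w by rewrite mul1r.
apply: (@natural_identity R X S a aH a0 k' (fun w => k (v + w)) 0 z _ E) => t tI.
rewrite add0r subr0.
have n1 : \forall w \near (t%:C * z : C), nat_at k' w.
  by apply: near_disc0 nk'; exact: le_lt_trans (segment0 z tI) zr.
have n2 : \forall w \near (t%:C * z : C), modulus (w - - v) < rho.
  apply: (@near_disc _ (- v) rho) => //; rewrite opprK addrC.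
  have := @disc_segment R 0 (v + z) v rho t tI; rewrite !subr0 => /(_ vzr vr).
  by rewrite (_ : v + z - v = z)//; ring.
apply: filterS2 n1 n2 => w h1 h2; split=> //.
have : nat_at (fun u => k (v + 1 * u)) w.
  by apply: natural_affine; [rewrite expr1n|apply: nk; rewrite mul1r; rewrite opprK addrC in h2].
by rewrite (_ : (fun w => k (v + 1 * w)) = (fun w => k (v + w)))//; apply/funext => u; rewrite E1.
Qed.

Definition shift v k : C -> X := xget k [set k' | shifts v k k'].

Lemma shiftP v k : natural_disc k -> modulus v < rho -> shifts v k (shift v k).
Proof. by move=> nk vr; have [k' H] := shift_exists nk vr; exact: (xgetPex k (ex_intro _ k' H)). Qed.

Lemma shift_disc v k : natural_disc k -> modulus v < rho -> natural_disc (shift v k).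
Proof. by move=> nk /(shiftP nk)[]. Qed.

Lemma shift_eq v k k' : natural_disc k -> modulus v < rho -> shifts v k k' -> shift v k = k'.
Proof.
move=> nk vr [nk' E']; have [nd E] := shiftP nk vr; apply: natural_disc_eq => //.
by apply: filterS2 E E' => z -> ->.
Qed.

Lemma shiftE (v : C) k (z : C) : natural_disc k -> modulus v < rho -> modulus z < rho -> modulus (v + z) < rho ->
  shift v k z = k (v + z).
Proof. by move=> nk vr zr vz; exact: nbhs_singleton (shift_agree nk (shiftP nk vr) vr zr vz). Qed.

Lemma shift0 k : natural_disc k -> shift 0 k = k.
Proof.
move=> nk; apply: shift_eq; rewrite ?modulus0//; split=> //.
by apply: filterE => z; rewrite add0r.
Qed.

Lemma shiftD (v w : C) k : natural_disc k -> modulus v < rho -> modulus w < rho -> modulus (v + w) < rho ->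
  shift w (shift v k) = shift (v + w) k.
Proof.
move=> nk vr wr vwr; have nv := shift_disc nk vr.
apply: shift_eq => //; split; first exact: shift_disc.
have [_ E] := shiftP nk vwr.
have E2 := near_add (shift_agree nk (shiftP nk vr) vr wr vwr).
by apply: filterS2 E E2 => z -> ->; rewrite addrA.
Qed.

Lemma shiftC (v w : C) k : natural_disc k -> modulus v < rho -> modulus w < rho -> modulus (v + w) < rho ->
  shift w (shift v k) = shift v (shift w k).
Proof. by move=> nk vr wr vwr; rewrite !shiftD// addrC// addrC. Qed.

Lemma iter_shift_disc n v k : natural_disc k -> modulus v < rho -> natural_disc (iter n (shift v) k).
Proof. by move=> nk vr; elim: n => //= n IH; exact: shift_disc. Qed.

Lemma modulus_nat (n : nat) : modulus (n%:R : C) = n%:R.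
Proof. by rewrite (_ : (n%:R : C) = (n%:R : R)%:C) ?modulus_real ?ger0_norm// rmorph_nat. Qed.

Lemma modulus_divn (v : C) (n : nat) : modulus (v / n.+1%:R) = modulus v / n.+1%:R.
Proof.
by rewrite modulusM modulusV modulus_nat.
Qed.

Lemma iter_shift_small n (v : C) k : natural_disc k -> modulus v < rho ->
  iter n.+1 (shift (v / n.+1%:R)) k = shift v k.
Proof.
move=> nk vr; have n0 : (n.+1%:R : C) != 0 by rewrite pnatr_eq0.
have st j : (j <= n.+1)%N -> iter j (shift (v / n.+1%:R)) k = shift (v / n.+1%:R * j%:R) k.
  elim: j => [|j IH] jn; first by rewrite mulr0 shift0.
  have lem i : (i <= n.+1)%N -> modulus (v / n.+1%:R * i%:R) < rho.
    move=> le_in; apply: le_lt_trans vr.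
    rewrite modulusM modulus_divn modulus_nat.
    by rewrite mulrAC -mulrA ler_piMr ?modulus_ge0// ler_pdivrMr ?ltr0n// mul1r ler_nat.
  have e1 : v / n.+1%:R * j%:R + v / n.+1%:R = v / n.+1%:R * j.+1%:R by rewrite -[j.+1%:R]natr1 mulrDr mulr1.
  have h1 : modulus (v / n.+1%:R) < rho by have := lem 1%N isT; rewrite mulr1.
  have h2 := lem j (ltnW jn); have h3 := lem j.+1 jn; rewrite -e1 in h3.
  by rewrite iterS IH ?(ltnW jn)// (shiftD nk h2 h1 h3) e1.
by rewrite st// divfK.
Qed.

Lemma iter_mul (T : Type) (f : T -> T) m n x : iter (m * n) f x = iter m (iter n f) x.
Proof. by elim: m => //= m IH; rewrite mulSn iterD IH. Qed.

Lemma half_rho : rho / 2 < rho.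
Proof. by rewrite ltr_pdivrMr// ltr_pMr// ltr1n. Qed.

(** [v] is cut into steps that are shorter than the radius of the discs. *)
Definition steps (v : C) : nat := Num.truncn (2 * modulus v / rho).

Lemma stepsP v : modulus (v / (steps v).+1%:R) < rho / 2.
Proof.
rewrite modulus_divn ltr_pdivrMr// -ltr_pdivrMl ?divr_gt0//.
have := truncnS_gt (2 * modulus v / rho); rewrite -/(steps v).
by rewrite (_ : (rho / 2)^-1 * modulus v = 2 * modulus v / rho)// invf_div mulrAC.
Qed.

Definition translate v k := iter (steps v).+1 (shift (v / (steps v).+1%:R)) k.

(** The number of steps is immaterial, by comparison with a common refinement. *)
Lemma translateE (v : C) n k : natural_disc k -> modulus (v / n.+1%:R) < rho ->
  iter n.+1 (shift (v / n.+1%:R)) k = translate v k.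
Proof.
move=> nk vn; set N := (n.+1 * (steps v).+1).-1.
have NE : N.+1 = (n.+1 * (steps v).+1)%N by rewrite prednK.
have vs : modulus (v / (steps v).+1%:R) < rho by exact: lt_trans (stepsP v) half_rho.
have it m (f g : (C -> X) -> C -> X) : (forall k, natural_disc k -> f k = g k /\ natural_disc (g k)) ->
    iter m f k = iter m g k.
  move=> fg; suff [] : iter m f k = iter m g k /\ natural_disc (iter m g k) by [].
  elim: m => //= m [-> H]; exact: fg.
transitivity (iter N.+1 (shift (v / N.+1%:R)) k).
  rewrite NE iter_mul; apply: it => k' nk'.
  have -> : v / (n.+1 * (steps v).+1)%:R = v / n.+1%:R / (steps v).+1%:R by rewrite natrM invfM mulrA.
  rewrite iter_shift_small//; split=> //; exact: shift_disc.
rewrite NE mulnC iter_mul /translate; apply: it => k' nk'.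
have -> : v / ((steps v).+1 * n.+1)%:R = v / (steps v).+1%:R / n.+1%:R by rewrite natrM invfM mulrA.
by rewrite iter_shift_small//; split=> //; exact: shift_disc.
Qed.

Lemma translate_disc v k : natural_disc k -> natural_disc (translate v k).
Proof.
by move=> nk; apply: iter_shift_disc => //; exact: lt_trans (stepsP v) half_rho.
Qed.

Lemma translateD (v w : C) k : natural_disc k -> modulus w < rho / 2 ->
  translate (v + w) k = shift w (translate v k).
Proof.
move=> nk wr; have wr' : modulus w < rho := lt_trans wr half_rho.
set n := (steps v + steps (v + w)%R)%N.
have div (u : C) (i : nat) : (i <= n)%N -> modulus (u / n.+1%:R) <= modulus (u / i.+1%:R).
  move=> le_in; rewrite !modulus_divn ler_wpM2l ?modulus_ge0// lef_pV2 ?posrE ?ltr0n// ler_nat ltnS.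
  exact: le_in.
have vn : modulus (v / n.+1%:R) < rho / 2 by apply: le_lt_trans (div v _ _) (stepsP v); exact: leq_addr.
have vwn : modulus ((v + w) / n.+1%:R) < rho / 2.
  by apply: le_lt_trans (div (v + w) _ _) (stepsP (v + w)); exact: leq_addl.
have wn : modulus (w / n.+1%:R) < rho / 2.
  by apply: le_lt_trans wr; have := div w 0%N isT; rewrite divr1.
have [vn' vwn' wn'] : [/\ modulus (v / n.+1%:R) < rho, modulus ((v + w) / n.+1%:R) < rho & modulus (w / n.+1%:R) < rho].
  by split; apply: lt_trans half_rho.
have vw' : modulus (v / n.+1%:R + w / n.+1%:R) < rho by rewrite -mulrDl.
rewrite -(translateE nk vwn') -(translateE nk vn') -(iter_shift_small n (iter_shift_disc _ nk vn') wr').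
set f := shift (v / _); set g := shift (w / _); set h := shift _.
have hE k' : natural_disc k' -> h k' = g (f k') by move=> nk'; rewrite /h /g /f shiftD// -mulrDl.
have fg k' : natural_disc k' -> f (g k') = g (f k').
  by move=> nk'; rewrite /f /g shiftC//; rewrite addrC.
have df k' : natural_disc k' -> natural_disc (f k') by move=> nk'; exact: shift_disc.
have dg k' : natural_disc k' -> natural_disc (g k') by move=> nk'; exact: shift_disc.
have itf i k' : natural_disc k' -> natural_disc (iter i f k') by move=> nk'; elim: i => //= i /df.
have itg i k' : natural_disc k' -> natural_disc (iter i g k') by move=> nk'; elim: i => //= i /dg.
have fgi i k' : natural_disc k' -> f (iter i g k') = iter i g (f k').
  by move=> nk'; elim: i => //= i IH; rewrite fg ?IH//; exact: itg.
elim: (n.+1) => //= i ->; rewrite hE; last by apply: itg; exact: itf.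
by rewrite fgi//; exact: itf.
Qed.

Variable k0 : C -> X.
Hypothesis dk0 : natural_disc k0.

Lemma natural_plane : forall v, nat_at (fun v => translate v k0 0) v.
Proof.
move=> v; have dv := translate_disc v dk0; have [nv _] := dv.
have n0 : nat_at (translate v k0) (- v + 1 * v) by apply: nv; rewrite mul1r addNr modulus0.
have := natural_affine (expr1n _ 2) n0.
apply: near_natural; apply: near_sub.
have r2 : 0 < rho / 2 by rewrite divr_gt0.
apply: filterS (near_modulus 0 r2) => z; rewrite subr0 => zr.
have zr' := lt_trans zr half_rho.
by rewrite mul1r addKr translateD// shiftE ?addr0 ?modulus0.
Qed.

End NaturalPlane.

Section FlatTorus.
Variables (R : realType) (X : topologicalType) (S : compact_riemann_surface R X).
Local Notation C := (cplx R).
Variable a : chart R X -> X -> C.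
Hypothesis aT : forall c d x, atlas S c -> atlas S d -> cdom c x -> cdom d x ->
  a d x = a c x * jac c d x ^+ 2.
Hypothesis aH : forall c, atlas S c -> holomorphic_on (crange c [set: X]) (a c \o cinv c).
Hypothesis a0 : forall c x, atlas S c -> cdom c x -> a c x != 0.

Lemma natural_plane_exists : exists F : C -> X, forall v, natural_at S a F v.
Proof.
have [rho rho0 unif] := natural_uniform aT aH a0; have [x _] := surface_nonempty S.
have [k dk _] := natural_disc_exists rho0 unif x.
by exists (fun v => translate S a rho v k 0); move=> v; exact: (natural_plane aH a0 rho0 unif dk v).
Qed.

Variable F : C -> X.
Hypothesis nF : forall v, natural_at S a F v.

Let near_nF (v : C) : \forall w \near v, natural_at S a F w.
Proof. exact: (@filterE _ (nbhs v) _ _ nF). Qed.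

(** The image is open. It is closed because a natural disc around a limit point
   is, up to sign and translation, a part of the plane. *)
Lemma plane_surjective x : exists v, F v = x.
Proof.
pose I := F @` [set: C].
have oI : open I.
  rewrite openE => _ [v _ <-]; have [q _ nq] := natural_section aH a0 (near_nF v) (@ltr01 R).
  by apply: filterS nq => y [_ _ <-]; exists (v + q y).
have cI : closed I.
  move=> y cly; have [d d0 [k ky nk]] := natural_exists aT aH a0 y.
  have n0 : \forall w \near (0 : C), natural_at S a k w by apply: near_disc0 nk; rewrite modulus0.
  have [q _ nq] := natural_section aH a0 n0 d0; rewrite ky in nq.
  have [_ [[v _ <-] [_ wd Ew]]] := cly _ nq; set w := q (F v) in wd Ew; rewrite add0r in Ew.
  have nw : \forall u \near w, natural_at S a k u by apply: near_disc0 wd nk.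
  have [e e1 ne] := natural_unique aH a0 nw (near_nF v) Ew.
  have e2 : e ^+ 2 = 1 by case: e1 => ->; rewrite ?sqrrN expr1n.
  have me := sign_modulus e2.
  exists (v + 1 * - (e * w)) => //.
  have -> : y = k (w + e * - (e * w)) by rewrite mulrN mulrA -expr2 e2 mul1r subrr.
  suff N : \forall u \near (- (e * w) : C), F (v + 1 * u) = k (w + e * u) by exact: nbhs_singleton N.
  apply: (@natural_identity R X S a aH a0 (fun u => F (v + 1 * u)) (fun u => k (w + e * u)) 0 (- (e * w))); last first.
    by apply: filterS ne => u; rewrite mul1r.
  move=> t tI; rewrite add0r subr0.
  have tw : modulus (t%:C * - (e * w) - - (e * w)) < d.
    have := @disc_segment R 0 0 w d t tI; rewrite !subr0 modulus0 sub0r => /(_ d0 wd) h.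
    rewrite (_ : _ - _ = e * (w + t%:C * - w)); last by ring.
    by rewrite modulusM me mul1r.
  apply: (near_disc tw) => u ud; split; first by apply: natural_affine (nF _); rewrite expr1n.
  apply: (natural_affine e2); apply: nk.
  have -> : w + e * u = e * (u - - (e * w)) by rewrite opprK mulrDr mulrA -expr2 e2 mul1r addrC.
  by rewrite modulusM me mul1r.
have : I = [set: X].
  apply: (surface_connected S).
  - by exists (F 0), 0.
  - by exists I => //; rewrite setTI.
  - by exists I => //; rewrite setTI.
by move=> IT; have : I x by [rewrite IT]; move=> [v _ <-]; exists v.
Qed.

Definition period (l : C) := forall z, F (z + l) = F z.

Lemma plane_identity (e v w : C) : e ^+ 2 = 1 ->
  (\forall u \near (0 : C), F (w + u) = F (v + e * u)) -> forall u, F (w + u) = F (v + e * u).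
Proof.
move=> e2 E u.
suff N : \forall z \near u, F (w + z) = F (v + e * z) by exact: nbhs_singleton N.
apply: (@natural_identity R X S a aH a0 (fun u => F (w + u)) (fun u => F (v + e * u)) 0 u _ E) => t tI.
apply: filterE => z; split; last exact: natural_affine (nF _).
have := natural_affine (expr1n _ 2) (nF (w + 1 * z)).
by have -> : (fun u => F (w + 1 * u)) = (fun u => F (w + u)) by apply/funext => z'; rewrite mul1r.
Qed.

(** Two points of the plane over the same point differ by a period: a half-turn
   has a fixed point, where [F] is injective. *)
Lemma plane_period v w : F v = F w -> period (w - v).
Proof.
move=> E; have [e e1 ne] := natural_unique aH a0 (near_nF v) (near_nF w) E.
have e2 : e ^+ 2 = 1 by case: e1 => ->; rewrite ?sqrrN expr1n.
have {ne} H := plane_identity e2 ne; case: e1 => e1; subst e.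
  by move=> z; have := H (z - v); rewrite mul1r subrKC => <-; congr F; ring.
pose c := (v + w) / 2; have two : (2 : C) != 0 by rewrite pnatr_eq0.
have [d d0 inj] := natural_injective aH a0 (near_nF c).
pose u : C := (d / 2)%:C; have ud : modulus u < d by rewrite modulus_real ger0_norm; lra.
have := H (c + u - w); rewrite subrKC (_ : v + -1 * (c + u - w) = c + - u); last by rewrite /c; field.
move=> /inj; rewrite modulusN => /(_ ud ud) un.
have : (u + u) = 0 by rewrite {2}un subrr.
rewrite -real_complexD => /eqP; rewrite eq_complex /= => /andP[/eqP h _].
have d2 : 0 < d / 2 by rewrite divr_gt0.
by exfalso; move: (addr_gt0 d2 d2); rewrite h ltxx.
Qed.

Lemma period_discrete : exists2 d : R, 0 < d & forall l, period l -> modulus l < d -> l = 0.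
Proof.
have [d d0 inj] := natural_injective aH a0 (near_nF 0); exists d => // l pl ld.
by apply: inj => //; rewrite ?modulus0// !add0r -(pl 0) add0r.
Qed.

End FlatTorus.

(** * Singular cochains *)
Section SingularCochains.
Variables (R : realType) (X : topologicalType).

Lemma row_continuous (T : topologicalType) n (f : T -> 'rV[R]_n) (x : T) :
  (forall j, {for x, continuous (fun u => f u 0 j)}) -> {for x, continuous f}.
Proof.
move=> cf; apply/cvg_ballP => e e0.
have n1 j : \forall u \near x, ball (f x 0 j) e (f u 0 j).
  by have /cvg_ballP := cf j; exact.
have n2 : \forall u \near x, forall j, ball (f x 0 j) e (f u 0 j) by exact: filter_forall.
by apply: filterS n2 => u h; split=> // i j; rewrite ord1.
Qed.

Lemma face_lift n (k : 'I_n.+2) (x : 'rV[R]_n.+1) j : face k x 0 (lift k j) = x 0 j.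
Proof. by rewrite mxE liftK. Qed.

Lemma face_self n (k : 'I_n.+2) (x : 'rV[R]_n.+1) : face k x 0 k = 0.
Proof. by rewrite mxE unlift_none. Qed.

Lemma face_sum (V : nmodType) n (k : 'I_n.+2) (x : 'rV[R]_n.+1) (h : R -> 'I_n.+2 -> V) :
  (forall i, h 0 i = 0) -> \sum_i h (face k x 0 i) i = \sum_i h (x 0 i) (lift k i).
Proof.
move=> h0; rewrite (@bigD1_ord _ _ _ _ k)//= face_self h0 add0r.
by apply: eq_bigr => i _; rewrite face_lift.
Qed.

Lemma face_simplex n (k : 'I_n.+2) (x : 'rV[R]_n.+1) : std_simplex x -> std_simplex (face k x).
Proof.
move=> [x0 x1]; split=> [i|]; last by rewrite (face_sum k x (h := fun r _ => r)).
by case: (unliftP k i) => [j|] ->; rewrite ?face_lift ?face_self.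
Qed.

Lemma face_continuous n (k : 'I_n.+2) : continuous (@face R n k).
Proof.
move=> x; apply: row_continuous => i.
case: (unliftP k i) => [j|] ->.
  have -> : (fun u : 'rV[R]_n.+1 => face k u 0 (lift k j)) = (fun u => u 0 j) by apply/funext => u; rewrite face_lift.
  exact: coord_continuous.
have -> : (fun u : 'rV[R]_n.+1 => face k u 0 k) = (fun=> 0) by apply/funext => u; rewrite face_self.
exact: cst_continuous.
Qed.

Lemma face_face n (k k' : 'I_n.+3) (l l' : 'I_n.+2) :
  (forall i, lift k (lift l i) = lift k' (lift l' i)) -> @face R n.+1 k \o face l = @face R n.+1 k' \o face l'.
Proof.
move=> E; apply/funext => x; apply/rowP => i /=.
have two (k1 : 'I_n.+3) (l1 : 'I_n.+2) : face k1 (face l1 x) 0 i = 0 /\ (forall j, i <> lift k1 (lift l1 j))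
    \/ exists2 j, i = lift k1 (lift l1 j) & face k1 (face l1 x) 0 i = x 0 j.
  case: (unliftP k1 i) => [i1|] ei; last first.
    left; split; first by rewrite ei face_self.
    by move=> j; rewrite ei => /eqP; rewrite (negPf (neq_lift _ _)).
  case: (unliftP l1 i1) => [i2|] ei1; last first.
    left; split; first by rewrite ei face_lift ei1 face_self.
    by move=> j; rewrite ei ei1 => /lift_inj /eqP; rewrite (negPf (neq_lift _ _)).
  by right; exists i2; rewrite ei ei1// !face_lift.
case: (two k l) => [[-> N]|[j ej ->]]; case: (two k' l') => [[-> N']|[j' ej' ->]] //.
- by case: (N j'); rewrite E.
- by case: (N' j); rewrite -E.
- by congr (x 0 _); apply: (@lift_inj _ l'); apply: (@lift_inj _ k'); rewrite -E -ej.
Qed.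

Lemma singular_comp n m (s : 'rV[R]_n.+1 -> X) (f : 'rV[R]_m.+1 -> 'rV[R]_n.+1) :
  singular_simplex s -> continuous f -> (forall x, std_simplex x -> std_simplex (f x)) ->
  singular_simplex (s \o f).
Proof.
rewrite /singular_simplex => /subspace_continuousP cs cf fS; apply/subspace_continuousP => x Sx B nB.
have n1 : \forall y \near f x, std_simplex y -> B (s y) := cs (f x) (fS x Sx) B nB.
have n2 : \forall y \near x, std_simplex (f y) -> B (s (f y)) := cf x _ n1.
have n3 : \forall y \near x, std_simplex y -> B (s (f y)) by apply: filterS n2 => y h /fS.
exact: n3.
Qed.

Lemma singular_face n (k : 'I_n.+2) (s : 'rV[R]_n.+2 -> X) :
  singular_simplex s -> singular_simplex (s \o face k).
Proof. by move=> cs; apply: singular_comp => //; [exact: face_continuous|exact: face_simplex]. Qed.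

Lemma coboundary1 (phi : ('rV[R]_1 -> X) -> R) s :
  coboundary phi s = phi (s \o face 0) - phi (s \o face 1).
Proof. by rewrite /coboundary big_ord_recl big_ord1 expr0 expr1 mul1r mulN1r; congr (_ - phi (s \o face _)); exact: val_inj. Qed.

Lemma coboundary2 (phi : ('rV[R]_2 -> X) -> R) s :
  coboundary phi s = phi (s \o face 0) - phi (s \o face 1) + phi (s \o face (lift ord0 (lift ord0 ord0))).
Proof.
rewrite /coboundary !big_ord_recl big_ord0 addr0 /= /bump /= !(addn0, addn1).
rewrite expr0 expr1 sqrrN expr1n !mul1r mulN1r addrA.
by rewrite (_ : lift ord0 ord0 = 1)//; exact: val_inj.
Qed.

Lemma coboundary3 (phi : ('rV[R]_3 -> X) -> R) s :
  coboundary phi s = phi (s \o face 0) - phi (s \o face 1)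
    + phi (s \o face (lift ord0 (lift ord0 ord0))) - phi (s \o face ord_max).
Proof.
rewrite /coboundary !big_ord_recl big_ord0 addr0 /= /bump /= !(addn0, addn1).
rewrite expr0 expr1 (exprS _ 2) sqrrN expr1n mulr1 !mul1r !mulN1r !addrA.
by rewrite (_ : lift ord0 ord0 = 1) 1?(_ : lift ord0 (lift ord0 (lift ord0 ord0)) = ord_max)//; exact: val_inj.
Qed.

Definition cup (f g : ('rV[R]_2 -> X) -> R) (s : 'rV[R]_3 -> X) : R :=
  f (s \o face (lift ord0 (lift ord0 ord0))) * g (s \o face 0).

Lemma cup_cocycle f g : cocycle f -> cocycle g -> cocycle (cup f g).
Proof.
move=> [cf df] [cg dg]; split.
  move=> s t cs ct st; congr (_ * _).
    apply: cf; [exact: singular_face|exact: singular_face|].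
    by move=> x /set_mem Sx; apply: st; apply/mem_set; exact: face_simplex.
  apply: cg; [exact: singular_face|exact: singular_face|].
  by move=> x /set_mem Sx; apply: st; apply/mem_set; exact: face_simplex.
move=> s cs.
pose i2 : 'I_4 := lift ord0 (lift ord0 ord0); pose i3 : 'I_4 := ord_max.
have F3 := df _ (singular_face (k := i3) cs); have F0 := dg _ (singular_face (k := 0) cs).
rewrite !coboundary2 /= in F3 F0.
rewrite coboundary3 /cup -/i2 -/i3.
pose j2 : 'I_3 := lift ord0 (lift ord0 ord0); rewrite -/j2 in F3 F0 *.
have e (k k' : 'I_4) (l l' : 'I_3) : (forall i, lift k (lift l i) = lift k' (lift l' i)) ->
    s \o face k \o face l = s \o face k' \o face l'.
  by move=> /face_face E; exact: (congr1 (fun h => s \o h) E).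
have e1 : f (s \o face 0 \o face j2) = f (s \o face i3 \o face 0).
  by congr (f _); apply: e => -[[|[|i]] Hi] //; apply/val_inj.
have e2 : f (s \o face 1 \o face j2) = f (s \o face i3 \o face 1).
  by congr (f _); apply: e => -[[|[|i]] Hi] //; apply/val_inj.
have e3 : f (s \o face i2 \o face j2) = f (s \o face i3 \o face j2).
  by congr (f _); apply: e => -[[|[|i]] Hi] //; apply/val_inj.
have e4 : g (s \o face 1 \o face 0) = g (s \o face 0 \o face 0).
  by congr (g _); apply: e => -[[|[|i]] Hi] //; apply/val_inj.
have e5 : g (s \o face i2 \o face 0) = g (s \o face 0 \o face 1).
  by congr (g _); apply: e => -[[|[|i]] Hi] //; apply/val_inj.
have e6 : g (s \o face i3 \o face 0) = g (s \o face 0 \o face j2).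
  by congr (g _); apply: e => -[[|[|i]] Hi] //; apply/val_inj.
rewrite e1 e2 e3 e4 e5 e6.
have -> : f (s \o face i3 \o face 1) = f (s \o face i3 \o face 0) + f (s \o face i3 \o face j2) by lra.
have -> : g (s \o face 0 \o face 1) = g (s \o face 0 \o face 0) + g (s \o face 0 \o face j2) by lra.
by ring.
Qed.

End SingularCochains.

(** * Cohomology of a quotient of the plane by translations *)
Section PlaneCovering.
Variables (R : realType) (X : topologicalType).
Local Notation C := (cplx R).
Variable F : C -> X.
Hypothesis cF : continuous F.
Hypothesis surjF : forall x, exists v, F v = x.
Hypothesis sectF : forall v, exists q : X -> C,
  \forall y \near F v, {for y, continuous q} /\ F (v + q y) = y.
Hypothesis perF : forall v w, F v = F w -> period F (w - v).

Definition path_lifts (s : R -> X) (t : R) :=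
  exists2 g : R -> C, continuous g & forall u, u <= t -> F (g u) = s u.

Lemma clamp_continuous (t0 t1 : R) : continuous (fun u : R => Num.max t0 (Num.min u t1)).
Proof.
move=> u; have c1 : {for u, continuous (fun u : R => Num.min u t1)}.
  by apply: (@continuous_min R R id (fun=> t1)); [exact: cvg_id|exact: cst_continuous].
by apply: (@continuous_max R R (fun=> t0) (fun u => Num.min u t1)); [exact: cst_continuous|].
Qed.

(** A lift is continued by a local section of the covering, moved by the
   period that makes both agree at the end of the lift. *)
Lemma lift_extend (s : R -> X) (w : C) (q : X -> C) t0 t1 : continuous s -> t0 <= t1 ->
  (forall u, t0 <= u <= t1 -> {for s u, continuous q} /\ F (w + q (s u)) = s u) ->
  path_lifts s t0 -> path_lifts s t1.
Proof.
move=> cs t01 Q [g cg Fg]; pose cl u := Num.max t0 (Num.min u t1).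
have clI u : t0 <= cl u <= t1 by rewrite /cl le_max lexx /= ge_max t01 ge_min lexx orbT.
have cl0 u : u <= t0 -> cl u = t0.
  by move=> ut; rewrite /cl max_l// ge_min ut.
pose rh u := q (s (cl u)).
exists (fun u => g (Num.min u t0) + (rh u - rh t0)).
  move=> u; have crh : {for u, continuous rh}.
    have c1 : {for u, continuous (fun u => s (cl u))} := continuous_comp (@clamp_continuous t0 t1 u) (cs _).
    exact: (continuous_comp c1 (Q _ (clI u)).1).
  have c2 : {for u, continuous (fun u : R => Num.min u t0)}.
    by apply: (@continuous_min R R id (fun=> t0)); [exact: cvg_id|exact: cst_continuous].
  have c3 : {for u, continuous (fun u => g (Num.min u t0))} := continuous_comp c2 (cg _).
  have c4 : {for u, continuous (fun _ : R => rh t0)} := @cst_continuous _ _ _ _.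
  exact: (continuousD c3 (continuousB crh c4)).
move=> u ut; have [ut0|tu] := leP u t0.
  by rewrite /rh (cl0 u ut0) (cl0 t0 (lexx _)) subrr addr0 Fg.
have e1 : cl u = u by rewrite /cl min_l// max_r// ltW.
rewrite /rh e1 (cl0 t0 (lexx _)).
have [_ E0] := Q t0 (ltac:(by rewrite lexx)).
have [_ E] := Q u (ltac:(by rewrite ltW)).
have pl : period F (g t0 - (w + q (s t0))) by apply: perF; rewrite E0 Fg.
by rewrite -[RHS]E -(pl (w + q (s u))); congr F; ring.
Qed.

(** The set of times up to which the path lifts is open and closed. *)
Lemma path_lifting (s : R -> X) : continuous s -> (forall u, u <= 0 -> s u = s 0) -> path_lifts s 1.
Proof.
move=> cs s0; have mono t t' : t' <= t -> path_lifts s t -> path_lifts s t'.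
  by move=> tt [g cg Fg]; exists g => // u ut; apply: Fg; exact: le_trans ut tt.
have loc t : exists2 d : R, 0 < d & forall t0 t1, t0 <= t1 -> t - d < t0 -> t1 < t + d ->
    path_lifts s t0 -> path_lifts s t1.
  have [v Ev] := surjF (s t); have [q nq] := sectF v; rewrite Ev in nq.
  have n1 : \forall u \near t, {for s u, continuous q} /\ F (v + q (s u)) = s u := cs t _ nq.
  have /nbhs_ballP[d d0 dP] := n1; exists d => // t0 t1 t01 h0 h1.
  apply: (@lift_extend s v q) => // u /andP[u0 u1]; apply: dP.
  by rewrite /ball /= ltr_norml; apply/andP; split; lra.
apply: (@unit_interval_clopen R (path_lifts s)); last by rewrite ler01 lexx.
- have [v Ev] := surjF (s 0); exists (fun=> v); first exact: cst_continuous.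
  by move=> u /s0 ->.
- move=> t tI Pt; have [d d0 dP] := loc t; apply/nbhs_ballP; exists d => // u.
  rewrite /ball /= ltr_norml => /andP[h1 h2]; have [ut|tu] := leP u t; first exact: mono ut Pt.
  by apply: (dP t u (ltW tu)) => //; lra.
move=> t tI Pt; have [d d0 dP] := loc t; apply/nbhs_ballP; exists d => // u.
rewrite /ball /= ltr_norml => /andP[h1 h2] Pu; apply: Pt; have [tu|ut] := leP t u; first exact: mono tu Pu.
by apply: (dP u t (ltW ut)) => //; lra.
Qed.

Definition plane_simplex n (l : seq C) (x : 'rV[R]_n.+1) : X := F (\sum_k (x 0 k)%:C * l`_k).

Lemma plane_singular n l : singular_simplex (@plane_simplex n l).
Proof.
have cs (r : seq 'I_n.+1) : continuous (fun x : 'rV[R]_n.+1 => \sum_(k <- r) (x 0 k)%:C * l`_k : C).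
  elim: r => [|k r IH] x.
    rewrite (_ : (fun x => _) = fun=> 0); first exact: cst_continuous.
    by apply/funext => y; rewrite big_nil.
  rewrite (_ : (fun x => _) = fun y : 'rV[R]_n.+1 => (y 0 k)%:C * l`_k + \sum_(k <- r) (y 0 k)%:C * l`_k); last first.
    by apply/funext => y; rewrite big_cons.
  have c1 : {for x, continuous (fun y : 'rV[R]_n.+1 => (y 0 k)%:C : C)}.
    exact: (continuous_comp (@coord_continuous R 1 n.+1 0 k x) (@continuous_real_complex R _)).
  have c2 : {for x, continuous (fun _ : 'rV[R]_n.+1 => l`_k : C)} := @cst_continuous _ _ _ _.
  exact: (continuousD (continuousM c1 c2) (IH x)).
have cp : continuous (@plane_simplex n l).
  move=> x; exact: (@continuous_comp _ _ _ (fun x : 'rV[R]_n.+1 => \sum_k (x 0 k)%:C * l`_k : C) F x (cs _ x) (@cF _)).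
exact: continuous_subspaceT.
Qed.

Lemma plane_face n (l l' : seq C) (k : 'I_n.+2) : (forall i : 'I_n.+1, l`_(lift k i) = l'`_i) ->
  @plane_simplex n.+1 l \o face k = plane_simplex l'.
Proof.
move=> E; apply/funext => x /=; congr F.
rewrite (face_sum k x (h := fun r i => r%:C * l`_i)); last by move=> i; rewrite mul0r.
by apply: eq_bigr => i _; rewrite E.
Qed.

Definition edge (phi : ('rV[R]_2 -> X) -> R) (u v : C) := phi (plane_simplex [:: u; v]).

Lemma plane_triangle (phi : ('rV[R]_2 -> X) -> R) (u v w : C) :
  coboundary phi (plane_simplex [:: u; v; w]) = edge phi v w - edge phi u w + edge phi u v.
Proof.
rewrite coboundary2; congr (phi _ - phi _ + phi _); apply: plane_face => -[[|[|i]] Hi] //.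
Qed.

Lemma edge_period (phi : ('rV[R]_2 -> X) -> R) l u v : cochain phi -> period F l -> edge phi (u + l) (v + l) = edge phi u v.
Proof.
move=> cphi pl; apply: cphi; [exact: plane_singular|exact: plane_singular|].
move=> x /set_mem [_]; rewrite /plane_simplex !big_ord_recl !big_ord0 /= !addr0 => x1.
rewrite -[RHS]pl; congr F.
have alg (A B : C) : A + B = 1 -> A * (u + l) + B * (v + l) = A * u + B * v + l.
  by move=> AB; rewrite -[in RHS](mul1r l) -AB; ring.
by apply: alg; rewrite -real_complexD x1.
Qed.

Section Periods.
Variable phi : ('rV[R]_2 -> X) -> R.
Hypothesis cphi : cocycle phi.

Lemma edge_add u v w : edge phi u w = edge phi u v + edge phi v w.
Proof.
have := (cphi.2 _ (@plane_singular 2 [:: u; v; w])); rewrite plane_triangle.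
by move=> h; lra.
Qed.

Lemma edge_refl u : edge phi u u = 0.
Proof. by have := edge_add u u u; lra. Qed.

Lemma edge_periodD l l' : period F l -> edge phi 0 (l + l') = edge phi 0 l + edge phi 0 l'.
Proof. by move=> pl; rewrite (edge_add 0 l) -(edge_period 0 l' cphi.1 pl) add0r (addrC l'). Qed.

(** The edges from 0 to the points over [x] have the same value when the
   periods have value 0; this value is the 0-cochain that [phi] bounds. *)
Hypothesis phi0 : forall l, period F l -> edge phi 0 l = 0.

Lemma edge_fibre v w : F v = F w -> edge phi 0 v = edge phi 0 w.
Proof.
move=> /perF pl; have := edge_periodD v pl; rewrite (phi0 pl) add0r => <-.
by rewrite subrK.
Qed.

(** The cone over a lifted path, with its apex at the origin, is a 2-simplex of
   which two faces are straight edges and the third one is the path. *)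
Lemma edge_exact : exact_cochain phi.
Proof.
pose vx x := sval (cid (surjF x)); have FvE x : F (vx x) = x := svalP (cid (surjF x)).
have S1 : @std_simplex R 0 (const_mx 1) by split=> [k|]; rewrite ?big_ord1 mxE.
exists (fun s => edge phi 0 (vx (s (const_mx 1)))); split.
  by move=> s t _ _ /(_ _ (mem_set S1)) ->.
move=> s cs.
pose pt (u : R) : 'rV[R]_2 := \row_j if j == 0 then 1 - u else u.
pose cl (u : R) := Num.max 0 (Num.min u 1).
have clI u : 0 <= cl u <= 1 by rewrite /cl le_max lexx /= ge_max ler01 ge_min lexx orbT.
have clE u : 0 <= u <= 1 -> cl u = u by move=> /andP[u0 u1]; rewrite /cl min_l// max_r.
have cpt : continuous pt.
  move=> u; apply: row_continuous => j; case: (altP (j =P 0)) => [->|j0].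
    rewrite (_ : (fun u => _) = (fun u => 1 - u)); last by apply/funext => y; rewrite mxE eqxx.
    exact: (continuousB (@cst_continuous _ _ _ _) (@cvg_id _ _)).
  rewrite (_ : (fun u => _) = id); first exact: cvg_id.
  by apply/funext => y; rewrite mxE (negPf j0).
have ptS u : 0 <= u <= 1 -> std_simplex (pt u).
  move=> /andP[u0 u1]; split=> [k|]; last by rewrite !big_ord_recl big_ord0 !mxE /= addr0 subrK.
  by rewrite mxE; case: ifP => _ //; rewrite subr_ge0.
have ptE (x : 'rV[R]_2) : std_simplex x -> pt (x 0 1) = x /\ 0 <= x 0 1 <= 1.
  move=> [x0]; rewrite !big_ord_recl big_ord0 addr0 => x1.
  have e1 : lift ord0 ord0 = 1 :> 'I_2 by exact: val_inj.
  rewrite e1 in x1; split; last by rewrite x0 /=; have := x0 0; move: x1 => /=; lra.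
  apply/rowP => j; rewrite mxE; case: (altP (j =P 0)) => [->|j0]; first by rewrite -x1 addrK.
  by congr (x 0 _); apply: val_inj; case: j j0 => [[|[|]]].
have cst : continuous (fun u => s (pt (cl u))).
  move=> u B nB; have /subspace_continuousP cs' := cs.
  have n1 : \forall y \near pt (cl u), std_simplex y -> B (s y) := cs' _ (ptS _ (clI u)) B nB.
  have n2 : \forall y \near u, std_simplex (pt (cl y)) -> B (s (pt (cl y))).
    exact: (continuous_comp (@clamp_continuous 0 1 u) (cpt _)) n1.
  have n3 : \forall y \near u, B (s (pt (cl y))) by apply: filterS n2 => y; apply; exact: ptS.
  exact: n3.
have [g0 cg0 Fg0] : path_lifts (fun u => s (pt (cl u))) 1.
  apply: path_lifting => // u u0; congr (s (pt _)); rewrite [RHS]clE ?lexx ?ler01//.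
  by rewrite /cl max_l// ge_min u0.
pose g u := g0 (cl u).
have cg : continuous g by move=> u; exact: (continuous_comp (@clamp_continuous 0 1 u) (cg0 _)).
have Fg u : 0 <= u <= 1 -> F (g u) = s (pt u).
  by move=> uI; rewrite /g clE// Fg0 ?clE//; case/andP: uI.
have [M M0 gM] : exists2 M : R, 0 <= M & forall u, modulus (g u) <= M.
  have cm : {within `[0 : R, 1], continuous (fun u => modulus (g0 u))}.
    apply: continuous_subspaceT => u; exact: (continuous_comp (cg0 u) (@continuous_modulus R _)).
  have [c _ cM] := EVT_max ler01 cm; exists (modulus (g0 c)); first exact: modulus_ge0.
  by move=> u; apply: cM; rewrite in_itv /= clI.
pose G (x : 'rV[R]_3) : C := (1 - x 0 0)%:C * g (x 0 ord_max / (1 - x 0 0)).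
have cG : continuous G.
  move=> x; have c0 : {for x, continuous (fun y : 'rV[R]_3 => 1 - y 0 0)}.
    exact: (continuousB (@cst_continuous _ _ (1 : R) x) (@coord_continuous R 1 3 0 0 x)).
  have [x00|x00] := eqVneq (1 - x 0 0) 0; last first.
    have c1 : {for x, continuous (fun y : 'rV[R]_3 => y 0 ord_max / (1 - y 0 0))}.
      have c4 : {for x, continuous (fun y : 'rV[R]_3 => y 0 ord_max)} by exact: coord_continuous.
      have c5 : {for x, continuous (fun y : 'rV[R]_3 => (1 - y 0 0)^-1)} by exact: continuousV.
      exact: (@continuousM R _ (fun y : 'rV[R]_3 => y 0 ord_max) (fun y => (1 - y 0 0)^-1) x c4 c5).
    have c2 : {for x, continuous (fun y : 'rV[R]_3 => g (y 0 ord_max / (1 - y 0 0)))} := continuous_comp c1 (cg _).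
    have c3 : {for x, continuous (fun y : 'rV[R]_3 => (1 - y 0 0)%:C : C)} := continuous_comp c0 (@continuous_real_complex R _).
    exact: (continuousM c3 c2).
  have Gx : G x = 0 by rewrite /G x00 mul0r.
  move=> B; rewrite Gx => /nbhs_modulus[e e0 eB].
  have M1 : 0 < M + 1 by rewrite ltr_wpDl.
  have n1 : nbhs x (fun y : 'rV[R]_3 => ball (1 - x 0 0) (e / (M + 1)) (1 - y 0 0)).
    by have /cvg_ballP := c0; apply; rewrite divr_gt0.
  have n2 : \forall y \near x, B (G y).
    apply: filterS n1 => y; rewrite /ball /= x00 sub0r normrN => h; apply: eB.
    rewrite subr0 /G modulusM modulus_real.
    apply: le_lt_trans (_ : `|1 - y 0 0| * (M + 1) < e); last by rewrite -ltr_pdivlMr.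
    by apply: ler_wpM2l => //; apply: le_trans (gM _) _; rewrite lerDl.
  exact: n2.
have cT : continuous (F \o G) by move=> x; exact: (@continuous_comp _ _ _ G F x (cG x) (@cF _)).
have sT : singular_simplex (F \o G) by exact: continuous_subspaceT.
have := cphi.2 _ sT; rewrite coboundary2.
pose j2 : 'I_3 := lift ord0 (lift ord0 ord0); rewrite -/j2.
have m2 : ord_max = j2 :> 'I_3 by exact: val_inj.
have onS k (t : 'rV[R]_2 -> X) : singular_simplex t ->
    (forall x : 'rV[R]_2, std_simplex x -> F (G (face k x)) = t x) -> phi (F \o G \o face k) = phi t.
  move=> ct E; apply: cphi.1; [exact: singular_face|by []|].
  by move=> x /set_mem Sx /=; exact: E.
have l1 (x : 'rV[R]_2) (k : 'I_3) j i : i = lift k j -> face k x 0 i = x 0 j by move=> ->; exact: face_lift.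
have -> : phi (F \o G \o face 0) = phi s.
  apply: onS => // x /[dup] Sx /ptE[xE xI].
  rewrite /G face_self m2 (l1 x 0 1) ; last exact: val_inj.
  by rewrite subr0 divr1 mul1r Fg// xE.
have -> : phi (F \o G \o face 1) = edge phi 0 (g 1).
  apply: onS; first exact: plane_singular.
  move=> x /[dup] [[x0 x1]] /ptE[xE xI]; rewrite /plane_simplex /G m2.
  rewrite (l1 x 1 0); last exact: val_inj.
  rewrite (l1 x 1 1); last exact: val_inj.
  move: x1; rewrite !big_ord_recl !big_ord0 /= !addr0 => x1; congr F; rewrite mulr0 add0r.
  have e1 : lift ord0 ord0 = 1 :> 'I_2 by exact: val_inj.
  rewrite e1 in x1 *; have -> : 1 - x 0 0 = x 0 1 by rewrite -x1 addrC addKr.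
  by have [->|n0] := eqVneq (x 0 1) 0; [rewrite !mul0r|rewrite divff].
have -> : phi (F \o G \o face j2) = edge phi 0 (g 0).
  apply: onS; first exact: plane_singular.
  move=> x /[dup] [[x0 x1]] /ptE[xE xI]; rewrite /plane_simplex /G m2 face_self.
  rewrite (l1 x j2 0); last exact: val_inj.
  move: x1; rewrite !big_ord_recl !big_ord0 /= !addr0 => x1; congr F; rewrite mulr0 add0r mul0r.
  have e1 : lift ord0 ord0 = 1 :> 'I_2 by exact: val_inj.
  by rewrite e1 in x1 *; have -> : 1 - x 0 0 = x 0 1 by rewrite -x1 addrC addKr.
have f0 : s (face 0 (const_mx 1)) = F (g 1).
  rewrite Fg ?lexx ?ler01//; congr s; apply/rowP => j; rewrite mxE [RHS]mxE; case: (unliftP 0 j) => [j'|] ->.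
    by rewrite /= mxE.
  by rewrite /= subrr.
have f1 : s (face 1 (const_mx 1)) = F (g 0).
  rewrite Fg ?lexx ?ler01//; congr s; apply/rowP => j; rewrite mxE [RHS]mxE; case: (unliftP 1 j) => [j'|] ->.
    by rewrite /= mxE (ord1 j') /= subr0.
  by [].
rewrite coboundary1 /= f0 f1.
rewrite (edge_fibre (FvE (F (g 1)))) (edge_fibre (FvE (F (g 0)))).
by move=> h; lra.
Qed.

End Periods.
End PlaneCovering.

Section PeriodLattice.
Variables (R : realType) (X : topologicalType).
Local Notation C := (cplx R).
Variable F : C -> X.
Hypothesis discF : exists2 d : R, 0 < d & forall l, period F l -> modulus l < d -> l = 0.

Lemma period0 : period F 0.
Proof. by move=> z; rewrite addr0. Qed.

Lemma periodB l l' : period F l -> period F l' -> period F (l - l').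
Proof. by move=> pl pl' z; rewrite -(pl' (z + (l - l'))) -[RHS]pl; congr F; ring. Qed.

Lemma periodMn l n : period F l -> period F (l * n%:R).
Proof.
move=> pl; elim: n => [|n IH]; first by rewrite mulr0; exact: period0.
by move=> z; rewrite -natr1 mulrDr mulr1 addrA pl IH.
Qed.

Lemma periodMz l (n : int) : period F l -> period F (l * n%:~R).
Proof.
move=> pl; case: n => n; first exact: periodMn.
rewrite NegzE mulrNz mulrN -[- _]add0r; apply: periodB; first exact: period0.
exact: periodMn.
Qed.

(** Pigeonhole on the cells of side [d / 2] of a box. *)
Lemma bounded_collision (d M : R) (f : nat -> C) : 0 < d -> 0 <= M ->
  (forall n, `|complex.Re (f n)| <= M /\ `|complex.Im (f n)| <= M) ->
  exists i j : nat, i <> j /\ modulus (f i - f j) < d.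
Proof.
move=> d0 M0 fM; have e0 : 0 < d / 2 by rewrite divr_gt0.
pose cell (x : R) := Num.truncn ((x + M) / (d / 2)).
pose K := (Num.truncn (2 * M / (d / 2))).+1.
have cellK x : `|x| <= M -> (cell x < K)%N.
  rewrite ler_norml => /andP[x0 x1]; rewrite ltnS; apply: le_truncn.
  by rewrite ler_pM2r ?invr_gt0//; lra.
have cellP x y : `|x| <= M -> `|y| <= M -> cell x = cell y -> `|x - y| < d / 2.
  move=> xM yM xy.
  have cl x' : `|x'| <= M -> (cell x')%:R * (d / 2) <= x' + M < ((cell x')%:R + 1) * (d / 2).
    rewrite ler_norml => /andP[x0 _]; rewrite -ler_pdivlMr// -ltr_pdivrMr// natr1.
    by apply: truncn_itv; apply: divr_ge0; [lra|exact: ltW].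
  have := cl x xM; have := cl y yM; rewrite xy ltr_norml => /andP[h1 h2] /andP[h3 h4].
  move: h2 h4; rewrite mulrDl mul1r => h2 h4; apply/andP; split; lra.
pose c (n : 'I_(K * K).+1) : 'I_K * 'I_K :=
  (Ordinal (cellK _ (fM n).1), Ordinal (cellK _ (fM n).2)).
have : ~~ injectiveb c.
  apply/negP => /injectiveP /leq_card; rewrite card_prod !card_ord; lia.
case/injectivePn => i [j ij [ci cj]]; exists i, j; split.
  by move=> E; move/eqP: ij; apply; exact: val_inj.
have h1 := cellP _ _ (fM i).1 (fM j).1 ci; have h2 := cellP _ _ (fM i).2 (fM j).2 cj.
have -> : f i - f j = (complex.Re (f i) - complex.Re (f j)) +i* (complex.Im (f i) - complex.Im (f j)).
  by case: (f i) (f j) => [a b] [a' b'].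
rewrite /modulus /sqmod /= -[ltRHS](ger0_norm (ltW d0)) -sqrtr_sqr ltr_sqrt.
move: h1 h2; rewrite !ltr_norml => /andP[h1 h1'] /andP[h2 h2']; nra.
by rewrite exprn_gt0.
Qed.

(** Rounding the coordinates of the multiples of a period leaves a bounded
   sequence of periods, which takes a value twice. *)
Lemma period_relation l1 l2 l (x y : R) : period F l1 -> period F l2 -> period F l ->
  l = l1 * x%:C + l2 * y%:C ->
  exists n n1 n2 : int, n != 0 /\ l * n%:~R = l1 * n1%:~R + l2 * n2%:~R.
Proof.
move=> p1 p2 pl El; have [d d0 dP] := discF.
pose fl (t : R) (n : nat) : int := Num.floor (t * n%:R).
pose f n : C := l * n%:R - l1 * (fl x n)%:~R - l2 * (fl y n)%:~R.
have pf n : period F (f n).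
  by apply: periodB; [apply: periodB|]; [exact: periodMn|exact: periodMz|exact: periodMz].
pose fr (t : R) n := t * n%:R - (fl t n)%:~R.
have frI t n : 0 <= fr t n <= 1.
  have := floor_itv (t * n%:R); rewrite /fr -/(fl t n) intrD => /andP[h1 h2].
  by apply/andP; split; lra.
have fE n : f n = l1 * (fr x n)%:C + l2 * (fr y n)%:C.
  rewrite /f /fr El !rmorphB !rmorphM /= !rmorph_nat !rmorph_int; ring.
pose M : R := `|complex.Re l1| + `|complex.Im l1| + `|complex.Re l2| + `|complex.Im l2|.
have M0 : 0 <= M by rewrite !addr_ge0.
have bd (u v s t : R) : 0 <= s <= 1 -> 0 <= t <= 1 -> `|u * s + v * t| <= `|u| + `|v|.
  move=> /andP[s0 s1] /andP[t0 t1]; apply: le_trans (ler_normD _ _) _.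
  by rewrite !normrM (ger0_norm s0) (ger0_norm t0); apply: lerD; rewrite ler_piMr.
have fM n : `|complex.Re (f n)| <= M /\ `|complex.Im (f n)| <= M.
  have re (u v : C) (s t : R) : complex.Re (u * s%:C + v * t%:C) = complex.Re u * s + complex.Re v * t.
    by case: u v => [u1 u2] [v1 v2] /=; ring.
  have im (u v : C) (s t : R) : complex.Im (u * s%:C + v * t%:C) = complex.Im u * s + complex.Im v * t.
    by case: u v => [u1 u2] [v1 v2] /=; ring.
  rewrite fE re im; split; apply: le_trans (bd _ _ _ _ (frI x n) (frI y n)) _; rewrite /M.
    have := normr_ge0 (complex.Im l1); have := normr_ge0 (complex.Im l2); lra.
  have := normr_ge0 (complex.Re l1); have := normr_ge0 (complex.Re l2); lra.
have [i [j [ij fij]]] := bounded_collision d0 M0 fM.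
have /eqP := dP _ (periodB (pf i) (pf j)) fij; rewrite subr_eq0 => /eqP E.
exists (i%:Z - j%:Z), (fl x i - fl x j), (fl y i - fl y j); split.
  by rewrite subr_eq0; apply/eqP => -[]; exact: ij.
rewrite !intrB -!pmulrn.
have alg (u v w a b c a' b' c' : C) : u * a - v * b - w * c = u * a' - v * b' - w * c' ->
    u * (a - a') = v * (b - b') + w * (c - c').
  move=> h; apply/eqP; rewrite -subr_eq0; apply/eqP.
  have -> : u * (a - a') - (v * (b - b') + w * (c - c')) = u * a - v * b - w * c - (u * a' - v * b' - w * c') by ring.
  by rewrite h subrr.
by apply: alg; exact: E.
Qed.

(** Two periods that are independent over the reals if there are such, and
   otherwise any nonzero period, with 0. *)
Lemma period_generators : exists l1 l2, [/\ period F l1, period F l2 &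
  forall l, period F l -> exists n n1 n2 : int, n != 0 /\ l * n%:~R = l1 * n1%:~R + l2 * n2%:~R].
Proof.
pose cross (u v : C) := complex.Re u * complex.Im v - complex.Im u * complex.Re v.
have [[l1 [l2 [p1 p2 N]]]|D] := pselect (exists l1 l2, [/\ period F l1, period F l2 & cross l1 l2 != 0]).
  exists l1, l2; split=> // l pl.
  apply: (@period_relation l1 l2 l (cross l l2 / cross l1 l2) (cross l1 l / cross l1 l2)) => //.
  move: N; rewrite /cross; case: (l1) (l2) (l) => [a b] [a' b'] [u v] /= N.
  by apply/eqP; rewrite eq_complex /= !mulr0 !subr0 !add0r; apply/andP; split; apply/eqP; field.
have [[l1 p1 N]|D1] := pselect (exists2 l1, period F l1 & l1 != 0); last first.
  exists 0, 0; split; [exact: period0|exact: period0|] => l pl; exists 1, 0, 0; split=> //.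
  by rewrite !mulr0 addr0 (_ : l = 0) ?mul0r//; apply/eqP/negPn/negP => N; apply: D1; exists l.
exists l1, 0; split=> //; first exact: period0.
move=> l pl; pose s := sqmod l1; have s0 : s != 0 by rewrite sqmod_eq0.
pose x := (complex.Re l * complex.Re l1 + complex.Im l * complex.Im l1) / s.
apply: (@period_relation l1 0 l x 0) => //; first exact: period0.
have : cross l1 l = 0 by apply/eqP/negPn/negP => N'; apply: D; exists l1, l.
move: s0; rewrite /x /s /sqmod /cross; case: (l1) (l) => [a b] [u v] /= s0 cr.
apply/eqP; rewrite eq_complex /= !mul0r !mulr0 !subr0 !add0r !addr0; apply/andP; split; apply/eqP.
  apply: (mulIf s0); rewrite mulrA divfK//.
  by have := congr1 (fun t => b * t) cr; rewrite mulr0; clear; lra.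
apply: (mulIf s0); rewrite mulrA divfK//.
by have := congr1 (fun t => a * t) cr; rewrite mulr0; clear; lra.
Qed.

End PeriodLattice.

Section FlatEuler.
Variables (R : realType) (X : topologicalType).
Local Notation C := (cplx R).
Variable F : C -> X.
Hypothesis cF : continuous F.
Hypothesis surjF : forall x, exists v, F v = x.
Hypothesis sectF : forall v, exists q : X -> C,
  \forall y \near F v, {for y, continuous q} /\ F (v + q y) = y.
Hypothesis perF : forall v w, F v = F w -> period F (w - v).
Hypothesis discF : exists2 d : R, 0 < d & forall l, period F l -> modulus l < d -> l = 0.

Lemma cocycle_sum b (beta : 'I_b -> ('rV[R]_2 -> X) -> R) (c : 'rV[R]_b) : (forall k, cocycle (beta k)) ->
  cocycle (fun s => - \sum_(k < b) c 0 k * beta k s).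
Proof.
move=> cb; split.
  by move=> s t cs ct st; congr (- _); apply: eq_bigr => k _; congr (_ * _); exact: (cb k).1.
move=> s cs; rewrite coboundary2.
have -> : forall x y z : R, - x - - y + - z = - (x - y + z) by move=> x y z; ring.
rewrite -sumrB -big_split /=; apply/eqP; rewrite oppr_eq0; apply/eqP; apply: big1 => k _.
have := (cb k).2 s cs; rewrite coboundary2 => h.
by rewrite -mulrBr -mulrDr h mulr0.
Qed.

Lemma edge_periodMn (phi : ('rV[R]_2 -> X) -> R) l n : cocycle phi -> period F l ->
  edge F phi 0 (l * n%:R) = edge F phi 0 l * n%:R.
Proof.
move=> cphi pl; elim: n => [|n IH]; first by rewrite !mulr0 (edge_refl cF cphi).
by rewrite -!natr1 !mulrDr !mulr1 (edge_periodD cF cphi) ?IH//; exact: periodMn.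
Qed.

Lemma edge_periodMz (phi : ('rV[R]_2 -> X) -> R) l (n : int) : cocycle phi -> period F l ->
  edge F phi 0 (l * n%:~R) = edge F phi 0 l * n%:~R.
Proof.
move=> cphi pl; case: n => n; first exact: edge_periodMn.
rewrite NegzE !mulrNz !mulrN; apply/eqP; rewrite -addr_eq0 -!pmulrn -(edge_periodMn _ cphi pl) addrC.
rewrite -(edge_periodD cF cphi); last exact: periodMn.
by rewrite subrr (edge_refl cF cphi).
Qed.

(** The values on the two generating periods embed the first cohomology in a
   plane, and when they fill it the cup product of a basis is not exact: on
   the two triangles of a fundamental parallelogram it has different values. *)
Lemma flat_euler_ge0 chi : euler_characteristic R X chi -> 0 <= chi.
Proof.
move=> [b0 [b1 [b2 [[be0 [_ H0]] [be [cb H1]] [be2 [_ H2]] ->]]]].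
have b00 : b0 != 0%N.
  apply/eqP => E; subst b0.
  have c1 : @cocycle R X 0 (fun=> 1).
    by split=> // s _; rewrite coboundary1 subrr.
  have [c [H _]] := H0 _ c1.
  have sF : @singular_simplex R X 0 (fun=> F 0) by apply: continuous_subspaceT; exact: cst_continuous.
  by have := H _ sF; rewrite big_ord0 subr0 => /eqP; rewrite oner_eq0.
have [l1 [l2 [p1 p2 gen]]] := period_generators discF.
pose M : 'M[R]_(b1, 2) := \matrix_(k, j) edge F (be k) 0 (if j == 0 then l1 else l2).
have free (c : 'rV[R]_b1) : c *m M = 0 -> c = 0.
  move=> cM; pose phi s := - \sum_(k < b1) c 0 k * be k s.
  have cphi : cocycle phi by exact: cocycle_sum.
  have e12 j : edge F phi 0 (if j == 0 then l1 else l2) = - (c *m M) 0 j.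
    by rewrite /edge /phi mxE; congr (- _); apply: eq_bigr => k _; rewrite mxE.
  have e1 := e12 0; have e2 := e12 1; rewrite cM !mxE oppr0 /= in e1 e2.
  have ex : exact_cochain phi.
    apply: (edge_exact cF surjF sectF perF cphi) => l pl; have [n [n1 [n2 [n0 E]]]] := gen l pl.
    have := congr1 (edge F phi 0) E; rewrite (edge_periodMz _ cphi pl) (edge_periodD cF cphi); last exact: periodMz.
    rewrite (edge_periodMz _ cphi p1) (edge_periodMz _ cphi p2) e1 e2 !mul0r addr0 => /eqP.
    by rewrite mulf_eq0 intr_eq0 (negPf n0) orbF => /eqP.
  have cz : cocycle (fun _ : 'rV[R]_2 -> X => 0 : R) by split=> // s _; rewrite coboundary2 !subr0 addr0.
  have [c' [_ U]] := H1 _ cz.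
  have <- : c' = c.
    by apply: U; rewrite (_ : (fun s => _) = phi)//; apply/funext => s; rewrite sub0r.
  apply: U; exists (fun=> 0); split=> // s _; rewrite coboundary1 subrr sub0r.
  by apply/eqP; rewrite oppr_eq0; apply/eqP; apply: big1 => k _; rewrite mxE mul0r.
have rM : row_free M by apply/inj_row_free.
have b12 : (b1 <= 2)%N by rewrite -(eqP rM); exact: rank_leq_col.
have [b1E|b1N] := eqVneq b1 2%N; last first.
  by move: b00 b12 b1N; lia.
suff : b2 != 0%N by move: b00 b1E; lia.
apply/eqP => E; subst b2 b1.
have := cup_cocycle (cb 0) (cb 1) => /H2[c' [[psi [psiC psiP]] _]].
have T1 := psiP _ (@plane_singular R X F cF 2 [:: 0; l1; l1 + l2]).
have T2 := psiP _ (@plane_singular R X F cF 2 [:: 0; l2; l2 + l1]).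
move: T1 T2; rewrite !big_ord0 !subr0 !plane_triangle /cup.
have fE u v w : (@plane_simplex R X F 2 [:: u; v; w] \o face (lift ord0 (lift ord0 ord0)) = plane_simplex F [:: u; v])
   /\ (@plane_simplex R X F 2 [:: u; v; w] \o face 0 = plane_simplex F [:: v; w]).
  by split; apply: plane_face => -[[|[|i]] Hi].
rewrite !(fE _ _ _).1 !(fE _ _ _).2.
have tr (phi : ('rV[R]_2 -> X) -> R) l l' : cochain phi -> period F l ->
    edge F phi l (l + l') = edge F phi 0 l'.
  by move=> cphi pl; rewrite -(edge_period cF 0 l' cphi pl) add0r addrC.
rewrite -!/(edge F _ _ _) (tr _ _ _ (cb 1).1 p1) (tr _ _ _ (cb 1).1 p2) (tr _ _ _ psiC p1) (tr _ _ _ psiC p2).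
rewrite (addrC l2 l1) => T1 T2.
have dM : \det M = 0.
  rewrite det2 !mxE /=; lra.
have : M \in unitmx by rewrite -row_free_unit.
by rewrite unitmxE dM unitr0.
Qed.

End FlatEuler.

(** * The induced metric *)
Section InducedMetric.
Variables (R : realType) (X : topologicalType).
Variables (S : compact_riemann_surface R X) (L : half_canonical S).
Variables (m : nat) (p : 'I_m -> X) (theta : 'I_m -> R).
Local Notation C := (cplx R).

Lemma toda_eq (U : set C) (f f' : C -> C) (g g' : C -> R) : open U ->
  (forall z, U z -> f z = f' z) -> (forall z, U z -> g z = g' z) -> toda U f g -> toda U f' g'.
Proof.
move=> oU ff gg [sg g0 E]; split.
- exact: eq_smooth_on gg sg.
- by move=> z Uz; rewrite -gg// g0.
move=> z Uz; rewrite -ff// -gg// -E//; apply: (eq_d_zbar oU Uz) => w Uw.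
rewrite -gg//; congr (_ / _); apply: (eq_d_z oU Uw) => v Uv; by rewrite gg.
Qed.

(** [hhat] in terms of real coordinates, where its properties are polynomial
   identities. *)
Definition real_hhat (f : C) (g : R) (v w : C) : R :=
  (g + 4 * sqmod f / g) * (complex.Re v * complex.Re w + complex.Im v * complex.Im w)
  + 4 * (complex.Re f * (complex.Re v * complex.Re w - complex.Im v * complex.Im w)
         - complex.Im f * (complex.Re v * complex.Im w + complex.Im v * complex.Re w)).

Lemma hhatE (a : chart R X -> X -> C) (H : half_index L -> X -> 'M[R[i]]_2) c x v w :
  hhat a H c x v w = real_hhat (a c x) (g_of H c x) v w.
Proof.
rewrite /hhat /real_hhat; move: (a c x) (g_of H c x) => f g; cbv zeta.
have e1 : 4 * f * conjc f / (g%:C : C) = (4 * sqmod f / g)%:C.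
  by rewrite 2!real_complexM real_complexV sqmodC (rmorph_nat (real_complex R) 4) mulrA.
have e2 : (2 : R[i]) = (2 : R)%:C by rewrite rmorph_nat.
rewrite (_ : 4 * _ * _ / _ = (4 * sqmod f / g)%:C); last exact: e1.
rewrite (_ : g%:C + _ = (g + 4 * sqmod f / g)%:C); last by rewrite real_complexD.
have e3 (z : R[i]) : z / (2 : R)%:C = z * (2^-1 : R)%:C by rewrite [in RHS]real_complexV.
rewrite e2 e3.
move: (g + _) => e.
by case: f v w {e1} => [a1 a2] [v1 v2] [w1 w2] /=; field.
Qed.

Lemma real_hhat_jac (f : C) (g : R) (J v w : C) : g != 0 -> J != 0 ->
  real_hhat (f * J ^+ 2) (g * sqmod J) v w = real_hhat f g (J * v) (J * w).
Proof.
move=> g0 J0; have n0 : sqmod J != 0 by rewrite sqmod_eq0.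
move: n0; rewrite /real_hhat /sqmod expr2; case: f J v w J0 => [f1 f2] [j1 j2] [v1 v2] [w1 w2] J0 /= n0.
by field; rewrite g0 n0.
Qed.

(** [hhat] is the pull-back metric [|2 f dz + g dzbar|^2 / g]. *)
Lemma real_hhat_gt0 (f : C) (g : R) (v : C) : 0 < g -> 4 * sqmod f < g ^+ 2 -> v != 0 -> 0 < real_hhat f g v v.
Proof.
move=> g0 fg v0; have gn : g != 0 by rewrite gt_eqF.
have -> : real_hhat f g v v = sqmod (2 * f * v + g%:C * conjc v) / g.
  have e2 : (2 : R[i]) = (2 : R)%:C by rewrite rmorph_nat.
  rewrite e2 /real_hhat /sqmod; case: f v {fg v0} => [f1 f2] [v1 v2] /=.
  by field.
apply: divr_gt0 => //; rewrite lt_neqAle sqmod_ge0 andbT eq_sym sqmod_eq0 addr_eq0.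
apply/eqP => E; have := congr1 (@sqmod R) E.
have N (z : C) : sqmod (- z) = sqmod z by rewrite /sqmod; case: z => x y /=; ring.
have cj (z : C) : sqmod (conjc z) = sqmod z by rewrite /sqmod; case: z => x y /=; ring.
have r (t : R) : sqmod (t%:C : C) = t ^+ 2 by rewrite /sqmod /=; ring.
have e2 : (2 : C) = (2 : R)%:C by rewrite rmorph_nat.
rewrite N !sqmodM cj e2 !r => /(mulIf _) h.
have h2 : sqmod v != 0 by rewrite sqmod_eq0.
by move: fg; rewrite -(h h2) -natrX ltxx.
Qed.

Hypothesis theta_small : forall i, 0 <= theta i < 2^-1.
Variables (a : chart R X -> X -> C) (lam : chart R X -> X -> R) (A : R).
Variable H : half_index L -> X -> 'M[R[i]]_2.
Hypothesis qa : quadratic_differential S (div_D p) a.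
Hypothesis hH : hermitian_einstein p theta a lam A H.

Lemma g_ofE c j x : atlas S c -> cdom c x -> cdom (half_chart j) x -> punctured p x ->
  g_of H c x = complex.Re (H j x 1 1) / complex.Re (H j x 0 0) * sqmod (jac (half_chart j) c x).
Proof.
move=> ac dc dj px; rewrite /g_of; case: cid => k dk /=; cbv zeta.
have [s0 sj e0 e1 _] := metric_transition hH dk dj px.
have [A0 C0] := entries_gt0 hH dj px.
have ak := half_chart_atlas k; have aj := half_chart_atlas j.
have q0 : modulus (jac c (half_chart k) x) != 0 by rewrite modulus_eq0 (jac_neq0 ac ak dc dk).
have E : jac (half_chart k) (half_chart j) x * jac (half_chart j) c x * jac c (half_chart k) x = 1.
  by rewrite -(jac_comp ak aj ac dk dj dc) -(jac_comp ak ac ak dk dc dk) (jac_refl dk).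
set u := modulus _ in q0 *; set s := sqmod (half_trans k j x) in s0 sj e0 e1.
have Q : sqmod (jac (half_chart j) c x) * (s ^+ 2 * u ^+ 2) = 1.
  have -> : s ^+ 2 * u ^+ 2 = sqmod (jac (half_chart k) (half_chart j) x) * sqmod (jac c (half_chart k) x).
    by rewrite sj /u modulus_sqr.
  rewrite mulrCA mulrA -(sqmodM (jac (half_chart k) _ x)) -(sqmodM (_ * _)) E.
  by rewrite /sqmod /= expr0n expr1n addr0.
have us : s ^+ 2 * u ^+ 2 != 0 by rewrite mulf_neq0// expf_neq0.
have {}Q : sqmod (jac (half_chart j) c x) = (s ^+ 2 * u ^+ 2)^-1 by apply: (mulIf us); rewrite mulVf.
by rewrite Q e0 e1; field; rewrite q0 s0 gt_eqF.
Qed.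

Lemma g_of_gt0 c x : atlas S c -> cdom c x -> punctured p x -> 0 < g_of H c x.
Proof.
move=> ac dc px; have [j dj] := half_cover L x; rewrite (g_ofE ac dc dj px).
have [A0 C0] := entries_gt0 hH dj px; rewrite mulr_gt0 ?divr_gt0//.
by rewrite lt_neqAle sqmod_ge0 andbT eq_sym sqmod_eq0 (jac_neq0 (half_chart_atlas j) ac dj dc).
Qed.

Lemma g_of_jac c d x : atlas S c -> atlas S d -> cdom c x -> cdom d x -> punctured p x ->
  g_of H d x = g_of H c x * sqmod (jac c d x).
Proof.
move=> ac ad dc dd px; have [j dj] := half_cover L x.
rewrite (g_ofE ac dc dj px) (g_ofE ad dd dj px) (jac_comp (half_chart_atlas j) ac ad dj dc dd).
by rewrite (sqmodM (jac (half_chart j) c x)) mulrA.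
Qed.

Hypothesis diag : forall j x, cdom (half_chart j) x -> punctured p x -> H j x 0 1 = 0.
Hypothesis lt1 : forall x, punctured p x -> ratio_at a H x < 1.

Lemma g_of_lt c x : atlas S c -> cdom c x -> punctured p x -> 4 * sqmod (a c x) < g_of H c x ^+ 2.
Proof.
move=> ac dc px; have [j dj] := half_cover L x; have aj := half_chart_atlas j.
have [A0 C0] := entries_gt0 hH dj px.
rewrite (g_ofE ac dc dj px) (quadratic_transition qa aj ac dj dc px) (sqmodM (a _ x)) [sqmod (_ ^+ 2)]sqmodM -expr2.
have J0 : 0 < sqmod (jac (half_chart j) c x) by rewrite lt_neqAle sqmod_ge0 andbT eq_sym sqmod_eq0 (jac_neq0 aj ac dj dc).
rewrite exprMn mulrA ltr_pM2r ?exprn_gt0//.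
have := lt1 px; rewrite (ratio_atE qa hH dj px) ltr_pdivrMr ?exprn_gt0// mul1r.
by rewrite expr_div_n ltr_pdivlMr ?exprn_gt0.
Qed.

Let piece (c : chart R X) j := crange c (punctured p `&` cdom (half_chart (h := L) j)).

Let open_piece c j : open (piece c j).
Proof. by apply: open_crange; apply: openI; [exact: (open_punctured S p)|exact: cdom_open]. Qed.

Let pieceP c z : crange c (punctured p) z -> exists j, piece c j z.
Proof.
move=> /crangeP[rz pz]; have [j dj] := half_cover L (cinv c z).
by exists j; apply/crangeP; split.
Qed.

Lemma chart_toda c j : atlas S c -> toda (piece c j) (a c \o cinv c) (g_of H c \o cinv c).
Proof.
move=> ac; have aj := half_chart_atlas j; have T := half_chart_toda theta_small hH diag j.
pose phi := cmap (half_chart j) \o cinv c.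
have inP z : piece c j z -> [/\ (cmap c @` cdom c) z, cdom c (cinv c z), cmap c (cinv c z) = z,
    punctured p (cinv c z) & cdom (half_chart j) (cinv c z)].
  by move=> /crangeP[/[dup] rz /chart_inv[dz zz] [pz dj]].
have dphi z : piece c j z -> is_derive z (1 : C) phi (jac (half_chart j) c (cinv c z)).
  by move=> /inP[_ dz zz pz dj]; have := transition_cder aj ac dj dz; rewrite zz.
have oV : open (crange (half_chart j) (punctured p)) by apply: open_crange; exact: (open_punctured S p).
have hphi : holomorphic_on (piece c j) phi by move=> z /dphi; exact: cder_holomorphic.
have dE z : piece c j z -> derive1 phi z = jac (half_chart j) c (cinv c z) by move=> /dphi /cder_derive1.
have Vphi z : piece c j z -> crange (half_chart j) (punctured p) (phi z).
  by move=> /inP[_ _ _ pz dj]; exact: crange_mem.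
have nphi z : piece c j z -> derive1 phi z != 0.
  by move=> pz; rewrite dE//; have [_ dz _ _ dj] := inP _ pz; exact: (jac_neq0 aj ac dj dz).
have T2 := toda_comp (@open_piece c j) oV T hphi Vphi nphi.
refine (toda_eq (@open_piece c j) _ _ T2) => z /[dup] Uz /inP[_ dz zz pz dj].
  by rewrite /= cmapK// dE// -(quadratic_transition qa aj ac dj dz pz).
by rewrite /= cmapK// dE// -(g_ofE ac dz dj pz).
Qed.

Let holo_piece c j : atlas S c -> holomorphic_on (piece c j) (a c \o cinv c).
Proof.
move=> ac z /crangeP[rz [pz _]]; apply: (quadratic_holomorphic qa ac).
by apply/crangeP.
Qed.

Lemma hhat_riemannian : riemannian_metric_on S (punctured p) (hhat a H).
Proof.
split.
- move=> c x ac dc px; split.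
  + by move=> v w; rewrite !hhatE /real_hhat; ring.
  + move=> t u v w; rewrite !hhatE /real_hhat.
    by case: u v w => [u1 u2] [v1 v2] [w1 w2] /=; ring.
  move=> v v0; rewrite hhatE; apply: real_hhat_gt0 => //; first exact: g_of_gt0.
  exact: g_of_lt.
- move=> c v w ac s z /pieceP[j Uz].
  suff sm : smooth_on (piece c j) (fun z => hhat a H c (cinv c z) v w) by exact: sm.
  have oU := @open_piece c j; have [sg g0 _] := chart_toda j ac.
  have [sp sq] := csmooth_holomorphic oU (holo_piece ac).
  have gn y : piece c j y -> (g_of H c \o cinv c) y != 0 by move=> /g0 ?; rewrite gt_eqF.
  have s2 := smoothD oU (smoothM oU sp sp) (smoothM oU sq sq).
  have se := smoothD oU sg (smoothM oU (smoothZ oU 4 s2) (smoothV oU sg gn)).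
  have := smoothD oU (smoothM oU se (smooth_cst oU (complex.Re v * complex.Re w + complex.Im v * complex.Im w)))
    (smoothZ oU 4 (smoothB oU (smoothM oU sp (smooth_cst oU (complex.Re v * complex.Re w - complex.Im v * complex.Im w)))
       (smoothM oU sq (smooth_cst oU (complex.Re v * complex.Im w + complex.Im v * complex.Re w))))).
  by apply: (eq_smooth_on oU) => y _; rewrite hhatE /real_hhat /sqmod /= !expr2.
move=> c d x v w ac ad dc dd px; rewrite !hhatE.
rewrite (quadratic_transition qa ac ad dc dd px) (g_of_jac ac ad dc dd px) real_hhat_jac//.
  by rewrite gt_eqF// g_of_gt0.
exact: (jac_neq0 ac ad dc dd).
Qed.

Lemma hhat_curvature : has_gauss_curvature S (punctured p) (hhat a H) (-1).
Proof.
move=> c z ac /pieceP[j Uz].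
have nd w : piece c j w -> (g_of H c \o cinv c) w ^+ 2 -
    4 * (complex.Re ((a c \o cinv c) w) ^+ 2 + complex.Im ((a c \o cinv c) w) ^+ 2) != 0.
  move=> /crangeP[/chart_inv[dw _] [pw _]]; rewrite gt_eqF// subr_gt0.
  exact: g_of_lt.
apply: (pullback_curvature (@open_piece c j) (holo_piece ac) (chart_toda j ac) _ _ _ _ nd Uz) => w _;
  rewrite mxE hhatE /real_hhat /energy /sqmod /dir /=.
- by ring.
- by ring.
- by ring.
by ring.
Qed.

End InducedMetric.

Section FlatCase.
Variables (R : realType) (X : topologicalType).
Variables (S : compact_riemann_surface R X) (L : half_canonical S).
Variables (m : nat) (p : 'I_m -> X).
Local Notation C := (cplx R).

(** Such a quadratic differential is flat: the surface is a quotient of the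
   plane by translations. *)
Lemma nowhere_zero_euler_ge0 (a : chart R X -> X -> C) chi : quadratic_differential S (div_D p) a ->
  nowhere_zero L m a -> euler_characteristic R X chi -> 0 <= chi.
Proof.
move=> qa [m0 nz]; have px x : punctured p x by move=> [i _ _]; case: i => i; rewrite m0.
have aT c d x : atlas S c -> atlas S d -> cdom c x -> cdom d x -> a d x = a c x * jac c d x ^+ 2.
  by move=> ac ad dc dd; exact: (quadratic_transition qa ac ad dc dd).
have aH c : atlas S c -> holomorphic_on (crange c [set: X]) (a c \o cinv c).
  move=> ac z /crangeP[rz _]; apply: (quadratic_holomorphic qa ac); apply/crangeP; split=> //; exact: px.
have a0 c x : atlas S c -> cdom c x -> a c x != 0.
  move=> ac dc; have [j dj] := half_cover L x; have aj := half_chart_atlas j.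
  by rewrite (aT _ _ _ aj ac dj dc) mulf_neq0 ?nz// expf_neq0// (jac_neq0 aj ac dj dc).
have [F nF] := natural_plane_exists aT aH a0.
have near_nF (v : C) : \forall w \near v, natural_at S a F w by exact: (@filterE _ (nbhs v) _ _ nF).
apply: (@flat_euler_ge0 R X F).
- by move=> v; have [] := nF v.
- exact: (plane_surjective aT aH a0 nF).
- move=> v; have [q _ nq] := natural_section aH a0 (near_nF v) (@ltr01 R).
  by exists q; apply: filterS nq => y [].
- exact: (plane_period aH a0 nF).
exact: (period_discrete aH a0 nF).
Qed.

End FlatCase.

Theorem corollary1p5 (R : realType) (X : topologicalType)
    (S : compact_riemann_surface R X) (L : half_canonical S)
    (m : nat) (p : 'I_m -> X) (p_inj : injective p)
    (theta : 'I_m -> R)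
    (chi : int) (chiP : euler_characteristic R X chi)
    (chi_theta : chi%:~R + \sum_(i < m) (theta i - 1) < 0 :> R)
    (lam : chart R X -> X -> R) (lamP : conformal_metric S lam)
    (lam_flat : forall i, euclidean_near S lam (p i))
    (A : R) (AP : total_area S lam A)
    (theta_small : forall i, 0 <= theta i < 2^-1) :
  [/\ div_D1 p theta = (fun=> 0), div_D3 p theta = (fun=> 0),
      div_D4 p theta = (fun=> 0) &
      forall a : chart R X -> X -> cplx R,
        quadratic_differential S (div_D p) a ->
      forall H : half_index L -> X -> 'M[complex R]_2,
        hermitian_einstein p theta a lam A H ->
        riemannian_metric_on S (punctured p) (hhat a H) /\
        has_gauss_curvature S (punctured p) (hhat a H) (-1)].
Proof.
have frac i : fracpart (theta i) = theta i := fracpart_theta theta_small i.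
split.
- apply/funext => x; rewrite /div_D1 /point_divisor; apply: big1 => i _.
  by rewrite frac andNb.
- apply/funext => x; rewrite /div_D3 /point_divisor; apply: big1 => i _.
  by have /andP[_ lt2] := theta_small i; rewrite frac (lt_eqF lt2) andbF.
- apply/funext => x; rewrite /div_D4 /point_divisor; apply: big1 => i _.
  by have /andP[_ lt2] := theta_small i; rewrite frac (lt_gtF lt2) andbF.
move=> a qa H hH.
have not_flat : ~ nowhere_zero L m a.
  move=> flat; have m0 := flat.1; have chi0 := nowhere_zero_euler_ge0 qa flat chiP.
  subst m; move: chi_theta; rewrite big_ord0 addr0 ltrz0; by rewrite ltNge chi0.
have [diag|//] := diagonal_or_flat p_inj theta_small qa hH.
have [lt1|//] := ratio_lt1_or_flat p_inj theta_small qa hH diag.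
split; first exact: (hhat_riemannian theta_small qa hH diag lt1).
exact: (hhat_curvature theta_small qa hH diag lt1).
Qed.
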